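(* Let $q$ be a power of $2$. Then for every $n\ge 1$, both groups $\mathrm{O}^{+}(2n,\mathbb{F}_q)$ and $\mathrm{O}^{-}(2n,\mathbb{F}_q)$ are totally orthogonal.
   Context: $\mathrm{O}^+(2n,\mathbb{F}_q)$ is the group of $g\in\mathrm{GL}(2n,\mathbb{F}_q)$ preserving the quadratic form $x_1x_{2n}+x_2x_{2n-1}+\cdots+x_nx_{n+1}$ on $\mathbb{F}_q^{2n}$ (the split orthogonal group); $\mathrm{O}^-(2n,\mathbb{F}_q)$ is the group preserving a non-degenerate quadratic form on $\mathbb{F}_q^{2n}$ of Witt index $n-1$ (the non-split orthogonal group). A finite group is totally orthogonal if every irreducible complex character $\chi$ has Frobenius–Schur indicator $\varepsilon(\chi)=\frac{1}{|G|}\sum_{g\in G}\chi(g^2)$ equal to $1$, i.e. every irreducible complex representation is realizable over $\mathbb{R}$. *)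

(* Defs.v *)
From HB Require Import structures.
From mathcomp Require Import all_boot all_order all_algebra all_fingroup all_solvable all_field all_character.
Set Implicit Arguments. Unset Strict Implicit. Unset Printing Implicit Defensive.
Import Order.TTheory GRing.Theory Num.Theory.
Local Open Scope ring_scope.

Section Forms.
Variables (F : fieldType) (d : nat).

Definition is_quadratic_form (Q : 'rV[F]_d -> F) : Prop :=
  exists A : 'M[F]_d, forall x, Q x = (x *m A *m x^T) 0 0.

Definition polar (Q : 'rV[F]_d -> F) (x y : 'rV[F]_d) : F := Q (x + y) - Q x - Q y.

Definition qnondegenerate (Q : 'rV[F]_d -> F) : Prop :=
  forall x, (forall y, polar Q x y = 0) -> x = 0.

Definition qtotally_singular (Q : 'rV[F]_d -> F) k (U : 'M[F]_(k, d)) : Prop :=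
  forall v : 'rV[F]_d, (v <= U)%MS -> Q v = 0.

Definition qwitt_index (Q : 'rV[F]_d -> F) (w : nat) : Prop :=
  (exists U : 'M[F]_d, qtotally_singular Q U /\ \rank U = w) /\
  (forall U : 'M[F]_d, qtotally_singular Q U -> (\rank U <= w)%N).

End Forms.

(* The split form x_1 x_{2n} + x_2 x_{2n-1} + ... + x_n x_{n+1} on F^{k+1}
   (used with k+1 = 2n); 0-based: sum_{i<n} x_i x_{k-i}. *)
Definition split_qform (F : fieldType) (n k : nat) (x : 'rV[F]_k.+1) : F :=
  \sum_(i < n) x 0 (inord i) * x 0 (inord (k - i)).

(* The orthogonal group of Q inside GL(m, F) (matrices of size m.-1.+1,
   which is m for m > 0), acting on row vectors. *)
Definition qorth_set (F : finFieldType) (m : nat) (Q : 'rV[F]_m.-1.+1 -> F)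
  : {set {'GL_m[F]}} :=
  [set g : {'GL_m[F]} | [forall x, Q (x *m GLval g) == Q x]].

Lemma qorth_group_set (F : finFieldType) (m : nat) (Q : 'rV[F]_m.-1.+1 -> F) :
  group_set (qorth_set Q).
Proof.
apply/group_setP; split.
  by rewrite inE; apply/forallP => x; rewrite GL_1E mulmx1.
move=> g h; rewrite !inE => /forallP Hg /forallP Hh; apply/forallP => x.
by rewrite GL_MxE mulmxA (eqP (Hh _)) (eqP (Hg _)).
Qed.

Canonical qorth_group (F : finFieldType) (m : nat) (Q : 'rV[F]_m.-1.+1 -> F) :=
  Group (qorth_group_set Q).

Definition Oplus (F : finFieldType) (n : nat) : {group {'GL_(n.*2)[F]}} :=
  qorth_group (split_qform n (k := (n.*2).-1)).

Definition fs_indicator (gT : finGroupType) (G : {group gT}) (chi : 'CF(G)) : algC :=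
  #|G|%:R^-1 * \sum_(g in G) chi (g ^+ 2)%g.

Definition totally_orthogonal (gT : finGroupType) (G : {group gT}) : Prop :=
  forall i : Iirr G, fs_indicator 'chi[G]_i = 1.

(* Main.v *)
Require Import Defs.
From HB Require Import structures.
From mathcomp Require Import all_boot all_order all_algebra all_fingroup all_solvable all_field all_character.
From mathcomp Require Import ring zify.
Set Implicit Arguments. Unset Strict Implicit. Unset Printing Implicit Defensive.
Import Order.TTheory GRing.Theory Num.Theory.
Local Open Scope ring_scope.

(** For [s] normalizing [G] with [s^2] in [G], let
    [fs_ind s chi = |G|^-1 sum_g chi((s g)^2)] be the twisted Frobenius-Schur
    indicator.  If every element of [G] is conjugate to its inverse, an
    irreducible [psi] of indicator [-1] is ruled out by expanding [<psi, psi> = 1]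
    over the odd parts [x] of the elements of [G]: every contribution is even as
    soon as, for [x] of odd order inverted by [s], the virtual characters of [C(x)],
    restricted to 2-subgroups normalized by [s], contain the irreducible
    characters of twisted indicator [-1] with even multiplicity ([N2prop]).

    In an orthogonal group of characteristic 2, a 2-subgroup of [C(x)] together
    with [s] fixes a vector.  The stabilizers of vectors in [C(x)] are semidirect
    products [N ><| L] with [N] a 2-group made of Siegel transformations, of a
    transvection, or of a unitary Heisenberg group, and [L] in a space of smaller
    dimension.  [N2prop] goes up from stabilizers in [L] to [N ><| L], by Clifford
    theory if [N] is elementary abelian, and for Heisenberg [N] by extending the
    faithful characters of its centre to a twisted-real linear character of a
    Lagrangian subgroup.

    For the conjugacy of [g = x u] and [g^-1]: on the fixed space of [x] the
    isometry is the 2-element [u], on which all characters are real by [N2prop] for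
    [x = s = 1]; on the orthogonal space one splits off nondegenerate cyclic
    subspaces [v F[g]], reversed by [v p(g) |-> v p(g^-1)]. *)

(** * Representations with a twisted invariant form *)

(** For fixed odd [x], the function [u |-> psi(x u)] on [C(x)] is a combination of irreducible
    characters with multiplicities times roots of unity as coefficients. An [s] inverting [x] pairs
    these characters by [z |-> conj (z^s)] without changing the coefficients, so modulo 2 only the
    twisted-real ones survive: this is why indicators twisted by [s] have to be controlled. Only
    2-elements [u] matter, and a high power of the permutation character on a Sylow 2-subgroup is
    their indicator function modulo a power of 2.

    Virtual characters with even multiplicities at indicator [-1] behave like a twisted real
    representation ring: stable under restriction, products and, on 2-groups, division by an element
    of odd degree. The division replaces an extension of the Heisenberg character to the whole
    group, which may not be available.

    [N2prop] assumes either that [s] is in the 2-subgroup or reality on 2-elements. The first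
    alternative presupposes nothing about conjugacy, so it can serve to prove that unipotent
    elements are real; the second is used once reality in the orthogonal group is known. This avoids
    a circle. *)

Section Kron.
Variable K : fieldType.

(** The tensor product of [A] and [B], taken as the matrix of [X |-> A^T X B] on vectorized
    matrices, which makes multiplicativity immediate. *)
Definition kron m n (A : 'M[K]_m) (B : 'M[K]_n) : 'M[K]_(m * n) :=
  lin_mx (mulmxr B \o mulmx A^T).

Lemma mxvec_kron m n (A : 'M[K]_m) (B : 'M[K]_n) X :
  mxvec X *m kron A B = mxvec (A^T *m X *m B).
Proof. by rewrite mul_vec_lin. Qed.

Lemma kronE m n (A : 'M[K]_m) (B : 'M[K]_n) i j k l :
  kron A B (mxvec_index i j) (mxvec_index k l) = A i k * B j l.
Proof.
have -> : kron A B (mxvec_index i j) (mxvec_index k l) =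
          (mxvec (delta_mx i j) *m kron A B) 0 (mxvec_index k l).
  by rewrite mxvec_delta -rowE [RHS]mxE.
rewrite mxvec_kron mxvecE mxE (bigD1 j) //= big1 ?addr0; last first.
  move=> j' nj; rewrite mxE (bigD1 i) //= big1 ?addr0 => [|i' ni]; last first.
    by rewrite !mxE (negPf ni) mulr0.
  by rewrite !mxE eqxx (negPf nj) mulr0 mul0r.
rewrite mxE (bigD1 i) //= big1 ?addr0 => [|i' ni]; last first.
  by rewrite !mxE (negPf ni) mulr0.
by rewrite !mxE !eqxx mulr1.
Qed.

Lemma kronM m n (A A' : 'M[K]_m) (B B' : 'M[K]_n) :
  kron (A *m A') (B *m B') = kron A B *m kron A' B'.
Proof.
apply/row_matrixP => i; rewrite !rowE mulmxA -[delta_mx 0 i]vec_mxK.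
by rewrite !mxvec_kron trmx_mul !mulmxA.
Qed.

Lemma kron1 m n : kron (1%:M : 'M[K]_m) (1%:M : 'M[K]_n) = 1%:M.
Proof.
apply/row_matrixP => i; rewrite !rowE -[delta_mx 0 i]vec_mxK mxvec_kron.
by rewrite trmx1 mul1mx !mulmx1.
Qed.

Lemma trmx_kron m n (A : 'M[K]_m) (B : 'M[K]_n) : (kron A B)^T = kron A^T B^T.
Proof.
apply/matrixP=> p q; case/mxvec_indexP: p => i j; case/mxvec_indexP: q => k l.
by rewrite mxE !kronE !mxE.
Qed.

Lemma kron_unit m n (A : 'M[K]_m) (B : 'M[K]_n) :
  A \in unitmx -> B \in unitmx -> kron A B \in unitmx.
Proof.
move=> uA uB; have/mulmx1_unit[] // : kron A B *m kron (invmx A) (invmx B) = 1%:M.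
by rewrite -kronM !mulmxV // kron1.
Qed.

Lemma kronZ m n (a b : K) (A : 'M[K]_m) (B : 'M[K]_n) :
  kron (a *: A) (b *: B) = (a * b) *: kron A B.
Proof.
apply/matrixP=> p q; case/mxvec_indexP: p => i j; case/mxvec_indexP: q => k l.
by rewrite [RHS]mxE !kronE !mxE mulrACA.
Qed.

Lemma mxtrace_kron m n (A : 'M[K]_m) (B : 'M[K]_n) :
  \tr (kron A B) = \tr A * \tr B.
Proof.
rewrite /mxtrace mulr_suml (reindex _ (curry_mxvec_bij m n)) /=.
rewrite (eq_bigr (fun p => A p.1 p.1 * B p.2 p.2)) => [|[i j] _]; last by rewrite kronE.
rewrite -(pair_bigA _ (fun i j => A i i * B j j)) /=.
by apply: eq_bigr => i _; rewrite mulr_sumr.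
Qed.

End Kron.

Definition even_int (z : algC) := (z / 2%:R) \in Num.int.

Lemma even_int0 : even_int 0. Proof. by rewrite /even_int mul0r. Qed.

Lemma even_intD x y : even_int x -> even_int y -> even_int (x + y).
Proof. by rewrite /even_int mulrDl => ? ?; apply: rpredD. Qed.

Lemma even_intN x : even_int x -> even_int (- x).
Proof. by rewrite /even_int mulNr rpredN. Qed.

Lemma even_intM (x y : algC) : x \in Num.int -> even_int y -> even_int (x * y).
Proof. by rewrite /even_int -mulrA; apply: rpredM. Qed.

Lemma even_int_sum (I : Type) (r : seq I) (P : pred I) f :
  (forall i, P i -> even_int (f i)) -> even_int (\sum_(i <- r | P i) f i).
Proof.
by move=> h; elim/big_ind: _; [exact: even_int0 | exact: even_intD | exact: h].
Qed.

Lemma even_int_nat n : even_int n%:R = ~~ odd n.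
Proof.
apply/idP/idP => [/intrP[m Em] | en].
  have: (n%:R : algC) = (m *+ 2)%:~R.
    by rewrite -(mulr_natr m 2) intrM -Em mulfVK ?pnatr_eq0.
  rewrite pmulrn => /intr_inj/(congr1 absz); rewrite absz_nat => ->.
  by rewrite -(mulr_natr m 2) abszM /= muln2 odd_double.
by rewrite /even_int -[n](odd_double_half n) (negPf en) add0n -muln2 natrM mulfK ?pnatr_eq0.
Qed.

Lemma even_int1 : even_int 1 = false.
Proof. exact: (even_int_nat 1). Qed.

(** Orbits of length two contribute twice one of their terms; the enumeration rank selects one
    element of each. The additive subgroup [S] is the ring of integers in one use and that of
    algebraic integers in the other. *)
Lemma half_sum_involution (S : zmodClosed algC) (I : finType) (inv : I -> I) (f : I -> algC) :
    involutive inv -> (forall i, f (inv i) = f i) -> (forall i, f i \in S) ->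
    (forall i, inv i = i -> f i / 2%:R \in S) ->
  (\sum_i f i) / 2%:R \in S.
Proof.
move=> invK fE fS fix_even.
rewrite (bigID (fun i => inv i == i)) /= mulrDl; apply: rpredD.
  by rewrite mulr_suml; apply: rpred_sum => i /eqP; apply: fix_even.
rewrite (bigID (fun i => enum_rank i < enum_rank (inv i))%N) /=.
rewrite [X in _ + X](reindex_inj (can_inj invK)) /=.
rewrite [X in _ + X](eq_bigl (fun i => (inv i != i) && (enum_rank i < enum_rank (inv i))%N)).
  under [X in _ + X]eq_bigr do rewrite fE.
  rewrite -mulr2n -[X in X / _](mulr_natr _ 2) mulfK ?pnatr_eq0 //.
  by apply: rpred_sum => i _; apply: fS.
move=> i; rewrite invK eq_sym; case: eqP => //= ne.
rewrite -leqNgt leq_eqVlt; case: eqP => // /val_inj/enum_rank_inj E.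
by case: ne.
Qed.

Lemma even_int_involution (I : finType) (inv : I -> I) (f : I -> algC) :
    involutive inv -> (forall i, f (inv i) = f i) -> (forall i, f i \in Num.int) ->
    (forall i, inv i = i -> even_int (f i)) ->
  even_int (\sum_i f i).
Proof. exact: half_sum_involution. Qed.

Lemma odd_skew_singular (r : nat) (A : 'M[algC]_r) :
  A^T = - A -> A \in unitmx -> ~~ odd r.
Proof.
move=> skA uA; apply/negP => or.
have := det_tr A; rewrite skA -scaleN1r detZ -signr_odd or expr1 mulN1r => /eqP.
rewrite eq_sym -addr_eq0 -mulr2n mulrn_eq0 /= => /eqP d0.
by move: uA; rewrite unitmxE d0 unitr0.
Qed.

Lemma mxtrace_idempotent d (E : 'M[algC]_d) : E *m E = E -> \tr E = (\rank E)%:R.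
Proof.
move=> idE; have EE := mulmx_base E.
have CB : row_base E *m col_base E = 1%:M.
  apply: (row_free_inj (row_base_free E)); rewrite mul1mx.
  apply: (row_full_inj (col_base_full E)).
  by rewrite -mulmxA [LHS]mulmxA EE idE.
by rewrite -{1}EE mxtrace_mulC CB mxtrace1.
Qed.

Section Twisted.
Variable gT : finGroupType.
Implicit Types (G H : {group gT}) (s : gT).

Definition twists s G := (s \in 'N(G)%g) && (s ^+ 2 \in G)%g.

Definition fs_ind G s (phi : 'CF(G)) : algC :=
  #|G|%:R^-1 * \sum_(g in G) phi ((s * g) ^+ 2)%g.

Definition twisted_real G s (phi : 'CF(G)) :=
  forall g, g \in G -> phi (g ^ s)%g = (phi g)^*.

(** For [s = 1] this is an invariant form with [M^T = e M]. In general [M^T] is invariant for the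
    twist [s^-1]; the factor [rG (s ^+ 2)] brings it back to the twist [s], so that it can be
    compared with [M]. *)
Definition has_form G s d (rG : mx_representation algC G d) (e : algC) M :=
  [/\ M \in unitmx, {in G, forall g, rG g *m M *m (rG (g ^ s)%g)^T = M}
    & rG (s ^+ 2)%g *m M^T = e *: M].

Definition typed_char G s e (chi : 'CF(G)) :=
  exists d (rG : mx_representation algC G d) M,
    has_form s rG e M /\ cfRepr rG = chi.

Lemma sqr_twist s g : ((s * g) ^+ 2 = s ^+ 2 * (g ^ s) * g)%g.
Proof. by rewrite !expgS !expg0 !mulg1 conjgE !mulgA mulgK. Qed.

Lemma twistsN s G : twists s G -> s \in 'N(G)%g. Proof. by case/andP. Qed.
Lemma twists2 s G : twists s G -> (s ^+ 2)%g \in G. Proof. by case/andP. Qed.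

Lemma sub_has_form G H s d (rG : mx_representation algC G d) e M (sHG : H \subset G) :
  has_form s rG e M -> has_form s (subg_repr rG sHG) e M.
Proof. by case=> uM invM symM; split=> // g Hg; apply/invM/(subsetP sHG). Qed.

Lemma typed_Res G H s e (chi : 'CF(G)) :
  H \subset G -> typed_char s e chi -> typed_char s e ('Res[H] chi).
Proof.
move=> sHG [d [rG [M [fM <-]]]]; exists d, (subg_repr rG sHG), M.
by split; [apply: sub_has_form | rewrite cfRepr_sub].
Qed.

Lemma kron_repr G d1 d2 (r1 : mx_representation algC G d1)
    (r2 : mx_representation algC G d2) :
  mx_repr G (fun g => kron (r1 g) (r2 g)).
Proof.
split=> [|g h Gg Gh]; first by rewrite !repr_mx1 kron1.
by rewrite !repr_mxM // kronM.
Qed.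

Lemma typed_mul G s e1 e2 (chi1 chi2 : 'CF(G)) :
    typed_char s e1 chi1 -> typed_char s e2 chi2 ->
  typed_char s (e1 * e2) (chi1 * chi2).
Proof.
move=> [d1 [r1 [M1 [[u1 i1 s1] <-]]]] [d2 [r2 [M2 [[u2 i2 s2] <-]]]].
exists _, (MxRepresentation (kron_repr r1 r2)), (kron M1 M2); split.
  split=> [|g Gg|] /=; first exact: kron_unit.
    by rewrite trmx_kron -!kronM i1 ?i2.
  by rewrite trmx_kron -kronM s1 s2 kronZ.
by apply/cfun_inP=> g Gg; rewrite !cfunE Gg /= mxtrace_kron.
Qed.

Lemma idempotent_base d (E : 'M[algC]_d) :
  E *m E = E -> row_base E *m col_base E = 1%:M.
Proof.
move=> idE; have EE := mulmx_base E.
apply: (row_free_inj (row_base_free E)); rewrite mul1mx.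
apply: (row_full_inj (col_base_full E)).
by rewrite -mulmxA [LHS]mulmxA EE idE.
Qed.

Lemma twists_bij G s : s \in 'N(G)%g -> {in G, forall g, (g ^ s)%g \in G}.
Proof. by move=> nGs g Gg; rewrite memJ_norm. Qed.

Lemma sum_conj_norm (R : nmodType) G s (f : gT -> R) : s \in 'N(G)%g ->
  \sum_(g in G) f (g ^ s)%g = \sum_(g in G) f g.
Proof.
move=> nGs; rewrite [RHS](reindex_inj (conjg_inj s)) /=.
by apply: eq_bigl => g; rewrite memJ_norm.
Qed.

(* The G-fixed vectors carry a nondegenerate skew-symmetric form. *)
Lemma typed_even G s (chi : 'CF(G)) :
  twists s G -> typed_char s (-1) chi -> even_int '[chi, 1].
Proof.
case/andP=> nGs G2 [d [rG [M [[uM invM symM] <-]]]].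
pose E : 'M_d := #|G|%:R^-1 *: \sum_(g in G) rG g.
have nzG : (#|G|%:R : algC) != 0 by apply: neq0CG.
have avg m n (X : 'M[algC]_(m, n)) : #|G|%:R^-1 *: \sum_(g in G) X = X.
  by rewrite sumr_const -scaler_nat scalerA mulVf // scale1r.
have Er h : h \in G -> E *m rG h = E.
  move=> Gh; rewrite -scalemxAl mulmx_suml; congr (_ *: _).
  rewrite [RHS](reindex_inj (mulIg h)) /=; apply: eq_big => g.
    by rewrite groupMr.
  by move=> Gg; rewrite repr_mxM.
have idE : E *m E = E.
  rewrite {2}/E -scalemxAr mulmx_sumr.
  by rewrite (eq_bigr (fun=> E)) // avg.
have ErT h : h \in G -> (rG h)^T *m E^T = E^T by move=> Gh; rewrite -trmx_mul Er.
have EMl : E *m M *m E^T = M *m E^T.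
  rewrite {1}/E -!scalemxAl !mulmx_suml (eq_bigr (fun=> M *m E^T)) => [|g Gg].
    exact: avg.
  by rewrite -(ErT (g ^ s)%g) ?twists_bij // !mulmxA invM // -mulmxA ErT ?twists_bij.
have EMr : E *m M *m E^T = E *m M.
  have EMg g : g \in G -> E *m M *m (rG (g ^ s)%g)^T = E *m M.
    by move=> Gg; rewrite -{1}(Er g) // -!mulmxA [rG g *m _]mulmxA invM.
  rewrite {2}/E linearZ /= -scalemxAr linear_sum mulmx_sumr /=.
  rewrite -(sum_conj_norm _ nGs) (eq_bigr (fun=> E *m M)) //.
  exact: avg.
have EM : E *m M = M *m E^T by rewrite -EMr EMl.
have [r [B [C [BC CB rE]]]] : exists r (B : 'M_(r, d)) (C : 'M_(d, r)),
    [/\ B *m C = 1%:M, C *m B = E & \rank E = r].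
  exists (\rank E), (row_base E), (col_base E).
  by split; [exact: idempotent_base | exact: mulmx_base | by []].
have BE : B *m E = B by rewrite -CB mulmxA BC mul1mx.
have Br h : h \in G -> B *m rG h = B by move=> Gh; rewrite -BE -mulmxA Er.
have er : ~~ odd (\rank E); first rewrite rE.
  apply: (@odd_skew_singular _ (B *m M *m B^T)).
    rewrite !trmx_mul trmxK -{1}(Br (s ^+ 2)%g) // -!mulmxA [rG _ *m _]mulmxA symM.
    by rewrite scaleN1r mulNmx mulmxN.
  have/mulmx1_unit[] // : B *m M *m B^T *m (C^T *m invmx M *m C) = 1%:M.
  rewrite !mulmxA -(mulmxA _ B^T) -trmx_mul CB -(mulmxA B M) -EM mulmxA BE.
  by rewrite -(mulmxA _ M) mulmxV // mulmx1.
suff -> : '[cfRepr rG, 1] = (\rank E)%:R by rewrite even_int_nat.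
rewrite -mxtrace_idempotent // mxtraceZ raddf_sum cfdotE; congr (_ * _).
by apply: eq_bigr => g Gg; rewrite cfun1E cfunE Gg conjC1 mulr1.
Qed.

End Twisted.

(** * Twisted Frobenius-Schur theory for irreducible representations *)

Section IrrForm.
Variables (gT : finGroupType) (G : {group gT}) (s : gT) (d : nat).
Variable rG : mx_representation algC G d.
Hypotheses (tw : twists s G) (irrG : mx_irreducible rG).

Definition invariant_form (M : 'M[algC]_d) :=
  {in G, forall g, rG g *m M *m (rG (g ^ s)%g)^T = M}.

Definition form_avg (X : 'M[algC]_d) : 'M[algC]_d :=
  #|G|%:R^-1 *: \sum_(g in G) rG g *m X *m (rG (g ^ s)%g)^T.

Let nGs : s \in 'N(G)%g. Proof. exact: twistsN tw. Qed.

Lemma form_avg_invariant X : invariant_form (form_avg X).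
Proof.
move=> h Gh; rewrite /form_avg -scalemxAr -scalemxAl mulmx_sumr mulmx_suml.
congr (_ *: _); rewrite [RHS](reindex_inj (mulgI h)) /=; apply: eq_big => g.
  by rewrite groupMl.
move=> Gg; rewrite conjMg (repr_mxM rG Gh Gg).
by rewrite (repr_mxM rG (twists_bij nGs Gh) (twists_bij nGs Gg)) trmx_mul !mulmxA.
Qed.

Lemma form_avg_id M : invariant_form M -> form_avg M = M.
Proof.
move=> iM; rewrite /form_avg (eq_bigr (fun=> M)) // sumr_const -scaler_nat.
by rewrite scalerA mulVf ?neq0CG // scale1r.
Qed.

Lemma invariant_form_comm M g : invariant_form M -> g \in G ->
  rG g *m M = M *m invmx (rG (g ^ s)%g)^T.
Proof.
move=> iM Gg; have uT : (rG (g ^ s)%g)^T \in unitmx.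
  by rewrite unitmx_tr repr_mx_unit ?twists_bij.
by apply: (canRL (mulmxK uT)); apply: iM.
Qed.

Lemma invariant_form_unit M : invariant_form M -> M != 0 -> M \in unitmx.
Proof.
move=> iM nzM; have [_ irr] := (mx_irrP rG).1 irrG.
rewrite -row_free_unit -kermx_eq0; apply/eqP/eqP; apply: contraNT nzM => nzK.
have/irr/(_ nzK) fK : mxmodule rG (kermx M).
  apply/mxmoduleP=> g Gg; apply/sub_kermxP.
  by rewrite -mulmxA invariant_form_comm // mulmxA mulmx_ker mul0mx.
have : (1%:M <= kermx M)%MS by rewrite sub1mx.
by move/sub_kermxP; rewrite mul1mx => ->.
Qed.

Lemma invariant_form_unique M N : invariant_form M -> M \in unitmx ->
  invariant_form N -> exists c, N = c *: M.
Proof.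
move=> iM uM iN.
have : is_scalar_mx (N *m invmx M).
  apply: (mx_abs_irr_cent_scalar (groupC irrG)); apply/centgmxP=> g Gg.
  rewrite mulmxA invariant_form_comm // -!mulmxA; congr (_ *m _).
  apply: (can_inj (mulmxK uM)); rewrite mulmxKV // -mulmxA.
  by rewrite invariant_form_comm // mulKmx.
case/is_scalar_mxP=> c Ec; exists c.
by rewrite -mul_scalar_mx -Ec -mulmxA mulVmx // mulmx1.
Qed.

Lemma invariant_form_dual M :
  invariant_form M -> invariant_form (rG (s ^+ 2)%g *m M^T).
Proof.
have G2 := twists2 tw.
move=> iM g Gg; have Ggs : (g ^ s)%g \in G by rewrite twists_bij.
have iMs := iM _ Ggs; rewrite -conjgM -[(s * s)%g]/(s ^+ 2)%g in iMs.
have -> : rG g *m (rG (s ^+ 2)%g *m M^T) = rG (s ^+ 2)%g *m (rG (g ^ (s ^+ 2))%g *m M^T).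
  rewrite !mulmxA -!repr_mxM ?groupJ //; congr (rG _ *m _).
  by rewrite conjgE !mulgA mulgV mul1g.
rewrite -mulmxA; congr (_ *m _); apply: trmx_inj.
by rewrite !trmx_mul !trmxK mulmxA iMs.
Qed.

Lemma invariant_form_dualK M : invariant_form M ->
  rG (s ^+ 2)%g *m (rG (s ^+ 2)%g *m M^T)^T = M.
Proof.
move=> iM; rewrite trmx_mul trmxK mulmxA -[RHS](iM _ (twists2 tw)).
by congr (_ *m (rG _)^T); rewrite conjgE -[(s ^+ 2)%g]/(s * s)%g !mulgA mulVg mul1g.
Qed.

(** [M |-> rho(s^2) M^T] is an involution of the line of invariant forms ([invariant_form_dualK]),
    so its eigenvalue squares to 1. *)
Lemma invariant_form_sign M : invariant_form M -> M \in unitmx ->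
  exists b : bool, rG (s ^+ 2)%g *m M^T = (-1) ^+ b *: M.
Proof.
move=> iM uM.
have [c Ec] := invariant_form_unique iM uM (invariant_form_dual iM).
have := invariant_form_dualK iM; rewrite Ec linearZ /= -scalemxAr Ec scalerA.
have nzM : M != 0.
  have [d_gt0 _] := (mx_irrP rG).1 irrG; apply: contraTneq uM => ->.
  by rewrite -(prednK d_gt0) unitmxE det0 unitr0.
move/eqP; rewrite -[X in _ == X]scale1r -subr_eq0 -scalerBl scaler_eq0 (negPf nzM) orbF.
rewrite -expr2 subr_sqr_1 mulf_eq0 subr_eq0 addr_eq0 => /orP[] /eqP->.
  by exists false.
by exists true.
Qed.

Lemma fs_ind_repr : fs_ind s (cfRepr rG) =
  \sum_a \sum_b \sum_c rG (s ^+ 2)%g a b * form_avg (delta_mx a c) c b.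
Proof.
have G2 := twists2 tw.
rewrite /fs_ind; transitivity (#|G|%:R^-1 * \sum_(g in G) \sum_a \sum_b \sum_c
   rG (s ^+ 2)%g a b * (rG g c a * rG (g ^ s)%g b c)).
  congr (_ * _); apply: eq_bigr => g Gg.
  have Ggs := twists_bij nGs Gg; have G2gs := groupM G2 Ggs.
  rewrite sqr_twist cfunE (groupM G2gs Gg) (repr_mxM rG G2gs Gg) (repr_mxM rG G2 Ggs) /=.
  rewrite mulr1n -mulmxA /mxtrace; apply: eq_bigr => a _; rewrite mxE.
  apply: eq_bigr => b _; rewrite mxE mulr_sumr; apply: eq_bigr => c _.
  by rewrite [rG g c a * _]mulrC.
rewrite exchange_big mulr_sumr; apply: eq_bigr => a _.
rewrite exchange_big mulr_sumr; apply: eq_bigr => b _.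
rewrite exchange_big mulr_sumr; apply: eq_bigr => c _.
rewrite -mulr_sumr mulrCA; congr (_ * _).
rewrite /form_avg mxE summxE; congr (_ * _); apply: eq_bigr => g Gg.
rewrite mxE (bigD1 c) //= big1 ?addr0 => [|j nj]; last first.
  by rewrite mxE big1 ?mul0r // => k _; rewrite mxE (negPf nj) andbF mulr0.
rewrite !mxE (bigD1 a) //= big1 ?addr0 => [|j nj].
  by rewrite mxE !eqxx mulr1.
by rewrite mxE (negPf nj) mulr0.
Qed.

Lemma form_avg_sum X :
  form_avg X = \sum_a \sum_c X a c *: form_avg (delta_mx a c).
Proof.
have avD : {morph form_avg : A B / A + B >-> A + B}.
  move=> A B; rewrite /form_avg -scalerDr -big_split; congr (_ *: _).
  by apply: eq_bigr => g _; rewrite mulmxDr mulmxDl.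
have av0 : form_avg 0 = 0.
  by rewrite /form_avg big1 ?scaler0 // => g _; rewrite mulmx0 mul0mx.
rewrite {1}[X]matrix_sum_delta (big_morph _ avD av0); apply: eq_bigr => a _.
rewrite (big_morph _ avD av0); apply: eq_bigr => c _.
rewrite /form_avg [RHS]scalerA mulrC -[RHS]scalerA; congr (_ *: _).
by rewrite scaler_sumr; apply: eq_bigr => g _; rewrite -scalemxAr -scalemxAl.
Qed.

(** All invariant forms are multiples of [M], so averaging is [X |-> phi X *: M] with [phi] linear
    and [phi M = 1]. Inserting this in the expansion of the indicator over matrix units leaves the
    sign. *)
Lemma fs_ind_form M b : invariant_form M -> M \in unitmx ->
  rG (s ^+ 2)%g *m M^T = (-1) ^+ nat_of_bool b *: M ->
  fs_ind s (cfRepr rG) = (-1) ^+ nat_of_bool b.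
Proof.
move=> iM uM symM.
have nzM : M != 0.
  have [d_gt0 _] := (mx_irrP rG).1 irrG; apply: contraTneq uM => ->.
  by rewrite -(prednK d_gt0) unitmxE det0 unitr0.
have [p [q nzpq]] : exists p, exists q, M p q != 0.
  case: (boolP [forall p, forall q, M p q == 0]) => [/forallP z|].
    by case/eqP: nzM; apply/matrixP=> p q; rewrite mxE (eqP (forallP (z p) q)).
  by case/forallPn=> p /forallPn[q nz]; exists p, q.
pose phi X := form_avg X p q / M p q.
have phiE X : form_avg X = phi X *: M.
  have [c Ec] := invariant_form_unique iM uM (@form_avg_invariant X).
  by rewrite /phi Ec mxE mulfK.
clearbody phi.
have phiM : \sum_a \sum_c M a c * phi (delta_mx a c) = 1.
  have := form_avg_sum M; rewrite form_avg_id // => /matrixP/(_ p q).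
  rewrite summxE => EM; apply: (mulIf nzpq); rewrite mul1r [RHS]EM mulr_suml.
  apply: eq_bigr => a _; rewrite summxE mulr_suml; apply: eq_bigr => c _.
  by rewrite mxE phiE mxE mulrA.
rewrite fs_ind_repr -[RHS]mulr1 -[X in _ = _ * X]phiM mulr_sumr; apply: eq_bigr => a _.
rewrite exchange_big mulr_sumr; apply: eq_bigr => c _ /=.
have := congr1 (fun N : 'M_d => N a c) symM; rewrite !mxE => Eac.
rewrite mulrA -Eac mulr_suml; apply: eq_bigr => k _.
by rewrite phiE !mxE -mulrA [phi _ * _]mulrC.
Qed.

Lemma fs_ind_no_form : (forall X, form_avg X = 0) -> fs_ind s (cfRepr rG) = 0.
Proof.
move=> av0; rewrite fs_ind_repr big1 // => a _; rewrite big1 // => b _.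
by rewrite big1 // => c _; rewrite av0 mxE mulr0.
Qed.

(** Twisted reality turns [conj (chi g)] into [chi (g ^ s)], and then ['[chi, chi]] is a sum of
    entries of averaged matrix units. If all of these vanished, so would the norm of [chi]. *)
Lemma twisted_real_form_avg : twisted_real s (cfRepr rG) ->
  exists X, form_avg X != 0.
Proof.
move=> sre; case: (boolP [forall a, forall c, form_avg (delta_mx a c) == 0]).
  move/forallP=> z; suff: '[cfRepr rG] = 0.
    have [d_gt0 _] := (mx_irrP rG).1 irrG.
    move/eqP; rewrite cfnorm_eq0 => /eqP/cfunP/(_ 1%g)/eqP.
    by rewrite cfRepr1 cfunE pnatr_eq0 -leqn0 leqNgt d_gt0.
  rewrite cfdotE (_ : _ * _ = \sum_a \sum_c form_avg (delta_mx a c) a c); last first.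
    rewrite /form_avg; under [RHS]eq_bigr => a _ do
      under eq_bigr => c _ do rewrite mxE summxE.
    under [RHS]eq_bigr => a _ do rewrite -mulr_sumr exchange_big.
    rewrite -mulr_sumr exchange_big; congr (_ * _); apply: eq_bigr => g Gg.
    rewrite -sre // !cfunE Gg twists_bij //= !mulr1n mulr_suml.
    apply: eq_bigr => a _; rewrite mulr_sumr; apply: eq_bigr => c _.
    rewrite mxE (bigD1 c) //= big1 ?addr0 => [|j nj]; last first.
      by rewrite mxE big1 ?mul0r // => k _; rewrite mxE (negPf nj) andbF mulr0.
    rewrite !mxE (bigD1 a) //= big1 ?addr0 => [|j nj].
      by rewrite mxE !eqxx mulr1.
    by rewrite mxE (negPf nj) mulr0.
  rewrite big1 // => a _; rewrite big1 // => c _.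
  by rewrite (eqP (forallP (z a) c)) mxE.
case/forallPn=> a /forallPn[c nz]; by exists (delta_mx a c).
Qed.

Lemma form_twisted_real M : invariant_form M -> M \in unitmx ->
  twisted_real s (cfRepr rG).
Proof.
move=> iM uM g Gg; rewrite -char_inv ?cfRepr_char // !cfunE groupV Gg twists_bij //=.
rewrite !mulr1n repr_mxV // -[LHS]mxtrace_tr.
have EM : M *m (rG (g ^ s)%g)^T = invmx (rG g) *m M.
  by apply: (canRL (mulKmx (repr_mx_unit rG Gg))); rewrite mulmxA iM.
by rewrite -[_^T](mulKmx uM) EM mxtrace_mulC -mulmxA mulmxV // mulmx1.
Qed.

End IrrForm.

Section FrobeniusSchur.
Variables (gT : finGroupType) (G : {group gT}) (s : gT).
Hypothesis tw : twists s G.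

Lemma fs_irrP (i : Iirr G) :
  (fs_ind s 'chi_i = 0 /\ ~ twisted_real s 'chi_i) \/
  exists b : bool, [/\ fs_ind s 'chi_i = (-1) ^+ b, twisted_real s 'chi_i
                     & typed_char s ((-1) ^+ b) 'chi_i].
Proof.
have /irr_reprP[[d rG] /= irrG ->] := mem_irr i.
case: (boolP [forall a, forall c, form_avg s rG (delta_mx a c) == 0]) => [z|].
  have av0 X : form_avg s rG X = 0.
    rewrite form_avg_sum big1 // => a _; rewrite big1 // => c _.
    by rewrite (eqP (forallP (forallP z a) c)) scaler0.
  left; split; first exact: fs_ind_no_form.
  by case/(twisted_real_form_avg tw irrG) => X; rewrite av0 eqxx.
case/forallPn=> a /forallPn[c nz]; right.
set M := form_avg _ _ _ in nz; have iM : invariant_form s rG M.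
  exact: form_avg_invariant.
have uM := invariant_form_unit tw irrG iM nz.
have [b Eb] := invariant_form_sign tw irrG iM uM; exists b; split.
- exact: fs_ind_form Eb.
- exact: form_twisted_real uM.
by exists d, rG, M; split.
Qed.

Lemma fs_ind_real i : twisted_real s 'chi[G]_i ->
  fs_ind s 'chi_i = 1 \/ fs_ind s 'chi_i = -1.
Proof.
move=> sre; case: (fs_irrP i) => [[_ //]|[[] [-> _ _]]]; by [right | left].
Qed.

Lemma fs_ind_typed i (b : bool) :
  fs_ind s 'chi[G]_i = (-1) ^+ b ->
  twisted_real s 'chi_i /\ typed_char s ((-1) ^+ b) 'chi_i.
Proof.
case: (fs_irrP i) => [[-> _] /esym/eqP|[b' [-> sre ty]]].
  by rewrite signr_eq0.
case: b b' ty => [] [] //= ty; rewrite expr0 expr1 => /eqP; rewrite 1?eqNr ?oner_eq0 //.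
by rewrite eq_sym eqNr oner_eq0.
Qed.

End FrobeniusSchur.

(** * Virtual characters and parity *)

Section RealLattice.
Local Open Scope group_scope.
Local Open Scope ring_scope.
Variable gT : finGroupType.
Implicit Types (G H K : {group gT}) (s : gT).

Lemma vchar_int G (phi : 'CF(G)) :
  (forall i, '[phi, 'chi_i] \in Num.int) -> phi \in 'Z[irr G].
Proof.
move=> h; rewrite [phi]cfun_sum_cfdot; apply: rpred_sum => i _.
by apply: scale_zchar => //; apply: irr_vchar.
Qed.

Definition twisted_conj G s (i : Iirr G) : Iirr G :=
  conjC_Iirr (conjg_Iirr i s^-1%g).

Lemma twisted_conjE G s (i : Iirr G) g : s \in 'N(G)%g ->
  'chi_(twisted_conj s i) g = ('chi_i (g ^ s)%g)^*.
Proof.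
by move=> nGs; rewrite conjC_IirrE cfConjCE conjg_IirrE cfConjgE ?groupV // invgK.
Qed.

Lemma twisted_conj_real G s (i : Iirr G) : s \in 'N(G)%g ->
  twisted_real s 'chi_i <-> twisted_conj s i = i.
Proof.
move=> nGs; split=> [sre | E g Gg].
  by apply/irr_inj/cfun_inP=> g Gg; rewrite twisted_conjE // sre // conjCK.
by rewrite -{2}E twisted_conjE // conjCK.
Qed.

Lemma twisted_conjK G s : twists s G -> involutive (@twisted_conj G s).
Proof.
case/andP=> nGs G2 i; apply/irr_inj/cfun_inP=> g Gg.
by rewrite !twisted_conjE // conjCK -conjgM -[(s * s)%g]/(s ^+ 2)%g cfunJ.
Qed.

Lemma twisted_conj_dot G s (a : 'CF(G)) i : s \in 'N(G)%g ->
  a \in 'Z[irr G] -> twisted_real s a ->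
  '[a, 'chi_(twisted_conj s i)] = '[a, 'chi_i].
Proof.
move=> nGs Za sre; rewrite -[RHS]conj_intr ?Cint_cfdot_vchar_irr // !cfdotE.
rewrite rmorphM fmorphV rmorph_nat rmorph_sum /=; congr (_ * _).
rewrite -[RHS](sum_conj_norm _ nGs).
apply: eq_bigr => g Gg.
by rewrite twisted_conjE // conjCK rmorphM /= conjCK sre // conjCK.
Qed.

(** The twisted analogue of the lattice of characters of real representations: it is spanned by the
    irreducibles of indicator 1, the doubles of those of indicator [-1], and the sums of two
    irreducibles swapped by [twisted_conj s]. *)
Definition RR G s (a : 'CF(G)) :=
  [/\ a \in 'Z[irr G], twisted_real s a
    & forall i, fs_ind s 'chi_i = -1 -> even_int '[a, 'chi_i]].

(** Modulo 2 only irreducibles fixed by [twisted_conj s] contribute; each has indicator 1 or [-1],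
    and in either case one of the two multiplicities is even. Thus [RR] is orthogonal modulo 2 to
    the quaternionic lattice, where multiplicities are even at indicator 1. *)
Lemma RR_pair G s (a b : 'CF(G)) : twists s G -> RR s a ->
    b \in 'Z[irr G] -> twisted_real s b ->
    (forall i, fs_ind s 'chi_i = 1 -> even_int '[b, 'chi_i]) ->
  even_int '[a, b].
Proof.
move=> tw [Za sa ea] Zb sb eb; have nGs := twistsN tw.
rewrite cfdot_sum_irr; apply: (even_int_involution (twisted_conjK tw)) => [i|i|i Ei].
- by rewrite !twisted_conj_dot.
- by rewrite rpredM ?aut_intr ?Cint_cfdot_vchar_irr.
rewrite conj_intr ?Cint_cfdot_vchar_irr //.
have [] := fs_ind_real tw ((twisted_conj_real i nGs).2 Ei).
  by move/eb; apply: even_intM; rewrite Cint_cfdot_vchar_irr.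
by move/ea; rewrite mulrC; apply: even_intM; rewrite Cint_cfdot_vchar_irr.
Qed.

Lemma fs_ind_conjC G s (phi : 'CF(G)) : fs_ind s (phi^*)%CF = (fs_ind s phi)^*.
Proof.
rewrite /fs_ind rmorphM fmorphV rmorph_nat rmorph_sum /=.
by congr (_ * _); apply: eq_bigr => g _; rewrite cfConjCE.
Qed.

Lemma typed_irr_conjC G s i (b : bool) : twists s G ->
  fs_ind s 'chi[G]_i = (-1) ^+ b -> typed_char s ((-1) ^+ b) (('chi_i)^*)%CF.
Proof.
move=> tw E; rewrite -conjC_IirrE; apply: (fs_ind_typed tw _).2.
by rewrite conjC_IirrE fs_ind_conjC E rmorph_sign.
Qed.

(** On [H] the product of ['chi_i] and the conjugate of ['chi_j] carries a form of sign [-1], so its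
    fixed space has even dimension. Read contrapositively: a twisted-real constituent of odd
    multiplicity inherits the indicator. *)
Lemma fs_Res_parity G H s i j (b : bool) : H \subset G -> twists s G -> twists s H ->
  fs_ind s 'chi[G]_i = (-1) ^+ b -> fs_ind s 'chi[H]_j = (-1) ^+ (~~ b) ->
  even_int '['Res[H] 'chi_i, 'chi_j].
Proof.
move=> sHG twG twH Ei Ej.
have -> : '['Res[H] 'chi_i, 'chi_j] = '['Res[H] 'chi_i * ('chi_j)^*%CF, 1].
  rewrite !cfdotE; congr (_ * _); apply: eq_bigr => g Hg.
  by rewrite cfun1E Hg conjC1 mulr1 !cfunE.
apply: (typed_even twH).
have -> : -1 = (-1) ^+ b * (-1) ^+ (~~ b) :> algC by case: b {Ei Ej}; rewrite ?expr0 ?expr1 ?mulr1 ?mul1r.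
apply: typed_mul; last exact: typed_irr_conjC.
exact/typed_Res/(fs_ind_typed twG Ei).2.
Qed.

Lemma twisted_real_Res G H s (a : 'CF(G)) : H \subset G -> s \in 'N(H)%g ->
  twisted_real s a -> twisted_real s ('Res[H] a).
Proof.
move=> sHG nHs sa g Hg; have Gg := subsetP sHG _ Hg.
by rewrite !cfResE ?twists_bij // sa.
Qed.

Lemma twisted_real_Ind G H s (a : 'CF(H)) : H \subset G -> s \in 'N(G)%g ->
  s \in 'N(H)%g -> twisted_real s a -> twisted_real s ('Ind[G] a).
Proof.
move=> sHG nGs nHs sa g Gg; rewrite !cfIndE // rmorphM fmorphV rmorph_nat rmorph_sum.
congr (_ * _); rewrite -(sum_conj_norm _ nGs); apply: eq_bigr => y Gy.
rewrite -conjJg; have [Hgy | nHgy] := boolP (g ^ y \in H)%g; first by rewrite sa.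
by rewrite (cfun0 _ nHgy) rmorph0 cfun0 // memJ_norm.
Qed.

Lemma twisted_realM G s (a b : 'CF(G)) :
  twisted_real s a -> twisted_real s b -> twisted_real s (a * b).
Proof. by move=> sa sb g Gg; rewrite !cfunE sa // sb // rmorphM. Qed.

Lemma twisted_realC G s (a : 'CF(G)) :
  twisted_real s a -> twisted_real s (a^*)%CF.
Proof. by move=> sa g Gg; rewrite !cfConjCE sa. Qed.

(** By reciprocity the multiplicity of ['chi_j] is a pairing with ['Ind 'chi_j], which lies in the
    quaternionic lattice of [G] by [fs_Res_parity]. *)
Lemma RR_Res G H s (a : 'CF(G)) : H \subset G -> twists s G -> twists s H ->
  RR s a -> RR s ('Res[H] a).
Proof.
move=> sHG twG twH Ra; have [Za sa ea] := Ra; have nHs := twistsN twH.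
split=> [||j Ej]; [exact: cfRes_vchar | exact: twisted_real_Res |].
rewrite cfdot_Res_l; apply: (RR_pair twG Ra).
- by apply/cfInd_vchar/irr_vchar.
- apply: twisted_real_Ind (twistsN twG) _ _ => //.
  by apply: (fs_ind_typed twH (b := true) _).1; rewrite Ej expr1.
move=> i Ei; rewrite -Frobenius_reciprocity cfdotC conj_intr.
  by apply: (fs_Res_parity (b := false) sHG twG twH); rewrite ?expr0 ?expr1.
by rewrite Cint_cfdot_vchar ?cfRes_vchar ?irr_vchar.
Qed.

Lemma RR_irr G s i : fs_ind s 'chi[G]_i = 1 -> twists s G -> RR s 'chi_i.
Proof.
move=> Ei tw; split=> [||j Ej]; first exact: irr_vchar.
  by apply: (fs_ind_typed tw (b := false) _).1; rewrite Ei expr0.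
rewrite cfdot_irr; case: eqP Ej => [<-|_ _]; last exact: even_int0.
by rewrite Ei => /eqP; rewrite eq_sym eqNr oner_eq0.
Qed.

Lemma RR_Ind_irr G H s j : H \subset G -> twists s G -> twists s H ->
  fs_ind s 'chi[H]_j = 1 -> RR s ('Ind[G] 'chi_j).
Proof.
move=> sHG twG twH Ej; split=> [||i Ei]; first by apply/cfInd_vchar/irr_vchar.
  apply: twisted_real_Ind (twistsN twG) (twistsN twH) _ => //.
  by apply: (fs_ind_typed twH (b := false) _).1; rewrite Ej expr0.
rewrite -Frobenius_reciprocity cfdotC conj_intr.
  by apply: (fs_Res_parity (b := true) sHG twG twH); rewrite ?expr0 ?expr1.
by rewrite Cint_cfdot_vchar ?cfRes_vchar ?irr_vchar.
Qed.

Lemma cfdotM_conjr G (a b c : 'CF(G)) : '[a * b, c] = '[a, b^*%CF * c].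
Proof.
rewrite !cfdotE; congr (_ * _); apply: eq_bigr => g _.
by rewrite !cfunE rmorphM /= conjCK mulrA.
Qed.

Lemma RR_mul G s (a b : 'CF(G)) : twists s G -> RR s a -> RR s b -> RR s (a * b).
Proof.
move=> tw Ra Rb; have [[Za sa _] [Zb sb _]] := (Ra, Rb).
split=> [||k Ek]; first exact: rpredM.
  exact: twisted_realM.
have sk : twisted_real s 'chi_k.
  by apply: (fs_ind_typed tw (b := true) _).1; rewrite Ek expr1.
rewrite cfdotM_conjr; apply: (RR_pair tw Ra).
- by rewrite rpredM ?irr_vchar ?cfConjC_vchar.
- by apply: twisted_realM => //; apply: twisted_realC.
move=> i Ei; have si : twisted_real s 'chi_i.
  by apply: (fs_ind_typed tw (b := false) _).1; rewrite Ei expr0.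
rewrite mulrC cfdotM_conjr cfConjCK cfdotC conj_intr; last first.
  by rewrite Cint_cfdot_vchar ?rpredM ?irr_vchar.
rewrite cfdotM_conjr; apply: (RR_pair tw Rb).
- by rewrite rpredM ?irr_vchar ?cfConjC_vchar ?irr_vchar.
- by apply: twisted_realM => //; apply: twisted_realC.
move=> j Ej.
have -> : '[('chi_i)^*%CF * 'chi_k, 'chi_j] = '[('chi_i)^*%CF * 'chi_k * ('chi_j)^*%CF, 1].
  rewrite !cfdotE; congr (_ * _); apply: eq_bigr => g Hg.
  by rewrite cfun1E Hg conjC1 mulr1 !cfunE.
apply: (typed_even tw); rewrite -[-1]mul1r -[1 * -1]mulr1.
have typ1 (l : Iirr G) : fs_ind s 'chi_l = 1 -> typed_char s 1 (('chi_l)^*)%CF.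
  by move=> El; apply: (typed_irr_conjC (b := false)); rewrite ?expr0.
apply: typed_mul; last exact: typ1.
apply: typed_mul; first exact: typ1.
by apply: (fs_ind_typed tw (b := true) _).2; rewrite Ek expr1.
Qed.

Lemma RR_conjC G s (a : 'CF(G)) : RR s a -> RR s (a^*)%CF.
Proof.
case=> Za sa ea; split=> [||i Ei]; [exact: cfConjC_vchar | exact: twisted_realC |].
rewrite cfdot_conjCl -conjC_IirrE conj_intr ?Cint_cfdot_vchar_irr //.
by apply: ea; rewrite conjC_IirrE fs_ind_conjC Ei rmorphN1.
Qed.

Lemma RR0 G s : RR s (0 : 'CF(G)).
Proof.
split=> [||i _]; [exact: cfun0_zchar | by move=> g _; rewrite !cfunE conjC0 |].
by rewrite cfdot0l even_int0.
Qed.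

Lemma RR_add G s (a b : 'CF(G)) : RR s a -> RR s b -> RR s (a + b).
Proof.
case=> Za sa ea [Zb sb eb]; split=> [||i Ei].
- exact: rpredD.
- by move=> g Gg; rewrite !cfunE sa // sb // rmorphD.
by rewrite cfdotDl; apply: even_intD; [exact: ea | exact: eb].
Qed.

Lemma RR_sum G s (I : finType) (P : pred I) (a : I -> 'CF(G)) :
  (forall i, P i -> RR s (a i)) -> RR s (\sum_(i | P i) a i).
Proof. by move=> h; elim/big_ind: _; [exact: RR0 | exact: RR_add | exact: h]. Qed.

Lemma twists_coset G s h : h \in G -> twists s G -> twists (h * s) G.
Proof.
move=> Gh /andP[nGs G2]; apply/andP; split; first by rewrite groupM // (subsetP (normG G)).
have -> : ((h * s) ^+ 2 = h * h ^ s^-1 * s ^+ 2)%g.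
  by rewrite !expgS !expg0 !mulg1 conjgE invgK !mulgA mulgKV.
by rewrite groupM // groupM // memJ_norm ?groupV.
Qed.

Lemma fs_ind_coset G s h (phi : 'CF(G)) : h \in G -> s \in 'N(G)%g ->
  fs_ind (h * s)%g phi = fs_ind s phi.
Proof.
move=> Gh nGs; rewrite /fs_ind; congr (_ * _).
rewrite [RHS](reindex_inj (mulgI (h ^ s)%g)) /=; apply: eq_big => g.
  by rewrite groupMl // memJ_norm.
by rewrite conjgE !mulgA mulgV mul1g.
Qed.

Lemma twisted_real_coset G s h (phi : 'CF(G)) : h \in G ->
  twisted_real s phi -> twisted_real (h * s)%g phi.
Proof. by move=> Gh sr g Gg; rewrite conjgM sr ?groupJ // cfunJ. Qed.

Lemma RR_coset G s h (a : 'CF(G)) : h \in G -> s \in 'N(G)%g ->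
  RR s a -> RR (h * s)%g a.
Proof.
move=> Gh nGs [Za sa ea]; split=> [||i]; first by [].
  exact: twisted_real_coset.
by rewrite fs_ind_coset //; apply: ea.
Qed.

Lemma fs_ind_lin G s (l : 'CF(G)) : twists s G -> l \is a linear_char ->
  twisted_real s l -> l (s ^+ 2)%g = 1 -> fs_ind s l = 1.
Proof.
move=> /andP[nGs G2] ll sl l2; rewrite /fs_ind (eq_bigr (fun=> 1)) => [|g Gg].
  by rewrite sumr_const mulVf ?neq0CG.
have Ggs : (g ^ s)%g \in G by rewrite memJ_norm.
rewrite sqr_twist (lin_charM ll (groupM G2 Ggs) Gg) (lin_charM ll G2 Ggs) l2 mul1r sl //.
by rewrite mulrC -normCK normC_lin_char // expr1n.
Qed.

End RealLattice.

(** * Averages over the kernel of a semidirect product *)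

Section SemidirectAverage.
Local Open Scope group_scope.
Local Open Scope ring_scope.
Variables (gT : finGroupType) (K H G : {group gT}).
Hypothesis defG : (K ><| H = G)%g.

Let sKG : K \subset G. Proof. by case/sdprod_context: defG => /andP[]. Qed.
Let sHG : H \subset G. Proof. by case/sdprod_context: defG. Qed.
Let nKG : K <| G. Proof. by case/sdprod_context: defG. Qed.
Let KH : (K * H)%g = G. Proof. by case/sdprodP: defG. Qed.

Lemma sum_sdprod (R : nmodType) (f : gT -> R) :
  \sum_(g in G) f g = \sum_(h in H) \sum_(k in K) f (k * h)%g.
Proof.
rewrite (partition_big (remgr K H) (mem H)) => [|g]; last first.
  by rewrite -KH; apply: mem_remgr.
have tiKH : (K :&: H = 1)%g by case/sdprodP: defG.
apply: eq_bigr => h Hh; rewrite (reindex_inj (mulIg h)) /=; apply: eq_bigl => k.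
apply/andP/idP => [[Gkh /eqP Er] | Kk].
  have Gk : k \in G by rewrite -(groupMr _ (subsetP sHG _ Hh)).
  have : (k * h)%g \in (K * H)%g by rewrite KH.
  by move/mem_divgr; rewrite /divgr Er mulgK.
split; last by rewrite remgrMid.
by apply: groupM; [apply: (subsetP sKG) | apply: (subsetP sHG)].

Qed.

Fact sdprod_avg_subproof (phi : 'CF(G)) : is_class_fun <<H>>
  [ffun x => (#|K|%:R^-1 * \sum_(k in K) phi (k * x)%g) *+ (x \in H)].
Proof.
rewrite genGid; apply: intro_class_fun => [x y Hx Hy | x /negbTE-> //].
rewrite groupJ // Hx; congr (_ * _ *+ _).
have nKy : y \in 'N(K)%g.
  by case/sdprod_context: defG => _ _ _ /subsetP->.
rewrite -(sum_conj_norm _ nKy); apply: eq_bigr => k Kk.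
by rewrite -conjMg cfunJ // (subsetP sHG).
Qed.

(** The character of [H] on the [K]-invariants, adjoint to the inflation [cfSdprod] (see
    [cfdot_sdprod_avg]). *)
Definition sdprod_avg phi := Cfun 1 (sdprod_avg_subproof phi) : 'CF(H).

Lemma sdprod_avgE phi h : h \in H ->
  sdprod_avg phi h = #|K|%:R^-1 * \sum_(k in K) phi (k * h)%g.
Proof. by move=> Hh; rewrite cfunElock Hh mulr1n. Qed.

Lemma cfdot_sdprod_avg phi psi :
  '[sdprod_avg phi, psi] = '[phi, cfSdprod defG psi].
Proof.
rewrite !cfdotE sum_sdprod -(sdprod_card defG) natrM invfM -mulrA.
rewrite [_ * (_ * _)]mulrCA; congr (_ * _); rewrite mulr_sumr; apply: eq_bigr => h Hh.
rewrite sdprod_avgE // -mulrA mulr_suml; congr (_ * _); apply: eq_bigr => k Kk.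
by rewrite cfSdprodE.
Qed.

Lemma sdprod_avg_vchar phi : phi \in 'Z[irr G] -> sdprod_avg phi \in 'Z[irr H].
Proof.
move=> Zphi; apply: vchar_int => j.
by rewrite cfdot_sdprod_avg -sdprod_IirrE Cint_cfdot_vchar_irr.
Qed.

Section Twist.
Variable s : gT.
Hypotheses (nKs : s \in 'N(K)%g) (nHs : s \in 'N(H)%g) (H2 : (s ^+ 2)%g \in H).

Let twH : twists s H. Proof. exact/andP. Qed.

Lemma sdprod_norm : s \in 'N(G)%g.
Proof. by rewrite -KH; apply/normP; rewrite conjsMg (normP nKs) (normP nHs). Qed.

Lemma sdprod_twists : twists s G.
Proof. by rewrite /twists sdprod_norm (subsetP sHG). Qed.

Lemma fs_ind_cfSdprod psi : fs_ind s (cfSdprod defG psi) = fs_ind s psi.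
Proof.
rewrite /fs_ind sum_sdprod -(sdprod_card defG) natrM invfM -mulrA.
rewrite mulrCA; congr (_ * _); rewrite mulr_sumr; apply: eq_bigr => h Hh.
rewrite (eq_bigr (fun=> psi ((s * h) ^+ 2)%g)) => [|k Kk].
  by rewrite sumr_const -(mulr_natl (psi _)) mulKf ?neq0CG.
rewrite !sqr_twist conjMg.
have H3 : (s ^+ 2 * h ^ s)%g \in H by rewrite groupM // memJ_norm.
have nKh x : x \in H -> x \in 'N(K)%g by case/sdprod_context: defG => _ _ _ /subsetP/(_ x).
have -> : (s ^+ 2 * (k ^ s * h ^ s) * (k * h) =
   ((k ^ s) ^ (s ^+ 2)^-1 * k ^ (s ^+ 2 * h ^ s)^-1) * (s ^+ 2 * h ^ s * h))%g.
  move: (s ^+ 2)%g (k ^ s)%g (h ^ s)%g => a b c.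
  by rewrite [(b ^ _)%g]conjgE [(k ^ _)%g]conjgE !invgK invMg !mulgA !mulgKV.
apply: cfSdprodE; last exact: groupM.
apply: groupM; rewrite memJ_norm ?groupV ?nKh //.
by rewrite memJ_norm.
Qed.

Lemma twisted_real_avg phi : twisted_real s phi -> twisted_real s (sdprod_avg phi).
Proof.
move=> sr h Hh; rewrite !sdprod_avgE ?memJ_norm // rmorphM fmorphV rmorph_nat rmorph_sum.
congr (_ * _); rewrite -(sum_conj_norm _ nKs); apply: eq_bigr => k Kk.
by rewrite -conjMg sr // groupM ?(subsetP sKG _ Kk) ?(subsetP sHG _ Hh).
Qed.

Lemma twisted_real_sdprod psi :
  twisted_real s psi -> twisted_real s (cfSdprod defG psi).
Proof.
move=> sr g; rewrite -{1}KH => /mulsgP[k h Kk Hh ->].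
by rewrite conjMg !cfSdprodE ?memJ_norm ?sr.
Qed.

Lemma RR_avg phi : RR s phi -> RR s (sdprod_avg phi).
Proof.
case=> Z sr ev; split=> [||j Ej]; first exact: sdprod_avg_vchar.
  exact: twisted_real_avg.
rewrite cfdot_sdprod_avg -sdprod_IirrE; apply: ev.
by rewrite sdprod_IirrE fs_ind_cfSdprod.
Qed.

Lemma cfSdprod_vchar psi : psi \in 'Z[irr H] -> cfSdprod defG psi \in 'Z[irr G].
Proof.
move=> Z; rewrite [psi]cfun_sum_cfdot linear_sum; apply: rpred_sum => j _.
by rewrite linearZ /= -sdprod_IirrE scale_zchar ?irr_vchar ?Cint_cfdot_vchar_irr.
Qed.

Lemma RR_sdprod psi : RR s psi -> RR s (cfSdprod defG psi).
Proof.
case=> Z sr ev; split=> [||i Ei]; first exact: cfSdprod_vchar.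
  exact: twisted_real_sdprod.
have -> : '[cfSdprod defG psi, 'chi_i] =
          \sum_j '[psi, 'chi_j] * (sdprod_Iirr defG j == i)%:R.
  rewrite [psi in LHS]cfun_sum_cfdot linear_sum cfdot_suml; apply: eq_bigr => j _.
  by rewrite linearZ /= cfdotZl -sdprod_IirrE cfdot_irr.
apply: even_int_sum => j _; case: eqP => [Eij | _]; last by rewrite mulr0 even_int0.
by rewrite mulr1; apply: ev; rewrite -fs_ind_cfSdprod -sdprod_IirrE Eij.
Qed.

End Twist.
End SemidirectAverage.

(** * Congruences of character values modulo powers of two *)

Definition aint_cong (m : nat) (x y : algC) := (x - y) / m%:R \in Aint.

Lemma aint_cong_refl m x : aint_cong m x x.
Proof. by rewrite /aint_cong subrr mul0r Aint0. Qed.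

Lemma aint_cong_trans m x y z : aint_cong m x y -> aint_cong m y z -> aint_cong m x z.
Proof.
rewrite /aint_cong => xy yz; have -> : x - z = (x - y) + (y - z) by rewrite addrA subrK.
by rewrite mulrDl rpredD.
Qed.

Lemma aint_congD m x y x' y' :
  aint_cong m x y -> aint_cong m x' y' -> aint_cong m (x + x') (y + y').
Proof. by rewrite /aint_cong => xy xy'; rewrite opprD addrACA mulrDl rpredD. Qed.

Lemma aint_cong_sqr m x y : x \in Aint -> y \in Aint -> aint_cong m x y ->
  aint_cong m (x ^+ 2) (y ^+ 2).
Proof. by move=> Ax Ay; rewrite /aint_cong subr_sqr mulrAC => ?; rewrite rpredM ?rpredD. Qed.

Lemma aint_cong_sum_sqr (I : Type) (r : seq I) (z : I -> algC) :
  (forall i, z i \in Aint) ->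
  aint_cong 2 ((\sum_(i <- r) z i) ^+ 2) (\sum_(i <- r) z i ^+ 2).
Proof.
move=> Az; elim: r => [|i r IH]; first by rewrite !big_nil expr0n /= aint_cong_refl.
rewrite !big_cons sqrrD addrAC; apply: aint_cong_trans (aint_congD (aint_cong_refl _ _) IH).
rewrite /aint_cong [X in X / _]addrAC subrr add0r -(mulr_natr _ 2) mulfK ?pnatr_eq0 //.
by rewrite rpredM ?rpred_sum.
Qed.

Lemma int_sqr_cong (a : algC) : a \in Num.int -> aint_cong 2 (a ^+ 2) a.
Proof.
move=> /intrP[m ->]; rewrite /aint_cong Aint_Cint //.
have: even_int ((m%:~R : algC) ^+ 2 - m%:~R); last by [].
rewrite -rmorphXn -rmorphB /=; case: m => n.
  case: n => [|n]; first by rewrite expr0n subrr even_int0.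
  rewrite expr2 -[n.+1%:Z in X in _ - X]mul1r -mulrBl -predn_int // -PoszM.
  by rewrite -pmulrn even_int_nat oddM /= andbN.
rewrite NegzE sqrrN opprK expr2 -[n.+1%:Z in X in _ + X]mulr1 -mulrDr -PoszD -PoszM.
by rewrite -pmulrn even_int_nat oddM addn1 /= andbN.
Qed.

Section CharCongruence.
Local Open Scope group_scope.
Local Open Scope ring_scope.
Variable gT : finGroupType.
Implicit Types G P : {group gT}.

(** On the cyclic group of [g] all irreducibles are linear; modulo 2, squaring passes inside the sum
    and integer coefficients satisfy [a^2 = a]. *)
Lemma vchar_sqr_cong G (rho : 'CF(G)) g : rho \in 'Z[irr G] -> g \in G ->
  aint_cong 2 (rho g ^+ 2) (rho (g ^+ 2)%g).
Proof.
move=> Zrho Gg; have sC : <[g]>%g \subset G by rewrite cycle_subG.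
have Cg := cycle_id g; have C2 : (g ^+ 2)%g \in <[g]>%g by rewrite groupX.
rewrite -!(cfResE rho sC) //; move: (cfRes_vchar <[g]> Zrho).
move: ('Res _) => r Zr; rewrite [r]cfun_sum_cfdot !sum_cfunE.
apply: aint_cong_trans (aint_cong_sum_sqr _ _) _ => [i|].
  by rewrite cfunE rpredM ?Aint_irr ?Aint_Cint ?Cint_cfdot_vchar_irr.
rewrite /aint_cong -sumrB mulr_suml; apply: rpred_sum => i _; rewrite !cfunE.
have ll : 'chi_i \is a linear_char by rewrite irr_cyclic_lin ?cycle_cyclic.
rewrite lin_charX // exprMn -mulrBl mulrAC rpredM ?rpredX ?Aint_irr //.
by apply: int_sqr_cong; rewrite Cint_cfdot_vchar_irr.
Qed.

Lemma vchar_pow2_cong G (rho : 'CF(G)) g n : rho \in 'Z[irr G] -> g \in G ->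
  aint_cong 2 (rho g ^+ (2 ^ n)) (rho (g ^+ (2 ^ n))%g).
Proof.
move=> Zrho Gg; elim: n => [|n IH]; first by rewrite expn0 expr1 expg1 aint_cong_refl.
rewrite expnSr exprM expgM; apply: aint_cong_trans (vchar_sqr_cong Zrho _); last first.
  by rewrite groupX.
by apply: aint_cong_sqr; rewrite ?rpredX ?Aint_vchar.
Qed.

Lemma aint_cong1_pow2 z n : z \in Aint -> aint_cong 2 z 1 ->
  aint_cong (2 ^ n.+1) (z ^+ (2 ^ n)) 1.
Proof.
move=> Az z1; elim: n => [|n IH]; first by rewrite expn0 expr1.
rewrite (expnSr 2 n) exprM; set y := z ^+ (2 ^ n) in IH *.
have n2 k : ((2 ^ k)%N%:R : algC) != 0 by rewrite pnatr_eq0 -lt0n expn_gt0.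
have [a Aa ->] : exists2 a, a \in Aint & y = 1 + a * (2 ^ n.+1)%:R.
  by exists ((y - 1) / (2 ^ n.+1)%:R); rewrite // divfK // addrC subrK.
rewrite /aint_cong.
have -> : (1 + a * (2 ^ n.+1)%:R) ^+ 2 - 1 = (a + a ^+ 2 * (2 ^ n)%:R) * (2 ^ n.+2)%:R.
  by rewrite !expnS !natrM; ring.
by rewrite mulfK // rpredD // rpredM ?rpredX // rpred_nat.
Qed.

(** The first [logn 2 #|G|] squarings bring [g] to 1, where the value is the odd degree; each of the
    [n] further squarings gains one factor 2 in the modulus. *)
Lemma vchar_unit_pow G (rho : 'CF(G)) n g : rho \in 'Z[irr G] -> ~~ even_int (rho 1%g) ->
  g \in G -> (2.-elt g)%g ->
  aint_cong (2 ^ n.+1) (rho g ^+ (2 ^ (logn 2 #|G| + n))) 1.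
Proof.
move=> Zrho odd1 Gg g2; rewrite expnD exprM.
apply: aint_cong1_pow2; first by rewrite rpredX ?Aint_vchar.
apply: aint_cong_trans (vchar_pow2_cong _ Zrho Gg) _.
have -> : (g ^+ (2 ^ logn 2 #|G|) = 1)%g.
  apply/eqP; rewrite -order_dvdn -p_part -(part_pnat_id g2).
  by rewrite partn_dvd // order_dvdG.
have /intrP[m Em] := Cint_vchar1 Zrho; rewrite Em in odd1 *.
rewrite /aint_cong Aint_Cint //.
have -> : m%:~R - 1 = (m - 1)%:~R :> algC by rewrite rmorphB rmorph1.
have: even_int ((m - 1)%:~R); last by [].
move: odd1; case: m {Em} => n' odd1.
  have on : odd n' by rewrite -pmulrn even_int_nat negbK in odd1.
  case: n' on {odd1} => // n' /= on.
  by rewrite -predn_int // -pmulrn even_int_nat.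
have on : odd n'.+1.
  move: odd1; rewrite NegzE mulrNz; apply: contraR => en.
  by apply: even_intN; rewrite -pmulrn even_int_nat.
rewrite NegzE -opprD mulrNz; apply: even_intN; rewrite -PoszD -pmulrn even_int_nat.
by rewrite addn1 /= negbK.
Qed.

Lemma vchar_odd_neq0 G (rho : 'CF(G)) g : rho \in 'Z[irr G] -> ~~ even_int (rho 1%g) ->
  g \in G -> (2.-elt g)%g -> rho g != 0.
Proof.
move=> Zrho odd1 Gg g2; apply: contraL (vchar_unit_pow 0 Zrho odd1 Gg g2) => /eqP->.
rewrite expr0n expn_eq0 /= /aint_cong sub0r mulNr mul1r rpredN.
apply/negP=> A; have Q2 : ((2 ^ 1)%:R : algC)^-1 \in Crat by rewrite rpredV rpred_nat.
by have := Cint_rat_Aint Q2 A; move: even_int1; rewrite /even_int mul1r => ->.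
Qed.

Lemma even_intW (y : algC) : even_int y -> y \in Num.int.
Proof. by move=> ey; rewrite -[y](divfK (_ : 2%:R != 0)) ?pnatr_eq0 // rpredM ?rpred_nat. Qed.

Lemma even_int_cong (x y : algC) : x \in Num.int -> even_int y ->
  aint_cong 2 x y -> even_int x.
Proof.
move=> Zx ey A; have Zy := even_intW ey.
have : even_int (x - y).
  apply: Cint_rat_Aint A.
  have Cr (z : algC) : z \in Num.int -> z \in Crat by case/intrP=> m ->; apply: rpred_int.
  by rewrite rpred_div ?rpred_nat // rpredB ?Cr.
by move/even_intD/(_ ey); rewrite subrK.
Qed.

End CharCongruence.

(** * Restriction to 2-subgroups and reduction to Sylow subgroups *)

Section SylowReduction.
Local Open Scope group_scope.
Local Open Scope ring_scope.
Variable gT : finGroupType.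
Implicit Types G H P S : {group gT}.

Lemma RR_exp G s (a b : 'CF(G)) n : twists s G -> RR s a -> RR s b -> RR s (a * b ^+ n).
Proof.
move=> tw Ra Rb; elim: n => [|n IH]; first by rewrite expr0 mulr1.
by rewrite exprSr mulrA; apply: RR_mul.
Qed.

(** [rho] is a unit modulo 2: some high power of it is congruent to 1 modulo [2 #|S|] at every
    element, so multiplying by that power preserves multiplicities modulo 2. Moreover [rho] vanishes
    nowhere, which gives the twisted reality of [theta]. *)
Lemma RR_cancel S s (theta rho : 'CF(S)) : (2.-group S)%g -> twists s S ->
    theta \in 'Z[irr S] -> RR s rho -> ~~ even_int (rho 1%g) -> RR s (theta * rho) ->
  RR s theta.
Proof.
move=> S2 tw Zt Rr odd1 Rtr; have [Zr sr _] := Rr.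
have st : twisted_real s theta.
  move=> g Sg; have Sgs : (g ^ s)%g \in S by rewrite memJ_norm ?twistsN.
  have nz := vchar_odd_neq0 Zr odd1 Sg (mem_p_elt S2 Sg).
  have [_ /(_ g Sg) + _] := Rtr; rewrite !cfunE sr // rmorphM /=.
  by apply: mulIf; rewrite conjC_eq0.
split=> // i Ei.
(* The first [n] squarings reach 1 modulo 2, the other [n] raise the modulus to [2 ^ n.+1 = 2 #|S|].
   The factor [#|S|] absorbs the denominator of the inner product, and 2 is left. *)
set n := logn 2 #|S|; pose k := (2 ^ (n + n))%N.
have k_gt0 : (0 < k)%N by rewrite expn_gt0.
have [_ _ /(_ i Ei) ev] : RR s (theta * rho ^+ k).
  by rewrite -(prednK k_gt0) exprS mulrA; apply: RR_exp.
apply: even_int_cong ev _; first by rewrite Cint_cfdot_vchar_irr.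
rewrite /aint_cong -cfdotBl -[X in X - _]mulr1 -mulrBr cfdotE.
have cS : (#|S| = 2 ^ n)%N by rewrite /n -p_part part_pnat_id.
rewrite mulrC mulrA mulr_sumr; apply: rpred_sum => g Sg.
rewrite !cfunE cfun1E Sg exp_cfunE //.
have g2 : (2.-elt g)%g by apply: mem_p_elt S2 Sg.
have := vchar_unit_pow n Zr odd1 Sg g2; rewrite -/n -/k /aint_cong => A.
have -> : (2%:R)^-1 / #|S|%:R * (theta g * (1 - rho g ^+ k) * ('chi_i g)^*) =
          - (theta g * ((rho g ^+ k - 1) / (2 ^ n.+1)%:R) * ('chi_i g)^*).
  rewrite expnS natrM cS invfM; ring.
rewrite -cfConjCE -conjC_IirrE rpredN; apply: rpredM; last exact: Aint_irr.
by apply: rpredM => //; apply: Aint_vchar.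
Qed.

Definition two_elts_real G s (chi : 'CF(G)) :=
  forall g, g \in G -> (2.-elt g)%g -> chi (g ^ s)%g = (chi g)^*.

(** If [s] lies in [P], then [RR s] on [P] amounts to untwisted reality ([RR_coset]), and this
    reality is part of the claim. In the other alternative twisted reality on 2-elements is given,
    and the parity of the multiplicities is the claim. *)
Definition N2prop G s := forall P (chi : 'CF(G)),
  P \subset G -> (2.-group P)%g -> twists s P -> chi \in 'Z[irr G] ->
  s \in P \/ two_elts_real s chi -> RR s ('Res[P] chi).

(** [P <s>] is a 2-group, hence lies in a Sylow 2-subgroup of [G <s>]; its intersection with the
    normal subgroup [G] is Sylow in [G] and normalized by [s]. *)
Lemma Sylow_twists G P s : s \in 'N(G)%g -> P \subset G -> (2.-group P)%g ->
  twists s P -> exists P1 : {group gT},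
   [/\ P \subset P1, (2.-Sylow(G) P1)%g & twists s P1].
Proof.
move=> nGs sPG P2 /andP[nPs Ps2].
have nPc : <[s]>%g \subset 'N(P)%g by rewrite cycle_subG.
have Q2 : (2.-group (P <*> <[s]>))%g.
  rewrite norm_joinEr // pgroupM P2 /=.
  have : (s ^+ (2 * #|P|) = 1)%g by rewrite expgM expg_cardG.
  by move/eqP; rewrite -order_dvdn => /pnat_dvd; apply; rewrite pnatM pnat_id.
have nGG1 : G <| (G <*> <[s]>)%g by rewrite /normal joing_subl join_subG normG cycle_subG.
have sQ : (P <*> <[s]>)%g \subset (G <*> <[s]>)%g by rewrite genS // setSU.
have [Q1 SQ1 sQ1] := Sylow_superset sQ Q2.
exists (Q1 :&: G)%G; split.
- by rewrite subsetI sPG andbT (subset_trans _ sQ1) ?joing_subl.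
- exact: Hall_setI_normal nGG1 SQ1.
have Q1s : s \in Q1 by apply: (subsetP sQ1); rewrite mem_gen // inE cycle_id orbT.
apply/andP; split; last by rewrite inE groupX // (subsetP sPG _ Ps2).
by apply/normP; rewrite conjIg (normP nGs) (normP (subsetP (normG Q1) _ Q1s)).
Qed.

Lemma N2prop_Sylow G s : s \in 'N(G)%g ->
    (forall P (chi : 'CF(G)), (2.-Sylow(G) P)%g -> twists s P ->
       chi \in 'Z[irr G] -> s \in P \/ two_elts_real s chi -> RR s ('Res[P] chi)) ->
  N2prop G s.
Proof.
move=> nGs h P chi sPG P2 tw Zchi re.
have [P1 [sPP1 SP1 tw1]] := Sylow_twists nGs sPG P2 tw.
rewrite -(cfResRes chi sPP1 (pHall_sub SP1)); apply: RR_Res => //.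
by apply: h => //; case: re => [Ps|]; [left; apply: (subsetP sPP1) | right].
Qed.

Lemma N2prop_sub G H P s (chi : 'CF(G)) : (H \subset G) -> P \subset H ->
    (2.-group P)%g -> twists s P -> chi \in 'Z[irr G] -> s \in 'N(H)%g ->
    s \in P \/ two_elts_real s chi -> N2prop H s -> RR s ('Res[P] chi).
Proof.
move=> sHG sPH P2 tw Zchi nHs re n2; rewrite -(cfResRes chi sPH sHG).
apply: n2 => //; first exact: cfRes_vchar.
case: re => [|re]; [by left | right=> g Hg g2].
by rewrite !cfResE ?memJ_norm //; apply: re; rewrite ?(subsetP sHG _ Hg).
Qed.

End SylowReduction.

(** * Clifford theory *)

Section LinearExtension.
Local Open Scope group_scope.
Local Open Scope ring_scope.
Variable gT : finGroupType.
Implicit Types K H G : {group gT}.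

Lemma norm_mul_p_elt K (p : nat) n g : (p.-group K)%g -> g \in 'N(K)%g -> n \in K ->
  (p.-elt g)%g -> (p.-elt (n * g))%g.
Proof.
move=> pK; rewrite -cycle_subG => nKg Kn pg.
have pKg : (p.-group (K <*> <[g]>))%g by rewrite norm_joinEr // pgroupM pK.
by rewrite (mem_p_elt pKg) //= norm_joinEr // mem_mulg ?cycle_id.
Qed.

Lemma lin_char_of_fun G (f : gT -> algC) : f 1%g = 1 ->
    {in G &, forall x y, f (x * y)%g = f x * f y} ->
  exists2 l : 'CF(G), l \is a linear_char & {in G, l =1 f}.
Proof.
move=> f1 fM; have rf : mx_repr G (fun g => (f g)%:M : 'M[algC]_1).
  by split=> [|g h Gg Gh]; rewrite ?f1 ?fM // -scalar_mxM.
exists (cfRepr (MxRepresentation rf)); last first.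
  by move=> g Gg; rewrite cfunE Gg /= mxtrace_scalar !mulr1n.
by rewrite qualifE /= cfRepr_char cfRepr1 eqxx.
Qed.

Lemma sdprod_lin_ext K H G (l : 'CF(K)) : (K ><| H = G)%g -> l \is a linear_char ->
    H \subset 'I[l]%g ->
  exists2 l' : 'CF(G), l' \is a linear_char & {in K & H, forall k h, l' (k * h)%g = l k}.
Proof.
move=> defG ll sHI; have [_ KH _ tiKH] := sdprodP defG.
have [f1 fM] : l (divgr K H 1%g) = 1 /\ {in G &, forall x y,
    l (divgr K H (x * y)%g) = l (divgr K H x) * l (divgr K H y)}.
  split; first by rewrite -{1}(mulg1 1%g) divgrMid ?lin_char1.
  move=> x y; rewrite -KH => /mulsgP[k h Kk Hh ->] /mulsgP[k' h' Kk' Hh' ->].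
  have Ih : (h^-1)%g \in 'I[l]%g by rewrite groupV (subsetP sHI).
  have nKh : (h^-1)%g \in 'N(K)%g by case/setIdP: Ih.
  have -> : (k * h * (k' * h') = k * k' ^ h^-1 * (h * h'))%g.
    by rewrite conjgE invgK !mulgA mulgKV.
  have Kc : (k' ^ h^-1)%g \in K by rewrite memJ_norm.
  rewrite (divgrMid tiKH (groupM Kk Kc) (groupM Hh Hh')) !divgrMid // lin_charM //.
  by rewrite inertia_valJ.
have [l' ll' l'E] := lin_char_of_fun f1 fM; exists l' => // k h Kk Hh.
by rewrite l'E ?divgrMid // -KH mem_mulg.
Qed.

Lemma Ind_twisted_conj G H s (j : Iirr H) g : H \subset G -> s \in 'N(G)%g ->
  s \in 'N(H)%g ->
  'Ind[G] 'chi_(twisted_conj s j) g = ('Ind[G] 'chi_j (g ^ s)%g)^*.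
Proof.
move=> sHG nGs nHs; rewrite !cfIndE // rmorphM fmorphV rmorph_nat rmorph_sum.
congr (_ * _); rewrite -[RHS](sum_conj_norm _ nGs); apply: eq_bigr => y Gy.
by rewrite -conjJg twisted_conjE.
Qed.

End LinearExtension.

Section Clifford.
Local Open Scope group_scope.
Local Open Scope ring_scope.
Variables (gT : finGroupType) (N L G P N0 : {group gT}) (s : gT) (chi : 'CF(G)).
Hypotheses (defG : (N ><| L = G)%g) (pN : (2.-group N)%g).
Hypotheses (nNs : s \in 'N(N)%g) (nLs : s \in 'N(L)%g) (Ls2 : (s ^+ 2)%g \in L).
Hypothesis sGL : s \in G -> s \in L.
Hypotheses (sN0 : N0 \subset N) (sqN : {in N, forall n, (n ^+ 2)%g \in N0}).
Hypothesis Zchi : chi \in 'Z[irr G].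
Hypothesis kerchi : forall i, '[chi, 'chi_i] != 0 -> N0 \subset cfker 'chi_i.
Hypotheses (SP : (2.-Sylow(G) P)%g) (twP : twists s P).
Hypothesis re : s \in P \/ two_elts_real s chi.
Hypothesis rec : forall (m : Iirr N) s', N0 \subset cfker 'chi_m ->
  s' \in (L :* s)%g -> ('chi_m ^ s')%CF = 'chi_m -> N2prop 'I_L['chi_m]%G s'.

Let sNG : N \subset G. Proof. by case/sdprod_context: defG => /andP[]. Qed.
Let sLG : L \subset G. Proof. by case/sdprod_context: defG. Qed.
Let nNG : N <| G. Proof. by case/sdprod_context: defG. Qed.
Let sPG : P \subset G. Proof. exact: pHall_sub SP. Qed.
Let pP : (2.-group P)%g. Proof. exact: pHall_pgroup SP. Qed.
Let sNP : N \subset P.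
Proof. exact: normal_sub_max_pgroup (Hall_max SP) pN nNG. Qed.
Let nNP : N <| P. Proof. exact: normalS sNP sPG nNG. Qed.
Let S := (L :&: P)%G.
Let defP : (N ><| S = P)%g.
Proof. by rewrite (sdprod_modl defG sNP); apply/setIidPr. Qed.

Let kerlin m : N0 \subset cfker 'chi[N]_m ->
  'chi_m \is a linear_char /\ {in N, forall n, 'chi_m n ^+ 2 = 1}.
Proof.
move=> kN0; have ll : 'chi_m \is a linear_char.
  rewrite lin_irr_der1 (subset_trans _ kN0) // gen_subG.
  apply/subsetP=> _ /imset2P[x y Nx Ny ->].
  (* A commutator is a product of three squares, hence lies in [N0]: the quotient of [N] by [N0] is
     elementary abelian. *)
  have -> : ([~ x, y] = (x^-1) ^+ 2 * (x * y^-1) ^+ 2 * y ^+ 2)%g.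
    by rewrite commgEl conjgE !expgS !expg0 !mulg1 !mulgA !(mulgKV, mulgK).
  by apply: groupM; [apply: groupM|]; apply: sqN; rewrite ?groupV // groupM ?groupV.
split=> // n Nn; rewrite -lin_charX // (cfker1 (subsetP kN0 _ (sqN Nn))).
by rewrite lin_char1.
Qed.

Let kerreal m : N0 \subset cfker 'chi[N]_m -> {in N, forall n, ('chi_m n)^* = 'chi_m n}.
Proof.
move=> kN0 n Nn; have [ll sq] := kerlin kN0.
have /eqP := sq n Nn; rewrite sqrf_eq1 => /orP[] /eqP->; first exact: conjC1.
by rewrite rmorphN1.
Qed.

Let cliff_data (k : Iirr P) : '['Res[P] chi, 'chi_k] != 0 ->
  exists m t, [/\ N0 \subset cfker 'chi[N]_m, m \in irr_constt ('Res[N] 'chi_k),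
    t \in irr_constt ('Ind['I_P['chi_m]%G] 'chi_m) & 'chi_k = 'Ind[P] 'chi_t].
Proof.
move=> nz; have [m mk] := constt_cfRes_irr N k.
have [i [nzi ik]] : exists i, '[chi, 'chi_i] != 0 /\ k \in irr_constt ('Res[P] 'chi_i).
  case: (boolP [exists i, ('[chi, 'chi_i] != 0) && (k \in irr_constt ('Res[P] 'chi_i))]).
    by case/existsP=> i /andP[? ?]; exists i.
  move/existsPn=> z; case/eqP: nz; rewrite [chi]cfun_sum_cfdot linear_sum cfdot_suml.
  apply: big1 => i _; rewrite linearZ /= cfdotZl; apply/eqP; rewrite mulf_eq0.
  by move: (z i); rewrite irr_consttE negb_and !negbK.
have kk : N0 \subset cfker 'chi_k.
  apply: subset_trans (cfker_constt (cfRes_char _ (irr_char i)) ik).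
  by rewrite sub_cfker_Res ?kerchi // (subset_trans sN0).
have km : N0 \subset cfker 'chi_m.
  apply: subset_trans (cfker_constt (cfRes_char _ (irr_char k)) mk).
  by rewrite sub_cfker_Res.
have [irrI _ onto _ _] := constt_Inertia_bijection m nNP.
have : k \in irr_constt ('Ind[P] 'chi_m) by rewrite constt_Ind_Res.
rewrite -onto => /imsetP[t tA Ek]; exists m, t; split=> //.
by rewrite Ek cfIirrE ?irrI.
Qed.

Section OneOrbit.
Variable m : Iirr N.
Hypothesis km : N0 \subset cfker 'chi_m.
Let T := 'I_P['chi_m]%G.
Let TG := 'I_G['chi_m]%G.
Let Sm := 'I_S['chi_m]%G.
Let Lm := 'I_L['chi_m]%G.
Let defT : (N ><| Sm = T)%g. Proof. exact: sdprod_modl defP (sub_inertia _). Qed.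
Let defTG : (N ><| Lm = TG)%g. Proof. exact: sdprod_modl defG (sub_inertia _). Qed.
Let sTTG : T \subset TG. Proof. by rewrite setSI. Qed.
Let sTGG : TG \subset G. Proof. exact: subsetIl. Qed.
Let sTG : T \subset G. Proof. exact: subset_trans sTTG sTGG. Qed.
Let sSmLm : Sm \subset Lm. Proof. by rewrite setSI // subsetIl. Qed.

Variable l : 'CF(TG).
Hypotheses (ll : l \is a linear_char)
  (lE : {in N & Lm, forall k h, l (k * h)%g = 'chi_m k}).

(** The linear character [l] extends ['chi_m], whose square is 1. Multiplication by [l] therefore
    makes the ['chi_m]-part of [chi] trivial on [N], and [alpha] is the virtual character of [Lm] on
    that part. *)
Let alpha : 'CF(Lm) := sdprod_avg defTG ('Res[TG] chi * l).

Let lreal : {in TG, forall g, (l g)^* = l g}.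
Proof.
move=> g; have [_ KH _ _] := sdprodP defTG; rewrite -{1}KH => /mulsgP[n h Nn Hh ->].
by rewrite lE // kerreal.
Qed.

Let Zalpha : alpha \in 'Z[irr Lm].
Proof.
apply: sdprod_avg_vchar; rewrite rpredM ?cfRes_vchar //.
by rewrite char_vchar ?lin_charW.
Qed.

Let dotE (z : 'CF(Sm)) :
  '['Res[T] chi, cfSdprod defT z * 'Res[T] l] = '['Res[Sm] alpha, z].
Proof.
have -> : 'Res[Sm] alpha = sdprod_avg defT ('Res[T] chi * 'Res[T] l).
  apply/cfun_inP=> h Sh; have Lh := subsetP sSmLm _ Sh.
  rewrite cfResE // !sdprod_avgE //; congr (_ * _); apply: eq_bigr => n Nn.
  have Tnh : (n * h)%g \in T.
    by have [_ <- _ _] := sdprodP defT; apply: mem_mulg.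
  by rewrite !cfunE (cfResE _ sTGG) ?(subsetP sTTG _ Tnh) // (cfResE _ sTG) // (cfResE _ sTTG).
rewrite cfdot_sdprod_avg cfdotM_conjr mulrC; congr '[_, _ * _].
by apply/cfun_inP=> g Tg; rewrite cfConjCE cfResE // lreal // (subsetP sTTG).
Qed.

Let alpha_real s' : s' \in (L :* s)%g -> ('chi_m ^ s')%CF = 'chi_m ->
  two_elts_real s chi -> two_elts_real s' alpha.
Proof.
case/rcosetP=> y Ly -> fixm r2 g Lg g2; have Gy := subsetP sLG _ Ly.
have nLm : (y * s)%g \in 'N(Lm)%g.
  have nNy : (y * s)%g \in 'N(N)%g by rewrite groupM // (subsetP (normal_norm nNG)).
  apply/normP; rewrite conjIg; congr (_ :&: _).
    by apply/normP; rewrite groupM // (subsetP (normG L)).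
  by rewrite conjg_inertia // fixm.
have nNy : (y * s)%g \in 'N(N)%g by rewrite groupM // (subsetP (normal_norm nNG)).
have Lgs : (g ^ (y * s))%g \in Lm by rewrite memJ_norm.
rewrite !sdprod_avgE // rmorphM fmorphV rmorph_nat rmorph_sum; congr (_ * _).
rewrite -(sum_conj_norm _ nNy); apply: eq_bigr => n Nn.
have Nns : (n ^ (y * s))%g \in N by rewrite memJ_norm.
have Gng : (n * g)%g \in G.
  by rewrite groupM ?(subsetP sNG _ Nn) // (subsetP sLG) //; case/setIP: Lg.
have TGng : (n * g)%g \in TG by have [_ <- _ _] := sdprodP defTG; apply: mem_mulg.
have TGngs : (n ^ (y * s) * g ^ (y * s))%g \in TG.
  by have [_ <- _ _] := sdprodP defTG; apply: mem_mulg.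
rewrite !cfunE !(cfResE _ sTGG) // !lE // rmorphM /= kerreal //.
have -> : 'chi_m (n ^ (y * s))%g = 'chi_m n by rewrite -{1}fixm cfConjgEJ.
congr (_ * _); rewrite -conjMg conjgM r2 ?groupJ // ?cfunJ //.
rewrite p_eltJ (norm_mul_p_elt pN) // (subsetP (normal_norm nNG)) // (subsetP sLG) //.
by case/setIP: Lg.
Qed.

Let orbit_norm s' : s' \in (S :* s)%g -> ('chi_m ^ s')%CF = 'chi_m ->
  [/\ twists s' Sm, twists s' T & s' \in 'N(N)%g].
Proof.
move=> /rcosetP[y Sy ->] fixm; have [Ly Py] := setIP Sy.
have nNy : (y * s)%g \in 'N(N)%g.
  by rewrite groupM // (subsetP (normal_norm nNG)) // (subsetP sLG).
have /andP[nPs P2] := twists_coset Py twP.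
have twL : twists s L by apply/andP.
have /andP[nLys L2] := twists_coset Ly twL.
have I2 : ((y * s) ^+ 2)%g \in 'I['chi_m]%g.
  rewrite groupX // inE nNy; exact/eqP.
have nI : ('I['chi_m] :^ (y * s) = 'I['chi_m])%g by rewrite conjg_inertia // fixm.
split=> //; apply/andP; split.
- by apply/normP; rewrite !conjIg nI (normP nPs) (normP nLys).
- by rewrite inE I2 andbT inE L2.
- by apply/normP; rewrite !conjIg nI (normP nPs).
by rewrite inE I2 P2.
Qed.

Let orbit_RR s' : s' \in (S :* s)%g -> ('chi_m ^ s')%CF = 'chi_m ->
  RR s' ('Res[Sm] alpha).
Proof.
move=> Ss' fixm; have [twSm _ nNs'] := orbit_norm Ss' fixm.
have Ls' : s' \in (L :* s)%g by apply: subsetP Ss'; rewrite rcosetS ?subsetIl.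
apply: (rec km Ls' fixm) => //.
  by apply: pgroupS pP; rewrite subIset // subsetIr.
case: re => [Ps|r2]; last by right; apply: alpha_real.
left; have /rcosetP[y Sy Es'] := Ss'.
have Ss : s \in S by rewrite inE Ps sGL // (subsetP sPG).
rewrite inE; apply/andP; split; first by rewrite Es' groupM.
by rewrite inE nNs'; apply/eqP.
Qed.

Variable t : Iirr T.
Hypothesis tA : t \in irr_constt ('Ind[T] 'chi_m).

Let resN : {in N, forall n, 'chi_t n = 'chi_t 1%g * 'chi_m n}.
Proof.
have nNT : N <| T by apply: normal_Inertia.
have mt : m \in irr_constt ('Res[N] 'chi_t) by rewrite -constt_Ind_Res.
have := Clifford_Res_sum_cfclass nNT mt; rewrite cfclass_inertia big_seq1 => E.
have [lm _] := kerlin km.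
have E1 : 'chi_t 1%g = '['Res[N] 'chi_t, 'chi_m].
  by rewrite -(cfRes1 N) E cfunE lin_char1 // mulr1 -E.
by move=> n Nn; rewrite E1 -(cfResE _ (normal_sub nNT)) // E cfunE -E.
Qed.

Let zeta := 'Res[Sm] 'chi_t.

(** On [N] the character ['chi_t] is a multiple of ['chi_m] and [l] is ['chi_m], of square 1; so the
    product is trivial on [N], that is, inflated from [Sm]. *)
Let zetaE : cfSdprod defT zeta = 'chi_t * 'Res[T] l.
Proof.
have lT : 'Res[T] l \is a linear_char by apply: cfRes_lin_char.
have irr_tl : 'chi_t * 'Res[T] l \in irr T by rewrite mulrC mul_lin_irr ?mem_irr.
have -> : zeta = 'Res[Sm] ('chi_t * 'Res[T] l).
  have sST : Sm \subset T by case/sdprod_context: defT.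
  apply/cfun_inP=> h Sh; rewrite !cfResE // ?(subsetP sST) // cfunE.
  rewrite cfResE // ?(subsetP sST) // -[h]mul1g lE ?mul1g //; last exact: (subsetP sSmLm).
  by rewrite (lin_char1 (kerlin km).1) mulr1.
apply: cfRes_sdprodK; have /irrP[j Ej] := irr_tl; rewrite Ej cfkerEirr -Ej.
have sNT : N \subset T by case/sdprod_context: defT => /andP[].
apply/subsetP=> n Nn; rewrite inE !cfunE !cfResE ?(subsetP sNT _ Nn) //.
have lN k : k \in N -> l k = 'chi_m k by move=> Nk; rewrite -{1}[k]mulg1 lE.
rewrite resN // !lN // -mulrA -expr2 (kerlin km).2 //.
by rewrite (lin_char1 (kerlin km).1).
Qed.

Let zeta_irr : zeta \in irr Sm.
Proof.
rewrite -(cfSdprod_irr defT) zetaE mulrC mul_lin_irr ?mem_irr //.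
exact: cfRes_lin_char.
Qed.

Let lT2 : 'Res[T] l * 'Res[T] l = 1.
Proof.
apply/cfun_inP=> g Tg; rewrite !cfunE cfResE // cfun1E Tg.
have TGg := subsetP sTTG _ Tg.
move: TGg; have [_ KH _ _] := sdprodP defTG; rewrite -{1}KH => /mulsgP[n h Nn Hh ->].
by rewrite lE // -expr2 (kerlin km).2.
Qed.

Let dot_t : '['Res[P] chi, 'Ind[P] 'chi_t] = '['Res[Sm] alpha, zeta].
Proof.
rewrite -cfdot_Res_l cfResRes ?subsetIl // -dotE zetaE -mulrA lT2 mulr1 //.
Qed.

Let dot_tC : '['Res[P] chi, 'Ind[P] ('chi_t)^*%CF] = '['Res[Sm] alpha, zeta^*%CF].
Proof.
rewrite -cfdot_Res_l cfResRes ?subsetIl // -dotE.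
congr '[_, _]; have -> : cfSdprod defT zeta^*%CF = ('chi_t * 'Res[T] l)^*%CF.
  rewrite -zetaE; apply/cfun_inP=> g; have [_ KH _ _] := sdprodP defT.
  by rewrite -{1}KH => /mulsgP[n h Nn Hh ->]; rewrite cfConjCE !cfSdprodE // cfConjCE.
rewrite rmorphM /=; have -> : (('Res[T] l)^*)%CF = 'Res[T] l.
  by apply/cfun_inP=> g Tg; rewrite cfConjCE cfResE // lreal // (subsetP sTTG).
by rewrite -mulrA lT2 mulr1.
Qed.

(** The indicator [-1] passes from ['chi_k] to ['chi_t] and from there to [zeta], because each
    occurs exactly once in the restriction of the preceding one. For [zeta] the parity comes from
    the recursion applied to [alpha]. *)
Lemma Clifford_orbit_parity k s' : s' \in (S :* s)%g -> ('chi_m ^ s')%CF = 'chi_m ->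
  'chi_k = 'Ind[P] 'chi_t -> fs_ind s 'chi_k = -1 -> even_int '['Res[P] chi, 'chi_k].
Proof.
move=> Ss' fixm Ek fk; have [twSm twT nNs'] := orbit_norm Ss' fixm.
have [y Sy Es'] := rcosetP Ss'; have Py : y \in P by case/setIP: Sy.
have twP' : twists s' P by rewrite Es' twists_coset.
have fk' : fs_ind s' 'chi_k = -1 by rewrite Es' fs_ind_coset ?twistsN.
have [rk _] := fs_ind_typed twP' (b := true) fk'.
have [_ inj _ _ _] := constt_Inertia_bijection m nNP.
have sTP : T \subset P := subsetIl _ _.
have nPs' := twistsN twP'; have nTs' := twistsN twT.
have sNT : N \subset T by case/sdprod_context: defT => /andP[].
have tct : twisted_conj s' t = t.
  apply: inj => //; last first.
    rewrite /Ind_Iirr; congr cfIirr; apply/cfun_inP=> g Pg.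
    by rewrite Ind_twisted_conj // -Ek rk // conjCK.
  rewrite constt_Ind_Res irr_consttE.
  have -> : 'Res[N] 'chi_(twisted_conj s' t) = 'chi_t 1%g *: 'chi_m.
    apply/cfun_inP=> n Nn; rewrite cfResE // twisted_conjE // cfunE resN ?memJ_norm //.
    rewrite rmorphM /= conj_natr ?Cnat_irr1 // kerreal ?memJ_norm //.
    by congr (_ * _); rewrite -{1}fixm cfConjgEJ.
  by rewrite cfdotZl cfnorm_irr mulr1 irr1_neq0.
have rt := (twisted_conj_real t nTs').2 tct.
have one : '['Res[T] 'chi_k, 'chi_t] = 1 by rewrite cfdot_Res_l -Ek cfnorm_irr.
have ft : fs_ind s' 'chi_t = -1.
  case: (fs_ind_real twT rt) => // ft.
  have := fs_Res_parity (b := true) sTP twP' twT fk' ft.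
  by rewrite one even_int1.
have /irrP[z Ez] := zeta_irr.
have sST : Sm \subset T by case/sdprod_context: defT.
have rz : twisted_real s' 'chi_z.
  by rewrite -Ez; apply: twisted_real_Res (twistsN twSm) rt.
have fz : fs_ind s' 'chi_z = -1.
  case: (fs_ind_real twSm rz) => // fz.
  have := fs_Res_parity (b := true) sST twT twSm ft fz.
  by rewrite -/zeta Ez cfnorm_irr even_int1.
rewrite Ek dot_t Ez; have [_ _] := orbit_RR Ss' fixm; exact.
Qed.

Lemma Clifford_orbit_real k : s \in P -> 'chi_k = 'Ind[P] 'chi_t ->
  '['Res[P] chi, 'chi_k] = '['Res[P] chi, ('chi_k)^*%CF].
Proof.
move=> Ps Ek; rewrite Ek conj_cfInd dot_t dot_tC.
have Ss : s \in S by rewrite inE Ps sGL // (subsetP sPG).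
(* As [s] lies in [S], the coset contains 1: the recursion can be used with the trivial twist, which
   fixes every [m]. *)
have S1 : 1%g \in (S :* s)%g by rewrite mem_rcoset mul1g groupV.
have [Za r1 _] := orbit_RR S1 (cfConjgJ1 _).
rewrite cfdot_conjCr conj_intr; last first.
  by rewrite Cint_cfdot_vchar ?cfConjC_vchar // ?cfRes_vchar ?irr_vchar.
congr '[_, _]; apply/cfun_inP=> g Sg; rewrite cfConjCE -r1 // conjg1 //.
Qed.

End OneOrbit.

Let orbit_ext (m : Iirr N) : N0 \subset cfker 'chi_m ->
  exists2 l : 'CF('I_G['chi_m]%G), l \is a linear_char
    & {in N & 'I_L['chi_m], forall n h, l (n * h)%g = 'chi_m n}.
Proof.
move=> km; have defTG : (N ><| 'I_L['chi_m] = 'I_G['chi_m]%G)%g.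
  exact: sdprod_modl defG (sub_inertia _).
by apply: (sdprod_lin_ext (H := 'I_L['chi_m]%G) defTG (kerlin km).1); apply: subsetIr.
Qed.

(** The twisted conjugate of [m] also occurs in the twisted-real ['chi_k], so it is [P]-conjugate to
    [m]. Since ['chi_m] is real, correcting [s] by the conjugating element gives a twist fixing [m],
    and modulo [N] the correction can be taken in [S]. *)
Let orbit_fixer (k : Iirr P) (m : Iirr N) : N0 \subset cfker 'chi_m ->
  m \in irr_constt ('Res[N] 'chi_k) -> twisted_real s 'chi_k ->
  exists2 s', s' \in (S :* s)%g & ('chi_m ^ s')%CF = 'chi_m.
Proof.
move=> km mk rk; have rNk := twisted_real_Res sNP nNs rk.
have Zk : 'Res[N] 'chi_k \in 'Z[irr N] by rewrite cfRes_vchar ?irr_vchar.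
have m'k : '['Res[N] 'chi_k, 'chi_(twisted_conj s m)] != 0.
  by rewrite twisted_conj_dot // -irr_consttE.
have : 'chi_(twisted_conj s m) \in ('chi_m ^: P)%CF.
  apply: contraNT m'k => notin; rewrite (Clifford_Res_sum_cfclass nNP mk) cfdotZl.
  rewrite reindex_cfclass // cfdot_suml big1 ?mulr0 // => j Pj.
  by rewrite cfdot_irr; case: eqP Pj notin => // -> ->.
case/cfclassP=> y Py Ey.
have nNy := subsetP (normal_norm nNP) _ Py.
have fixE n : n \in N -> 'chi_m (n ^ (y * s))%g = 'chi_m n.
  move=> Nn; rewrite conjgM -[LHS]kerreal ?memJ_norm // -twisted_conjE // Ey.
  by rewrite cfConjgEJ.
have [_ KH _ _] := sdprodP defP; move: (Py); rewrite -KH => /mulsgP[n0 h Nn0 Sh Eyh].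
have nNh : (h * s)%g \in 'N(N)%g.
  by rewrite groupM // (subsetP (normal_norm nNP)) //; case/setIP: Sh.
exists (h * s)%g; first by rewrite mem_rcoset mulgK.
apply/cfun_inP=> n Nn; rewrite -{1}(conjgKV (h * s)%g n) cfConjgEJ //.
have Nn' : (n ^ (h * s)^-1)%g \in N by rewrite memJ_norm ?groupV.
rewrite -{2}(conjgKV (h * s)%g n) -[in RHS](conjgKV n0 (n ^ _)%g) -conjgM mulgA -Eyh.
by rewrite (fixE _ (groupJ Nn' (groupVr Nn0))) [RHS]cfunJ ?groupV.
Qed.

Lemma Clifford_RR : RR s ('Res[P] chi).
Proof.
have ZR : 'Res[P] chi \in 'Z[irr P] by apply: cfRes_vchar.
split=> // [g Pg|k fk].
  have nPs := twistsN twP; have Pgs : (g ^ s)%g \in P by rewrite memJ_norm.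
  case: re => [Ps|r2]; last first.
    by rewrite !cfResE // r2 ?(subsetP sPG) // (mem_p_elt pP).
  rewrite cfunJ // -cfConjCE; congr (fun_of_cfun _ g).
  rewrite [LHS]cfun_sum_cfdot [RHS]cfun_sum_cfdot; apply: eq_bigr => k _.
  congr (_ *: _); rewrite -{2}['chi_k]cfConjCK cfdot_conjC -conjC_IirrE.
  rewrite conj_intr ?Cint_cfdot_vchar_irr //.
  (* The equality is symmetric in [j] and its conjugate, so it is enough to have it where the left
     side is non-zero. *)
  have half j : '['Res[P] chi, 'chi_j] != 0 ->
      '['Res[P] chi, 'chi_j] = '['Res[P] chi, 'chi_(conjC_Iirr j)].
    move=> nz; have [m [t [km _ tA Ej]]] := cliff_data nz.
    have [l ll lE] := orbit_ext km.
    by rewrite conjC_IirrE; apply: (Clifford_orbit_real km ll lE tA).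
  have [k0|] := eqVneq '['Res[P] chi, 'chi_k] 0; last exact: half.
  have [->//|nz'] := eqVneq '['Res[P] chi, 'chi_(conjC_Iirr k)] 0.
  by rewrite [RHS]half // conjC_IirrK.
have [->|nz] := eqVneq '['Res[P] chi, 'chi_k] 0; first exact: even_int0.
have [m [t [km mk tA Ek]]] := cliff_data nz; have [l ll lE] := orbit_ext km.
have [rk _] := fs_ind_typed twP (b := true) fk.
have [s' Ss' fixm] := orbit_fixer km mk rk.
exact: (Clifford_orbit_parity km ll lE tA Ss' fixm Ek fk).
Qed.

End Clifford.

(** * Heisenberg normal subgroups *)

Section CentralCharacter.
Local Open Scope group_scope.
Local Open Scope ring_scope.
Variables (gT : finGroupType) (Z G : {group gT}).
Hypothesis cZG : Z \subset 'Z(G)%g.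

Definition lies_over (l : 'CF(Z)) (H : {group gT}) (phi : 'CF(H)) :=
  {in Z & H, forall z g, phi (z * g)%g = l z * phi g}.

Lemma irr_center_mul (i : Iirr G) z g : z \in 'Z(G)%g -> g \in G ->
  'chi_i (z * g)%g * 'chi_i 1%g = 'chi_i z * 'chi_i g.
Proof.
case/setIP=> Gz /centP cz Gg.
have : is_scalar_mx ('Chi_i z).
  apply: mx_abs_irr_cent_scalar; first exact/groupC/socle_irr.
  by apply/centgmxP=> h Gh; rewrite -!repr_mxM // cz.
rewrite -irrRepr; move: 'Chi_i => rG /is_scalar_mxP[a Ea].
rewrite !cfunE Gz Gg group1 groupM //= !mulr1n (repr_mxM rG Gz Gg) Ea mul_scalar_mx.
rewrite mxtraceZ repr_mx1 !mxtrace_scalar mulr_natr.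
by rewrite -[in RHS]mulr_natr -mulrA mulr_natl mulrnAr.
Qed.

Lemma irr_lies_over (i : Iirr G) : exists j : Iirr Z, lies_over 'chi_j 'chi_i.
Proof.
have nz := irr1_neq0 i; pose f z := 'chi_i z / 'chi_i 1%g.
have [||l ll lE] := @lin_char_of_fun _ Z f; first by rewrite /f divff.
  move=> x y Zx Zy; rewrite /f; apply: (mulIf (mulf_neq0 nz nz)).
  have Gy : y \in G by have /setIP[] := subsetP cZG _ Zy.
  rewrite mulrA mulfVK // irr_center_mul ?(subsetP cZG) //.
  by rewrite [RHS]mulrACA !mulfVK.
have /irrP[j Ej] := lin_char_irr ll; exists j => z g Zz Gg; rewrite -Ej lE //.
by apply: (mulIf nz); rewrite irr_center_mul ?(subsetP cZG) // mulrAC /f mulfVK.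
Qed.

Definition central_Iirr (i : Iirr G) : Iirr Z :=
  odflt 0 [pick j | [forall z in Z, forall g in G,
    'chi_i (z * g)%g == 'chi[Z]_j z * 'chi_i g]].

Lemma central_IirrP i : lies_over 'chi_(central_Iirr i) 'chi_i.
Proof.
rewrite /central_Iirr; case: pickP => [j /= /forall_inP h z g Zz Gg | none].
  by have /forall_inP/(_ g Gg)/eqP := h z Zz.
have [j jP] := irr_lies_over i; have /negP[] := none j.
by apply/forall_inP=> z Zz; apply/forall_inP=> g Gg; apply/eqP/jP.
Qed.

Definition central_part (j : Iirr Z) (chi : 'CF(G)) : 'CF(G) :=
  \sum_(i | central_Iirr i == j) '[chi, 'chi_i] *: 'chi_i.

Lemma central_part_sum chi : chi = \sum_j central_part j chi.
Proof.
by rewrite {1}[chi]cfun_sum_cfdot (partition_big central_Iirr predT).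
Qed.

Lemma central_part_vchar j chi : chi \in 'Z[irr G] -> central_part j chi \in 'Z[irr G].
Proof.
move=> Zc; apply: rpred_sum => i _.
by rewrite scale_zchar ?irr_vchar ?Cint_cfdot_vchar_irr.
Qed.

Lemma central_part_over j chi : lies_over 'chi_j (central_part j chi).
Proof.
move=> z g Zz Gg; rewrite !sum_cfunE mulr_sumr; apply: eq_bigr => i /eqP <-.
by rewrite !cfunE central_IirrP // mulrCA.
Qed.

Lemma central_part_dot j chi i : '[central_part j chi, 'chi_i] != 0 ->
  central_Iirr i = j.
Proof.
apply: contraNeq => ne; rewrite cfdot_suml big1 // => k /eqP Ek.
rewrite cfdotZl cfdot_irr; case: eqP => [Eki|_]; last by rewrite mulr0.
by rewrite -Ek Eki eqxx in ne.
Qed.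

Lemma central_partE j chi g : g \in G ->
  central_part j chi g = #|Z|%:R^-1 * \sum_(z in Z) ('chi_j z)^* * chi (z * g)%g.
Proof.
move=> Gg; rewrite sum_cfunE; transitivity (\sum_i '['chi_(central_Iirr i), 'chi_j] *
    ('[chi, 'chi_i] * 'chi_i g)).
  rewrite [RHS](bigID (fun i => central_Iirr i == j)) /= [X in _ + X]big1 ?addr0.
    by apply: eq_bigr => i /eqP->; rewrite cfnorm_irr mul1r cfunE.
  by move=> i ne; rewrite cfdot_irr (negPf ne) mul0r.
rewrite [in RHS](eq_bigr (fun z => \sum_i ('chi_(central_Iirr i) z * ('chi_j z)^*) *
    ('[chi, 'chi_i] * 'chi_i g))) => [|z Zz]; last first.
  rewrite {1}[chi]cfun_sum_cfdot sum_cfunE mulr_sumr; apply: eq_bigr => i _.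
  by rewrite cfunE central_IirrP //; ring.
rewrite exchange_big /= mulr_sumr; apply: eq_bigr => i _.
by rewrite cfdotE -mulrA mulr_suml.
Qed.

End CentralCharacter.

Section LiesOver.
Local Open Scope group_scope.
Local Open Scope ring_scope.
Variables (gT : finGroupType) (Z : {group gT}).
Implicit Types H G : {group gT}.

Lemma central_part_id G (j : Iirr Z) (phi : 'CF(G)) : Z \subset 'Z(G)%g ->
  lies_over 'chi_j phi -> central_part j phi = phi.
Proof.
move=> cZG ov; apply/cfun_inP=> g Gg; rewrite central_partE //.
transitivity ('['chi_j] * phi g); last by rewrite cfnorm_irr mul1r.
rewrite cfdotE -mulrA mulr_suml; congr (_ * _); apply: eq_bigr => z Zz.
by rewrite ov // mulrA [_^* * _]mulrC.
Qed.

Lemma lies_over_Res G H (l : 'CF(Z)) (phi : 'CF(G)) : H \subset G -> Z \subset H ->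
  lies_over l phi -> lies_over l ('Res[H] phi).
Proof.
move=> sHG sZH ov z g Zz Hg; have Hz := subsetP sZH _ Zz.
by rewrite !cfResE ?(groupM Hz Hg) // ov // (subsetP sHG).
Qed.

Lemma lies_over_Ind G H (l : 'CF(Z)) (phi : 'CF(H)) : H \subset G -> Z \subset H ->
  Z \subset 'Z(G)%g -> lies_over l phi -> lies_over l ('Ind[G] phi).
Proof.
move=> sHG sZH cZG ov z g Zz Gg; rewrite !cfIndE // mulrCA; congr (_ * _).
rewrite mulr_sumr; apply: eq_bigr => y Gy.
have /setIP[_ /centP cz] := subsetP cZG _ Zz.
rewrite conjMg; have -> : (z ^ y = z)%g by rewrite conjgE (cz _ Gy) mulKg.
have Hz := subsetP sZH _ Zz.
have [Hgy|nHgy] := boolP (g ^ y \in H)%g; first by rewrite ov.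
by rewrite (cfun0 phi nHgy) mulr0 cfun0 ?(groupMl _ Hz).
Qed.

End LiesOver.

Section Heisenberg.
Local Open Scope group_scope.
Local Open Scope ring_scope.
Variables (gT : finGroupType) (N L G P Z : {group gT}) (s : gT) (chi : 'CF(G)).
Hypotheses (defG : (N ><| L = G)%g) (pN : (2.-group N)%g).
Hypotheses (nNs : s \in 'N(N)%g) (nLs : s \in 'N(L)%g) (Ls2 : (s ^+ 2)%g \in L).
Hypothesis sGL : s \in G -> s \in L.
Hypotheses (sZN : Z \subset N) (cZG : Z \subset 'Z(G)%g).
Hypotheses (sqN : {in N, forall n, (n ^+ 2)%g \in Z}).
Hypotheses (sqZ : {in Z, forall z, (z ^+ 2)%g = 1%g}) (cZs : {in Z, forall z, (z ^ s)%g = z}).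
Hypothesis Zchi : chi \in 'Z[irr G].
Hypotheses (SP : (2.-Sylow(G) P)%g) (twP : twists s P).
Hypothesis re : s \in P \/ two_elts_real s chi.
Hypothesis rec : forall (m : Iirr N) s', Z \subset cfker 'chi_m ->
  s' \in (L :* s)%g -> ('chi_m ^ s')%CF = 'chi_m -> N2prop 'I_L['chi_m]%G s'.
Hypothesis nondeg : forall j : Iirr Z, j != 0 ->
  forall n, n \in N -> n \notin Z -> exists2 n', n' \in N & 'chi_j [~ n, n']%g != 1.
(** [A] meets [N] in a Lagrangian: the index makes ['Ind l] restrict to the irreducible character of
    [N] above ['chi_j], of degree the square root of [#|N : Z|]. Twisted reality and the value 1 at
    [s ^+ 2] give [l], and hence ['Ind l], indicator 1. *)
Hypothesis extension : forall j : Iirr Z, j != 0 ->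
  exists (A : {group gT}) (l : 'CF(A)), [/\ A \subset P, Z \subset A, twists s A,
    (#|P : A| ^ 2 * #|Z| = #|N|)%N &
    [/\ l \is a linear_char, twisted_real s l, l (s ^+ 2)%g = 1
      & {in Z, l =1 'chi_j}]].

Let sNG : N \subset G. Proof. by case/sdprod_context: defG => /andP[]. Qed.
Let sLG : L \subset G. Proof. by case/sdprod_context: defG. Qed.
Let nNG : N <| G. Proof. by case/sdprod_context: defG. Qed.
Let sPG : P \subset G. Proof. exact: pHall_sub SP. Qed.
Let pP : (2.-group P)%g. Proof. exact: pHall_pgroup SP. Qed.
Let sNP : N \subset P.
Proof. exact: normal_sub_max_pgroup (Hall_max SP) pN nNG. Qed.
Let nNP : N <| P. Proof. exact: normalS sNP sPG nNG. Qed.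
Let S := (L :&: P)%G.
Let defP : (N ><| S = P)%g.
Proof. by rewrite (sdprod_modl defG sNP); apply/setIidPr. Qed.
Let sZP : Z \subset P. Proof. exact: subset_trans sZN sNP. Qed.
Let cZP : Z \subset 'Z(P)%g.
Proof. by rewrite subsetI sZP (subset_trans cZG) // subIset // centS ?orbT. Qed.
Let nGs : s \in 'N(G)%g. Proof. exact: (sdprod_norm defG nNs nLs). Qed.
Let twG : twists s G. Proof. exact: (sdprod_twists defG nNs nLs Ls2). Qed.

Let Zlin (j : Iirr Z) : 'chi_j \is a linear_char.
Proof.
apply/char_abelianP; apply: abelianS cZG _; exact: center_abelian.
Qed.

Let Zreal (j : Iirr Z) z : z \in Z -> ('chi_j z)^* = 'chi_j z /\ 'chi_j z ^+ 2 = 1.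
Proof.
move=> Zz; have sq : 'chi_j z ^+ 2 = 1.
  by rewrite -lin_charX // sqZ // lin_char1.
split=> //; have /eqP := sq; rewrite sqrf_eq1 => /orP[] /eqP->; first exact: conjC1.
by rewrite rmorphN1.
Qed.

Let part_real (j : Iirr Z) : two_elts_real s chi -> two_elts_real s (central_part j chi).
Proof.
move=> r2 g Gg g2; have Ggs : (g ^ s)%g \in G by rewrite memJ_norm.
rewrite !central_partE // rmorphM fmorphV rmorph_nat rmorph_sum; congr (_ * _).
apply: eq_bigr => z Zz; rewrite rmorphM /= !(Zreal _ Zz).1; congr (_ * _).
rewrite -{1}(cZs Zz) -conjMg; have /setIP[Gz /centP cz] := subsetP cZG _ Zz.
apply: r2; first exact: groupM.
by rewrite (norm_mul_p_elt pN) ?(subsetP (normal_norm nNG)) ?(subsetP sZN).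
Qed.

Let N2L : N2prop L s.
Proof.
have E : 'I_L['chi[N]_0]%G = L.
  apply: group_inj => /=; rewrite irr0 inertia1; apply/setIidPl.
  exact: subset_trans sLG (normal_norm nNG).
rewrite -E; apply: rec; first by rewrite irr0 cfker_cfun1.
  exact: rcoset_refl.
by rewrite irr0 cfConjg_cfun1.
Qed.

(** Conjugating [n] by [n'] multiplies it by the central element [[~ n, n']], and thus multiplies
    [phi n] by a value different from 1. *)
Let vanish (H : {group gT}) (j : Iirr Z) (phi : 'CF(H)) n : N \subset H -> H \subset G ->
  j != 0 -> lies_over 'chi_j phi -> n \in N -> n \notin Z -> phi n = 0.
Proof.
move=> sNH sHG nzj ov Nn nZn; have [n' Nn' ne] := nondeg nzj Nn nZn.
have Zc : [~ n, n']%g \in Z.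
  have -> : ([~ n, n'] = (n^-1) ^+ 2 * (n * n'^-1) ^+ 2 * n' ^+ 2)%g.
    by rewrite commgEl conjgE !expgS !expg0 !mulg1 !mulgA !(mulgKV, mulgK).
  by apply: groupM; [apply: groupM|]; apply: sqN; rewrite ?groupV // groupM ?groupV.
have /setIP[_ /centP cc] := subsetP cZG _ Zc.
have E : phi n = 'chi_j [~ n, n']%g * phi n.
  rewrite -ov ?(subsetP sNH) // cc ?(subsetP sNG) // -conjg_mulR.
  by rewrite cfunJ ?(subsetP sNH).
apply: contraNeq ne => nz; apply/eqP.
by apply: (mulIf nz); rewrite mul1r -E.
Qed.

Let normN (H H' : {group gT}) (j : Iirr Z) (phi : 'CF(H)) (psi : 'CF(H')) :
  N \subset H -> H \subset G -> N \subset H' -> j != 0 ->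
  lies_over 'chi_j phi -> lies_over 'chi_j psi ->
  \sum_(n in N) phi n * (psi n)^* = #|Z|%:R * (phi 1%g * (psi 1%g)^*).
Proof.
move=> sNH sHG sNH' nzj ovf ovs; rewrite (bigID (mem Z)) /= addrC big1 ?add0r.
  rewrite (eq_bigl (mem Z)) => [|z]; last first.
    by apply: andb_idl => Zz; apply: (subsetP sZN).
  rewrite (eq_bigr (fun=> phi 1%g * (psi 1%g)^*)) => [|z Zz].
    by rewrite sumr_const mulr_natl.
  rewrite -[z]mulg1 ovf // ovs // rmorphM /= (Zreal _ Zz).1 mulrACA -expr2.
  by rewrite (Zreal _ Zz).2 mul1r.
by move=> n /andP[Nn nZ]; rewrite (vanish sNH sHG nzj) // mul0r.
Qed.

Section OneCharacter.
Variable j : Iirr Z.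
Hypothesis nzj : j != 0.
Variables (A : {group gT}) (l : 'CF(A)).
Hypotheses (sAP : A \subset P) (sZA : Z \subset A) (twA : twists s A).
Hypothesis cA : (#|P : A| ^ 2 * #|Z| = #|N|)%N.
Hypotheses (ll : l \is a linear_char) (lr : twisted_real s l).
Hypotheses (l2 : l (s ^+ 2)%g = 1) (lE : {in Z, l =1 'chi_j}).

Let phi := central_part j chi.
Let eta := 'Ind[P] l.

Let l_over : lies_over 'chi_j l.
Proof. by move=> z g Zz Ag; rewrite (lin_charM ll (subsetP sZA _ Zz) Ag) lE. Qed.

Let eta_over : lies_over 'chi_j eta.
Proof. exact: lies_over_Ind l_over. Qed.

Let eta1 : eta 1%g = #|P : A|%:R.
Proof. by rewrite cfInd1 // lin_char1 // mulr1. Qed.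

Let etaN_irr : 'Res[N] eta \in irr N.
Proof.
rewrite irrEchar cfRes_char ?cfInd_char ?lin_charW //=.
have ovN : lies_over 'chi_j ('Res[N] eta) by apply: lies_over_Res.
rewrite cfdotE (normN (subxx N) sNG (subxx N) nzj ovN ovN) cfRes1 eta1 rmorph_nat -!natrM.
by rewrite mulnn mulnC cA mulVf ?neq0CG.
Qed.

Let eta_irr : eta \in irr P.
Proof. by apply: cfRes_irr_irr etaN_irr; rewrite cfInd_char ?lin_charW. Qed.

(** By reciprocity [l], of indicator 1, occurs exactly once in the restriction of [eta] to [A]. *)
Let eta_fs : fs_ind s eta = 1.
Proof.
have /irrP[c Ec] := eta_irr; have /irrP[a Ea] := lin_char_irr ll; rewrite Ec.
have rc : twisted_real s 'chi_c.
  by rewrite -Ec; apply: twisted_real_Ind => //; apply: twistsN.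
case: (fs_ind_real twP rc) => // fc.
have fa : fs_ind s 'chi_a = 1 by rewrite -Ea; apply: fs_ind_lin.
have := fs_Res_parity (b := true) sAP twP twA fc fa.
by rewrite -Ec -Ea cfdot_Res_l -/eta Ec cfnorm_irr even_int1.
Qed.

Let gallagher (k : Iirr P) : lies_over 'chi_j 'chi_k ->
  exists b : Iirr S, 'chi_k = eta * cfSdprod defP 'chi_b.
Proof.
move=> ov; have /irrP[c Ec] := eta_irr; have /irrP[t Et] := etaN_irr.
have chiN : 'Res[N] 'chi_c = 'chi_t by rewrite -Ec.
have [irrM _ onto _] := constt_Ind_ext nNP chiN.
have : k \in irr_constt ('Ind[P] 'chi_t).
  rewrite constt_Ind_Res irr_consttE -Et.
  have ovk : lies_over 'chi_j ('Res[N] 'chi_k) by apply: lies_over_Res.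
  have ove : lies_over 'chi_j ('Res[N] eta) by apply: lies_over_Res.
  rewrite cfdotE (normN (subxx N) sNG (subxx N) nzj ovk ove).
  by rewrite !cfRes1 eta1 !mulf_neq0 ?invr_eq0 ?neq0CG ?irr1_neq0 // conjC_eq0 pnatr_eq0 -lt0n.
rewrite onto => /codomP[b Eb].
have Ek : 'chi_k = 'chi_(mod_Iirr b) * 'chi_c by rewrite Eb cfIirrE ?irrM.
have kN : N \subset cfker 'chi_(mod_Iirr b) by rewrite mod_IirrE // cfker_mod.
have Eb' := cfRes_sdprodK defP kN.
have : 'Res[S] 'chi_(mod_Iirr b) \in irr S.
  by rewrite -(cfSdprod_irr defP) Eb' mem_irr.
by case/irrP=> b' Eb''; exists b'; rewrite -Eb'' Eb' mulrC Ec.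
Qed.

Let phi_split : exists2 th : 'CF(S), th \in 'Z[irr S] &
  'Res[P] phi = eta * cfSdprod defP th.
Proof.
have ovP : lies_over 'chi_j ('Res[P] phi).
  by apply: lies_over_Res => //; apply: central_part_over.
rewrite ['Res[P] phi]cfun_sum_cfdot; 
elim/big_ind: _ => [|a b|k _].
- by exists 0; [exact: cfun0_zchar | rewrite linear0 mulr0].
- case=> [x Zx ->] [y Zy ->]; exists (x + y); first exact: rpredD.
  by rewrite linearD mulrDr.
have [->|nz] := eqVneq '['Res[P] phi, 'chi_k] 0.
  by exists 0; [exact: cfun0_zchar | rewrite scale0r linear0 mulr0].
have ov : lies_over 'chi_j 'chi_k.
  have : '[central_part j ('Res[P] phi), 'chi_k] != 0 by rewrite central_part_id.
  by move/central_part_dot <-; apply: central_IirrP.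
have [b Eb] := gallagher ov; exists ('['Res[P] phi, 'chi_k] *: 'chi_b).
  by rewrite scale_zchar ?irr_vchar // Cint_cfdot_vchar_irr ?cfRes_vchar ?central_part_vchar.
by rewrite linearZ /= -scalerAr -Eb.
Qed.

(** [eta] lives on [P] only, so [th] does not directly come from a virtual character of [L].
    Multiplying [phi] by the conjugate of [Om], which is [eta] induced to [G], and averaging over
    [N] does give one; its restriction to [S] is [th * rho], where [rho] has odd degree [#|G : P|]
    and can be cancelled. *)
Lemma Heisenberg_part_RR : RR s ('Res[P] phi).
Proof.
have [th Zth Eth] := phi_split; have /irrP[c Ec] := eta_irr.
have Reta : RR s eta by rewrite Ec; apply: RR_irr => //; rewrite -Ec.
have nPs := twistsN twP.
have nSs : s \in 'N(S)%g by apply/normP; rewrite conjIg (normP nLs) (normP nPs).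
have S2 : (s ^+ 2)%g \in S by rewrite inE Ls2 twists2.
have twS : twists s S by apply/andP.
pose Om := 'Ind[G] eta.
have ROm : RR s Om by rewrite /Om Ec; apply: RR_Ind_irr => //; rewrite -Ec.
have ZOm : Om \in 'Z[irr G] by case: ROm.
have ovOm : lies_over 'chi_j Om by apply: lies_over_Ind eta_over.
pose rho := sdprod_avg defP (eta * ('Res[P] Om)^*%CF).
have Rrho : RR s rho.
  by apply: RR_avg => //; apply: RR_mul => //; apply: RR_conjC; apply: RR_Res ROm.
have rho1 : ~~ even_int (rho 1%g).
  rewrite sdprod_avgE // (eq_bigr (fun n => eta n * (Om n)^*)) => [|n Nn]; last first.
    by rewrite mulg1 !cfunE cfResE // (subsetP sNP).
  rewrite (normN sNP sPG sNG nzj eta_over ovOm) (cfInd1 eta sPG : Om 1%g = _) eta1 rmorphM !rmorph_nat /=.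
  have -> : #|N|%:R^-1 * (#|Z|%:R * (#|P : A|%:R * (#|G : P|%:R * #|P : A|%:R))) =
            #|G : P|%:R :> algC.
    rewrite -cA natrM natrX; field.
    by rewrite neq0CG pnatr_eq0 -lt0n indexg_gt0.
  rewrite even_int_nat negbK odd_2'nat.
  by case/and3P: SP.
have prod : 'Res[S] (sdprod_avg defG (phi * Om^*%CF)) = th * rho.
  apply/cfun_inP=> h Sh; have [Lh Ph] := setIP Sh.
  rewrite cfResE ?subsetIl // cfunE !sdprod_avgE // mulrCA; congr (_ * _).
  rewrite mulr_sumr; apply: eq_bigr => n Nn.
  have Pnh := groupM (subsetP sNP _ Nn) Ph.
  rewrite !cfunE cfResE //.
  have -> : phi (n * h)%g = eta (n * h)%g * th h.
    by rewrite -(cfResE _ sPG Pnh) Eth cfunE cfSdprodE.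
  by ring.
have RP : RR s (th * rho).
  rewrite -prod; apply: N2L => //.
  - exact: subsetIl.
  - by apply: pgroupS pP; apply: subsetIr.
  - apply: sdprod_avg_vchar; rewrite rpredM ?central_part_vchar //.
    exact: cfConjC_vchar.
  case: re => [Ps|r2]; first by left; rewrite inE Ps sGL // (subsetP sPG).
  right=> g Lg g2; rewrite !sdprod_avgE ?memJ_norm // rmorphM fmorphV rmorph_nat rmorph_sum.
  congr (_ * _); rewrite -(sum_conj_norm _ nNs); apply: eq_bigr => n Nn.
  have Gg := subsetP sLG _ Lg; have Gn := subsetP sNG _ Nn.
  have ng2 : (2.-elt (n * g))%g.
    by rewrite (norm_mul_p_elt pN) // (subsetP (normal_norm nNG)).
  rewrite -conjMg !cfunE rmorphM /= (part_real j r2) ?(groupM Gn Gg) //.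
  by have [_ rOm _] := ROm; rewrite (rOm _ (groupM Gn Gg)).
rewrite Eth; apply: RR_mul => //; apply: RR_sdprod => //.
apply: RR_cancel Rrho rho1 RP => //.
by apply: pgroupS pP; apply: subsetIr.
Qed.

End OneCharacter.

Lemma Heisenberg_RR : RR s ('Res[P] chi).
Proof.
rewrite [chi](central_part_sum Z) linear_sum; apply: RR_sum => j _.
(* Above the trivial character of [Z] the group [N] acts through the elementary abelian quotient by
   [Z], and [Clifford_RR] applies with [N0 = Z]. *)
have [->|nzj] := eqVneq j 0; last first.
  have [A [l [sAP sZA twA cA [ll lr l2 lE]]]] := extension nzj.
  exact: (Heisenberg_part_RR nzj sAP sZA twA cA ll lr l2 lE).
apply: (Clifford_RR defG pN nNs nLs Ls2 sGL sZN sqN) => //.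
- exact: central_part_vchar.
- move=> i /central_part_dot Ei; apply/subsetP=> z Zz.
  have Gz : z \in G by have /setIP[] := subsetP cZG _ Zz.
  rewrite cfkerEirr inE -{1}[z]mulg1 (central_IirrP cZG) // Ei irr0 cfun1E Zz mul1r eqxx //.
by case: re => [|r2]; [left | right; apply: part_real].
Qed.

End Heisenberg.

(** * A local criterion for real representations *)

Section LocalParity.
Local Open Scope group_scope.
Local Open Scope ring_scope.
Variables (gT : finGroupType) (G : {group gT}) (i : Iirr G) (x s : gT) (P : {group gT}).
Let C := 'C_G[x]%G.
Hypotheses (Gx : x \in G) (xs : (x ^ s = x^-1)%g).
Hypotheses (fsi : fs_ind s 'chi_i = -1) (twG : twists s G) (twC : twists s C).
Hypotheses (SP : (2.-Sylow(C) P)%g) (twP : twists s P).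
Hypothesis n2 : N2prop C s.
Hypothesis real2 : forall chi : 'CF(C), chi \in 'Z[irr C] -> two_elts_real s chi.

Let sPC : P \subset C. Proof. exact: pHall_sub SP. Qed.
Let sCG : C \subset G. Proof. exact: subsetIl. Qed.
Let P2 : (2.-group P)%g. Proof. exact: pHall_pgroup SP. Qed.
Let nCs := twistsN twC.
Let nPs := twistsN twP.
Let Cx : x \in C. Proof. by rewrite inE Gx cent1id. Qed.
Let cxC : <[x]>%g \subset 'Z(C)%g.
Proof.
rewrite cycle_subG inE Cx /=; apply/centP=> y /setIP[_ /cent1P]; exact.
Qed.
(** It vanishes off the 2-elements and has odd degree [#|C : P|], so a high power of it is the
    indicator function of the 2-elements modulo a power of 2. *)
Let Pi : 'CF(C) := 'Ind[C] (1 : 'CF(P)).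
Let m z := '['Res[C] 'chi_i, 'chi_z].
Let w (z : Iirr C) := 'chi_z x / 'chi_z 1%g.

Let wE (z : Iirr C) u : u \in C -> 'chi_z (x * u)%g = w z * 'chi_z u.
Proof.
move=> Cu; apply: (mulIf (irr1_neq0 z)).
rewrite irr_center_mul ?(subsetP cxC) ?cycle_id // mulrAC /w mulfVK ?irr1_neq0 //.
Qed.

Let Aw z : w z \in Aint.
Proof.
have [j jP] := irr_lies_over cxC z; have cx := cycle_id x.
suff -> : w z = 'chi_j x by apply: Aint_irr.
by apply: (mulIf (irr1_neq0 z)); rewrite -jP // wE.
Qed.

Let Zm z : m z \in Num.int.
Proof. by rewrite Cint_cfdot_vchar_irr // cfRes_vchar ?irr_vchar. Qed.

Let h : 'CF(C) := \sum_z (m z * w z) *: 'chi_z.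

Let hE u : u \in C -> h u = 'chi_i (x * u)%g.
Proof.
move=> Cu; have Cxu := groupM Cx Cu.
rewrite -(cfResE _ sCG Cxu) ['Res[C] 'chi_i]cfun_sum_cfdot !sum_cfunE.
by apply: eq_bigr => z _; rewrite !cfunE wE // mulrA.
Qed.

Let sg := @twisted_conj _ C s.

Let ri : twisted_real s 'chi_i.
Proof. exact: (fs_ind_typed twG (b := true) fsi).1. Qed.

Let m_sg z : m (sg z) = m z.
Proof.
apply: twisted_conj_dot => //; first by rewrite cfRes_vchar ?irr_vchar.
exact: twisted_real_Res.
Qed.

Let w_sg z : w (sg z) = w z.
Proof.
rewrite /w !twisted_conjE // xs conj1g -!char_inv ?irr_char // invgK.
by rewrite invg1.
Qed.

Let Pi_real : twisted_real s Pi.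
Proof.
by apply: twisted_real_Ind => // g Pg; rewrite !cfun1E memJ_norm // Pg conjC1.
Qed.

Let a k (z z' : Iirr C) := '['Res[P] ('chi_z * Pi ^+ k), 'Res[P] 'chi_z'].

Let ZPi k z : 'chi_z * Pi ^+ k \in 'Z[irr C].
Proof.
by rewrite rpredM ?irr_vchar // rpredX // cfInd_vchar // -irr0 irr_vchar.
Qed.

Let Za k z z' : a k z z' \in Num.int.
Proof. by rewrite Cint_cfdot_vchar ?cfRes_vchar ?irr_vchar. Qed.

Let a_sg k z z' : a k (sg z) (sg z') = a k z z'.
Proof.
rewrite -[RHS]conj_intr // /a !cfdotE [RHS]rmorphM fmorphV rmorph_nat rmorph_sum.
congr (_ * _); rewrite -(sum_conj_norm _ nPs); apply: eq_bigr => g Pg.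
have Cg := subsetP sPC _ Pg; have Pgs : (g ^ s)%g \in P by rewrite memJ_norm.
have Cgs := subsetP sPC _ Pgs.
have C2g : ((g ^ s) ^ s)%g = (g ^ (s ^+ 2))%g by rewrite -conjgM.
rewrite !cfResE // !cfunE !exp_cfunE // !twisted_conjE // C2g.
by rewrite !(cfunJ _ _ (twists2 twC)) Pi_real // !rmorphM !rmorphXn /= !conjCK.
Qed.

(** Restricting to [P] and inducing back multiplies by [Pi], so this is also [|C|^-1] times the sum
    over [u] in [C] of [|'chi_i (x u)|^2 Pi(u)^(k+1)]. The same number is thus seen on [P], where
    parities are known, and on [C], where it is wanted. *)
Let D k := '['Res[P] (h * Pi ^+ k), 'Res[P] h].

Let DE k : D k = \sum_p (m p.1 * w p.1) * (m p.2 * w p.2)^* * a k p.1 p.2.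
Proof.
rewrite /D {1 2}/h mulr_suml !linear_sum cfdot_suml.
rewrite -(pair_bigA _ (fun z z' => m z * w z * (m z' * w z')^* * a k z z')) /=.
apply: eq_bigr => z _; rewrite cfdot_sumr; apply: eq_bigr => z' _.
by rewrite -scalerAl !linearZ /= cfdotZl cfdotZr mulrA.
Qed.

(** If [z'] has indicator 1, its multiplicity in the restriction of ['chi_i], which has indicator
    [-1], is even. If it has indicator [-1], then on [P] it lies in the quaternionic lattice, while
    the other factor is in [RR] by [N2prop]. *)
Let parity_fix k z z' : sg z' = z' -> even_int (m z') \/ even_int (a k z z').
Proof.
move=> fz; have rz := (twisted_conj_real z' nCs).2 fz.
case: (fs_ind_real twC rz) => fsz.
  by left; apply: (fs_Res_parity (b := true) sCG twG twC fsi).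
right; apply: (RR_pair twP) => //.
- by apply: n2 => //; right; apply: real2.
- by rewrite cfRes_vchar ?irr_vchar.
- exact: twisted_real_Res.
by move=> k' fk'; apply: (fs_Res_parity (b := true) sPC twC twP fsz).
Qed.

Let D_even k : D k / 2%:R \in Aint.
Proof.
pose f p := (m p.1 * w p.1) * (m p.2 * w p.2)^* * a k p.1 p.2.
pose t (p : Iirr C * Iirr C) := (sg p.1, sg p.2).
have Amw z : m z * w z \in Aint by apply: rpredM; [apply: Aint_Cint|].
have Amw' z : (m z * w z)^* \in Aint by rewrite Aint_aut.
have Aw' z : (w z)^* \in Aint by rewrite Aint_aut.
have Aa z z' : a k z z' \in Aint by apply: Aint_Cint.
have Af p : f p \in Aint by apply: rpredM => //; apply: rpredM.
have tK : involutive t by case=> z z'; rewrite /t /= /sg !twisted_conjK.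
have ft p : f (t p) = f p by rewrite /f /t /= !m_sg !w_sg a_sg.
rewrite DE; apply: (half_sum_involution tK ft Af) => p /(congr1 snd) /= Ep.
case: (parity_fix k p.1 Ep) => ev.
  have -> : f p / 2%:R = m p.1 * w p.1 * (w p.2)^* * (m p.2 / 2%:R) * a k p.1 p.2.
    have E : (m p.2 * w p.2)^* = m p.2 * (w p.2)^* by rewrite rmorphM /= conj_intr.
    by rewrite /f E; ring.
  apply: rpredM => //; apply: rpredM; first exact: rpredM.
  exact: Aint_Cint.
rewrite /f -(mulrA _ _ 2%:R^-1); apply: rpredM; last exact: Aint_Cint.
exact: rpredM.
Qed.

Let Pi_conj : (Pi^*)%CF = Pi.
Proof. by rewrite conj_cfInd rmorph1. Qed.

Let Pi0 u : u \in C -> ~~ (2.-elt u)%g -> Pi u = 0.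
Proof.
move=> Cu n2u; rewrite cfIndE // big1 ?mulr0 // => y Cy; rewrite cfun1E.
case: (boolP (_ \in _)) => // Puy; case/negP: n2u.
by rewrite -(p_eltJ _ _ y) (mem_p_elt P2).
Qed.

Let Pi1 : ~~ even_int (Pi 1%g).
Proof.
rewrite cfInd1 // cfun1E group1 mulr1 even_int_nat negbK odd_2'nat.
by case/and3P: SP.
Qed.

Lemma local_parity : (#|C|`_2^')%N%:R *
  (#|C|%:R^-1 * \sum_(u in C | (2.-elt u)%g) 'chi_i (x * u)%g * ('chi_i (x * u)%g)^*)
    / 2%:R \in Aint.
Proof.
(* The power [k.+1] of [Pi] is 1 modulo [2 ^ n.+1] on 2-elements: [2 ^ n] cancels the 2-part of
   [#|C|], and one factor 2 remains for the final division. *)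
set n := logn 2 #|C|; pose k := (2 ^ (n + n)).-1.
have Ek : k.+1 = (2 ^ (n + n))%N by rewrite prednK ?expn_gt0.
have cC : (#|C| = 2 ^ n * #|C|`_2^')%N by rewrite -[LHS](partnC 2%N) // p_part.
set A := _ * \sum_(u in C | _) _; have -> : A = D k + (A - D k) by rewrite addrC subrK.
rewrite mulrDr mulrDl; apply: rpredD; first by rewrite -mulrA rpredM ?rpred_nat.
have DkE : D k = #|C|%:R^-1 * \sum_(u in C | (2.-elt u)%g)
    'chi_i (x * u)%g * ('chi_i (x * u)%g)^* * Pi u ^+ k.+1.
  rewrite /D cfdot_Res_l -['Res[P] h]mul1r cfIndM // -/Pi cfdotE; congr (_ * _).
  rewrite [RHS]big_mkcondr /=; apply: eq_bigr => u Cu.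
  rewrite !cfunE exp_cfunE // rmorphM /= -[in (Pi u)^*]Pi_conj cfConjCE conjCK.
  case: ifP => [_|/negbT nu]; last by rewrite Pi0 // !(mulr0, mul0r).
  by rewrite hE // exprSr; ring.
rewrite DkE /A -mulrBr -sumrB mulrA mulr_sumr mulr_suml; apply: rpred_sum => u /andP[Cu u2].
have ZP : Pi \in 'Z[irr C] by rewrite cfInd_vchar // -irr0 irr_vchar.
have := vchar_unit_pow n ZP Pi1 Cu u2; rewrite -/n -Ek /aint_cong => B.
set y := 'chi_i _; have Ay : y \in Aint by apply: Aint_irr.
have c0 : (#|C|`_2^')%N%:R != 0 :> algC by rewrite pnatr_eq0 -lt0n part_gt0.
have t0 : (2 ^ n)%:R != 0 :> algC by rewrite pnatr_eq0 -lt0n expn_gt0.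
have -> : (#|C|`_2^')%N%:R / #|C|%:R * (y * y^* - y * y^* * Pi u ^+ k.+1) / 2%:R
  = - (y * y^* * ((Pi u ^+ k.+1 - 1) / (2 ^ n.+1)%:R)).
  rewrite {2}cC expnS !natrM; field; rewrite t0 c0 //.
rewrite rpredN; apply: rpredM => //; apply: rpredM => //.
by rewrite Aint_aut.
Qed.

End LocalParity.

Section RealLocal.
Local Open Scope group_scope.
Local Open Scope ring_scope.
Variables (gT : finGroupType) (G : {group gT}).
Hypothesis realG : forall g, g \in G -> exists2 t, t \in G & (g ^ t = g^-1)%g.
Hypothesis localG : forall x s, x \in G -> (2%N^'.-elt x)%g -> s \in G ->
  (x ^ s = x^-1)%g -> N2prop 'C_G[x]%G s.

Let inverting_norm x s : s \in G -> (x ^ s = x^-1)%g ->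
  s \in 'N('C_G[x])%g /\ (s ^+ 2)%g \in 'C_G[x]%g.
Proof.
move=> Gs xs; split.
  by apply/normP; rewrite conjIg conjGid // -cent1J xs -!cent_cycle cycleV.
rewrite inE groupX //=; apply/cent1P/commute_sym/commgP/conjg_fixP.
by rewrite expgS expg1 conjgM xs conjVg xs invgK.
Qed.

(** The odd part of [s] is a power of [s ^+ 2], hence centralizes [x]; the 2-part alone inverts
    [x]. *)
Let inverting_two_elt x : x \in G -> exists s, [/\ s \in G, (2.-elt s)%g & (x ^ s = x^-1)%g].
Proof.
move=> Gx; have [s Gs xs] := realG Gx; exists (s.`_2%N)%g.
have [_ C2] := inverting_norm Gs xs.
have Cs' : (s.`_2%N^')%g \in 'C_G[x]%g.
  have /cycleP[k Ek] := cycle_constt 2%N^' s.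
  have o' : odd #[(s.`_2%N^')%g]%g by rewrite odd_2'nat; apply: p_elt_constt.
  have -> : (s.`_2%N^' = (s ^+ 2) ^+ (k * (#[s.`_2%N^']./2).+1))%g.
    rewrite -expgM mulnCA expgM -Ek mul2n doubleS expgSr.
    have <- : #[(s.`_2%N^')%g]%g = (#[(s.`_2%N^')%g]%g)./2.*2.+1.
      by rewrite -[LHS]odd_double_half o'.
    by rewrite expg_order mul1g.
  exact: groupX.
split; [|exact: p_elt_constt|].
  by apply: subsetP (cycle_constt 2%N s); rewrite cycle_subG.
move: xs; rewrite -{1}[s](consttC 2%N) conjgM => /(canRL (conjgK _)) ->.
have /setIP[_ /cent1P cx] := groupVr Cs'.
by apply/conjg_fixP/commgP/commute_sym/commuteV.
Qed.

(** An element inverting [x * u] inverts both the odd part [x] and the 2-part [u]. It differs from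
    [s] by an element of the centralizer of [x], so [u ^ s] is conjugate to [u^-1] there. *)
Let real_two_elts x s (chi : 'CF('C_G[x]%G)) : x \in G -> (2%N^'.-elt x)%g -> s \in G ->
  (x ^ s = x^-1)%g -> chi \in 'Z[irr 'C_G[x]%G] -> two_elts_real s chi.
Proof.
move=> Gx x2' Gs xs Zchi u Cu u2; have /setIP[Gu /cent1P/commute_sym cxu] := Cu.
have u2'' : ((2%N^')^'.-elt u)%g by rewrite p_eltNK.
have [t Gt xut] := realG (groupM Gx Gu).
have E2 : (x * u).`_2%N%g = u.
  by rewrite consttM // (constt_p_elt u2) (constt1P x2') mul1g.
have E2' : (x * u).`_2%N^'%g = x.
  by rewrite consttM // (constt_p_elt x2') (constt1P u2'') mulg1.
have ut : (u ^ t = u^-1)%g by rewrite -{1}E2 -consttJ xut consttV E2.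
have xt : (x ^ t = x^-1)%g by rewrite -{1}E2' -consttJ xut consttV E2'.
have Cts : (t^-1 * s)%g \in 'C_G[x]%g.
  rewrite inE groupM ?groupV //=; apply/cent1P/commute_sym/commgP/conjg_fixP.
  have xtV : (x ^ t^-1 = x^-1)%g.
    by apply: (conjg_inj t); rewrite conjgKV conjVg xt invgK.
  by rewrite conjgM xtV conjVg xs invgK.
rewrite -(mulKVg t s) conjgM ut cfunJ // .
have : (chi : 'CF(_)) \in 'Z[irr 'C_G[x]%G] := Zchi.
case/vcharP=> [c1 Nc1 [c2 Nc2 ->]]; rewrite !cfunE rmorphB /=.
by rewrite !char_inv.
Qed.

Theorem real_local_fs_ind (i : Iirr G) : fs_ind 1%g 'chi_i = 1.
Proof.
have tw1 : twists 1%g G by rewrite /twists group1 expg1n group1.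
have r1 : twisted_real 1%g 'chi_i.
  move=> g Gg; rewrite conjg1; have [t Gt gt] := realG Gg.
  by rewrite -char_inv ?irr_char // -gt cfunJ.
case: (fs_ind_real tw1 r1) => // fi.
pose A x := \sum_(u in 'C_G[x]%g | (2.-elt u)%g) 'chi_i (x * u)%g * ('chi_i (x * u)%g)^*.
pose F x := if (2%N^'.-elt x)%g then A x else 0.
have FJ : {in G &, forall g h, F (g ^ h)%g = F g}.
  move=> g h Gg Gh; rewrite /F p_eltJ; case: ifP => // _.
  rewrite /A (reindex_inj (conjg_inj h)) /=; apply: eq_big => u.
    by rewrite p_eltJ -{1}(conjGid Gh) cent1J -conjIg memJ_conjg.
  by move=> _; rewrite -conjMg cfunJ.
have sumF : \sum_(g in G) 'chi_i g * ('chi_i g)^* = \sum_(x in G) F x.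
  rewrite (partition_big (fun g => g.`_2%N^'%g) (mem G)) => [|g Gg]; last first.
    by apply: subsetP (cycle_constt _ _); rewrite cycle_subG.
  apply: eq_bigr => x Gx; rewrite /F; case: ifP => [x2'|/negP nx]; last first.
    by apply: big1 => g /andP[_ /eqP Ex]; case: nx; rewrite -Ex; apply: p_elt_constt.
  rewrite (reindex_inj (mulgI x)) /=; apply: eq_bigl => u; rewrite groupMl // in_setI.
  apply/andP/andP=> [[Gu /eqP Ex]|[/andP[Gu /cent1P/commute_sym cxu] u2]].
    have Eu : u = (x * u).`_2%N%g.
      by apply: (mulgI x); rewrite -{1}(consttC (2%N^') (x * u)%g) Ex consttNK.
    rewrite Gu; split; last by rewrite Eu p_elt_constt.
    have := centsP (cycle_abelian (x * u)%g) _ (cycle_constt 2%N _) _ (cycle_constt 2%N^' _).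
    by rewrite Ex -Eu => cux; apply/cent1P.
  have u2'' : ((2%N^')^'.-elt u)%g by rewrite p_eltNK.
  by split=> //; rewrite consttM // (constt_p_elt x2') (constt1P u2'') mulg1.
have loc x : x \in G -> (#|G|`_2%N^')%N%:R * (#|'C_G[x]|%:R^-1 * F x) / 2%:R \in Aint.
  move=> Gx; rewrite /F; case: ifP => x2'; last by rewrite !(mulr0, mul0r) rpred0.
  have [s [Gs s2 xs]] := inverting_two_elt Gx.
  have [nCs C2] := inverting_norm Gs xs.
  have twC : twists s 'C_G[x]%G by apply/andP.
  have p2 : (2.-group <[(s ^+ 2)%g]>)%g by apply: pgroupS s2; rewrite cycleX.
  have tws : twists s <[(s ^+ 2)%g]>%G.
    apply/andP; split; last exact: cycle_id.
    apply: (subsetP (cent_sub _)); rewrite cent_cycle.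
    by apply/cent1P; apply: commuteX.
  have sC : <[(s ^+ 2)%g]>%g \subset 'C_G[x]%g by rewrite cycle_subG.
  have [P [_ SP twP]] := Sylow_twists nCs sC p2 tws.
  have fsi : fs_ind s 'chi_i = -1 by rewrite -[s]mulg1 fs_ind_coset // groupC.
  have twG : twists s G by rewrite /twists groupX // (subsetP (normG G)).
  have := local_parity Gx xs fsi twG twC SP twP (localG Gx x2' Gs xs).
  move=> /(_ (fun chi => real_two_elts Gx x2' Gs xs)) H.
  have -> : (#|G|`_2%N^')%N = ((#|G|`_2%N^' %/ #|'C_G[x]|`_2%N^') * #|'C_G[x]|`_2%N^')%N.
    by rewrite divnK // partn_dvd // cardSg // subsetIl.
  by rewrite natrM -(mulrA _%:R) -(mulrA _%:R); apply: rpredM; [apply: rpred_nat | apply: H].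
have : (#|G|`_2%N^')%N%:R * '['chi_i] / 2%:R \in Aint.
  rewrite cfdotE sumF sum_by_classes // mulr_sumr mulr_sumr mulr_suml.
  apply: rpred_sum => _ /imsetP[x Gx ->]; have [y Gy ->] := repr_class G x.
  rewrite FJ //; have := loc x Gx; congr (_ / _ \in Aint); congr (_ * _).
  rewrite mulrA; congr (_ * _).
  rewrite -index_cent1 -(Lagrange (subsetIl G 'C[x])) natrM invfM.
  by rewrite mulfVK // pnatr_eq0 -lt0n indexg_gt0.
rewrite cfnorm_irr mulr1 => AG.
have QG : (#|G|`_2%N^')%N%:R / 2%:R \in (Crat : {pred algC}) by rewrite rpred_div ?rpred_nat.
have := Cint_rat_Aint QG AG; rewrite -/(even_int _) even_int_nat odd_2'nat.
by rewrite part_pnat.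
Qed.

End RealLocal.

(** * The group algebra of a cyclic group *)

Section CyclicAlgebra.
Variables (F : finFieldType) (n : nat).
Hypotheses (char2 : 2%N \in [pchar F]) (n_gt0 : (0 < n)%N).

Definition cyc_poly : {poly F} := 'X^n - 1.
Definition cyc_alg := {poly %/ cyc_poly}.
HB.instance Definition _ := GRing.ComNzRing.on cyc_alg.
HB.instance Definition _ := GRing.Lmodule.on cyc_alg.
HB.instance Definition _ := Finite.on cyc_alg.

Definition cyc_val (a : cyc_alg) : {poly F} := polyn a.
Definition cyc_pi (p : {poly F}) : cyc_alg := in_qpoly cyc_poly p.

Let monic_h : mk_monic cyc_poly = cyc_poly.
Proof. by rewrite /mk_monic /cyc_poly size_XnsubC // ltnS n_gt0 monicXnsubC. Qed.

Lemma size_cyc_val (a : cyc_alg) : (size (cyc_val a) <= n)%N.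
Proof.
have := size_mk_monic a; rewrite -/(cyc_val a); move: (cyc_val a) => p.
by rewrite monic_h size_XnsubC.
Qed.

Lemma cyc_val_pi (p : {poly F}) : (size p <= n)%N -> cyc_val (cyc_pi p) = p.
Proof.
by move=> sz; rewrite /cyc_val /cyc_pi in_qpoly_small // monic_h size_XnsubC.
Qed.

Lemma cyc_val_inj : injective cyc_val. Proof. exact: val_inj. Qed.

Lemma cyc_pi_divp (p : {poly F}) : exists q, p = q * cyc_poly + cyc_val (cyc_pi p).
Proof.
exists (Pdiv.CommonRing.rdivp p cyc_poly).
rewrite {1}[p](Pdiv.RingMonic.rdivp_eq (monicXnsubC 1 n_gt0)) /= monic_h //.
Qed.

Lemma cyc_pi_is_zmod_morphism : zmod_morphism cyc_pi.
Proof. by move=> p q; rewrite /cyc_pi raddfB. Qed.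
Lemma cyc_pi_is_monoid_morphism : monoid_morphism cyc_pi.
Proof. by split; [exact: rmorph1 | move=> p q; exact: rmorphM]. Qed.
HB.instance Definition _ := GRing.isZmodMorphism.Build {poly F} cyc_alg cyc_pi
  cyc_pi_is_zmod_morphism.
HB.instance Definition _ := GRing.isMonoidMorphism.Build {poly F} cyc_alg cyc_pi
  cyc_pi_is_monoid_morphism.

Lemma cyc_piK (a : cyc_alg) : cyc_pi (cyc_val a) = a.
Proof.
by apply: cyc_val_inj; rewrite cyc_val_pi // size_cyc_val.
Qed.

Definition cyc_gen : cyc_alg := cyc_pi 'X.
Definition cyc_const (c : F) : cyc_alg := cyc_pi c%:P.

Lemma cyc_const_is_zmod_morphism : zmod_morphism cyc_const.
Proof. by move=> a b; rewrite /cyc_const !raddfB. Qed.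
Lemma cyc_const_is_monoid_morphism : monoid_morphism cyc_const.
Proof. by split; [rewrite /cyc_const !rmorph1 | move=> a b; rewrite /cyc_const !rmorphM]. Qed.
HB.instance Definition _ := GRing.isZmodMorphism.Build F cyc_alg cyc_const
  cyc_const_is_zmod_morphism.
HB.instance Definition _ := GRing.isMonoidMorphism.Build F cyc_alg cyc_const
  cyc_const_is_monoid_morphism.

Lemma cyc_pi_h : cyc_pi cyc_poly = 0.
Proof.
apply: val_inj => /=; have := monicXnsubC (1 : F) n_gt0; rewrite -/cyc_poly => mh.
by rewrite monic_h (Pdiv.RingMonic.rmodpp mh).
Qed.

Lemma cyc_gen_n : cyc_gen ^+ n = 1.
Proof.
apply/eqP; rewrite -subr_eq0 -cyc_pi_h /cyc_poly rmorphB rmorphXn rmorph1 //.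
Qed.

Lemma cyc_expand (a : cyc_alg) : a = \sum_(k < n) cyc_const (cyc_val a)`_k * cyc_gen ^+ k.
Proof.
have E : cyc_val a = \sum_(k < n) ((cyc_val a)`_k)%:P * 'X^k.
  apply/polyP=> i; rewrite coef_sum; have [i_n|n_i] := ltnP i n.
    rewrite (bigD1 (Ordinal i_n)) //= big1 ?addr0 => [|j ne].
      by rewrite coefCM coefXn eqxx mulr1.
    rewrite coefCM coefXn; case: eqP => [Ei|_]; last by rewrite mulr0.
    by case/eqP: ne; apply: val_inj.
  rewrite nth_default ?(leq_trans (size_cyc_val a)) // big1 // => j _.
  by rewrite coefCM coefXn gtn_eqF ?mulr0 // (leq_trans (ltn_ord j)).
rewrite -{1}(cyc_piK a) {1}E rmorph_sum; apply: eq_bigr => k _.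
by rewrite rmorphM rmorphXn.
Qed.

(** The coefficient of the identity, that is, the symmetrizing form of the group algebra. *)
Definition cyc_eps (a : cyc_alg) : F := (cyc_val a)`_0.

Lemma cyc_epsD a b : cyc_eps (a + b) = cyc_eps a + cyc_eps b.
Proof. by rewrite /cyc_eps -coefD. Qed.

Lemma cyc_eps_sum I (r : seq I) P (f : I -> cyc_alg) :
  cyc_eps (\sum_(i <- r | P i) f i) = \sum_(i <- r | P i) cyc_eps (f i).
Proof. by apply: (big_morph cyc_eps cyc_epsD); rewrite /cyc_eps coef0. Qed.

Lemma cyc_epsZ c a : cyc_eps (cyc_const c * a) = c * cyc_eps a.
Proof.
have -> : cyc_const c * a = cyc_pi (c *: cyc_val a).
  by rewrite -mul_polyC rmorphM /= cyc_piK.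
by rewrite /cyc_eps cyc_val_pi ?coefZ // (leq_trans (size_scale_leq _ _)) // size_cyc_val.
Qed.

Lemma cyc_eps_gen k : cyc_eps (cyc_gen ^+ k) = (n %| k)%N%:R.
Proof.
have -> : cyc_gen ^+ k = cyc_gen ^+ (k %% n).
  by rewrite {1}(divn_eq k n) exprD mulnC exprM cyc_gen_n expr1n mul1r.
rewrite /dvdn; move: (k %% n)%N (ltn_pmod k n_gt0) => j jn.
by rewrite -rmorphXn /cyc_eps cyc_val_pi ?size_polyXn // coefXn eq_sym.
Qed.

Lemma cyc_eps_coef (a : cyc_alg) (k : 'I_n) : cyc_eps (a * cyc_gen ^+ (n - k)) = (cyc_val a)`_k.
Proof.
rewrite {1}[a]cyc_expand mulr_suml cyc_eps_sum (bigD1 k) //= big1 ?addr0 => [|j ne].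
  by rewrite -mulrA -exprD subnKC 1?ltnW // cyc_epsZ cyc_eps_gen dvdnn mulr1.
rewrite -mulrA -exprD cyc_epsZ cyc_eps_gen; case: dvdnP => [[q Eq]|]; last by rewrite mulr0.
case/eqP: ne; apply: val_inj => /=; have jn := ltn_ord j; have kn := ltn_ord k.
case: q Eq => [|[|q]]; rewrite ?mul0n ?mul1n ?mulSn; lia.
Qed.

Lemma cyc_eps_inj (a b : cyc_alg) : (forall c, cyc_eps (a * c) = cyc_eps (b * c)) -> a = b.
Proof.
move=> h; rewrite [a]cyc_expand [b]cyc_expand; apply: eq_bigr => k _.
by rewrite -!cyc_eps_coef h.
Qed.

(** The involution inverting the generator, as [n.-1] is [-1] modulo [n]. *)
Definition cyc_star (a : cyc_alg) : cyc_alg := cyc_pi (cyc_val a \Po 'X^(n.-1)).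

Lemma cyc_star_pi p : cyc_star (cyc_pi p) = cyc_pi (p \Po 'X^(n.-1)).
Proof.
have [q Eq] := cyc_pi_divp p; rewrite /cyc_star {2}Eq comp_polyD comp_polyM rmorphD rmorphM /=.
have -> : cyc_pi (cyc_poly \Po 'X^(n.-1)) = 0.
  rewrite /cyc_poly comp_polyB comp_polyC comp_Xn_poly -exprM mulnC exprM rmorphB rmorphXn /=.
  by rewrite rmorphXn /= -/cyc_gen cyc_gen_n expr1n rmorph1 subrr.
by rewrite mulr0 add0r.
Qed.

Lemma cyc_starD a b : cyc_star (a + b) = cyc_star a + cyc_star b.
Proof.
by rewrite -(cyc_piK a) -(cyc_piK b) -rmorphD !cyc_star_pi comp_polyD rmorphD.
Qed.

Lemma cyc_starM a b : cyc_star (a * b) = cyc_star a * cyc_star b.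
Proof.
by rewrite -(cyc_piK a) -(cyc_piK b) -rmorphM !cyc_star_pi comp_polyM rmorphM.
Qed.

Lemma cyc_star0 : cyc_star 0 = 0.
Proof. by apply: (addrI (cyc_star 0)); rewrite -cyc_starD !addr0. Qed.

Lemma cyc_star1 : cyc_star 1 = 1.
Proof. by rewrite -(rmorph1 (cyc_pi)) cyc_star_pi comp_polyC. Qed.

Lemma cyc_starX a k : cyc_star (a ^+ k) = cyc_star a ^+ k.
Proof. by elim: k => [|k IH]; rewrite ?cyc_star1 // !exprS cyc_starM IH. Qed.

Lemma cyc_star_sum I (r : seq I) P (f : I -> cyc_alg) :
  cyc_star (\sum_(i <- r | P i) f i) = \sum_(i <- r | P i) cyc_star (f i).
Proof. exact: (big_morph cyc_star cyc_starD cyc_star0). Qed.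

Lemma cyc_star_const c : cyc_star (cyc_const c) = cyc_const c.
Proof. by rewrite cyc_star_pi comp_polyC. Qed.

Lemma cyc_star_gen : cyc_star cyc_gen = cyc_gen ^+ n.-1.
Proof. by rewrite cyc_star_pi comp_polyX rmorphXn. Qed.

Lemma cyc_gen_star : cyc_gen * cyc_star cyc_gen = 1.
Proof. by rewrite cyc_star_gen -exprS prednK // cyc_gen_n. Qed.

Lemma cyc_star_sum_gen (a : cyc_alg) :
  cyc_star a = \sum_(k < n) cyc_const (cyc_val a)`_k * (cyc_star cyc_gen) ^+ k.
Proof.
rewrite {1}[a]cyc_expand cyc_star_sum; apply: eq_bigr => k _.
by rewrite cyc_starM cyc_starX cyc_star_const.
Qed.

Lemma cyc_starK : involutive cyc_star.
Proof.
have gK : cyc_star (cyc_star cyc_gen) = cyc_gen.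
  have: cyc_star cyc_gen * cyc_star (cyc_star cyc_gen) = cyc_star cyc_gen * cyc_gen.
    by rewrite -cyc_starM cyc_gen_star cyc_star1 mulrC cyc_gen_star.
  move/(congr1 (fun z => cyc_gen * z)); rewrite !mulrA cyc_gen_star !mul1r //.
move=> a; rewrite [cyc_star a]cyc_star_sum_gen cyc_star_sum [RHS]cyc_expand; apply: eq_bigr => k _.
by rewrite cyc_starM cyc_starX gK cyc_star_const.
Qed.

Lemma cyc_eps_star a : cyc_eps (cyc_star a) = cyc_eps a.
Proof.
rewrite cyc_star_sum_gen [in RHS](cyc_expand a) !cyc_eps_sum; apply: eq_bigr => k _.
rewrite !cyc_epsZ cyc_star_gen -exprM !cyc_eps_gen; congr (_ * _%:R); congr nat_of_bool.
by rewrite Gauss_dvdr // coprimenP.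
Qed.

Hypothesis odd_n : odd n.

(** [2 ^ (f * totient n)] is a power of [#|F|] and is 1 modulo [n], so this iterate of Frobenius
    fixes both the scalars and the generator. Hence the algebra is a product of finite fields, in
    which square roots and supporting idempotents are powers. *)
Lemma cyc_frobenius : exists2 e, (0 < e)%N & forall a : cyc_alg, a ^+ (2 ^ e) = a.
Proof.
have [f f_gt0 Ef] : exists2 f, (0 < f)%N & #|F| = (2 ^ f)%N.
  have /abelem_pgroup : (2.-abelem [set: F])%g by apply: fin_ring_pchar_abelem.
  rewrite /pgroup cardsT => /p_natP[f Ef]; exists f => //.
  by have := finNzRing_gt1 F; rewrite Ef; case: (f).
have co : coprime #|F| n by rewrite Ef coprime_pexpl // prime_coprime // dvdn2 odd_n.
exists (f * totient n)%N; first by rewrite muln_gt0 f_gt0 totient_gt0.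
set N := (2 ^ _)%N.
have pK : 2%N \in [pchar cyc_alg] by rewrite pchar_qpoly.
have gN : cyc_gen ^+ N = cyc_gen.
  have := Euler_exp_totient co; rewrite Ef -expnM -/N => E.
  by rewrite -(expr_mod N cyc_gen_n) E (expr_mod 1 cyc_gen_n) expr1.
have cN c : c ^+ N = c :> F.
  rewrite /N expnM -Ef; elim: (totient n) => [|t IH]; first by rewrite expr1.
  by rewrite expnS exprM expf_card.
move=> a; rewrite [a]cyc_expand; apply: (big_ind (fun u => u ^+ N = u)) => [|u v Eu Ev|k _].
- by rewrite expr0n expn_eq0.
- by rewrite exprDn_pchar ?Eu ?Ev // /N (eq_pnat _ (pcharf_eq pK)) pnatX.
by rewrite exprMn -rmorphXn cN exprAC gN.
Qed.

End CyclicAlgebra.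

(** * Quadratic spaces in characteristic two *)

Section QuadraticSpace.
Variables (F : finFieldType) (m : nat).
Local Notation V := 'rV[F]_m.-1.+1.
Local Notation GL := {'GL_m[F]}.
Variable Q : V -> F.
Hypotheses (char2 : 2%N \in [pchar F]) (qQ : is_quadratic_form Q) (ndQ : qnondegenerate Q).
Local Notation B := (polar Q).
Implicit Types (u v w : V) (g h : GL) (W T U : {set V}).

Lemma addvv v : v + v = 0.
Proof. by rewrite -mulr2n -scaler_nat pcharf0 ?scale0r. Qed.

Lemma oppv v : - v = v.
Proof. by apply/eqP; rewrite -subr_eq0 -opprD addvv oppr0. Qed.

Lemma addff (a : F) : a + a = 0.
Proof. by rewrite -mulr2n -mulr_natr pcharf0 ?mulr0. Qed.

Lemma oppf (a : F) : - a = a.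
Proof. by apply/eqP; rewrite -subr_eq0 -opprD addff oppr0. Qed.

Lemma qD u v : Q (u + v) = Q u + Q v + B u v.
Proof. by rewrite /polar; ring. Qed.

Lemma qZ a v : Q (a *: v) = a ^+ 2 * Q v.
Proof.
have [A EA] := qQ; rewrite !EA linearZ /= -!scalemxAl -!scalemxAr mxE [X in _ * X]mxE.
by rewrite mulrA expr2.
Qed.

Let polarE : exists A : 'M[F]_m.-1.+1, forall u v,
  B u v = (u *m A *m v^T) 0 0 + (v *m A *m u^T) 0 0.
Proof.
have [A EA] := qQ; exists A => u v; rewrite /polar !EA linearD /= !mulmxDl !mulmxDr.
have e M N : ((M + N) : 'M[F]_1) 0 0 = M 0 0 + N 0 0 by rewrite mxE.
by rewrite !e; ring.
Qed.

Lemma q0 : Q 0 = 0.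
Proof. by rewrite -(scale0r 0) qZ expr0n mul0r. Qed.

Lemma polarC u v : B u v = B v u.
Proof. by rewrite /polar (addrC u v); ring. Qed.

Lemma polarDl u u' v : B (u + u') v = B u v + B u' v.
Proof.
have [A EA] := polarE; rewrite !EA linearD /= !mulmxDl !mulmxDr.
have e M N : ((M + N) : 'M[F]_1) 0 0 = M 0 0 + N 0 0 by rewrite mxE.
by rewrite !e; ring.
Qed.

Lemma polarZl a u v : B (a *: u) v = a * B u v.
Proof.
have [A EA] := polarE; rewrite !EA linearZ /= -!scalemxAl -!scalemxAr mulrDr.
by rewrite !(mxE _ _ 0 0).
Qed.

Lemma polarDr u v v' : B u (v + v') = B u v + B u v'.
Proof. by rewrite polarC polarDl !(polarC _ u). Qed.

Lemma polarZr a u v : B u (a *: v) = a * B u v.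
Proof. by rewrite polarC polarZl (polarC _ u). Qed.

Lemma polar0l v : B 0 v = 0.
Proof. by rewrite -(scale0r 0) polarZl mul0r. Qed.

Lemma polar0r v : B v 0 = 0.
Proof. by rewrite polarC polar0l. Qed.

Lemma polarvv v : B v v = 0.
Proof. by rewrite /polar addvv q0 sub0r -opprD addff oppr0. Qed.

Lemma polar_suml I (r : seq I) P (f : I -> V) v :
  B (\sum_(i <- r | P i) f i) v = \sum_(i <- r | P i) B (f i) v.
Proof. by apply: (big_morph (B^~ v)) => [u u'|]; rewrite ?polarDl ?polar0l. Qed.

Lemma polar_inj v : (forall u, B v u = 0) -> v = 0.
Proof. exact: ndQ. Qed.

Local Notation O := (qorth_group Q).

Lemma orthP g : reflect (forall v, Q (v *m GLval g) = Q v) (g \in O).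
Proof. by rewrite inE; apply: (iffP forallP) => h v; apply/eqP. Qed.

Lemma orth_polar g u v : g \in O -> B (u *m GLval g) (v *m GLval g) = B u v.
Proof. by move/orthP=> og; rewrite /polar -mulmxDl !og. Qed.

Lemma mulmxGM v g h : v *m GLval (g * h)%g = v *m GLval g *m GLval h.
Proof. by rewrite GL_MxE mulmxA. Qed.

Lemma mulmxG1 v : v *m GLval (1%g : GL) = v.
Proof. by rewrite GL_1E mulmx1. Qed.

Lemma mulmxGK v g : v *m GLval g *m GLval (g^-1)%g = v.
Proof. by rewrite -mulmxGM mulgV mulmxG1. Qed.

Lemma mulmxGKV v g : v *m GLval (g^-1)%g *m GLval g = v.
Proof. by rewrite -mulmxGM mulVg mulmxG1. Qed.

Lemma GL_eqP g h : (forall v : V, v *m GLval g = v *m GLval h) -> g = h.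
Proof.
move=> E; apply: val_inj; apply/row_matrixP=> i; rewrite !rowE; exact: E.
Qed.

Lemma orth_polarV g u v : g \in O -> B (u *m GLval g) v = B u (v *m GLval (g^-1)%g).
Proof. by move=> og; rewrite -[in RHS](orth_polar _ _ og) mulmxGKV. Qed.

Lemma GL_of_fun (f : V -> V) : (forall u v, f (u + v) = f u + f v) ->
  (forall a v, f (a *: v) = a *: f v) -> (forall v, f v = 0 -> v = 0) ->
  exists g : GL, forall v, v *m GLval g = f v.
Proof.
move=> fD fZ finj; pose A := \matrix_i f (delta_mx 0 i) : 'M[F]_m.-1.+1.
have fA v : v *m A = f v.
  rewrite [in RHS](row_sum_delta v).
  have -> : f (\sum_j v 0 j *: delta_mx 0 j) = \sum_j f (v 0 j *: delta_mx 0 j).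
    by apply: (big_morph f fD); have := fZ 0 0; rewrite !scale0r.
  rewrite mulmx_sum_row; apply: eq_bigr => j _; rewrite fZ.
  by congr (_ *: _); apply/rowP=> k; rewrite !mxE.
have uA : A \is a GRing.unit.
  rewrite -[_ \is a _]/(A \in unitmx) -row_free_unit -kermx_eq0; apply/rowV0P=> v.
  by rewrite sub_kermx fA => /eqP; apply: finj.
by exists (insubd (1%g : GL) A) => v; rewrite /= val_insubd uA.
Qed.

Lemma orth_of_fun (f : V -> V) : (forall u v, f (u + v) = f u + f v) ->
  (forall a v, f (a *: v) = a *: f v) -> (forall v, Q (f v) = Q v) ->
  exists2 g : GL, g \in O & forall v, v *m GLval g = f v.
Proof.
move=> fD fZ fQ; have [g Eg] : exists g : GL, forall v, v *m GLval g = f v.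
  apply: GL_of_fun => // v f0; apply: polar_inj => u.
  by rewrite /polar -[Q (v + u)]fQ -[Q v]fQ -[Q u]fQ fD f0 add0r q0 subr0 subrr.
by exists g => //; apply/orthP=> v; rewrite Eg.
Qed.

Definition subsp U := [/\ 0 \in U, {in U &, forall u v, u + v \in U}
  & forall (a : F) v, v \in U -> a *: v \in U].

Definition perp U := [set v | [forall u in U, B v u == 0]].

Lemma perpP U v : reflect {in U, forall u, B v u = 0} (v \in perp U).
Proof. by rewrite inE; apply: (iffP forall_inP) => h u Uu; apply/eqP/h. Qed.

(** This says that the whole space is [U + perp U]; in characteristic 2 the projection needs no
    sign. *)
Definition nondeg U := forall v, exists2 u, u \in U & v + u \in perp U.

Lemma subsp_perp U : subsp (perp U).
Proof.
split=> [|u v /perpP pu /perpP pv|a v /perpP pv]; apply/perpP=> w Uw.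
- exact: polar0l.
- by rewrite polarDl pu ?pv ?addr0.
by rewrite polarZl pv ?mulr0.
Qed.

Lemma perpK U v : nondeg U -> {in perp U, forall u, B v u = 0} -> v \in U.
Proof.
move=> nU pv; have [u Uu puv] := nU v; suff -> : v = u by [].
apply/eqP; rewrite -subr_eq0 oppv; apply/eqP/polar_inj=> w.
have [u' Uu' pw] := nU w; rewrite -[w](addrK u') oppv polarDr.
rewrite ((perpP _ _ puv) _ Uu') addr0 polarDl pv // add0r polarC.
exact: (perpP _ _ pw).
Qed.

Lemma perp_cap U v : nondeg U -> v \in U -> v \in perp U -> v = 0.
Proof.
move=> nU Uv /perpP pv; apply: polar_inj => w; have [u Uu /perpP pw] := nU w.
by rewrite -[w](addrK u) oppv polarDr (pv _ Uu) addr0 polarC pw.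
Qed.

Lemma nondegP U u : subsp U -> nondeg U -> u \in U -> u != 0 ->
  exists2 v, v \in U & B u v = 1.
Proof.
move=> [_ _ UZ] nU Uu nz; have /existsP[v /andP[Uv nB]] : [exists v, (v \in U) && (B u v != 0)].
  apply: contraNT nz => /existsPn nex; apply/eqP/(perp_cap nU Uu)/perpP=> w Uw.
  by move: (nex w); rewrite Uw /= negbK => /eqP.
by exists ((B u v)^-1 *: v); rewrite ?UZ // polarZr mulVf.
Qed.

End QuadraticSpace.

(** * The hermitian form of an isometry of odd order *)

Section OddElement.
Variables (F : finFieldType) (m : nat).
Local Notation V := 'rV[F]_m.-1.+1.
Local Notation GL := {'GL_m[F]}.
Variable Q : V -> F.
Hypotheses (char2 : 2%N \in [pchar F]) (qQ : is_quadratic_form Q) (ndQ : qnondegenerate Q).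
Local Notation B := (polar Q).
Local Notation O := (qorth_group Q).
Implicit Types (u v w : V) (g h : GL) (W T U : {set V}).
Variable x : GL.
Hypotheses (Ox : x \in O) (odd_x : odd #[x]%g).
Local Notation n := #[x]%g.
Local Notation K := (cyc_alg F n).
Local Notation xi := (cyc_gen F n).
Implicit Types (a b c r : K).
Let n_gt0 : (0 < n)%N. Proof. exact: order_gt0. Qed.

Let starD := @cyc_starD F n n_gt0.
Let starM := @cyc_starM F n n_gt0.
Let starX := @cyc_starX F n n_gt0.
Let star0 := @cyc_star0 F n n_gt0.
Let star1 := @cyc_star1 F n n_gt0.
Let starK := @cyc_starK F n n_gt0.

Definition act v a := v *m horner_mx (GLval x) (cyc_val a).

Lemma GL_expgE g k : GLval (g ^+ k)%g = GLval g ^+ k.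
Proof. by elim: k => [|k IH]; rewrite ?GL_1E // expgS exprS GL_ME IH. Qed.

Lemma act_pi v p : act v (cyc_pi n p) = v *m horner_mx (GLval x) p.
Proof.
have [q Eq] := cyc_pi_divp n_gt0 p; rewrite /act {2}Eq rmorphD rmorphM /=.
have -> : horner_mx (GLval x) (cyc_poly F n) = 0.
  by rewrite rmorphB rmorphXn rmorph1 /= horner_mx_X -GL_expgE expg_order GL_1E subrr.
by rewrite mulr0 add0r.
Qed.

Lemma actDl u v a : act (u + v) a = act u a + act v a.
Proof. exact: mulmxDl. Qed.

Lemma act0l a : act 0 a = 0.
Proof. exact: mul0mx. Qed.

Lemma actDr v a b : act v (a + b) = act v a + act v b.
Proof. by rewrite -mulmxDr -rmorphD. Qed.

Lemma act0r v : act v 0 = 0.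
Proof. by rewrite /act (_ : cyc_val 0 = 0) // rmorph0 mulmx0. Qed.

Lemma actM v a b : act v (a * b) = act (act v a) b.
Proof.
rewrite -(cyc_piK n_gt0 a) -(cyc_piK n_gt0 b) -rmorphM !act_pi rmorphM /=.
by rewrite -mulmxA.
Qed.

Lemma act1 v : act v 1 = v.
Proof. by rewrite -(rmorph1 (cyc_pi n)) act_pi rmorph1 mulmx1. Qed.

Lemma act_const v (c : F) : act v (cyc_const n c) = c *: v.
Proof. by rewrite /cyc_const act_pi horner_mx_C mul_mx_scalar. Qed.

Lemma act_gen v : act v xi = v *m GLval x.
Proof. by rewrite /cyc_gen act_pi horner_mx_X. Qed.

Lemma actZl v (c : F) a : act (c *: v) a = c *: act v a.
Proof. by rewrite /act -scalemxAl. Qed.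

Lemma act_sumr I (r : seq I) P (f : I -> K) v :
  act v (\sum_(i <- r | P i) f i) = \sum_(i <- r | P i) act v (f i).
Proof. by apply: (big_morph (act v)); [exact: actDr | exact: act0r]. Qed.

Lemma act_expand v a : act v a = \sum_(k < n) (cyc_val a)`_k *: act v (xi ^+ k).
Proof.
rewrite {1}[a](cyc_expand n_gt0) act_sumr; apply: eq_bigr => k _.
by rewrite mulrC actM act_const.
Qed.

Lemma act_genX v k : act v (xi ^+ k) = v *m GLval (x ^+ k)%g.
Proof.
elim: k => [|k IH]; first by rewrite expr0 act1 mulmxG1.
by rewrite exprSr actM IH act_gen expgSr mulmxGM.
Qed.

Lemma act_comm g v a : commute g x -> act (v *m GLval g) a = act v a *m GLval g.
Proof.
move=> cgx; rewrite !(act_expand _ a) mulmx_suml; apply: eq_bigr => k _.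
by rewrite -scalemxAl !act_genX -!mulmxGM (commuteX k cgx).
Qed.

Lemma star_gen_act v : act v (cyc_star xi) = v *m GLval (x^-1)%g.
Proof.
rewrite (cyc_star_gen _ n_gt0) act_genX; congr (_ *m GLval _).
by apply/esym/eqP; rewrite eq_invg_mul -expgS prednK // expg_order.
Qed.

Lemma act_inv s v a : (x ^ s = x^-1)%g -> act v a *m GLval s = act (v *m GLval s) (cyc_star a).
Proof.
move=> xs; have xsk k : (x ^+ k * s = s * x^-1 ^+ k)%g by rewrite -xs -conjXg -conjgC.
rewrite (act_expand v) (cyc_star_sum_gen n_gt0) mulmx_suml act_sumr.
apply: eq_bigr => k _; rewrite mulrC actM act_const -scalemxAl; congr (_ *: _).
rewrite act_genX -mulmxGM xsk mulmxGM; elim: (k : nat) => [|j IH].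
  by rewrite expr0 act1 mulmxG1.
by rewrite exprSr actM -IH star_gen_act expgSr mulmxGM.
Qed.

Lemma act_adj u v a : B (act u a) v = B u (act v (cyc_star a)).
Proof.
rewrite (act_expand u) (cyc_star_sum_gen n_gt0) (polar_suml qQ) act_sumr (polarC Q u) (polar_suml qQ).
apply: eq_bigr => k _; rewrite mulrC actM act_const !(polarZl qQ); congr (_ * _).
rewrite act_genX (orth_polarV _ _ (groupX k Ox)) polarC; congr (B _ u).
elim: (k : nat) => [|j IH]; first by rewrite invg1 mulmxG1 expr0 act1.
by rewrite exprSr actM -IH star_gen_act expgS invMg mulmxGM.
Qed.

(** The unique [K]-valued form whose composition with [cyc_eps] is the polar form ([herm_eps]). Its
    hermitian properties all follow from those of the polar form because [cyc_eps] is
    nondegenerate. *)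
Definition herm u v : K := \sum_(k < n) cyc_const n (B (act u (xi ^+ k)) v) * xi ^+ (n - k).

Lemma herm_eps u v a : cyc_eps (herm u v * a) = B (act u a) v.
Proof.
rewrite (act_expand u) (polar_suml qQ) mulr_suml cyc_eps_sum.
apply: eq_bigr => k _; rewrite (polarZl qQ) -mulrA (cyc_epsZ n_gt0) mulrC [xi ^+ _ * a]mulrC.
by rewrite (cyc_eps_coef char2 n_gt0).
Qed.

Lemma herm_inj r u v : (forall a, B (act u a) v = cyc_eps (r * a)) -> herm u v = r.
Proof. by move=> E; apply: (cyc_eps_inj char2 n_gt0) => a; rewrite herm_eps. Qed.

Lemma hermDl u u' v : herm (u + u') v = herm u v + herm u' v.
Proof.
by apply: herm_inj => a; rewrite actDl (polarDl qQ) mulrDl cyc_epsD !herm_eps.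
Qed.

Lemma hermC u v : herm v u = cyc_star (herm u v).
Proof.
apply: herm_inj => a; rewrite -[a in RHS]starK -starM.
by rewrite (cyc_eps_star n_gt0) herm_eps [in RHS]act_adj starK polarC.
Qed.

Lemma hermDr u v v' : herm u (v + v') = herm u v + herm u v'.
Proof. by rewrite hermC hermDl starD -!hermC. Qed.

Lemma hermMl u v a : herm (act u a) v = herm u v * a.
Proof. by apply: herm_inj => b; rewrite -actM -mulrA herm_eps. Qed.

Lemma hermMr u v a : herm u (act v a) = herm u v * cyc_star a.
Proof. by rewrite hermC hermMl starM -hermC. Qed.

Lemma herm0l v : herm 0 v = 0.
Proof. by rewrite -(act0r 0) hermMl mulr0. Qed.

Lemma herm0r v : herm v 0 = 0.
Proof. by rewrite hermC herm0l star0. Qed.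

Lemma herm_comm g u v : g \in O -> commute g x ->
  herm (u *m GLval g) (v *m GLval g) = herm u v.
Proof. by move=> Og cgx; apply: herm_inj => a; rewrite act_comm // orth_polar // herm_eps. Qed.

Lemma herm_inv s u v : s \in O -> (x ^ s = x^-1)%g ->
  herm (u *m GLval s) (v *m GLval s) = cyc_star (herm u v).
Proof.
move=> Os xs; apply: herm_inj => a.
rewrite -{1}[a]starK -act_inv // orth_polar // -herm_eps.
by rewrite -(cyc_eps_star n_gt0) starM starK.
Qed.

Lemma herm_polar u v : herm u v = 0 -> B u v = 0.
Proof. by move=> h0; rewrite -{1}[u]act1 -herm_eps h0 mul0r /cyc_eps coef0. Qed.

Lemma herm_eq0 u v : (forall a, B (act u a) v = 0) -> herm u v = 0.
Proof. by move=> h; apply: herm_inj => a; rewrite h mul0r /cyc_eps coef0. Qed.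

Lemma herm_self v : cyc_star (herm v v) = herm v v.
Proof. by rewrite -hermC. Qed.

Lemma addaa a : a + a = 0.
Proof.
have pK : 2%N \in [pchar K] by rewrite pchar_qpoly.
by rewrite -mulr2n -mulr_natr pcharf0 ?mulr0.
Qed.

Lemma oppa a : - a = a.
Proof. by apply/eqP; rewrite -subr_eq0 -opprD addaa oppr0. Qed.

(** Frobenius has finite order [e], so the root is the value of its [e.-1]-st iterate. Being a power
    of [r], the root inherits self-adjointness and support. *)
Lemma sqrt_self r : cyc_star r = r -> exists2 t, cyc_star t = t & t * t = r /\
  forall c, c * c = c -> r * c = r -> t * c = t.
Proof.
have [e e_gt0 eK] := cyc_frobenius char2 n_gt0 odd_x.
move=> rs; exists (r ^+ (2 ^ e.-1)); first by rewrite starX rs.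
split; first by rewrite -exprD addnn -mul2n -expnS prednK.
move=> c cc rc; have cX k : c ^+ k.+1 = c.
  by elim: k => [|k IH]; rewrite ?expr1 // exprS IH.
rewrite -{2}rc exprMn -(prednK (_ : 0 < 2 ^ e.-1)%N) ?expn_gt0 // cX //.
Qed.

(** The self-adjoint part of [c K] is a field with identity [c]. So [c K] is either a field or a
    pair of fields swapped by [cyc_star], and the two cases are treated together. *)
Definition prim c := [/\ c * c = c, cyc_star c = c & forall r, cyc_star r = r ->
  r * c = r -> r != 0 -> exists2 r', cyc_star r' = r' & r' * c = r' /\ r * r' = c].

Lemma prim_exists v : v != 0 -> exists2 c, prim c & act v c != 0.
Proof.
move=> nzv; have [e e_gt0 eK] := cyc_frobenius char2 n_gt0 odd_x.
pose N := (2 ^ e)%N; have N2 : (2 <= N)%N.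
  by rewrite -(expn1 2) leq_pexp2l.
pose good c := [&& c * c == c, cyc_star c == c & act v c != 0].
have good1 : good 1 by rewrite /good mulr1 star1 act1 nzv !eqxx.
pose sz c := #|[set a * c | a : K]|.
(* [c] is chosen with the smallest ideal, so any idempotent of the same kind below [c] equals
   [c]. *)
case: (arg_minnP sz good1) => c /and3P[/eqP cc /eqP cs vc] cmin.
exists c => //; split=> // r rs rc nzr.
have shrink d : good d -> d * c = d -> d = c.
  move=> gd dc; have sub : [set a * d | a : K] \subset [set a * c | a : K].
    apply/subsetP=> _ /imsetP[a _ ->]; apply/imsetP; exists (a * d) => //.
    by rewrite -mulrA dc.
  have : [set a * d | a : K] = [set a * c | a : K].
    by apply/eqP; rewrite eqEcard sub cmin.
  move/setP/(_ c); have -> : c \in [set a * c | a : K].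
    by apply/imsetP; exists 1; rewrite ?mul1r.
  case/imsetP=> a _ Ea; have /and3P[/eqP dd _ _] := gd.
  have cd : c * d = c by rewrite {1 2}Ea -mulrA dd.
  by rewrite -[RHS]cd mulrC.
have rN : r * r ^+ N.-1 = r by rewrite -exprS prednK ?(leq_trans _ N2) ?eK.
(* Since [a ^+ N = a] holds identically, this is the idempotent supporting [r]. By minimality either
   [d = c], and [r] is invertible, or [c - d = c], which would make [r] zero. *)
pose d := r ^+ N.-1.
have dE : d = r * r ^+ N.-2 by rewrite /d -exprS; congr (_ ^+ _); lia.
have dc : d * c = d by rewrite dE mulrAC rc.
have rd : r * d = r by [].
have dd : d * d = d by rewrite {1}dE mulrAC rd -dE.
have ds : cyc_star d = d by rewrite starX rs.
suff Edc : d = c.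
  exists (r ^+ N.-2 * c); first by rewrite starM starX rs cs.
  by rewrite -mulrA cc; split=> //; rewrite mulrA -dE dc.
have [vd0|nzvd] := eqVneq (act v d) 0; last by apply: shrink => //; rewrite /good dd ds nzvd !eqxx.
have : c - d = c.
  apply: shrink; last by rewrite mulrBl cc dc.
  rewrite /good oppa starD cs ds eqxx actDr vd0 addr0 vc andbT.
  rewrite ?andbT; apply/eqP; rewrite mulrDl !mulrDr cc dd dc (mulrC c) dc.
  by rewrite -addrA addaa addr0.
move/eqP; rewrite -subr_eq0 addrAC subrr add0r oppr_eq0 => /eqP d0.
by rewrite -rd d0 mulr0 eqxx in nzr.
Qed.

(** As [f] preserves the polar form, the defect [Q (f w) + Q w] is additive in [w], and it is
    [x]-invariant. On the sum of the [x]-orbit of [v], which is a fixed vector, it is [n] times the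
    defect of [v], and [n] is odd. So the quadratic form only has to be checked on fixed vectors. *)
Lemma orth_of_fixed (f : V -> V) (y : GL) : y \in O ->
  (forall u v, f (u + v) = f u + f v) -> (forall u v, B (f u) (f v) = B u v) ->
  (forall v, f (v *m GLval x) = f v *m GLval y) ->
  (forall v, v *m GLval x = v -> Q (f v) = Q v) -> forall v, Q (f v) = Q v.
Proof.
move=> Oy fD fB fx fQ v; pose q w := Q (f w) + Q w.
have qA u w : q (u + w) = q u + q w.
  rewrite /q fD !qD fB; set b := B u w.
  have -> : Q (f u) + Q (f w) + b + (Q u + Q w + b) = Q (f u) + Q u + (Q (f w) + Q w) + (b + b).
    by ring.
  by rewrite addff ?addr0.
have qx w : q (w *m GLval x) = q w.
  by rewrite /q fx (orthP _ _ Oy) (orthP _ _ Ox).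
have qk k : q (v *m GLval (x ^+ k)%g) = q v.
  by elim: k => [|k IH]; rewrite ?mulmxG1 // expgSr mulmxGM qx.
have f0 : f 0 = 0 by apply: (addrI (f 0)); rewrite -fD !addr0.
pose w := \sum_(k < n) v *m GLval (x ^+ k)%g.
have wx : w *m GLval x = w.
  rewrite /w mulmx_suml; under eq_bigr do rewrite -mulmxGM -expgSr.
  move: (prednK n_gt0) (expg_order x); case: n => // k _ xk.
  by rewrite big_ord_recr [RHS]big_ord_recl /= xk addrC.
have : q w = q v.
  rewrite /w; have q0' : q 0 = 0 by rewrite /q f0 q0 ?addr0.
  rewrite (big_morph q qA q0') (eq_bigr (fun=> q v)) => [|k _]; last exact: qk.
  rewrite sumr_const card_ord -(odd_double_half n) odd_x addnC -mul2n mulrnDr.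
  by rewrite mulrnA mulr2n addff // mul0rn add0r.
rewrite {1}/q fQ // addff // => /esym/eqP.
by rewrite /q addr_eq0 oppf // => /eqP.
Qed.

End OddElement.

(** * Changing the twist, and the case of a normal subgroup of exponent two *)

Section N2Tools.
Local Open Scope group_scope.
Local Open Scope ring_scope.
Variable gT : finGroupType.
Implicit Types G H N L P : {group gT}.

(** Every Sylow 2-subgroup contains [N], and multiplying the twist by an element of [P] does not
    affect [RR]. This serves to make the twist fix a vector that determines a complement of [N]. *)
Lemma N2prop_coset G N s h : (N <| G)%g -> (2.-group N)%g -> h \in N -> s \in 'N(G)%g ->
  N2prop G (h * s)%g -> N2prop G s.
Proof.
move=> nNG N2 Nh nGs n2; apply: N2prop_Sylow => // P chi SP tw Zchi re.
have Ph : h \in P by apply: subsetP (normal_sub_max_pgroup (Hall_max SP) N2 nNG) _ Nh.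
have Gh := subsetP (pHall_sub SP) _ Ph; have nPs := twistsN tw.
have nPhs : (h * s)%g \in 'N(P)%g by rewrite groupM // (subsetP (normG P)).
have -> : s = (h^-1 * (h * s))%g by rewrite mulKg.
apply: RR_coset; rewrite ?groupV //.
apply: n2 => //; [exact: pHall_sub SP | exact: pHall_pgroup SP | exact: twists_coset |].
case: re => [Ps|r2]; first by left; rewrite groupM.
right=> g Gg g2; rewrite conjgM r2 ?groupJ // ?cfunJ //.
by rewrite p_eltJ.
Qed.

Lemma Clifford_N2prop G N L s : (N ><| L = G)%g -> {in N, forall n, (n ^+ 2)%g = 1%g} ->
    s \in 'N(N)%g -> s \in 'N(L)%g -> (s \in G -> s \in L) ->
    ((s ^+ 2)%g \in G -> (s ^+ 2)%g \in L) ->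
    (forall (i : Iirr N) s', s' \in (L :* s)%g -> ('chi_i ^ s')%CF = 'chi_i ->
       N2prop 'I_L['chi_i]%G s') ->
  N2prop G s.
Proof.
move=> defG N2 nNs nLs sGL s2GL rec.
have pN : (2.-group N)%g.
  by apply/pgroupP=> p pr /(Cauchy pr)[n Nn on]; have := order_dvdn n 2; rewrite N2 // eqxx on dvdn_prime2.
apply: N2prop_Sylow (sdprod_norm defG nNs nLs) _ => P chi SP tw Zchi re.
have Ls2 : (s ^+ 2)%g \in L by apply/s2GL/(subsetP (pHall_sub SP))/twists2.
apply: (Clifford_RR (N0 := 1%G) defG pN nNs nLs Ls2 sGL) => //.
- exact: sub1G.
- by move=> n Nn; rewrite N2 ?inE.
- by move=> i _; apply: sub1G.
by move=> i s' _; apply: rec.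
Qed.

End N2Tools.

(** * Vector stabilizers and vectors fixed by 2-groups *)

Section VectorTools.
Variables (F : finFieldType) (m : nat).
Local Notation V := 'rV[F]_m.-1.+1.
Local Notation GL := {'GL_m[F]}.
Hypothesis char2 : 2%N \in [pchar F].
Implicit Types (u v w : V) (g h : GL) (A U : {set V}) (D P G N : {group GL}).

Definition vstab_set v := [set g : GL | v *m GLval g == v].

Lemma vstab_group_set v : group_set (vstab_set v).
Proof.
apply/group_setP; split=> [|g h]; first by rewrite inE mulmxG1.
by rewrite !inE mulmxGM => /eqP-> /eqP->.
Qed.
Canonical vstab v := Group (vstab_group_set v).

Lemma vstabP v g : reflect (v *m GLval g = v) (g \in vstab v).
Proof. by rewrite inE; apply: eqP. Qed.

Lemma vstabJ v g : (vstab v :^ g = vstab (v *m GLval g))%g.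
Proof.
apply/setP=> h; rewrite mem_conjg !inE conjgE invgK !mulmxGM.
apply/eqP/eqP=> [E|->]; last by rewrite mulmxGK.
by rewrite -[LHS](mulmxGKV _ g) E.
Qed.

Lemma vstab_norm v g : v *m GLval g = v -> g \in 'N(vstab v)%g.
Proof. by move=> vg; apply/normP; rewrite vstabJ vg. Qed.

Lemma regular_sdprod N G v : N \subset G -> G \subset 'N(N)%g ->
    (forall g, g \in G -> exists2 n, n \in N & v *m GLval n = v *m GLval g) ->
    (forall n, n \in N -> v *m GLval n = v -> n = 1%g) ->
  (N ><| (G :&: vstab v) = G)%g.
Proof.
move=> sNG nNG tr reg; rewrite sdprodE.
- apply/eqP; rewrite eqEsubset mul_subG ?subsetIl //=; apply/subsetP=> g Gg.
  have [n Nn En] := tr _ (groupVr Gg).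
  apply/mulsgP; exists (n^-1)%g (n * g)%g; rewrite ?groupV ?mulKg //.
  apply/setIP; split; first exact: groupM (subsetP sNG _ Nn) Gg.
  by apply/vstabP; rewrite mulmxGM En mulmxGKV.
- by rewrite subIset // nNG.
apply/trivgP/subsetP=> n /setIP[Nn /setIP[_ /vstabP vn]].
by rewrite inE; apply/eqP/reg.
Qed.

Definition addset U := 0 \in U /\ {in U &, forall u v, u + v \in U}.
Definition vstable U g := {in U, forall v, v *m GLval g \in U}.

(** Modulo [A], [h] acts with square 1 on the vectors fixed by [D]; in characteristic 2 either [v]
    is fixed by [h], or [v h + v] is a non-zero fixed vector. *)
Lemma fix_step A U D h v : addset A -> addset U -> vstable A h -> vstable U h ->
    h \in 'N(D)%g -> (h ^+ 2)%g \in D -> v \in U -> v \notin A ->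
    {in D, forall g, v *m GLval g + v \in A} ->
  exists w, [/\ w \in U, w \notin A, {in D, forall g, w *m GLval g + w \in A}
    & w *m GLval h + w \in A].
Proof.
move=> [_ AD] [_ UD] Ah Uh nDh D2 Uv nAv fv.
have [Ad|nAd] := boolP (v *m GLval h + v \in A); first by exists v.
exists (v *m GLval h + v); split=> //.
- by apply: UD => //; apply: Uh.
- move=> g Dg; have Dg' : (g ^ h^-1)%g \in D by rewrite memJ_norm ?groupV.
  have -> : (v *m GLval h + v) *m GLval g + (v *m GLval h + v) =
    (v *m GLval (g ^ h^-1)%g + v) *m GLval h + (v *m GLval g + v).
    have E : (g ^ h^-1 * h = h * g)%g by rewrite conjgE invgK !mulgA mulgKV.
    rewrite !mulmxDl -!mulmxGM E.
    by rewrite -!addrA; congr (_ + _); rewrite addrCA.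
  by apply: AD; [apply: Ah; apply: fv | apply: fv].
have -> : (v *m GLval h + v) *m GLval h + (v *m GLval h + v) = v *m GLval (h ^+ 2)%g + v.
  rewrite mulmxDl -mulmxGM -[(h * h)%g]/(h ^+ 2)%g addrA -(addrA (_ *m GLval (h ^+ 2)%g)).
  by rewrite addvv ?addr0.
exact: fv.
Qed.

(** Induction along a maximal subgroup of index 2, with [fix_step] for an element outside it. That
    element and the maximal subgroup together generate [P]. *)
Lemma fix_coset A U P : (2.-group P)%g -> addset A -> addset U ->
    {in P, forall g, vstable A g} -> {in P, forall g, vstable U g} ->
    (exists2 v, v \in U & v \notin A) ->
  exists v, [/\ v \in U, v \notin A & {in P, forall g, v *m GLval g + v \in A}].
Proof.
move=> P2 aA aU; have [k] := ubnP #|P|; elim: k P P2 => // k IH P P2 cP PA PU [v0 Uv0 nv0].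
have [A0 AD] := aA.
have [P1|ntP] := eqVneq P 1%G.
  by exists v0; split=> // g; rewrite P1 => /set1P->; rewrite mulmxG1 addvv.
have [M maxM _] : {M : {group GL} | maximal M P & 1%G \subset M}.
  by apply: maxgroup_exists; rewrite proper1G.
have nMP := p_maximal_normal P2 maxM; have iMP := p_maximal_index P2 maxM.
have sMP := normal_sub nMP.
have [|||||v [Uv nv fv]] := IH M; last 1 first.
- have [h Ph nMh] : exists2 h, h \in P & h \notin M.
    by apply/subsetPn; apply: proper_subn; apply: maxgroupp maxM.
  have h2 : (h ^+ 2)%g \in M.
    have nMh' : h \in 'N(M)%g by apply: subsetP (normal_norm nMP) _ Ph.
    apply: coset_idr; first exact: groupX.
    rewrite morphX // -iMP -card_quotient ?normal_norm //.
    by rewrite expg_cardG // mem_quotient.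
  have [w [Uw nw fw fh]] := fix_step aA aU (PA _ Ph) (PU _ Ph) (subsetP (normal_norm nMP) _ Ph) h2 Uv nv fv.
  exists w; split=> //.
  pose S := [set g in P | w *m GLval g + w \in A].
  have gS : group_set S.
    apply/group_setP; split=> [|g g']; first by rewrite inE group1 mulmxG1 addvv.
    rewrite !inE => /andP[Pg Ag] /andP[Pg' Ag']; rewrite groupM //=.
    have -> : w *m GLval (g * g')%g + w = (w *m GLval g + w) *m GLval g' + (w *m GLval g' + w).
      by rewrite mulmxDl -mulmxGM [RHS]addrA -[X in _ = X + w]addrA addvv // addr0.
    by apply: AD => //; apply: PA.
  have sSP : S \subset P by apply/subsetP=> g; rewrite inE => /andP[].
  have [_ maxS] := maxgroupP maxM.
  case: (eqVproper sSP) => [E g Pg|pS].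
    by move/setP: E => /(_ g); rewrite inE Pg.
  have sMS : M \subset S by apply/subsetP=> g Mg; rewrite inE (subsetP sMP) ?fw.
  have /setP/(_ h) := maxS (Group gS) pS sMS.
  by rewrite /= inE Ph fh (negPf nMh).
- exact: pgroupS sMP P2.
- apply: leq_trans (proper_card (maxgroupp maxM)) _; by rewrite -ltnS.
- by move=> g Mg; apply: PA; apply: (subsetP sMP).
- by move=> g Mg; apply: PU; apply: (subsetP sMP).
by exists v0.
Qed.

Lemma fix_coset_twists A U P s : (2.-group P)%g -> twists s P -> addset A -> addset U ->
    {in P, forall g, vstable A g} -> {in P, forall g, vstable U g} ->
    vstable A s -> vstable U s -> (exists2 v, v \in U & v \notin A) ->
  exists v, [/\ v \in U, v \notin A, {in P, forall g, v *m GLval g + v \in A}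
    & v *m GLval s + v \in A].
Proof.
move=> P2 tw aA aU PA PU As Us ex; have [v [Uv nv fv]] := fix_coset P2 aA aU PA PU ex.
exact: fix_step aA aU As Us (twistsN tw) (twists2 tw) Uv nv fv.
Qed.

End VectorTools.

(** * Additive characters and duality in characteristic two *)

Section AdditiveCharacter.
Variable F : finFieldType.
Hypothesis char2 : 2%N \in [pchar F].

(** A maximal additive subgroup [M] avoiding 1 has index 2, because for [a] outside [M] the larger
    subgroup [M + {0, a}] contains 1. The character is the sign with kernel [M]. *)
Lemma additive_char_exists : exists psi : F -> algC,
  [/\ psi 0 = 1, forall a b, psi (a + b) = psi a * psi b, forall a, psi a ^+ 2 = 1
    & exists a, psi a != 1].
Proof.
pose add (M : {set F}) := (0 \in M) && [forall a in M, forall b in M, a + b \in M].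
have ex : add [set 0] && (1 \notin [set (0 : F)]).
  rewrite /add !inE eqxx oner_eq0 andbT /=; apply/forall_inP=> a /set1P->.
  by apply/forall_inP=> b /set1P->; rewrite addr0 inE.
have [M /maxsetP[/andP[/andP[M0 Ma] nM1] Mmax] _] :=
  @maxset_exists _ (fun M => add M && (1 \notin M)) _ ex.
have MD a b : a \in M -> b \in M -> a + b \in M.
  by move=> Ha Hb; have /forall_inP/(_ a Ha)/forall_inP/(_ b Hb) := Ma.
have key a : a \notin M -> a + 1 \in M.
  move=> nMa; pose M' := M :|: [set a + b | b in M].
  have aM' : a \in M' by rewrite !inE; apply/orP; right; apply/imsetP; exists 0; rewrite ?addr0.
  have addM' : add M'.
    rewrite /add !inE M0 /=; apply/forall_inP=> b; rewrite !inE => Hb.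
    apply/forall_inP=> c; rewrite !inE => Hc.
    case/orP: Hb => [Mb|/imsetP[b' Mb' ->]]; case/orP: Hc => [Mc|/imsetP[c' Mc' ->]].
    - by rewrite MD.
    - by apply/orP; right; apply/imsetP; exists (b + c'); rewrite ?MD // addrCA.
    - by apply/orP; right; apply/imsetP; exists (b' + c); rewrite ?MD // addrA.
    by rewrite addrACA addff // add0r MD.
  have : 1 \in M'.
    apply: contraNT nMa => n1; rewrite -(Mmax M') ?addM' ?n1 //.
    exact: subsetUl.
  rewrite !inE (negPf nM1) /= => /imsetP[b Mb E1].
  by rewrite E1 addrA addff // add0r.
exists (fun a => (-1) ^+ (a \notin M)); split.
- by rewrite M0.
- move=> a b; have Mab c d : c \in M -> c + d \in M -> d \in M.
    by move=> Mc Mcd; have := MD _ _ Mc Mcd; rewrite addrA addff // add0r.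
  have [Ma'|nMa] := boolP (a \in M); have [Mb|nMb] := boolP (b \in M).
  + by rewrite MD //= mulr1.
  + by rewrite (contra (Mab _ _ Ma') nMb) /= mul1r.
  + by rewrite addrC (contra (Mab _ _ Mb) nMa) /= mulr1.
  have -> : a + b = (a + 1) + (b + 1) by rewrite addrACA addff // addr0.
  by rewrite MD ?key //= expr1 mulrNN mulr1.
- by move=> a; rewrite sqrr_sign.
by exists 1; rewrite nM1 /= expr1 -subr_eq0 -opprD oppr_eq0 -mulr2n pnatr_eq0.
Qed.

End AdditiveCharacter.

Section Duality.
Variables (F : finFieldType) (m : nat).
Local Notation V := 'rV[F]_m.-1.+1.
Variable Q : V -> F.
Hypotheses (char2 : 2%N \in [pchar F]) (qQ : is_quadratic_form Q).
Local Notation B := (polar Q).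
Implicit Types (u v w : V) (U Y T : {set V}).
Variable psi : F -> algC.
Hypotheses (psi0 : psi 0 = 1) (psiD : forall a b, psi (a + b) = psi a * psi b).
Hypotheses (psi2 : forall a, psi a ^+ 2 = 1) (psi_nt : exists a, psi a != 1).

Lemma psi_polar1 U y : subsp U -> {in U, forall u, psi (B u y) = 1} ->
  {in U, forall u, B u y = 0}.
Proof.
move=> [_ _ UZ] h u Uu; apply/eqP; apply/negPn/negP => nz; have [a /negP[]] := psi_nt.
by have := h _ (UZ (a / B u y) u Uu); rewrite (polarZl qQ) mulfVK // => ->.
Qed.

Lemma sum_shift (R : nmodType) U u0 (f : V -> R) : addset U -> u0 \in U ->
  \sum_(u in U) f (u + u0) = \sum_(u in U) f u.
Proof.
move=> [_ UD] Uu0; rewrite [RHS](reindex_inj (addIr u0)); apply: eq_bigl => u.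
apply/idP/idP=> Hu; first exact: UD.
by have := UD _ _ Hu Uu0; rewrite -addrA addvv ?addr0.
Qed.

Lemma psi_sum U y : subsp U ->
  \sum_(u in U) psi (B u y) = if [forall u in U, B u y == 0] then #|U|%:R else 0.
Proof.
move=> sU; have [U0 UD UZ] := sU; case: ifP => [/forall_inP h|/negbT].
  rewrite (eq_bigr (fun=> 1)) ?sumr_const // => u Uu.
  by rewrite (eqP (h u Uu)).
rewrite negb_forall_in => /exists_inP[u0 Uu0 nz]; have [a na] := psi_nt.
pose u1 := (a / B u0 y) *: u0; have Uu1 : u1 \in U by apply: UZ.
have Eu1 : B u1 y = a by rewrite (polarZl qQ) mulfVK.
have /eqP : \sum_(u in U) psi (B u y) * psi a = \sum_(u in U) psi (B u y).
  rewrite -[RHS](sum_shift _ (conj U0 UD) Uu1); apply: eq_bigr => u _.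
  by rewrite (polarDl qQ) (psiD (B u y)) Eu1.
rewrite -mulr_suml -subr_eq0 -[X in _ - X]mulr1 -mulrBr mulf_eq0 subr_eq0 (negPf na) orbF.
by move/eqP.
Qed.

(** The Fourier coefficients [T y] add up to [#|Y|], so one of them is non-zero. Translating the sum
    that defines it shows that [mu] times [psi (B u y)] is 1, and the values of [psi] are their own
    inverses. *)
Lemma dual_char U Y (mu : V -> algC) : subsp U -> subsp Y ->
    {in U, forall u, {in Y, forall y, B u y = 0} -> u = 0} ->
    mu 0 = 1 -> {in U &, forall u v, mu (u + v) = mu u * mu v} ->
  exists2 y, y \in Y & {in U, forall u, mu u = psi (B u y)}.
Proof.
move=> [U0 UD UZ] sY nd mu0 muD.
pose T y := \sum_(u in U) mu u * psi (B u y).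
have sumT : \sum_(y in Y) T y = #|Y|%:R.
  rewrite /T exchange_big /= (bigD1 (0 : V)) //= [X in _ + X]big1 ?addr0.
    rewrite (eq_bigr (fun=> 1)) ?sumr_const // => y _.
    by rewrite mu0 (polar0l qQ) psi0 mulr1.
  move=> u /andP[Uu nzu].
  rewrite -mulr_sumr; under eq_bigr do rewrite polarC.
  rewrite psi_sum // ifN ?mulr0 //; apply: contra nzu => /forall_inP h.
  by apply/eqP/nd => // y Yy; rewrite polarC; apply/eqP/h.
have /existsP[y /andP[Yy nz]] : [exists y, (y \in Y) && (T y != 0)].
  apply: contraTT isT => /existsPn h; have : #|Y|%:R != 0 :> algC.
    by rewrite pnatr_eq0 -lt0n; apply/card_gt0P; exists 0; case: sY.
  rewrite -sumT big1 ?eqxx // => y Yy; apply/eqP; move: (h y).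
  by rewrite Yy negbK.
exists y => // u0 Uu0; have /eqP : T y * (mu u0 * psi (B u0 y)) = T y.
  rewrite /T mulr_suml -[RHS](sum_shift _ (conj U0 UD) Uu0); apply: eq_bigr => u Uu.
  by rewrite muD // (polarDl qQ) (psiD (B u y)) mulrACA.
rewrite -subr_eq0 -[X in _ - X]mulr1 -mulrBr mulf_eq0 (negPf nz) subr_eq0 => /eqP E.
by rewrite -[LHS]mulr1 -(psi2 (B u0 y)) expr2 mulrA E mul1r.
Qed.

Lemma perp_card T U : subsp T -> subsp U ->
    {in T, forall t, {in U, forall u, B u t = 0} -> t = 0} ->
  (#|T| * #|[set u in U | [forall t in T, B u t == 0%R]]| = #|U|)%N.
Proof.
move=> sT sU nd; have [T0 _ _] := sT; apply/eqP; rewrite -eqC_nat natrM; apply/eqP.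
pose S := \sum_(u in U) \sum_(t in T) psi (B u t).
transitivity S.
  rewrite /S (eq_bigr (fun u => if [forall t in T, B u t == 0] then #|T|%:R else 0)).
    rewrite -big_mkcondr sumr_const -[RHS]mulr_natr; congr (_ * _).
    by congr (_%:R); apply: eq_card => u; rewrite !inE.
  move=> u _; under eq_bigr do rewrite polarC.
  by rewrite psi_sum //; congr (if _ then _ else _); apply: eq_forallb => t; rewrite polarC.
rewrite /S exchange_big /= (bigD1 (0 : V)) //= [X in _ + X]big1 ?addr0.
  rewrite (eq_bigr (fun=> 1)) ?sumr_const // => u _.
  by rewrite polarC (polar0l qQ) psi0.
move=> t /andP[Tt nzt].
rewrite psi_sum // ifN //; apply: contra nzt => /forall_inP h.
by apply/eqP/nd => // u Uu; apply/eqP/h.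
Qed.

End Duality.

(** * Vector stabilizers in the centralizer *)

Section Classes.
Variables (F : finFieldType) (m : nat).
Local Notation V := 'rV[F]_m.-1.+1.
Local Notation GL := {'GL_m[F]}.
Variable Q : V -> F.
Hypotheses (char2 : 2%N \in [pchar F]) (qQ : is_quadratic_form Q) (ndQ : qnondegenerate Q).
Local Notation B := (polar Q).
Local Notation O := (qorth_group Q).
Variable x : GL.
Hypotheses (Ox : x \in O) (odd_x : odd #[x]%g).
Local Notation n := #[x]%g.
Local Notation xi := (cyc_gen F n).
Local Notation act := (@act F m x).
Local Notation herm := (@herm F m Q x).
Local Notation perp := (@perp F m Q).
Local Notation nondeg := (@nondeg F m Q).
Implicit Types (u v w e f : V) (g h s : GL) (W M U : {set V}).
Let addvv := @addvv F m char2.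
Let oppv := @oppv F m char2.
Let addff := @addff F char2.
Let BDl := @polarDl F m Q qQ.
Let BDr := @polarDr F m Q qQ.
Let BZl := @polarZl F m Q qQ.
Let BZr := @polarZr F m Q qQ.
Let B0l := @polar0l F m Q qQ.
Let Bvv := @polarvv F m Q char2 qQ.
Let perpPx := @perpP F m Q.

Lemma sqrtF (a : F) : exists b, b ^+ 2 = a.
Proof.
have inj : injective (fun b : F => b ^+ 2).
  move=> b c /= E; apply/eqP; rewrite -subr_eq0 -sqrf_eq0 oppf //.
  by rewrite sqrrD E -mulr_natl pcharf0 // mul0r addr0 addff.
by exists (invF inj a); rewrite (f_invF inj).
Qed.

Lemma vstableX U g k : vstable U g -> vstable U (g ^+ k)%g.
Proof.
move=> Ug; elim: k => [|k IH] v Uv; first by rewrite mulmxG1.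
by rewrite expgSr mulmxGM Ug ?IH.
Qed.

Lemma vstableV U g : vstable U g -> vstable U (g^-1)%g.
Proof. by move=> Ug; rewrite invg_expg; apply: vstableX. Qed.

Lemma vstableM U g h : vstable U g -> vstable U h -> vstable U (g * h)%g.
Proof. by move=> Ug Uh v Uv; rewrite mulmxGM Uh ?Ug. Qed.

Lemma perp_stable U g : g \in O -> vstable U g -> vstable (perp U) g.
Proof.
move=> Og Ug v /perpPx pv; apply/perpPx=> u Uu.
by rewrite orth_polarV // pv // vstableV.
Qed.

Lemma perpC U u v : u \in U -> v \in perp U -> B u v = 0.
Proof. by move=> Uu /perpPx pv; rewrite polarC pv. Qed.

(** The isometry group of [W] with its action of [x], realised in the ambient group by trivial
    action on [perp W]. Passing to smaller spaces then stays among subgroups of a single group. *)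
Definition GO_set W := [set g in O | (g * x == x * g)%g && [forall v in perp W, v *m GLval g == v]].

Lemma GO_setP W g : reflect [/\ g \in O, commute g x & {in perp W, forall v, v *m GLval g = v}]
  (g \in GO_set W).
Proof.
apply: (iffP setIdP) => [[Og /andP[/eqP c /forall_inP h]]|[Og c h]]; split=> //.
  by move=> v pv; apply/eqP/h.
by apply/andP; split; [exact/eqP | apply/forall_inP=> v pv; apply/eqP/h].
Qed.

Lemma GO_group_set W : group_set (GO_set W).
Proof.
apply/group_setP; split=> [|g h /GO_setP[Og cg fg] /GO_setP[Oh ch fh]]; apply/GO_setP.
  by split=> [||v _]; [exact: group1 | exact: commute_sym (commute1 x) | exact: mulmxG1].
split=> [||v pv]; first exact: groupM.
  by apply/commute_sym/commuteM; apply: commute_sym.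
by rewrite mulmxGM fg // fh.
Qed.
Canonical GO W := Group (GO_group_set W).

Lemma GOP W g : reflect [/\ g \in O, commute g x & {in perp W, forall v, v *m GLval g = v}]
  (g \in GO W).
Proof. exact: GO_setP. Qed.

Definition goodW W := [/\ subsp W, nondeg W & vstable W x].
(** The twists allowed on [GO W]. They may act on [perp W] in any way, so the same [s] stays
    admissible on smaller subspaces that it preserves. *)
Definition adm W s := [/\ s \in O, (x ^ s = x^-1)%g & vstable W s].

Lemma GO_stable W g : nondeg W -> g \in GO W -> vstable W g.
Proof.
move=> nW /GOP[Og _ fg] w Ww; apply: (perpK char2 qQ ndQ nW) => u pu.
by rewrite -{1}(fg u pu) orth_polar // (perpC Ww).
Qed.

Lemma adm_norm W s : adm W s -> s \in 'N(GO W)%g.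
Proof.
case=> Os xs Ws; apply/normP/eqP; rewrite eqEcard cardJg leqnn andbT.
apply/subsetP=> _ /imsetP[g /GOP[Og cg fg] ->]; apply/GOP; split.
- by rewrite groupJ.
- apply: commute_sym; rewrite -[x]invgK -xs; apply: commute_sym; apply/commuteV.
  rewrite /commute -!conjMg; congr (_ ^ _)%g; exact: cg.
move=> v pv; rewrite conjgE !mulmxGM fg ?mulmxGKV //.
by apply: perp_stable => //; [rewrite groupV | apply: vstableV].
Qed.

Lemma adm_coset W y s : nondeg W -> y \in GO W -> adm W s -> adm W (y * s)%g.
Proof.
move=> nW Gy [Os xs Ws]; have /GOP[Oy cy _] := Gy; split; first exact: groupM.
  have -> : (x ^ (y * s) = x ^ s)%g; last by [].
  by rewrite conjgM; congr (_ ^ _)%g; apply/conjg_fixP/commgP/commute_sym.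
by apply: vstableM => //; apply: GO_stable.
Qed.

Lemma splitM_good W M : goodW W -> subsp M -> nondeg M -> M \subset W -> vstable M x ->
  goodW (W :&: perp M).
Proof.
move=> [[W0 WD WZ] nW Wx] [M0 MD MZ] nM sMW Mx.
have [p0 pD pZ] := subsp_perp qQ M.
split.
- split=> [|u v|a v]; rewrite !in_setI; first by rewrite W0 p0.
    by move=> /andP[Wu pu] /andP[Wv pv]; rewrite WD ?pD.
  by move=> /andP[Wv pv]; rewrite WZ ?pZ.
- move=> v; have [w Ww pvw] := nW v; have [u Mu pwu] := nM w.
  exists (w + u); first by rewrite in_setI WD // (subsetP sMW).
  rewrite addrA; apply/perpPx=> t /setIP[Wt pt]; rewrite BDl (perpPx _ _ pvw) // add0r.
  by rewrite (perpC Mu pt).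
by move=> v /setIP[Wv pv]; rewrite in_setI Wx // perp_stable.
Qed.

Lemma splitM_GO W M g : goodW W -> subsp M -> nondeg M -> M \subset W -> vstable M x ->
  g \in GO (W :&: perp M) <-> g \in GO W /\ {in M, forall v, v *m GLval g = v}.
Proof.
move=> gW sM nM sMW Mx; have gW' := splitM_good gW sM nM sMW Mx.
have [[W0 WD WZ] nW Wx] := gW; have [_ nW' _] := gW'.
split=> [/GOP[Og cg fg]|[/GOP[Og cg fg] fM]].
  split; first apply/GOP; first split=> //.
    by move=> v /perpPx pv; apply: fg; apply/perpPx=> u /setIP[Wu _]; apply: pv.
  by move=> v Mv; apply: fg; apply/perpPx=> u /setIP[_ pu]; rewrite (perpC Mv pu).
apply/GOP; split=> // u pu; have [w Ww puw] := nW u; have [t Mt pwt] := nM w.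
have W'wt : w + t \in W :&: perp M by rewrite in_setI WD // (subsetP sMW).
have : w + t = 0.
  apply: (perp_cap char2 qQ ndQ nW' W'wt).
  have -> : w + t = u + (u + w) + t by rewrite addrA addvv add0r.
  apply/perpPx=> z W'z; have /setIP[Wz pz] := W'z.
  by rewrite BDl [B (u + (u + w)) z]BDl (perpPx _ _ pu) // (perpPx _ _ puw) // (perpC Mt pz) !addr0.
move/eqP; rewrite addr_eq0 oppv => /eqP wt.
have -> : u = (u + w) + t by rewrite wt -addrA addvv addr0.
by rewrite mulmxDl fg // fM.
Qed.

Lemma splitM_card W M v : M \subset W -> nondeg M -> v \in M -> v != 0 ->
  (#|W :&: perp M| < #|W|)%N.
Proof.
move=> sMW nM Mv nzv; apply: proper_card; apply/properP; split; first exact: subsetIl.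
exists v; first exact: (subsetP sMW).
rewrite in_setI negb_and; apply/orP; right; apply: contra nzv => pv.
by apply/eqP/(perp_cap char2 qQ ndQ nM Mv).
Qed.

Lemma adm_split W M s : adm W s -> vstable M s -> adm (W :&: perp M) s.
Proof.
case=> Os xs Ws Ms; split=> // v /setIP[Wv pv].
by rewrite in_setI Ws //= perp_stable.
Qed.

(** The stabilizer of [w] and of the coset [v + F w]. It occurs as an inertia group: on vectors
    orthogonal to [w], the character [u |-> psi (B u v)] determines [v] only modulo [w]. *)
Definition lstab_set w v := [set g : GL | (w *m GLval g == w) && [exists a : F, v *m GLval g == v + a *: w]].

Lemma lstab_setP w v g : reflect (w *m GLval g = w /\ exists a : F, v *m GLval g = v + a *: w)
  (g \in lstab_set w v).
Proof.
by rewrite inE; apply: (iffP andP) => [[/eqP h /existsP[a /eqP E]]|[h [a E]]]; split=> //;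
  [exists a | apply/eqP | apply/existsP; exists a; apply/eqP].
Qed.

Lemma lstab_group_set w v : group_set (lstab_set w v).
Proof.
apply/group_setP; split=> [|g h /lstab_setP[wg [a ag]] /lstab_setP[wh [b bh]]]; apply/lstab_setP.
  by rewrite !mulmxG1; split=> //; exists 0; rewrite scale0r addr0.
rewrite !mulmxGM wg wh; split=> //; exists (a + b).
by rewrite ag mulmxDl bh -scalemxAl wh -addrA scalerDl [b *: w + _]addrC.
Qed.
Canonical lstab w v := Group (lstab_group_set w v).

Lemma lstabP w v g : reflect (w *m GLval g = w /\ exists a : F, v *m GLval g = v + a *: w)
  (g \in lstab w v).
Proof. exact: lstab_setP. Qed.

Lemma norm_setI (A D : {set GL}) s : s \in 'N(A)%g -> s \in 'N(D)%g -> s \in 'N(A :&: D)%g.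
Proof. by move=> nA nD; apply/normP; rewrite conjIg (normP nA) (normP nD). Qed.

Lemma N2_eq (G H : {group GL}) s : G :=: H -> N2prop G s -> N2prop H s.
Proof. by move/group_inj->. Qed.

Definition xfix v := v *m GLval x = v.
Definition anis w := w = 0 \/ Q w != 0.

(** [classM] and [class3] are carried by the induction on [#|W|], as the inertia groups lead back to
    them. [class1], [class2] and [class4] are the cases into which [classM] splits; [class1] with
    [w = 0] concerns the whole of [GO W]. *)
Definition classM W := forall w y s, w \in W -> y \in W -> xfix w -> xfix y -> anis w ->
  adm W s -> s \in lstab w y -> N2prop (GO W :&: lstab w y)%G s.
Definition class1 W := forall w s, w \in W -> xfix w -> anis w -> adm W s ->
  w *m GLval s = w -> N2prop (GO W :&: vstab w)%G s.
Definition class2 W := forall w e s, w \in W -> e \in W -> xfix w -> xfix e -> anis w ->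
  e != 0 -> Q e = 0 -> B w e = 0 -> adm W s -> w *m GLval s = w -> e *m GLval s = e ->
  N2prop (GO W :&: vstab w :&: vstab e)%G s.
Definition class3 W := forall c e s, prim c -> xi * c != c -> e \in W -> act e c = e ->
  e != 0 -> herm e e = 0 -> adm W s -> e *m GLval s = e -> N2prop (GO W :&: vstab e)%G s.
Definition class4 W := forall w v s, w \in W -> v \in W -> xfix w -> xfix v -> Q w != 0 ->
  B v w != 0 -> adm W s -> s \in lstab w v -> N2prop (GO W :&: lstab w v)%G s.

Lemma lstab0 y : lstab 0 y :=: vstab y.
Proof.
apply/setP=> g; apply/lstabP/vstabP=> [[_ [a ->]]|E]; first by rewrite scaler0 addr0.
by rewrite mul0mx; split=> //; exists 0; rewrite scaler0 addr0.
Qed.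

Lemma vstab0 : vstab (0 : V) :=: [set: GL].
Proof. by apply/setP=> g; rewrite !inE mul0mx eqxx. Qed.

Lemma classM_cases W : goodW W -> class1 W -> class2 W -> class4 W -> classM W.
Proof.
move=> [[W0 WD WZ] nW Wx] k1 k2 k4 w y s Ww Wy fw fy aw ad /lstabP[ws [a ya]].
have [w0|nzw] := eqVneq w 0.
  have ys : y *m GLval s = y by rewrite ya w0 scaler0 addr0.
  have E : (GO W :&: lstab w y = GO W :&: vstab y)%g by rewrite w0 lstab0.
  have [y0|nzy] := eqVneq (Q y) 0; last first.
    by apply: (@N2_eq (GO W :&: vstab y)%G) => //; apply: k1 => //; right.
  have [yz|nzy] := eqVneq y 0.
    by apply: (@N2_eq (GO W :&: vstab y)%G) => //; apply: k1 => //; left.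
  apply: (@N2_eq (GO W :&: vstab 0 :&: vstab y)%G); first by rewrite /= E vstab0 setIT.
  by apply: k2; rewrite /xfix ?mul0mx ?B0l //; left.
have Qw : Q w != 0 by case: aw => // w0; rewrite w0 eqxx in nzw.
have [Byw|Byw] := eqVneq (B y w) 0; last by apply: k4 => //; apply/lstabP; split=> //; exists a.
have [l El] := sqrtF (Q y / Q w).
(* When [B y w = 0], the coset [y + F w] contains exactly one singular vector, so every isometry
   preserving the coset and [w] fixes it. *)
pose e := y + l *: w.
have Qe : Q e = 0.
  by rewrite /e qD qZ // El mulfVK // BZr Byw mulr0 addr0 addff.
have Bew : B e w = 0 by rewrite /e BDl Byw BZl Bvv mulr0 addr0.
have efix g b : g \in O -> w *m GLval g = w -> y *m GLval g = y + b *: w -> e *m GLval g = e.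
  move=> Og wg yg; have Eg : e *m GLval g = e + b *: w.
    by rewrite /e mulmxDl -scalemxAl wg yg addrAC.
  have := orthP _ _ Og e; rewrite Eg qD qZ // Qe add0r BZr Bew mulr0 addr0 => /eqP.
  by rewrite mulf_eq0 (negPf Qw) orbF expf_eq0 /= => /eqP->; rewrite scale0r addr0.
have E : (GO W :&: lstab w y = GO W :&: vstab w :&: vstab e)%g.
  apply/setP=> g; apply/setIP/setIP=> [[Gg /lstabP[wg [b yg]]]|[/setIP[Gg /vstabP wg] /vstabP eg]].
    have /GOP[Og _ _] := Gg; split; first by apply/setIP; split=> //; apply/vstabP.
    by apply/vstabP; apply: efix yg.
  split=> //; apply/lstabP; split=> //; exists 0; rewrite scale0r addr0.
  have -> : y = e + l *: w by rewrite /e -addrA addvv addr0.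
  by rewrite mulmxDl eg -scalemxAl wg.
have We : e \in W by rewrite WD ?WZ.
have fe : xfix e by rewrite /xfix mulmxDl fy -scalemxAl fw.
have es : e *m GLval s = e by case: (ad) => Os _ _; apply: efix ya.
have [e0|nze] := eqVneq e 0.
  apply: (@N2_eq (GO W :&: vstab w)%G); first by rewrite /= E e0 vstab0 setIT.
  exact: k1.
by apply: (@N2_eq (GO W :&: vstab w :&: vstab e)%G) => //; apply: k2 => //; rewrite polarC.
Qed.

Lemma class1_GO W s : goodW W -> class1 W -> adm W s -> N2prop (GO W) s.
Proof.
move=> [[W0 _ _] _ _] k1 ad; apply: (@N2_eq (GO W :&: vstab 0)%G).
  by rewrite /= vstab0 setIT.
by apply: k1 => //; [rewrite /xfix mul0mx | left | rewrite mul0mx].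
Qed.

Definition hplane e f := [set v | [exists a : F, [exists b : F, v == a *: e + b *: f]]].

Lemma hplaneP e f v : reflect (exists a b : F, v = a *: e + b *: f) (v \in hplane e f).
Proof.
rewrite inE; apply: (iffP existsP) => [[a /existsP[b /eqP E]]|[a [b ->]]]; exists a.
  by exists b.
by apply/existsP; exists b.
Qed.

Lemma hplane_props e f : B e f != 0 -> xfix e -> xfix f ->
  [/\ subsp (hplane e f), nondeg (hplane e f) & vstable (hplane e f) x].
Proof.
move=> nB fe ff; split.
- split=> [|_ _ /hplaneP[a [b ->]] /hplaneP[a' [b' ->]]|c _ /hplaneP[a [b ->]]]; apply/hplaneP.
  + by exists 0, 0; rewrite !scale0r addr0.
  + by exists (a + a'), (b + b'); rewrite !scalerDl addrACA.
  by exists (c * a), (c * b); rewrite scalerDr !scalerA.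
- move=> v; pose u := (B v f / B e f) *: e + (B v e / B e f) *: f; exists u.
    by apply/hplaneP; exists (B v f / B e f), (B v e / B e f).
  apply/perpPx=> _ /hplaneP[a [b ->]]; rewrite BDr !BZr !BDl !BZl !Bvv (polarC Q f e).
  by rewrite !mulr0 !mulfVK // !addr0 add0r !addff !mulr0 addr0.
move=> _ /hplaneP[a [b ->]]; apply/hplaneP; exists a, b.
by rewrite mulmxDl -!scalemxAl fe ff.
Qed.

Lemma hplane_sub W e f : subsp W -> e \in W -> f \in W -> hplane e f \subset W.
Proof. by move=> [_ WD WZ] We Wf; apply/subsetP=> _ /hplaneP[a [b ->]]; rewrite WD ?WZ. Qed.

Lemma mem_hplanel e f : e \in hplane e f.
Proof. by apply/hplaneP; exists 1, 0; rewrite scale1r scale0r addr0. Qed.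

Lemma mem_hplaner e f : f \in hplane e f.
Proof. by apply/hplaneP; exists 0, 1; rewrite scale1r scale0r add0r. Qed.

Lemma hplane_fix e f g : e *m GLval g = e -> f *m GLval g = f ->
  {in hplane e f, forall v, v *m GLval g = v}.
Proof. by move=> eg fg _ /hplaneP[a [b ->]]; rewrite mulmxDl -!scalemxAl eg fg. Qed.

Definition smaller W := forall W', goodW W' -> (#|W'| < #|W|)%N -> classM W' /\ class3 W'.

Lemma classM1 W : goodW W -> classM W -> class1 W.
Proof.
move=> [[W0 _ _] _ _] kM w s Ww fw aw ad ws; apply: (@N2_eq (GO W :&: lstab w 0)%G).
  congr (_ :&: _); apply/setP=> g; apply/lstabP/vstabP=> [[//]|wg].
  by split=> //; exists 0; rewrite mul0mx scale0r addr0.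
apply: kM => //; first by rewrite /xfix mul0mx.
by apply/lstabP; split=> //; exists 0; rewrite mul0mx scale0r addr0.
Qed.

(** The only vectors of [v + F w] with the same value of [Q] as [v] are [v] and its image under the
    transvection [r] with centre [w]. As [r] commutes with every isometry fixing [w], the group is
    [<[r]>] times the pointwise stabilizer of the nondegenerate plane of [v] and [w], which is [GO]
    of a smaller space. *)
Lemma class4_step W : goodW W -> smaller W -> class4 W.
Proof.
move=> gW sm w v s Ww Wv fw fv Qw Bvw ad ls.
have [[W0 WD WZ] nW Wx] := gW.
pose t u := u + (B u w / Q w) *: w.
have [r Or rE] : exists2 r : GL, r \in O & forall u, u *m GLval r = t u.
  apply: (orth_of_fun qQ ndQ) => [u u'|a u|u].
  - by rewrite /t BDl mulrDl scalerDl addrACA.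
  - by rewrite /t BZl scalerDr -mulrA scalerA.
  rewrite /t qD qZ // BZr expr2 -(mulrA _ _ (Q w)) mulfVK // -addrA addff addr0 //.
have nzw : w != 0 by apply: contra Qw => /eqP->; rewrite q0.
have tw : t w = w by rewrite /t Bvv mul0r scale0r addr0.
have tt u : t (t u) = u.
  by rewrite {1}/t {2}/t BDl BZl Bvv mulr0 addr0 /t -addrA addvv addr0.
have r2 : (r ^+ 2 = 1)%g.
  by apply: GL_eqP => u; rewrite expgS expg1 mulmxGM !rE tt mulmxG1.
have rcomm g : g \in O -> w *m GLval g = w -> (r ^ g = r)%g.
  move=> Og wg; apply: GL_eqP => u; rewrite conjgE !mulmxGM !rE /t mulmxDl mulmxGKV.
  by rewrite -scalemxAl wg orth_polarV ?groupV // invgK wg.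
have Gr : r \in GO W :&: lstab w v.
  apply/setIP; split; last by apply/lstabP; rewrite !rE tw; split=> //; exists (B v w / Q w).
  apply/GOP; split=> // [|u pu]; last first.
    by rewrite rE /t polarC (perpC Ww pu) mul0r scale0r addr0.
  by apply/commute_sym/commgP/conjg_fixP; apply/conjg_fixP/commgP/commute_sym/commgP/conjg_fixP/rcomm.
have vcases g : g \in O -> g \in lstab w v -> v *m GLval g = v \/ v *m GLval g = t v.
  move=> Og /lstabP[wg [a Ea]]; have := orthP _ _ Og v.
  rewrite Ea qD qZ // BZr -addrA => /eqP; rewrite addrC -subr_eq0 addrK expr2.
  have -> : a * a * Q w + a * B v w = a * (a * Q w + B v w) by ring.
  rewrite mulf_eq0 => /orP[/eqP->|]; first by left; rewrite scale0r addr0.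
  rewrite addr_eq0 oppf // => /eqP E; right; rewrite /t -E mulfK //.
have tv : t v != v.
  by rewrite /t -subr_eq0 addrAC subrr add0r scaler_eq0 negb_or nzw mulf_neq0 ?invr_eq0.
pose G := (GO W :&: lstab w v)%G.
have NE g : g \in <[r]>%g -> g = 1%g \/ g = r.
  case/cycleP=> k ->; rewrite -(odd_double_half k) expgD -mul2n expgM r2 expg1n mulg1.
  by case: (odd k); rewrite ?expg1; [right | left].
have defG : (<[r]> ><| (G :&: vstab v) = G)%g.
  apply: (regular_sdprod (N := <[r]>%G)); first by rewrite cycle_subG.
  - apply/subsetP=> g /setIP[/GOP[Og _ _] /lstabP[wg _]];     by apply/(subsetP (cent_sub _)); rewrite cent_cycle; apply/cent1P/esym/commgP/conjg_fixP/rcomm.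
  - move=> g /setIP[/GOP[Og _ _] lg]; case: (vcases g Og lg) => ->.
      by exists 1%g; rewrite ?group1 ?mulmxG1.
    by exists r; rewrite ?cycle_id ?rE.
  by move=> g /NE[->//|->] E; case/eqP: tv; rewrite -rE.
have [sM nM Mx] := hplane_props Bvw fv fw.
have sMW := hplane_sub (And3 W0 WD WZ) Wv Ww.
have EL : GO (W :&: perp (hplane v w)) :=: G :&: vstab v.
  apply/setP=> g; apply/idP/idP => [Hg|/setIP[/setIP[Gg /lstabP[wg _]] /vstabP vg]].
    have [Gg fg] := (splitM_GO g gW sM nM sMW Mx).1 Hg.
    have vg := fg _ (mem_hplanel v w); have wg := fg _ (mem_hplaner v w).
    rewrite !in_setI Gg /=; apply/andP; split; last exact/vstabP.
    by apply/lstabP; split=> //; exists 0; rewrite scale0r addr0.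
  by apply/(splitM_GO g gW sM nM sMW Mx); split=> //; apply: hplane_fix.
have gW' := splitM_good gW sM nM sMW Mx.
have [kM _] : classM (W :&: perp (hplane v w)) /\ class3 (W :&: perp (hplane v w)).
  by apply: sm => //; apply: (splitM_card sMW nM (mem_hplaner v w)).
have k1 := classM1 gW' kM.
have [Os xs Ws] := ad; have /lstabP[ws [a0 va0]] := ls.
have norm_G s' : adm W s' -> s' \in lstab w v -> s' \in 'N(G)%g.
  by move=> ad' ls'; apply: norm_setI (adm_norm ad') _; apply: (subsetP (normG _)).
(* Multiplying the twist by [r] if necessary makes it fix [v]. *)
wlog vs : s ad ls Os xs Ws ws a0 va0 / v *m GLval s = v.
  move=> wl; case: (vcases s Os ls) => vs; first exact: (wl s ad ls Os xs Ws ws a0 va0).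
  have rs : s \in 'N(G)%g.
    exact: norm_G.
  have nN : (<[r]>%G <| G)%g by case/sdprod_context: defG.
  have pN : (2.-group <[r]>%G)%g by rewrite /pgroup -orderE; apply: pnat_dvd (_ : 2.-nat 2)%N => //; rewrite order_dvdn r2.
  apply: (N2prop_coset nN pN (cycle_id r) rs).
  have /setIP[GOr lr] := Gr.
  have ad' := adm_coset nW GOr ad.
  have ls' : (r * s)%g \in lstab w v by rewrite groupM.
  have [Os' xs' Ws'] := ad'; have /lstabP[ws' [a' va']] := ls'.
  apply: (wl _ ad' ls' Os' xs' Ws' ws' a' va').
  by rewrite mulmxGM rE mulmxDl -scalemxAl ws vs -addrA addvv addr0.
apply: (Clifford_N2prop defG).
- by move=> g /NE[->|->]; rewrite ?expg1n.
- by apply/(subsetP (cent_sub _)); rewrite cent_cycle; apply/cent1P/esym/commgP/conjg_fixP/rcomm.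
- exact: norm_setI (norm_G _ ad ls) (vstab_norm vs).
- by move=> Gs; apply/setIP; split=> //; apply/vstabP.
- by move=> Gs; apply/setIP; split=> //; apply/vstabP; rewrite expgS expg1 mulmxGM !vs.
move=> i s' Ls' _.
have EI : 'I_(G :&: vstab v)['chi_i]%g = G :&: vstab v.
  apply/setIidPl; apply/subsetP=> g /setIP[/setIP[/GOP[Og _ _] /lstabP[wg _]] _].
  apply: (subsetP (cent_sub_inertia _)); rewrite cent_cycle.
  by apply/cent1P/esym/commgP/conjg_fixP/rcomm.
apply: (@N2_eq (GO (W :&: perp (hplane v w)))); first by rewrite /= EI -EL.
have ad' : adm (W :&: perp (hplane v w)) s.
  by apply: adm_split => // u Mu; rewrite (hplane_fix vs ws).
have [y Ly ->] := rcosetP Ls'; apply: class1_GO => //.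
by apply: adm_coset => //; [case: gW' | rewrite /= -EL in Ly].
Qed.

End Classes.

(** * Siegel transformations and singular vectors fixed by [x] *)

Section Siegel.
Variables (F : finFieldType) (m : nat).
Local Notation V := 'rV[F]_m.-1.+1.
Local Notation GL := {'GL_m[F]}.
Variable Q : V -> F.
Hypotheses (char2 : 2%N \in [pchar F]) (qQ : is_quadratic_form Q) (ndQ : qnondegenerate Q).
Local Notation B := (polar Q).
Local Notation O := (qorth_group Q).
Variable x : GL.
Hypotheses (Ox : x \in O) (odd_x : odd #[x]%g).
Local Notation n := #[x]%g.
Local Notation perp := (@perp F m Q).
Local Notation nondeg := (@nondeg F m Q).
Implicit Types (u v w e f : V) (g h s : GL) (W M U : {set V}).
Let addvv := @addvv F m char2.
Let oppv := @oppv F m char2.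
Let addff := @addff F char2.
Let BDl := @polarDl F m Q qQ.
Let BDr := @polarDr F m Q qQ.
Let BZl := @polarZl F m Q qQ.
Let BZr := @polarZr F m Q qQ.
Let B0l := @polar0l F m Q qQ.
Let B0r := @polar0r F m Q qQ.
Let Bvv := @polarvv F m Q char2 qQ.
Let perpPx := @perpP F m Q.
Let n_gt0 : (0 < n)%N. Proof. exact: order_gt0. Qed.
Local Notation GO := (@GO F m Q x).
Local Notation goodW := (@goodW F m Q x).
Local Notation adm := (@adm F m Q x).
Local Notation xfix := (@xfix F m x).

Definition xfixed W := [set v in W | v *m GLval x == v].

Lemma xfixedP W v : reflect (v \in W /\ xfix v) (v \in xfixed W).
Proof. by apply: (iffP setIdP) => [[Wv /eqP]|[Wv fv]]; split=> //; apply/eqP. Qed.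

Lemma xfixed_props W : goodW W -> subsp (xfixed W) /\ nondeg (xfixed W).
Proof.
move=> [[W0 WD WZ] nW Wx]; split.
  split=> [|u v /xfixedP[Wu fu] /xfixedP[Wv fv]|a v /xfixedP[Wv fv]]; apply/xfixedP.
  - by split=> //; rewrite /xfix mul0mx.
  - by split; [exact: WD | rewrite /xfix mulmxDl fu fv].
  by split; [exact: WZ | rewrite /xfix -scalemxAl fv].
move=> v; have [u Wu pvu] := nW v.
(* The orbit sum is fixed by [x] and, the order being odd, has the same polar products with fixed
   vectors as [u]. *)
pose t := \sum_(k < n) u *m GLval (x ^+ k)%g.
have Wt : t \in W.
  rewrite /t; elim/big_ind: _ => // k _; exact: vstableX.
have tx : xfix t.
  rewrite /xfix /t mulmx_suml; under eq_bigr do rewrite -mulmxGM -expgSr.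
  move: (prednK n_gt0) (expg_order x); case: n => // k _ xk.
  by rewrite big_ord_recr [RHS]big_ord_recl /= xk addrC.
exists t; first exact/xfixedP.
apply/perpPx=> z /xfixedP[Wz fz].
have xk k : z *m GLval (x ^- k)%g = z.
  rewrite -expgVn; elim: k => [|k IH]; first exact: mulmxG1.
  by rewrite expgSr mulmxGM IH -{1}fz mulmxGK.
have Bt : B t z = B u z.
  rewrite /t (polar_suml qQ) (eq_bigr (fun=> B u z)) => [|k _]; last first.
    by rewrite (orth_polarV _ _ (groupX k Ox)) xk.
  rewrite sumr_const card_ord -(odd_double_half n) odd_x addnC -mul2n mulrnDr.
  by rewrite mulrnA mulr2n addff mul0rn add0r.
by rewrite BDl Bt -BDl (perpPx _ _ pvu).
Qed.

Definition presx g := forall v, xfix v -> xfix (v *m GLval g).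

Lemma presx_comm g : commute g x -> presx g.
Proof. by move=> c v fv; rewrite /xfix -mulmxGM c mulmxGM fv. Qed.

Lemma presx_inv s : (x ^ s = x^-1)%g -> presx s.
Proof.
move=> xs v fv; rewrite /xfix; have fV : v *m GLval (x^-1)%g = v by rewrite -{1}fv mulmxGK.
have E : (s * x = x^-1 * s)%g by rewrite [RHS]conjgC conjVg xs invgK.
by rewrite -mulmxGM E mulmxGM fV.
Qed.

Lemma presxV g : g \in O -> presx g -> presx (g^-1)%g.
Proof.
move=> _ pg v fv; rewrite invg_expg; move: (#[g]%g).-1 => k.
by elim: k => [|k IH]; rewrite ?mulmxG1 // expgSr mulmxGM; apply: pg.
Qed.

(** For singular [e] and [u] orthogonal to [e], this is the isometry fixing [e] that adds
    [B v u *: e] to each [v] orthogonal to [e]; the terms with [B v e] are forced by the invariance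
    of [Q]. *)
Definition siegel e u v := v + B v e *: (u + Q u *: e) + B v u *: e.

Lemma siegelD e u v v' : siegel e u (v + v') = siegel e u v + siegel e u v'.
Proof. by rewrite /siegel !BDl; apply/rowP=> j; rewrite !mxE; ring. Qed.

Lemma siegelZ e u a v : siegel e u (a *: v) = a *: siegel e u v.
Proof. by rewrite /siegel !BZl; apply/rowP=> j; rewrite !mxE; ring. Qed.

Lemma siegelQ e u v : Q e = 0 -> B u e = 0 -> Q (siegel e u v) = Q v.
Proof.
move=> Qe ue; rewrite /siegel !(qD, qZ qQ) !(BDl, BDr, BZl, BZr) Qe ue !(mulr0, addr0).
rewrite Bvv; set a := B v e; set b := B v u.
have -> : Q v + a ^+ 2 * Q u + a * (b + Q u * a) + (b * a + a * (0 + Q u * (b * 0))) =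
  Q v + (a ^+ 2 * Q u + a ^+ 2 * Q u) + (a * b + a * b) by ring.
by rewrite !addff !addr0.
Qed.

Lemma siegelM e u u' v : B u e = 0 -> B u' e = 0 ->
  siegel e u' (siegel e u v) = siegel e (u + u') v.
Proof.
move=> ue ue'; rewrite /siegel qD !(BDl, BDr, BZl, BZr) Bvv ue (polarC Q e u') ue'.
by apply/rowP=> j; rewrite !mxE; ring.
Qed.

Lemma siegel_shift e u a v : Q e = 0 -> B u e = 0 -> siegel e (u + a *: e) v = siegel e u v.
Proof.
move=> Qe ue; rewrite /siegel qD qZ // Qe !(BDl, BDr, BZl, BZr) ue !(mulr0, addr0).
apply/rowP=> j; rewrite !mxE; set b := B v e.
have -> (p q r t : F) : p + b * (q + a * r + t) + (B v u + a * b) * r =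
  p + b * (q + t) + B v u * r + (a * b * r + a * b * r) by ring.
by rewrite addff addr0.
Qed.

Lemma class2_partner W w e : goodW W -> w \in W -> e \in W -> xfix w -> xfix e -> anis Q w ->
  e != 0 -> Q e = 0 -> B w e = 0 ->
  exists f, [/\ f \in W, xfix f, B e f = 1, Q f = 0 & B w f = 0].
Proof.
move=> gW Ww We fw fe aw nze Qe Bwe; have [[W0 WD WZ] nW Wx] := gW.
have [sX nX] := xfixed_props gW; have [X0 XD XZ] := sX.
have Xw : w \in xfixed W by apply/xfixedP.
have Xe : e \in xfixed W by apply/xfixedP.
have [f0 Xf0 [Bef0 Bwf0]] : exists2 f0, f0 \in xfixed W & B e f0 = 1 /\ B w f0 = 0.
  have [w0|nzw] := eqVneq w 0.
    have [f0 Xf0 E] := nondegP char2 qQ ndQ sX nX Xe nze.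
    by exists f0 => //; rewrite w0 B0l.
  have Qw : Q w != 0 by case: aw => // w0; rewrite w0 eqxx in nzw.
  have [z Xz Bwz] := nondegP char2 qQ ndQ sX nX Xw nzw.
  (* Making [f1] orthogonal to [w] by a multiple of [z] changes its product with [e]; starting from
     [e'] compensates for this. It is non-zero because [e] is singular and [w] is not. *)
  pose e' := e + B e z *: w.
  have Xe' : e' \in xfixed W by rewrite XD ?XZ.
  have nze' : e' != 0.
    apply: contra nze; rewrite /e' addr_eq0 oppv => /eqP E.
    have := Qe; rewrite {1}E qZ // => /eqP; rewrite mulf_eq0 (negPf Qw) orbF expf_eq0 /= => /eqP b0.
    by rewrite E b0 scale0r.
  have [f1 Xf1 E1] := nondegP char2 qQ ndQ sX nX Xe' nze'.
  exists (f1 + B w f1 *: z); first by rewrite XD ?XZ.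
  rewrite !BDr !BZr Bwz mulr1 addff; split=> //.
  by rewrite -E1 BDl BZl [B e z * _]mulrC.
have [Wf0 ff0] := xfixedP _ _ Xf0.
exists (f0 + Q f0 *: e); split.
- by rewrite WD ?WZ.
- by rewrite /xfix mulmxDl -scalemxAl ff0 fe.
- by rewrite BDr BZr Bvv mulr0 addr0.
- by rewrite qD qZ // Qe mulr0 addr0 BZr polarC Bef0 mulr1 addff.
by rewrite BDr BZr Bwe mulr0 addr0.
Qed.

(** The Siegel transformations along [e] are regular on the possible images of the hyperbolic
    partner [f], so the group is [N ><| L] with [L] in the space [W'] orthogonal to [e] and [f]. By
    duality a character of [N] is [u |-> psi (B u y)] with [y] determined modulo [w]; its inertia
    group in [L] is [GO W' :&: lstab w y], an instance of [classM] for [W']. *)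
Lemma class2_step W : goodW W -> smaller Q x W -> class2 Q x W.
Proof.
move=> gW sm w e s Ww We fw fe aw nze Qe Bwe ad ws es.
have [[W0 WD WZ] nW Wx] := gW.
have [f [Wf ff Bef Qf Bwf]] := class2_partner gW Ww We fw fe aw nze Qe Bwe.
have [psi [psi0 psiD psi2 psint]] := additive_char_exists char2.
pose U := [set u in xfixed W | (B u e == 0) && (B u w == 0)].
have UP u : reflect [/\ u \in W, xfix u, B u e = 0 & B u w = 0] (u \in U).
  by apply: (iffP setIdP) => [[/xfixedP[Wu fu] /andP[/eqP ue /eqP uw]]|[Wu fu -> ->]];
    split=> //; [apply/xfixedP | rewrite !eqxx].
(* Off [U] the default 1 may be taken; [nu] is evaluated on [U] only. *)
pose nu u : GL := odflt 1%g [pick g : GL | (g \in O) && [forall v, v *m GLval g == siegel e u v]].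
have nuP u : u \in U -> nu u \in O /\ forall v, v *m GLval (nu u) = siegel e u v.
  move=> /UP[Wu fu ue uw]; rewrite /nu; case: pickP => [g /andP[Og /forallP h]|none] /=.
    by split=> // v; apply/eqP.
  have [g Og gE] : exists2 g : GL, g \in O & forall v, v *m GLval g = siegel e u v.
    by apply: (orth_of_fun qQ ndQ) => [v v'|a v|v]; [exact: siegelD | exact: siegelZ | exact: siegelQ].
  by have /negP[] := none g; rewrite Og; apply/forallP=> v; apply/eqP.
have nuM : {in U &, forall u u', (nu u * nu u' = nu (u + u'))%g}.
  move=> u u' Uu Uu'; have [_ E] := nuP u Uu; have [_ E'] := nuP u' Uu'.
  have /UP[Wu fu ue uw] := Uu; have /UP[Wu' fu' ue' uw'] := Uu'.
  have UD : u + u' \in U.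
    by apply/UP; split; [exact: WD | rewrite /xfix mulmxDl fu fu' | rewrite BDl ue ue' addr0 | rewrite BDl uw uw' addr0].
  have [_ E''] := nuP _ UD.
  by apply: GL_eqP => v; rewrite mulmxGM E E' E'' siegelM.
have nu1 : nu 0 = 1%g.
  have U0 : 0 \in U by apply/UP; split; rewrite ?B0l // /xfix mul0mx.
  have [_ E] := nuP _ U0; apply: GL_eqP => v.
  by rewrite E mulmxG1 /siegel q0 // scale0r addr0 scaler0 addr0 B0r scale0r addr0.
have U0 : 0 \in U by apply/UP; split; rewrite ?B0l // /xfix mul0mx.
have UD : {in U &, forall u u', u + u' \in U}.
  move=> u u' /UP[Wu fu ue uw] /UP[Wu' fu' ue' uw'].
  by apply/UP; split; [exact: WD | rewrite /xfix mulmxDl fu fu' | rewrite BDl ue ue' addr0 | rewrite BDl uw uw' addr0].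
have gN : group_set (nu @: U).
  apply/group_setP; split=> [|_ _ /imsetP[u Uu ->] /imsetP[u' Uu' ->]].
    by apply/imsetP; exists 0.
  by apply/imsetP; exists (u + u'); rewrite ?UD ?nuM.
pose N := Group gN; pose G := (GO W :&: vstab w :&: vstab e)%G.
have Nnu u : u \in U -> nu u \in N by move=> Uu; apply: imset_f.
have NG : N \subset G.
  apply/subsetP=> _ /imsetP[u Uu ->]; have [On E] := nuP u Uu; have /UP[Wu fu ue uw] := Uu.
  apply/setIP; split; last by apply/vstabP; rewrite E /siegel Bvv polarC ue !scale0r !addr0.
  apply/setIP; split; last by apply/vstabP; rewrite E /siegel Bwe polarC uw !scale0r !addr0.
  apply/GOP; split=> // [|v pv]; last by rewrite E /siegel !(polarC Q v) (perpC We pv) (perpC Wu pv) !scale0r !addr0.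
  have Bx z v : xfix z -> B (v *m GLval x) z = B v z by move=> fz; rewrite -{1}fz orth_polar.
  apply: GL_eqP => v; rewrite !mulmxGM !E /siegel !Bx //.
  by rewrite !mulmxDl -!scalemxAl mulmxDl -scalemxAl fe fu.
have conjE g u : g \in O -> e *m GLval g = e -> u \in U -> u *m GLval g \in U ->
    (nu u ^ g = nu (u *m GLval g))%g.
  move=> Og eg Uu Uug; have [_ E] := nuP u Uu; have [_ E'] := nuP _ Uug.
  apply: GL_eqP => v; rewrite conjgE !mulmxGM E E' /siegel.
  rewrite !mulmxDl mulmxGKV -!scalemxAl mulmxDl -scalemxAl eg (orthP _ _ Og).
  have Bg z : B (v *m GLval (g^-1)%g) z = B v (z *m GLval g) by rewrite orth_polarV ?groupV ?invgK.
  by rewrite !Bg eg.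
have stabU g : g \in O -> e *m GLval g = e -> w *m GLval g = w -> vstable W g -> presx g ->
    {in U, forall u, u *m GLval g \in U}.
  move=> Og eg wg Wg pg u /UP[Wu fu ue uw]; apply/UP; split.
  - exact: Wg.
  - exact: pg.
  - by rewrite -{1}eg orth_polar.
  by rewrite -{1}wg orth_polar.
have normN g : g \in O -> e *m GLval g = e -> w *m GLval g = w -> vstable W g -> presx g ->
    g \in 'N(N)%g.
  move=> Og eg wg Wg pg; rewrite inE; apply/subsetP=> _ /imsetP[_ /imsetP[u Uu ->] ->].
  by rewrite conjE ?Nnu ?stabU.
have GP g : g \in G -> [/\ g \in O, e *m GLval g = e, w *m GLval g = w, vstable W g & presx g].
  move=> /setIP[/setIP[Gg /vstabP wg] /vstabP eg]; have /GOP[Og cg _] := Gg.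
  by split=> //; [apply: GO_stable Gg | apply: presx_comm].
have fsg u : u \in U -> f *m GLval (nu u) = f + u + (Q u + B f u) *: e.
  move=> Uu; have [_ ->] := nuP u Uu; rewrite /siegel (polarC Q f e) Bef scale1r.
  by apply/rowP=> j; rewrite !mxE; ring.
have tr g : g \in O -> e *m GLval g = e -> w *m GLval g = w -> vstable W g -> presx g ->
    exists2 u, u \in U & f *m GLval (nu u) = f *m GLval g.
  move=> Og eg wg Wg pg; pose f' := f *m GLval g.
  have Ef' : B e f' = 1 by rewrite -{1}eg orth_polar.
  have Uu : f + f' \in U.
    apply/UP; split; first by rewrite WD // Wg.
    - by rewrite /xfix mulmxDl ff pg.
    - by rewrite BDl (polarC Q f) (polarC Q f') Bef Ef' addff.
    by rewrite BDl (polarC Q f) (polarC Q f') Bwf -{1}wg orth_polar // Bwf addr0.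
  exists (f + f') => //; rewrite fsg // qD Qf (orthP _ _ Og f) Qf !add0r BDr Bvv add0r.
  by rewrite addff scale0r addr0 addrA addvv add0r.
have reg u : u \in U -> f *m GLval (nu u) = f -> nu u = 1%g.
  move=> Uu; rewrite fsg // => E0.
  have /eqP : u + (Q u + B f u) *: e = 0 by apply: (addrI f); rewrite addr0 addrA.
  rewrite addr_eq0 oppv => /eqP E.
  have [_ En] := nuP u Uu; apply: GL_eqP => v; rewrite En mulmxG1 /siegel.
  set l := Q u + B f u in E; have Qu : Q u = 0 by rewrite E qZ // Qe mulr0.
  by rewrite Qu scale0r addr0 E BZr scalerA [l * _]mulrC -addrA addvv addr0.
have defG : (N ><| (G :&: vstab f) = G)%g.
  apply: regular_sdprod => //.
  - by apply/subsetP=> g /GP[Og eg wg Wg pg]; apply: normN.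
  - by move=> g /GP[Og eg wg Wg pg]; have [u Uu E] := tr g Og eg wg Wg pg; exists (nu u); rewrite ?Nnu.
  by move=> _ /imsetP[u Uu ->]; apply: reg.
have N2 : {in N, forall g, (g ^+ 2)%g = 1%g}.
  by move=> _ /imsetP[u Uu ->]; rewrite expgS expg1 nuM // addvv.
have pN : (2.-group N)%g.
  by apply/pgroupP=> p pr /(Cauchy pr)[g Ng og]; have := order_dvdn g 2; rewrite N2 // eqxx og dvdn_prime2.
have normG s' : adm W s' -> w *m GLval s' = w -> e *m GLval s' = e -> s' \in 'N(G)%g.
  by move=> ad' ws' es'; apply: norm_setI (vstab_norm es'); apply: norm_setI (adm_norm ad') (vstab_norm ws').
have admP s' : adm W s' -> w *m GLval s' = w -> e *m GLval s' = e ->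
  [/\ s' \in O, vstable W s' & presx s'] by case=> Os xs Ws; split=> //; apply: presx_inv.
wlog fs : s ad ws es / f *m GLval s = f.
  move=> wl; have [Os Ws ps] := admP s ad ws es.
  have OsV : (s^-1)%g \in O by rewrite groupV.
  have esV : e *m GLval (s^-1)%g = e by rewrite -{1}es mulmxGK.
  have wsV : w *m GLval (s^-1)%g = w by rewrite -{1}ws mulmxGK.
  have [u Uu Eu] := tr _ OsV esV wsV (vstableV Ws) (presxV Os ps).
  have nNG : (N <| G)%g by case/sdprod_context: defG.
  apply: (N2prop_coset nNG pN (Nnu u Uu) (normG s ad ws es)).
  have Gn := subsetP NG _ (Nnu u Uu); have [On en wn _ _] := GP _ Gn.
  apply: wl.
  - by apply: adm_coset => //; case/setIP: Gn => /setIP[].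
  - by rewrite mulmxGM wn.
  - by rewrite mulmxGM en.
  by rewrite mulmxGM Eu mulmxGKV.
have nBef : B e f != 0 by rewrite Bef oner_eq0.
have [sM nM Mx] := hplane_props char2 qQ nBef fe ff.
have sMW := hplane_sub (And3 W0 WD WZ) We Wf.
set W' := W :&: perp (hplane e f).
have gW' : goodW W' := splitM_good qQ Ox gW sM nM sMW Mx.
have [kM _] : classM Q x W' /\ class3 Q x W'.
  by apply: sm => //; apply: (splitM_card char2 qQ ndQ sMW nM (mem_hplanel e f)).
have EL : G :&: vstab f :=: GO W' :&: vstab w.
  apply/setP=> g; apply/setIP/setIP=> [[/setIP[/setIP[Gg wg] /vstabP eg] /vstabP fg]|[Hg wg]].
    split=> //; apply/(splitM_GO char2 qQ ndQ Ox g gW sM nM sMW Mx); split=> //.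
    exact: hplane_fix.
  have [Gg fg] := (splitM_GO char2 qQ ndQ Ox g gW sM nM sMW Mx).1 Hg.
  split; last by apply/vstabP/fg/mem_hplaner.
  by apply/setIP; split; [apply/setIP; split | apply/vstabP/fg/mem_hplanel].
have ad' : adm W' s by apply: adm_split => // u Mu; rewrite (hplane_fix es fs).
have W'P v : reflect [/\ v \in W, B v e = 0 & B v f = 0] (v \in W').
  apply: (iffP setIP) => [[Wv /perpPx pv]|[Wv ve vf]].
    by split=> //; apply: pv; [apply: mem_hplanel | apply: mem_hplaner].
  split=> //; apply/perpPx=> _ /hplaneP[a [b ->]].
  by rewrite BDr !BZr ve vf !mulr0 addr0.
have W'w : w \in W' by apply/W'P.
pose Y := xfixed W'; have [sY nY] := xfixed_props gW'; have [Y0 YD YZ] := sY.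
pose U' := [set u in Y | B u w == 0].
have U'P u : reflect (u \in Y /\ B u w = 0) (u \in U').
  by apply: (iffP setIdP) => [[Yu /eqP]|[Yu E]]; split=> //; apply/eqP.
have sU' : subsp U'.
  split=> [|u v /U'P[Yu uw] /U'P[Yv vw]|a v /U'P[Yv vw]]; apply/U'P.
  - by split=> //; rewrite B0l.
  - by split; [exact: YD | rewrite BDl uw vw addr0].
  by split; [exact: YZ | rewrite BZl vw mulr0].
have sU'U u : u \in U' -> u \in U.
  by move=> /U'P[/xfixedP[/W'P[Wu ue _] fu] uw]; apply/UP.
(* By [siegel_shift] the parameter matters only modulo [e], so it can be made orthogonal to [f] as
   well. *)
have NU' g : g \in N -> exists2 u, u \in U' & g = nu u.
  move=> /imsetP[u Uu ->]; have /UP[Wu fu ue uw] := Uu.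
  pose u' := u + B u f *: e.
  have U'u' : u' \in U'.
    apply/U'P; split; last by rewrite BDl BZl (polarC Q e) Bwe uw mulr0 addr0.
    apply/xfixedP; split; last by rewrite /xfix mulmxDl -scalemxAl fu fe.
    apply/W'P; split; first by rewrite WD ?WZ.
    - by rewrite BDl BZl Bvv ue mulr0 addr0.
    by rewrite BDl BZl Bef mulr1 addff.
  exists u' => //; have [_ E] := nuP u Uu; have [_ E'] := nuP u' (sU'U _ U'u').
  by apply: GL_eqP => v; rewrite E E' siegel_shift.
have Yw : w \in Y by apply/xfixedP.
(* The annihilator of [U'] in [Y] is spanned by [w]; this is exactly the ambiguity of [y]. *)
have dlt d : d \in Y -> {in U', forall u, B u d = 0} -> exists a, d = a *: w.
  move=> Yd pd; have [w0|nzw] := eqVneq w 0.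
    exists 0; rewrite scale0r; apply: (perp_cap char2 qQ ndQ nY Yd); apply/perpPx=> u Yu.
    by rewrite polarC pd //; apply/U'P; rewrite w0 B0r.
  have [z Yz Bwz] := nondegP char2 qQ ndQ sY nY Yw nzw; exists (B d z).
  apply/eqP; rewrite -subr_eq0 oppv; apply/eqP/(perp_cap char2 qQ ndQ nY).
    by rewrite YD ?YZ.
  apply/perpPx=> y Yy.
  have [u [b [U'u ->]]] : exists u b, u \in U' /\ y = u + b *: z.
    exists (y + B y w *: z), (B y w); split; last by rewrite -addrA addvv addr0.
    apply/U'P; split; first by rewrite YD ?YZ.
    by rewrite BDl BZl (polarC Q z) Bwz mulr1 addff.
  have /U'P[_ uw] := U'u; rewrite !(BDl, BDr, BZl, BZr) Bwz mulr1.
  by rewrite (polarC Q d u) pd // (polarC Q w u) uw mulr0 !add0r mulrC addff.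
apply: (Clifford_N2prop defG) => //.
- by have [Os Ws ps] := admP s ad ws es; apply: normN.
- exact: norm_setI (normG s ad ws es) (vstab_norm fs).
- by move=> Gs; apply/setIP; split=> //; apply/vstabP.
- by move=> Gs; apply/setIP; split=> //; apply/vstabP; rewrite expgS expg1 mulmxGM !fs.
move=> i s' /rcosetP[y0 Ly0 Es'] fixi.
have Ly0' : y0 \in GO W' :&: vstab w by rewrite -EL.
have /setIP[GOy0 /vstabP wy0] := Ly0'.
have ad'' : adm W' s' by rewrite Es'; apply: adm_coset => //; case: gW'.
pose mu u := 'chi_i (nu u).
have linN : 'chi_i \is a linear_char.
  apply/char_abelianP; apply/centsP=> _ /imsetP[u Uu ->] _ /imsetP[u' Uu' ->].
  by rewrite /commute !nuM // addrC.
have [y Yy muE] : exists2 y, y \in Y & {in U', forall u, mu u = psi (B u y)}.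
  apply: (dual_char char2 qQ psi0 psiD psi2 psint sU' sY).
  - move=> u /U'P[Yu _] pu; apply: (perp_cap char2 qQ ndQ nY Yu); apply/perpPx=> z; exact: pu.
  - by rewrite /mu nu1 lin_char1.
  by move=> u u' U'u U'u'; rewrite /mu -nuM ?sU'U // lin_charM ?Nnu ?sU'U.
have key g : g \in O -> e *m GLval g = e -> f *m GLval g = f -> w *m GLval g = w ->
    vstable W g -> presx g -> ('chi_i ^ g)%CF = 'chi_i <-> g \in lstab w y.
  move=> Og eg fg wg Wg pg.
  have stabY z : z \in Y -> z *m GLval g \in Y.
    move=> /xfixedP[/W'P[Wz ze zf] fz]; apply/xfixedP; split; last exact: pg.
    by apply/W'P; split; [exact: Wg | rewrite -{1}eg orth_polar | rewrite -{1}fg orth_polar].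
  have stabU' u : u \in U' -> u *m GLval g \in U'.
    by move=> /U'P[Yu uw]; apply/U'P; split; [exact: stabY | rewrite -{1}wg orth_polar].
  have nNg := normN g Og eg wg Wg pg.
  have conjN u : u \in U' -> 'chi_i (nu u ^ g)%g = psi (B u (y *m GLval (g^-1)%g)).
    move=> U'u; rewrite conjE ?sU'U ?stabU' // -/(mu _) muE ?stabU' //.
    by rewrite orth_polarV.
  split=> [fixg|/lstabP[_ [a ya]]].
    have E u : u \in U' -> psi (B u (y *m GLval (g^-1)%g + y)) = 1.
      move=> U'u; rewrite BDr (psiD (B u _)) -conjN // -fixg cfConjgEJ // -/(mu u) muE //.
      by rewrite -expr2 psi2.
    have gVY : vstable Y (g^-1)%g by apply: vstableV => z; apply: stabY.
    have [a Ea] := dlt _ (YD _ _ (gVY _ Yy) Yy) (psi_polar1 qQ psint sU' E).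
    apply/lstabP; split=> //; exists a; move/eqP: Ea.
    rewrite -subr_eq0 oppv -addrA addrC addr_eq0 oppv => /eqP/(congr1 (fun z => z *m GLval g)).
    rewrite mulmxDl -scalemxAl wg mulmxGKV => E1.
    by rewrite -[in RHS]E1 -addrA addvv addr0.
  apply/cfun_inP=> h /NU'[u U'u ->].
  have gVY : vstable U' (g^-1)%g by apply: vstableV => z; apply: stabU'.
  rewrite -[nu u](conjgKV g) cfConjgEJ //.
  have -> : (nu u ^ g^-1 = nu (u *m GLval (g^-1)%g))%g.
    by rewrite -[in LHS](mulmxGKV u g) -conjE ?conjgK ?sU'U ?mulmxGKV // gVY.
  rewrite conjE ?sU'U ?mulmxGKV ?gVY // -!/(mu _) !muE ?gVY //.
  have yg : y *m GLval g = y + a *: w := ya.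
  have -> : B (u *m GLval (g^-1)%g) y = B u (y *m GLval g) by rewrite orth_polarV ?groupV ?invgK.
  by rewrite ya BDr BZr; case/U'P: U'u => _ ->; rewrite mulr0 addr0.
have LP g : g \in GO W' :&: vstab w ->
    [/\ g \in O, e *m GLval g = e, f *m GLval g = f & [/\ w *m GLval g = w, vstable W g & presx g]].
  rewrite -EL => /setIP[/GP[Og eg wg Wg pg] /vstabP fg]; by split.
have EI : 'I_(G :&: vstab f)['chi_i]%g = GO W' :&: lstab w y.
  rewrite EL; apply/setP=> g; apply/setIP/setIP=> [[Lg /setIdP[_ /eqP Ig]]|[Gg lg]].
    have [Og eg fg [wg Wg pg]] := LP g Lg; have /setIP[Gg _] := Lg.
    by split=> //; apply/key.
  have Lg : g \in GO W' :&: vstab w.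
    by apply/setIP; split=> //; apply/vstabP; case/lstabP: lg.
  have [Og eg fg [wg Wg pg]] := LP g Lg; split=> //.
  by rewrite inE normN //; apply/eqP/key.
apply: (@N2_eq _ _ (GO W' :&: lstab w y)%G); first by rewrite /= EI.
have [W'y fy] := xfixedP _ _ Yy.
apply: kM => //.
have [Oy ey fy0 [wy Wy py]] := LP y0 Ly0'; have [Os Ws ps] := admP s ad ws es.
by apply/key => //; rewrite Es' ?groupM ?mulmxGM ?ey ?fy0 ?wy //; [apply: vstableM | move=> v fv; rewrite mulmxGM; apply/ps/py].
Qed.

End Siegel.

(** * Unitary Heisenberg groups *)

Section HeisAlgebra.
Variables (F : finFieldType) (m : nat).
Local Notation V := 'rV[F]_m.-1.+1.
Local Notation GL := {'GL_m[F]}.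
Variable Q : V -> F.
Hypotheses (char2 : 2%N \in [pchar F]) (qQ : is_quadratic_form Q) (ndQ : qnondegenerate Q).
Local Notation B := (polar Q).
Local Notation O := (qorth_group Q).
Variable x : GL.
Hypotheses (Ox : x \in O) (odd_x : odd #[x]%g).
Local Notation n := #[x]%g.
Local Notation K := (cyc_alg F n).
Local Notation xi := (cyc_gen F n).
Local Notation star := (@cyc_star F n).
Local Notation act := (@act F m x).
Local Notation herm := (@herm F m Q x).
Local Notation perp := (@perp F m Q).
Local Notation nondeg := (@nondeg F m Q).
Implicit Types (u v w e f : V) (g h s : GL) (W M U : {set V}).
Let addvv := @addvv F m char2.
Let oppv := @oppv F m char2.
Let addff := @addff F char2.
Let perpPx := @perpP F m Q.
Let n_gt0 : (0 < n)%N. Proof. exact: order_gt0. Qed.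
Local Notation GO := (@GO F m Q x).
Local Notation goodW := (@goodW F m Q x).
Local Notation adm := (@adm F m Q x).
Local Notation xfix := (@xfix F m x).
Implicit Types (a b k r : K).
Let starD := @cyc_starD F n n_gt0.
Let starM := @cyc_starM F n n_gt0.
Let star0 := @cyc_star0 F n n_gt0.
Let starK := @cyc_starK F n n_gt0.
Let addaa := @addaa F m char2 x.
Let HDl := @hermDl F m Q char2 qQ x.
Let HDr := @hermDr F m Q char2 qQ x Ox.
Let HMl := @hermMl F m Q char2 qQ x.
Let HMr := @hermMr F m Q char2 qQ x Ox.
Let HC := @hermC F m Q char2 qQ x Ox.
Let H0l := @herm0l F m Q char2 qQ x.
Let H0r := @herm0r F m Q char2 qQ x Ox.

Lemma act_stable W v a : subsp W -> vstable W x -> v \in W -> act v a \in W.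
Proof.
move=> [W0 WD WZ] Wx Wv; rewrite act_expand; elim/big_ind: _ => // k _.
by apply: WZ; rewrite act_genX; apply: vstableX.
Qed.

Lemma eq_polar u v u' v' : herm u v = herm u' v' -> B u v = B u' v'.
Proof.
move=> E; rewrite -(act1 x u) -(act1 x u') -!(herm_eps char2 qQ) E //.
Qed.

Lemma herm_orth W u v : subsp W -> vstable W x -> u \in W -> v \in perp W -> herm v u = 0.
Proof.
move=> sW Wx Wu pv; apply: (herm_eq0 char2 qQ) => a; rewrite act_adj // polarC.
by apply: (perpC _ pv); apply: act_stable.
Qed.

Section Prim.
Variable c : K.
Hypotheses (pc : prim c) (ntc : xi * c != c).
Let cc : c * c = c. Proof. by case: pc. Qed.
Let cs : star c = c. Proof. by case: pc. Qed.

(** Otherwise [xi] would equal its inverse on [c K], so [xi^2] would be 1 there, and then [xi]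
    itself because [n] is odd. Thus [cyc_star] acts non-trivially on [c K]. *)
Lemma trace_xi_neq0 : (xi + star xi) * c != 0.
Proof.
apply: contra ntc; rewrite mulrDl addr_eq0 oppa // => /eqP E.
have xx : xi * xi * c = c.
  by rewrite -mulrA E mulrA cyc_gen_star // mul1r.
have xk (k : nat) : (xi * xi) ^+ k * c = c.
  by elim: k => [|k IH]; rewrite ?expr0 ?mul1r // exprSr -mulrA xx.
apply/eqP; rewrite -[X in xi * X](xk n./2) mulrA.
have -> : xi * (xi * xi) ^+ n./2 = xi ^+ n.
  by rewrite -expr2 -exprM -exprS mul2n; congr (_ ^+ _); rewrite -[RHS]odd_double_half odd_x.
by rewrite cyc_gen_n // mul1r.
Qed.

(** The element [t] takes the place of 1/2, absent in characteristic 2: [t * r] has trace [r] for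
    every self-adjoint [r] in [c K]. It is [xi * c] divided by its trace. *)
Lemma trace_one : exists2 t, t * c = t & t + star t = c.
Proof.
case: pc => _ _ inv; have [||r rs [rc Er]] := inv ((xi + star xi) * c) _ _ trace_xi_neq0.
- by rewrite starM starD starK cs addrC.
- by rewrite -mulrA cc.
exists (xi * c * r); first by rewrite -!mulrA [r * c]mulrC [c * (c * r)]mulrA cc.
by rewrite !starM cs rs -!mulrDl.
Qed.

(** A non-zero self-adjoint element of [c K] is invertible in it; such an element is [a + star a],
    or [a] itself if this sum is zero. *)
Lemma star_ideal (I : K -> Prop) : (forall a b, I a -> I b -> I (a + b)) ->
    (forall a b, I a -> I (a * b)) -> (forall a, I a -> I (star a)) ->
  (exists2 a, I a & a != 0 /\ a * c = a) -> I c.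
Proof.
move=> ID IM IS [a Ia [nza ac]].
suff [r [Ir rs rc nzr]] : exists r, [/\ I r, star r = r, r * c = r & r != 0].
  by case: pc => _ _ /(_ r rs rc nzr)[r' _ [_ <-]]; apply: IM.
have [E|nz] := eqVneq (a + star a) 0.
  exists a; split=> //; apply/eqP; rewrite eq_sym -subr_eq0 oppa //; exact/eqP.
exists (a + star a); split=> //; first by apply: ID => //; apply: IS.
  by rewrite starD starK addrC.
by rewrite mulrDl ac -[in X in _ + X]cs -starM ac.
Qed.

Lemma xfix_herm0 v u : xfix v -> act u c = u -> herm v u = 0.
Proof.
move=> fv uc; set h := herm v u.
have hc : h * c = h by rewrite -{1}cs -HMr uc.
have hx : h * xi = h by rewrite /h -HMl act_gen fv.
have hx' : h * star xi = h by rewrite -{1}hx -mulrA cyc_gen_star // mulr1.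
case: pc => _ _ inv; have [||r _ [_ Er]] := inv ((xi + star xi) * c) _ _ trace_xi_neq0.
- by rewrite starM starD starK cs addrC.
- by rewrite -mulrA cc.
by rewrite -hc -Er !mulrA mulrDr hx hx' addaa !mul0r.
Qed.

Lemma trace_onto u u1 : act u c = u -> herm u u1 != 0 -> forall a0, star a0 = a0 -> a0 * c = a0 ->
  exists k, herm u (act u1 k) + herm (act u1 k) u = a0.
Proof.
move=> uc nzh a0 a0s a0c; set h := herm u u1 in nzh.
have hc : h * c = h by rewrite -HMl uc.
have [k1 nz1] : exists k1, k1 * h + star (k1 * h) != 0.
  have [E|nz] := eqVneq (h + star h) 0; last by exists 1; rewrite mul1r.
  have hs : star h = h by apply/eqP; rewrite eq_sym -subr_eq0 oppa //; apply/eqP.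
  exists xi; rewrite starM hs -mulrDl; case: (pc) => _ _ /(_ h hs hc nzh)[h' _ [_ Eh]].
  apply: contra trace_xi_neq0 => /eqP E0; by rewrite -Eh mulrA E0 mul0r.
pose r := k1 * h + star (k1 * h); case: (pc) => _ _ inv.
have rc : r * c = r.
  by rewrite mulrDl -mulrA hc; congr (_ + _); rewrite starM -mulrA -[X in _ * X]starK starM starK cs hc.
have rs : star r = r by rewrite starD starK addrC.
have [r' rs' [_ Er]] := inv r rs rc nz1.
exists (star (k1 * r' * a0)); rewrite HMr starK HMl [herm u1 u]HC -/h.
rewrite !starM rs' a0s.
have -> : h * (k1 * r' * a0) + star h * (star k1 * r' * a0) = r * r' * a0.
  by rewrite /r starM; ring.
by rewrite Er mulrC.
Qed.

End Prim.

(** With [e] isotropic, [herm u e = 0] and [a + star a = herm u u], these maps preserve [herm], fix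
    [e] and act trivially on the orthogonal space of [e] modulo [e K]. The composition rule [heisM]
    is a Heisenberg group law whose cocycle is [herm u u']. *)
Definition heis e u a v := v + act u (herm v e) + act e (a * herm v e + herm v u).

Lemma heisD e u a v v' : heis e u a (v + v') = heis e u a v + heis e u a v'.
Proof.
rewrite /heis !HDl.
have -> : a * (herm v e + herm v' e) + (herm v u + herm v' u) =
  (a * herm v e + herm v u) + (a * herm v' e + herm v' u) by ring.
rewrite !actDr; apply/rowP=> j; rewrite !mxE; ring.
Qed.

Lemma heisM_act e u a v k : heis e u a (act v k) = act (heis e u a v) k.
Proof.
by rewrite /heis !HMl !actDl -!actM mulrDl mulrA.
Qed.

Lemma heisZ e u a (t : F) v : heis e u a (t *: v) = t *: heis e u a v.
Proof. by rewrite -!(act_const x) heisM_act. Qed.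

Lemma heisM e u a u' a' v : herm e e = 0 -> herm u e = 0 -> herm u' e = 0 ->
  heis e u' a' (heis e u a v) = heis e (u + u') (a + a' + herm u u') v.
Proof.
move=> ee ue ue'; have eu' : herm e u' = 0 by rewrite HC ue' star0.
rewrite {1}/heis; set v1 := heis e u a v.
have -> : herm v1 e = herm v e by rewrite /v1 /heis !HDl !HMl ue ee !mul0r !addr0.
have -> : herm v1 u' = herm v u' + herm u u' * herm v e.
  by rewrite /v1 /heis !HDl !HMl eu' mul0r addr0.
rewrite /v1 /heis HDr !actDl !actDr.
have -> : act e ((a + a' + herm u u') * herm v e) =
  act e (a * herm v e) + act e (a' * herm v e) + act e (herm u u' * herm v e).
  by rewrite -!actDr; congr act; ring.
by apply/rowP=> j; rewrite !mxE; ring.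
Qed.

Lemma heis0 e v : heis e 0 0 v = v.
Proof. by rewrite /heis act0l mul0r H0r !addr0 act0r addr0. Qed.

Lemma heis_herm e u a v w : herm e e = 0 -> herm u e = 0 -> a + star a = herm u u ->
  herm (heis e u a v) (heis e u a w) = herm v w.
Proof.
move=> ee ue ra; have eu : herm e u = 0 by rewrite HC ue star0.
rewrite /heis !HDl !HDr !HMl !HMr ee ue eu !starD !starM.
rewrite [herm u w]HC [herm e w]HC -ra; set A := herm v e; set A' := herm w e.
set b := herm v u; set b' := herm w u.
set X := (LHS).
have -> : X = herm v w + (b * star A' + b * star A') + (A * star a * star A' + A * star a * star A') +
   (A * star b' + A * star b') + (a * A * star A' + a * A * star A').
  by rewrite /X; ring.
by rewrite !addaa !addr0.
Qed.

Lemma heis_orth c e u a : prim c -> xi * c != c -> act e c = e -> act u c = u ->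
    herm e e = 0 -> herm u e = 0 -> a + star a = herm u u ->
  exists2 g : GL, g \in O & forall v, v *m GLval g = heis e u a v.
Proof.
move=> pc ntc ec uc ee ue ra; apply: (orth_of_fun qQ ndQ) => [v v'|t v|].
- exact: heisD.
- exact: heisZ.
(* The hermitian form controls the polar form only. The invariance of [Q] is recovered from the
   [x]-fixed vectors, on which the map is the identity. *)
apply: (orth_of_fixed char2 qQ Ox odd_x Ox) => [v v'|v w|v|v fv].
- exact: heisD.
- exact/eq_polar/heis_herm.
- by rewrite -!act_gen heisM_act.
by rewrite /heis !(xfix_herm0 pc ntc fv) // mulr0 addr0 act0r act0r !addr0.
Qed.

Definition kline v := [set act v a | a : K].

Lemma kline_props c v : prim c -> act v c = v -> herm v v != 0 ->
  [/\ subsp (kline v), nondeg (kline v) & vstable (kline v) x].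
Proof.
move=> pc vc nz; have [cc cs inv] := pc.
have hc : herm v v * c = herm v v by rewrite -HMl vc.
have [h' h's [h'c Eh]] := inv _ (herm_self char2 qQ Ox v) hc nz.
split.
- split=> [|_ _ /imsetP[a _ ->] /imsetP[b _ ->]|t _ /imsetP[a _ ->]]; apply/imsetP.
  + by exists 0; rewrite ?act0r.
  + by exists (a + b); rewrite ?actDr.
  by exists (a * cyc_const n t); rewrite ?actM ?act_const.
- move=> u; exists (act v (herm u v * h')); first by apply/imsetP; exists (herm u v * h').
  apply/perpPx=> _ /imsetP[a _ ->]; apply: (herm_polar char2 qQ (x := x)).
  have uc : herm u v * c = herm u v by rewrite -{1}cs -HMr vc.
  by rewrite HMr HDl HMl mulrCA [herm v v * h']Eh uc addaa mul0r.
by move=> _ /imsetP[a _ ->]; apply/imsetP; exists (a * xi); rewrite ?actM ?act_gen.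
Qed.

(** The line [y K] is nondegenerate and the elements of [GO W] are [K]-linear, so the stabilizer of
    [y] is the full group of the smaller space orthogonal to this line. *)
Lemma class_line W c y s : goodW W -> smaller Q x W -> prim c -> y \in W -> act y c = y ->
  herm y y != 0 -> adm W s -> y *m GLval s = y -> N2prop (GO W :&: vstab y)%G s.
Proof.
move=> gW sm pc Wy yc nz ad ys; have [sM nM Mx] := kline_props pc yc nz.
have [sW nW Wx] := gW.
have My : y \in kline y by apply/imsetP; exists 1; rewrite ?act1.
have sMW : kline y \subset W by apply/subsetP=> _ /imsetP[a _ ->]; apply: act_stable.
have nzy : y != 0 by apply: contra nz => /eqP->; rewrite H0l.
have gW' := splitM_good qQ Ox gW sM nM sMW Mx.
have [kM _] := sm _ gW' (splitM_card char2 qQ ndQ sMW nM My nzy).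
apply: (@N2_eq _ _ (GO (W :&: perp (kline y)))).
  apply/setP=> g; apply/idP/setIP=> [Hg|[Gg /vstabP yg]].
    have [Gg fg] := (splitM_GO char2 qQ ndQ Ox g gW sM nM sMW Mx).1 Hg.
    by split=> //; apply/vstabP/fg.
  apply/(splitM_GO char2 qQ ndQ Ox g gW sM nM sMW Mx); split=> // _ /imsetP[a _ ->].
  by have /GOP[_ cg _] := Gg; rewrite -act_comm // yg.
apply: class1_GO => //; first exact: classM1.
apply: adm_split => // _ /imsetP[a _ ->]; case: ad => _ xs _.
by rewrite act_inv // ys; apply/imsetP; exists (star a).
Qed.

End HeisAlgebra.

(** * Invariant Lagrangian subgroups for the hermitian form *)

Section Flag.
Variables (F : finFieldType) (m : nat).
Local Notation V := 'rV[F]_m.-1.+1.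
Local Notation GL := {'GL_m[F]}.
Variable Q : V -> F.
Hypotheses (char2 : 2%N \in [pchar F]) (qQ : is_quadratic_form Q) (ndQ : qnondegenerate Q).
Local Notation B := (polar Q).
Local Notation O := (qorth_group Q).
Variable x : GL.
Hypotheses (Ox : x \in O) (odd_x : odd #[x]%g).
Local Notation n := #[x]%g.
Local Notation K := (cyc_alg F n).
Local Notation xi := (cyc_gen F n).
Local Notation star := (@cyc_star F n).
Local Notation act := (@act F m x).
Local Notation herm := (@herm F m Q x).
Implicit Types (u v w e f : V) (g h s : GL) (W M U : {set V}).
Let addvv := @addvv F m char2.
Let oppv := @oppv F m char2.
Let addff := @addff F char2.
Let n_gt0 : (0 < n)%N. Proof. exact: order_gt0. Qed.
Implicit Types (a b k r : K).
Let starD := @cyc_starD F n n_gt0.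
Let starM := @cyc_starM F n n_gt0.
Let star0 := @cyc_star0 F n n_gt0.
Let starK := @cyc_starK F n n_gt0.
Let addaa := @addaa F m char2 x.
Let HDl := @hermDl F m Q char2 qQ x.
Let HDr := @hermDr F m Q char2 qQ x Ox.
Let HMl := @hermMl F m Q char2 qQ x.
Let HMr := @hermMr F m Q char2 qQ x Ox.
Let HC := @hermC F m Q char2 qQ x Ox.
Let H0l := @herm0l F m Q char2 qQ x.

Section FlagSec.
Variables (c : K) (U : {set V}) (D : {group GL}) (s : GL).
Hypotheses (pc : prim c) (ntc : xi * c != c).
Hypotheses (sU : subsp U) (Ua : forall u a, u \in U -> act u a \in U).
Hypotheses (Uc : {in U, forall u, act u c = u}).
Hypothesis nU : {in U, forall u, {in U, forall u', B u' u = 0} -> u = 0}.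
Hypotheses (D2 : (2.-group D)%g) (tw : twists s D).
Hypotheses (DO : {in D, forall g, g \in O}) (Dx : {in D, forall g, commute g x}).
Hypotheses (DU : {in D, forall g, vstable U g}).
Hypotheses (Os : s \in O) (xs : (x ^ s = x^-1)%g) (Us : vstable U s).
Let cc : c * c = c. Proof. by case: pc. Qed.
Let cs : star c = c. Proof. by case: pc. Qed.

Definition Kc := [set a : K | a * c == a].
Definition Kp := [set a : K | (a * c == a) && (star a == a)].

Lemma KcP a : reflect (a * c = a) (a \in Kc). Proof. by rewrite inE; apply: eqP. Qed.
Lemma KpP a : reflect (a * c = a /\ star a = a) (a \in Kp).
Proof. by rewrite inE; apply: (iffP andP) => [[/eqP ? /eqP ?]|[? ?]]; split=> //; apply/eqP. Qed.

(** [c K] is the direct sum of its self-adjoint part and [t] times that part, where [t] has trace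
    [c]. *)
Lemma card_Kc : #|Kc| = (#|Kp| ^ 2)%N.
Proof.
have [t tc tt] := trace_one char2 odd_x pc ntc.
pose f (p : K * K) := p.1 + t * p.2.
have -> : Kc = f @: setX Kp Kp.
  apply/setP=> a; apply/KcP/imsetP=> [ac|[[k l] /setXP[/KpP[kc ks] /KpP[lc ls]] ->]]; last first.
    by rewrite /f /= mulrDl kc -mulrA lc.
  have sac : star a * c = star a by rewrite -{1}cs -starM ac.
  exists (a + t * (a + star a), a + star a).
    apply/setXP; split; apply/KpP; last first.
      by rewrite mulrDl ac sac starD starK addrC.
    split; first by rewrite mulrDl ac -mulrA mulrDl ac sac.
    apply/eqP; rewrite -subr_eq0 oppa // starD starM starD starK.
    have -> : star a + star t * (star a + a) + (a + t * (a + star a)) =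
      (a + star a) + (t + star t) * (a + star a) by ring.
    by rewrite tt mulrC mulrDl ac sac addaa.
  by rewrite /f /= -addrA addaa addr0.
rewrite card_in_imset ?cardsX // => [[k l] [k' l']] /setXP[/KpP[kc ks] /KpP[lc ls]].
move=> /setXP[/KpP[kc' ks'] /KpP[lc' ls']]; rewrite /f /= => E.
have El : l = l'.
  have E2 := congr1 star E; rewrite !starD !starM ks ks' ls ls' in E2.
  have : k + t * l + (k + star t * l) = k' + t * l' + (k' + star t * l') by rewrite E E2.
  have e p q : p + t * q + (p + star t * q) = (t + star t) * q by rewrite addrACA addaa add0r mulrDl.
  by rewrite !e tt !(mulrC c) lc lc'.
by move: E; rewrite El => /addIr ->.
Qed.

Definition isotropic_flag (Y : {set V}) := [&& Y \subset U, 0 \in Y,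
  [forall u in Y, forall v in Y, (u + v \in Y) && (herm u v == 0)],
  [forall u in Y, forall a : K, act u a \in Y],
  [forall u in Y, forall g in D, u *m GLval g \in Y] & [forall u in Y, u *m GLval s \in Y]].

Lemma isoP (Y : {set V}) : reflect ([/\ Y \subset U, addset Y & {in Y &, forall u v, herm u v = 0}] /\
  [/\ forall u a, u \in Y -> act u a \in Y, {in D, forall g, vstable Y g} & vstable Y s])
  (isotropic_flag Y).
Proof.
apply: (iffP idP) => [/and5P[YU Y0 /forall_inP h1 /forall_inP h2 /andP[/forall_inP h3 /forall_inP h4]]|].
  split; split=> //.
  - by split=> // u v Yu Yv; have /forall_inP/(_ v Yv)/andP[] := h1 u Yu.
  - by move=> u v Yu Yv; have /forall_inP/(_ v Yv)/andP[_ /eqP] := h1 u Yu.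
  - by move=> u a Yu; have /forallP := h2 u Yu.
  by move=> g Dg u Yu; have /forall_inP := h3 u Yu; apply.
move=> [[YU [Y0 YD] Yh] [Ya YDg Ys]]; apply/and5P; split=> //.
- apply/forall_inP=> u Yu; apply/forall_inP=> v Yv.
  by rewrite YD // Yh // eqxx.
- by apply/forall_inP=> u Yu; apply/forallP=> a; apply: Ya.
apply/andP; split; last by apply/forall_inP.
by apply/forall_inP=> u Yu; apply/forall_inP=> g Dg; apply: YDg.
Qed.

(** [T] is a Lagrangian for the commutator form [herm u v + herm v u], and [D] and [s] act trivially
    on [T] modulo [Y]. If [Y] is a maximal invariant isotropic submodule, its orthogonal has rank at
    most 1 over [Y], since two orthogonal fixed anisotropic vectors would combine to an isotropic
    one. In rank 1, the self-adjoint multiples of a fixed generator provide the missing half. *)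
Lemma flag_exists : exists Y T : {set V},
  [/\ addset Y, addset T, Y \subset T, T \subset U & (#|T| ^ 2 = #|U|)%N] /\
  [/\ {in T & Y, forall t y, herm t y = 0}, {in T &, forall t t', herm t t' = herm t' t},
    {in T & D, forall t g, t *m GLval g + t \in Y} & {in T, forall t, t *m GLval s + t \in Y}].
Proof.
have [U0 UD UZ] := sU; have [psi [psi0 psiD psi2 psint]] := additive_char_exists char2.
have [|Y /maxsetP[/isoP[[YU aY Yh] [Ya YDg Ys]] Ymax] _] := @maxset_exists _ isotropic_flag [set 0].
  apply/isoP; split; split; first by rewrite sub1set.
  - by split=> [|u v /set1P-> /set1P->]; rewrite ?addr0 inE.
  - by move=> u v /set1P-> _; rewrite H0l.
  - by move=> u a /set1P->; rewrite act0l inE.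
  - by move=> g _ u /set1P->; rewrite mul0mx inE.
  by move=> u /set1P->; rewrite mul0mx inE.
have [Y0 YD] := aY.
have YZ (a : F) y : y \in Y -> a *: y \in Y by move=> Yy; rewrite -(act_const x); apply: Ya.
have sY : subsp Y by split.
pose Yp := [set u in U | [forall y in Y, B u y == 0%R]].
have YpP u : reflect (u \in U /\ {in Y, forall y, herm u y = 0}) (u \in Yp).
  apply: (iffP setIdP) => [[Uu /forall_inP h]|[Uu h]]; split=> //.
    move=> y Yy; apply: (herm_eq0 char2 qQ) => a; rewrite act_adj //.
    by apply/eqP/h/Ya.
  by apply/forall_inP=> y Yy; apply/eqP/(herm_polar char2 qQ (x := x))/h.
have cYp : (#|Y| * #|Yp| = #|U|)%N.
  apply: (perp_card char2 qQ psi0 psiD psint sY sU) => y Yy h.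
  by apply: nU => //; apply: (subsetP YU).
have YYp : Y \subset Yp.
  by apply/subsetP=> y Yy; apply/YpP; split; [apply: (subsetP YU) | move=> y' Yy'; apply: Yh].
have sYp : subsp Yp.
  split=> [|u v /YpP[Uu hu] /YpP[Uv hv]|a v /YpP[Uv hv]]; apply/YpP.
  - by split=> // y Yy; rewrite H0l.
  - by split=> [|y Yy]; [exact: UD | rewrite HDl hu ?hv ?addr0].
  by split=> [|y Yy]; [exact: UZ | rewrite -(act_const x) HMl hv // mul0r].
have Ypa u a : u \in Yp -> act u a \in Yp.
  by move=> /YpP[Uu hu]; apply/YpP; split=> [|y Yy]; [exact: Ua | rewrite HMl hu // mul0r].
have [Yp0 YpD YpZ] := sYp.
have YpDg g : g \in D -> vstable Yp g.
  move=> Dg u /YpP[Uu hu]; apply/YpP; split; first exact: DU.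
  move=> y Yy; have YV := vstableV (YDg g Dg) Yy.
  by rewrite -(mulmxGKV y g) (herm_comm char2 qQ _ _ (DO Dg) (Dx Dg)) hu.
have Yps : vstable Yp s.
  move=> u /YpP[Uu hu]; apply/YpP; split; first exact: Us.
  move=> y Yy; have YV := vstableV Ys Yy.
  by rewrite -(mulmxGKV y s) (herm_inv char2 qQ _ _ Os xs) hu // star0.
pose fixY v := {in D, forall g, v *m GLval g + v \in Y} /\ v *m GLval s + v \in Y.
(* An isotropic vector fixed modulo [Y] could be adjoined to [Y], against maximality. *)
have grow v : v \in Yp -> fixY v -> herm v v = 0 -> v \in Y.
  move=> Ypv [fD fs] hv; pose Y2 := [set y + act v a | y in Y, a in [set: K]].
  have Y2P z : reflect (exists y a, y \in Y /\ z = y + act v a) (z \in Y2).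
    apply: (iffP imset2P) => [[y a Yy _ ->]|[y [a [Yy ->]]]]; first by exists y, a.
    by exists y a.
  have [Uv hvY] := YpP v Ypv.
  have hYv y : y \in Y -> herm y v = 0 by move=> Yy; rewrite HC hvY // star0.
  have sY2 : Y \subset Y2.
    by apply/subsetP=> y Yy; apply/Y2P; exists y, 0; rewrite act0r addr0.
  rewrite -(Ymax Y2) //; first by apply/Y2P; exists 0, 1; rewrite act1 add0r.
  apply/isoP; split; split.
  - by apply/subsetP=> _ /Y2P[y [a [Yy ->]]]; rewrite UD ?Ua // (subsetP YU).
  - split; first exact: (subsetP sY2).
    move=> _ _ /Y2P[y [a [Yy ->]]] /Y2P[y' [a' [Yy' ->]]]; apply/Y2P.
    by exists (y + y'), (a + a'); rewrite YD // actDr addrACA.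
  - move=> _ _ /Y2P[y [a [Yy ->]]] /Y2P[y' [a' [Yy' ->]]].
    by rewrite !HDl !HDr !HMl !HMr Yh // hv hvY // hYv // !mul0r !addr0.
  - move=> _ b /Y2P[y [a [Yy ->]]]; apply/Y2P; exists (act y b), (a * b).
    by rewrite actDl actM Ya.
  - move=> g Dg _ /Y2P[y [a [Yy ->]]]; apply/Y2P.
    exists (y *m GLval g + act (v *m GLval g + v) a), a; split.
      by rewrite YD ?YDg // Ya // fD.
    by rewrite mulmxDl -(act_comm _ _ (Dx Dg)) actDl -!addrA addvv addr0.
  move=> _ /Y2P[y [a [Yy ->]]]; apply/Y2P.
  exists (y *m GLval s + act (v *m GLval s + v) (star a)), (star a); split.
    by rewrite YD ?Ys // Ya.
  by rewrite mulmxDl (act_inv _ _ xs) actDl -!addrA addvv addr0.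
have aYp : addset Yp by split.
have [YpY|] := boolP (Yp \subset Y).
  have E : Yp = Y by apply/eqP; rewrite eqEsubset YpY.
  exists Y, Y; split; split=> //.
  - by rewrite -mulnn -{2}E.
  - by move=> t t' Yt Yt'; rewrite !Yh.
  - by move=> t g Yt Dg; rewrite YD ?YDg.
  by move=> t Yt; rewrite YD ?Ys.
move=> /subsetPn ex.
have [v [Ypv nYv fD fs]] := fix_coset_twists char2 D2 tw aY aYp YDg YpDg Ys Yps ex.
have [Uv hvY] := YpP v Ypv; have vc := Uc Uv.
have hYv y : y \in Y -> herm y v = 0 by move=> Yy; rewrite HC hvY // star0.
have nzh : herm v v != 0 by apply: contraNneq nYv => h0; apply: grow.
have hs := herm_self char2 qQ Ox v.
have hc : herm v v * c = herm v v by rewrite -HMl vc.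
have [h' h's [h'c Eh]] : exists2 r', star r' = r' & r' * c = r' /\ herm v v * r' = c.
  by case: pc => _ _ inv; apply: inv.
pose Y1 := [set u in Yp | herm u v == 0].
have Y1P u : reflect (u \in Yp /\ herm u v = 0) (u \in Y1).
  by apply: (iffP setIdP) => [[? /eqP]|[? E]]; split=> //; apply/eqP.
have Y1Y : Y1 \subset Y.
  apply: contraTT isT => /subsetPn ex1.
  have aY1 : addset Y1.
    split=> [|u u' /Y1P[Yu hu] /Y1P[Yu' hu']]; apply/Y1P; first by rewrite H0l.
    by split; [exact: YpD | rewrite HDl hu hu' addr0].
  have Y1D : {in D, forall g, vstable Y1 g}.
    move=> g Dg u /Y1P[Yu hu]; apply/Y1P; split; first exact: YpDg.
    have Yg := fD g Dg; have [_ hug] := YpP _ (YpDg g Dg u Yu).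
    have := hug _ Yg; rewrite HDr (herm_comm char2 qQ _ _ (DO Dg) (Dx Dg)) hu add0r //.
  have Y1s : vstable Y1 s.
    move=> u /Y1P[Yu hu]; apply/Y1P; split; first exact: Yps.
    have [_ hus] := YpP _ (Yps u Yu).
    by have := hus _ fs; rewrite HDr (herm_inv char2 qQ _ _ Os xs) hu star0 add0r.
  have [v' [Y1v' nYv' fD' fs']] := fix_coset_twists char2 D2 tw aY aY1 YDg Y1D Ys Y1s ex1.
  have /Y1P[Ypv' hv'v] := Y1v'; have [Uv' hv'Y] := YpP v' Ypv'.
  have nzh' : herm v' v' != 0 by apply: contraNneq nYv' => h0; apply: grow.
  have hs' := herm_self char2 qQ Ox v'.
  have hc' : herm v' v' * c = herm v' v' by rewrite -HMl Uc.
  have [g' g's [g'c Eg]] : exists2 r', star r' = r' & r' * c = r' /\ herm v' v' * r' = c.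
    by case: pc => _ _ inv; apply: inv.
  (* The coefficient [t] is the square root of [herm v v] over [herm v' v'], which makes
     [v + act v' t] isotropic. It has to be self-adjoint for [s] to fix this vector modulo [Y],
     since [s] is semilinear. *)
  have rs : star (herm v v * g') = herm v v * g' by rewrite starM hs g's.
  have [t ts [tt tc]] := sqrt_self char2 odd_x rs.
  pose v2 := v + act v' t.
  have hvv' : herm v v' = 0 by rewrite HC hv'v star0.
  have h2 : herm v2 v2 = 0.
    rewrite /v2 !HDl !HDr !HMl !HMr hvv' hv'v !mul0r addr0 add0r ts -mulrA tt.
    by rewrite mulrCA Eg hc addaa.
  have f2 : fixY v2.
    split=> [g Dg|].
      have -> : v2 *m GLval g + v2 = (v *m GLval g + v) + act (v' *m GLval g + v') t.
        by rewrite /v2 mulmxDl -(act_comm _ _ (Dx Dg)) actDl addrACA.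
      by rewrite YD ?fD // Ya // fD'.
    have -> : v2 *m GLval s + v2 = (v *m GLval s + v) + act (v' *m GLval s + v') t.
      by rewrite /v2 mulmxDl (act_inv _ _ xs) ts actDl addrACA.
    by rewrite YD // Ya.
  have Yv2 : v2 \in Y by apply: grow => //; rewrite YpD ?Ypa.
  have : herm v2 v = 0 by apply: hYv.
  by rewrite /v2 HDl HMl hv'v mul0r addr0 => /eqP; rewrite (negPf nzh).
have inj (A1 : {set K}) : A1 \subset Kc -> #|[set y + act v a | y in Y, a in A1]| = (#|Y| * #|A1|)%N.
  move=> sA; rewrite curry_imset2X card_in_imset ?cardsX // => [[y a] [y' a']].
  move=> /setXP[Yy /= Aa] /setXP[Yy' /= Aa'] E.
  have /KcP ac := subsetP sA _ Aa; have /KcP ac' := subsetP sA _ Aa'.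
  have E' : y + act v a = y' + act v a' := E.
  have : herm (y + act v a) v = herm (y' + act v a') v by rewrite E'.
  rewrite !HDl !HMl (hYv y Yy) (hYv y' Yy') !add0r => Ea.
  have Eaa : a = a'.
    by rewrite -ac -ac' -Eh ![_ * (herm v v * _)]mulrA ![_ * herm v v]mulrC Ea.
  by move: E'; rewrite Eaa => /addIr ->.
pose T := [set y + act v a | y in Y, a in Kp].
have TP z : reflect (exists y a, [/\ y \in Y, a * c = a, star a = a & z = y + act v a]) (z \in T).
  apply: (iffP imset2P) => [[y a Yy /KpP[ac as_] ->]|[y [a [Yy ac as_ ->]]]]; first by exists y, a.
  by exists y a => //; apply/KpP.
have cYp2 : #|Yp| = (#|Y| * #|Kc|)%N.
  rewrite -inj //; congr #|pred_of_set _|; apply/setP=> u; apply/idP/imset2P=> [Yu|[y a Yy _ ->]].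
    have [Uu huY] := YpP u Yu; pose a := herm u v * h'.
    have ac : a * c = a by rewrite /a -mulrA h'c.
    have Y1u : u + act v a \in Y1.
      apply/Y1P; split; first by rewrite YpD ?Ypa.
      have uc : herm u v * c = herm u v by rewrite -{1}cs -HMr vc.
      by rewrite HDl HMl mulrCA Eh uc addaa.
    exists (u + act v a) a; [exact: (subsetP Y1Y) | exact/KcP |].
    by rewrite -addrA addvv addr0.
  by rewrite YpD ?Ypa // (subsetP YYp).
exists Y, T; split; split=> //.
- split; first by apply/TP; exists 0, 0; split; rewrite ?mul0r ?star0 ?act0r ?addr0.
  move=> _ _ /TP[y [a [Yy ac as_ ->]]] /TP[y' [a' [Yy' ac' as' ->]]]; apply/TP.
  exists (y + y'), (a + a'); split; [exact: YD | by rewrite mulrDl ac ac' | by rewrite starD as_ as' |].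
  by rewrite actDr addrACA.
- by apply/subsetP=> y Yy; apply/TP; exists y, 0; split; rewrite ?mul0r ?star0 ?act0r ?addr0.
- by apply/subsetP=> _ /TP[y [a [Yy _ _ ->]]]; rewrite UD ?Ua // (subsetP YU).
- have -> : #|T| = (#|Y| * #|Kp|)%N by apply: inj; apply/subsetP=> a /KpP[? _]; apply/KcP.
  by rewrite -cYp cYp2 card_Kc expnMn mulnA mulnn.
- by move=> _ y /TP[y' [a [Yy' _ _ ->]]] Yy; rewrite HDl HMl Yh // hvY // mul0r addr0.
- move=> _ _ /TP[y [a [Yy ac as_ ->]]] /TP[y' [a' [Yy' ac' as' ->]]].
  rewrite !HDl !HDr !HMl !HMr (Yh y y') // (Yh y' y) // (hYv y Yy) (hYv y' Yy').
  rewrite (hvY y Yy) (hvY y' Yy') as_ as'; ring.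
- move=> _ g /TP[y [a [Yy ac as_ ->]]] Dg.
  have -> : (y + act v a) *m GLval g + (y + act v a) = (y *m GLval g + y) + act (v *m GLval g + v) a.
    by rewrite mulmxDl -(act_comm _ _ (Dx Dg)) actDl addrACA.
  by rewrite !YD ?YDg // Ya // fD.
move=> _ /TP[y [a [Yy ac as_ ->]]].
have -> : (y + act v a) *m GLval s + (y + act v a) = (y *m GLval s + y) + act (v *m GLval s + v) a.
  by rewrite mulmxDl (act_inv _ _ xs) as_ actDl addrACA.
by rewrite !YD ?Ys // Ya.
Qed.

End FlagSec.
End Flag.

(** * Stabilizers of isotropic vectors for the hermitian form *)

Section Class3.
Variables (F : finFieldType) (m : nat).
Local Notation V := 'rV[F]_m.-1.+1.
Local Notation GL := {'GL_m[F]}.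
Variable Q : V -> F.
Hypotheses (char2 : 2%N \in [pchar F]) (qQ : is_quadratic_form Q) (ndQ : qnondegenerate Q).
Local Notation B := (polar Q).
Local Notation O := (qorth_group Q).
Variable x : GL.
Hypotheses (Ox : x \in O) (odd_x : odd #[x]%g).
Local Notation n := #[x]%g.
Local Notation K := (cyc_alg F n).
Local Notation xi := (cyc_gen F n).
Local Notation star := (@cyc_star F n).
Local Notation act := (@act F m x).
Local Notation herm := (@herm F m Q x).
Local Notation perp := (@perp F m Q).
Local Notation nondeg := (@nondeg F m Q).
Implicit Types (u v w e f : V) (g h s : GL) (W M U : {set V}).
Let addvv := @addvv F m char2.
Let oppv := @oppv F m char2.
Let addff := @addff F char2.
Let BDl := @polarDl F m Q qQ.
Let BDr := @polarDr F m Q qQ.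
Let perpPx := @perpP F m Q.
Let n_gt0 : (0 < n)%N. Proof. exact: order_gt0. Qed.
Local Notation GO := (@GO F m Q x).
Local Notation goodW := (@goodW F m Q x).
Local Notation adm := (@adm F m Q x).
Local Notation xfix := (@xfix F m x).
Implicit Types (a b k r : K).
Let starD := @cyc_starD F n n_gt0.
Let starM := @cyc_starM F n n_gt0.
Let star0 := @cyc_star0 F n n_gt0.
Let starK := @cyc_starK F n n_gt0.
Let addaa := @addaa F m char2 x.
Let HDl := @hermDl F m Q char2 qQ x.
Let HDr := @hermDr F m Q char2 qQ x Ox.
Let HMl := @hermMl F m Q char2 qQ x.
Let HMr := @hermMr F m Q char2 qQ x Ox.
Let HC := @hermC F m Q char2 qQ x Ox.
Let H0l := @herm0l F m Q char2 qQ x.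
Let H0r := @herm0r F m Q char2 qQ x Ox.

Local Notation heisx := (@heis F m Q x).

Lemma class3_partner W c e s : goodW W -> prim c -> xi * c != c -> e \in W -> act e c = e ->
    e != 0 -> herm e e = 0 -> adm W s -> e *m GLval s = e ->
  exists f, [/\ f \in W, act f c = f, herm e f = c & herm f f = 0].
Proof.
move=> [sW nW Wx] pc ntc We ec nze hee [Os xs Ws] es; have [W0 WD WZ] := sW.
have [cc cs _] := pc.
have [f1 Wf1 Ef1] : exists2 u, u \in W & herm e u = c.
  apply: (star_ideal char2 pc (I := fun a => exists2 u, u \in W & herm e u = a)).
  - by move=> _ _ [u Wu <-] [u' Wu' <-]; exists (u + u'); rewrite ?WD ?HDr.
  - move=> _ b [u Wu <-]; exists (act u (star b)); first exact: act_stable.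
    by rewrite HMr starK.
  - move=> _ [u Wu <-]; exists (u *m GLval s); first exact: Ws.
    by rewrite -{1}es (herm_inv char2 qQ _ _ Os xs).
  have [u Wu Beu] := nondegP char2 qQ ndQ sW nW We nze.
  exists (herm e u); first by exists u.
  split; last by rewrite -HMl ec.
  apply/eqP=> /(herm_polar char2 qQ) E; by move/eqP: Beu; rewrite E eq_sym oner_eq0.
have [t tc tt] := trace_one char2 odd_x pc ntc.
have [f2 [Wf2 f2c Ef2]] : exists f2, [/\ f2 \in W, act f2 c = f2 & herm e f2 = c].
  by exists (act f1 c); rewrite act_stable // -actM cc HMr Ef1 cs cc.
have Ef2' : herm f2 e = c by rewrite HC Ef2 cs.
pose h1 := herm f2 f2.
have h1c : h1 * c = h1 by rewrite -HMl f2c.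
have h1s : star h1 = h1 := herm_self char2 qQ Ox f2.
(* The correction adds to [h1 = herm f2 f2] the trace of [t * h1], which is again [h1]. *)
exists (f2 + act e (t * h1)); split.
- by rewrite WD // act_stable.
- by rewrite actDl f2c -actM -mulrA h1c.
- by rewrite HDr HMr hee mul0r addr0.
rewrite !HDl !HDr !HMl !HMr hee Ef2 Ef2' -/h1 starM h1s.
have -> : h1 + c * (star t * h1) + (c * (t * h1) + 0 * (star t * h1) * (t * h1)) =
  h1 + (t + star t) * (h1 * c) by ring.
by rewrite h1c tt mulrC h1c addaa.
Qed.

Definition kplane e f := [set act e p.1 + act f p.2 | p : K * K].

Lemma kplaneP e f v : reflect (exists a b, v = act e a + act f b) (v \in kplane e f).
Proof.
by apply: (iffP imsetP) => [[[a b] _ ->]|[a [b ->]]]; [exists a, b | exists (a, b)].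
Qed.

Lemma kplane_props c e f : star c = c -> act e c = e -> act f c = f ->
    herm e f = c -> herm e e = 0 -> herm f f = 0 ->
  [/\ subsp (kplane e f), nondeg (kplane e f) & vstable (kplane e f) x].
Proof.
move=> cs ec fc ef ee ff; have fe : herm f e = c by rewrite HC ef cs.
split.
- split=> [|_ _ /kplaneP[a [b ->]] /kplaneP[a' [b' ->]]|t _ /kplaneP[a [b ->]]]; apply/kplaneP.
  + by exists 0, 0; rewrite !act0r addr0.
  + by exists (a + a'), (b + b'); rewrite !actDr addrACA.
  by exists (a * cyc_const n t), (b * cyc_const n t); rewrite !actM !act_const scalerDr.
- move=> v; exists (act e (herm v f) + act f (herm v e)).
    by apply/kplaneP; exists (herm v f), (herm v e).
  have vec : herm v e * c = herm v e by rewrite -{1}cs -HMr ec.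
  have vfc : herm v f * c = herm v f by rewrite -{1}cs -HMr fc.
  apply/perpPx=> _ /kplaneP[a [b ->]]; apply: (herm_polar char2 qQ (x := x)).
  rewrite HDr !HMr !HDl !HMl ee ff ef fe !mul0r add0r addr0 ![c * _]mulrC vec vfc.
  by rewrite !addaa !mul0r addr0.
move=> _ /kplaneP[a [b ->]]; apply/kplaneP; exists (a * xi), (b * xi).
by rewrite !actM !act_gen mulmxDl.
Qed.

Lemma kplane_perp e f v : v \in perp (kplane e f) <-> herm v e = 0 /\ herm v f = 0.
Proof.
split=> [/perpPx pv|[ve vf]].
  split; apply: (herm_eq0 char2 qQ) => a; rewrite act_adj //; apply: pv; apply/kplaneP.
    by exists (star a), 0; rewrite act0r addr0.
  by exists 0, (star a); rewrite act0r add0r.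
apply/perpPx=> _ /kplaneP[a [b ->]]; apply: (herm_polar char2 qQ (x := x)).
by rewrite HDr !HMr ve vf !mul0r addr0.
Qed.

Lemma lin_char_abelian_ext (gT : finGroupType) (A D : {group gT}) (l : 'CF(D)) :
  D \subset A -> abelian A -> l \is a linear_char ->
  exists2 l' : 'CF(A), l' \is a linear_char & {in D, l' =1 l}.
Proof.
move=> sDA abA ll; have /irrP[d Ed] := lin_char_irr ll.
have [t tc] : exists t, t \in irr_constt ('Ind[A] 'chi_d).
  by apply/neq0_has_constt; rewrite cfInd_eq0 ?irr_char // irr_neq0.
have lt : 'chi_t \is a linear_char by apply/char_abelianP.
exists 'chi_t => // g Dg; rewrite Ed -(cfResE _ sDA Dg); congr (fun_of_cfun _ g).
have /irrP[d' Ed'] : 'Res[D] 'chi_t \in irr D by rewrite lin_char_irr ?cfRes_lin_char.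
move: tc; rewrite constt_Ind_Res irr_consttE Ed' cfdot_irr.
by have [->//|_] := eqVneq d' d; rewrite /= eqxx.
Qed.

Section Step.
Variables (W : {set V}) (c : K) (e f : V).
Hypotheses (gW : goodW W) (pc : prim c) (ntc : xi * c != c).
Hypotheses (We : e \in W) (ec : act e c = e) (hee : herm e e = 0) (nze : e != 0).
Hypotheses (Wf : f \in W) (fc : act f c = f) (hef : herm e f = c) (hff : herm f f = 0).

Let sW : subsp W. Proof. by case: gW. Qed.
Let nW : nondeg W. Proof. by case: gW. Qed.
Let Wx : vstable W x. Proof. by case: gW. Qed.
Let cc : c * c = c. Proof. by case: pc. Qed.
Let cs : star c = c. Proof. by case: pc. Qed.
Let hfe : herm f e = c. Proof. by rewrite HC hef cs. Qed.
Let M := kplane e f.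
Let Mprops : [/\ subsp M, nondeg M & vstable M x]. Proof. exact: kplane_props hef hee hff. Qed.
Let sMW : M \subset W.
Proof. by case: sW => _ WD _; apply/subsetP=> _ /kplaneP[a [b ->]]; rewrite WD ?act_stable. Qed.
Let Me : e \in M. Proof. by apply/kplaneP; exists 1, 0; rewrite act1 act0r addr0. Qed.
Let Mf : f \in M. Proof. by apply/kplaneP; exists 0, 1; rewrite act1 act0r add0r. Qed.
Let W' := W :&: perp M.
Let gW' : goodW W'. Proof. by case: Mprops => sM nM Mx; apply: splitM_good. Qed.
Let W'P v : reflect [/\ v \in W, herm v e = 0 & herm v f = 0] (v \in W').
Proof.
by apply: (iffP setIP) => [[Wv /kplane_perp[]]|[Wv ve vf]]; split=> //; apply/kplane_perp.
Qed.
Let U := [set u in W' | act u c == u].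
Let UP u : reflect (u \in W' /\ act u c = u) (u \in U).
Proof. by apply: (iffP setIdP) => [[? /eqP]|[? ?]]; split=> //; apply/eqP. Qed.
Let sU : subsp U.
Proof.
case: gW' => [[W0 WD WZ] _ _]; split=> [|u v /UP[Wu uc] /UP[Wv vc]|a v /UP[Wv vc]]; apply/UP.
- by rewrite act0l.
- by rewrite WD // actDl uc vc.
by rewrite WZ // actZl vc.
Qed.
Let Ua u a : u \in U -> act u a \in U.
Proof.
case: gW' => sW' _ W'x /UP[Wu uc]; apply/UP; split; first exact: act_stable.
by rewrite -actM mulrC actM uc.
Qed.
Let Ue u : u \in U -> herm u e = 0. Proof. by move=> /UP[/W'P[]]. Qed.
Let Uf u : u \in U -> herm u f = 0. Proof. by move=> /UP[/W'P[]]. Qed.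
Let Uc u : u \in U -> act u c = u. Proof. by move=> /UP[]. Qed.
Let UW u : u \in U -> u \in W. Proof. by move=> /UP[/W'P[]]. Qed.
Let ndU : nondeg U.
Proof.
case: gW' => sW' nW' W'x v; have [w W'w pvw] := nW' v.
exists (act w c); first by apply/UP; rewrite -actM cc; split=> //; apply: act_stable.
apply/perpPx=> u Uu; have [W'u uc] := UP u Uu.
by rewrite BDl act_adj // cs uc -BDl (perpPx _ _ pvw).
Qed.

Let Dp u a := [&& u \in U, a * c == a & a + star a == herm u u].
Let DpP u a : reflect [/\ u \in U, a * c = a & a + star a = herm u u] (Dp u a).
Proof. by apply: (iffP and3P) => [[? /eqP ? /eqP ?]|[? ? ?]]; split=> //; apply/eqP. Qed.

Lemma heis_nu_exists : exists nu : V -> K -> GL, forall u a, Dp u a ->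
  nu u a \in O /\ forall v, v *m GLval (nu u a) = heisx e u a v.
Proof.
exists (fun u a => odflt 1%g [pick g : GL | (g \in O) && [forall v, v *m GLval g == heisx e u a v]]).
move=> u a /DpP[Uu ac ra]; case: pickP => [g /andP[Og /forallP h]|none] /=.
  by split=> // v; apply/eqP.
have [g Og gE] := heis_orth char2 qQ ndQ Ox odd_x pc ntc ec (Uc Uu) hee (Ue Uu) ra.
by have /negP[] := none g; rewrite Og; apply/forallP=> v; apply/eqP.
Qed.

Variable nu : V -> K -> GL.
Hypothesis nuP : forall u a, Dp u a -> nu u a \in O /\ forall v, v *m GLval (nu u a) = heisx e u a v.

Let DpM u a u' a' : Dp (u) (a) -> Dp (u') (a') -> Dp (u + u') (a + a' + herm u u').
Proof.
case: sU => _ UD _ /DpP[Uu ac ra] /DpP[Uu' ac' ra']; apply/DpP; split.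
- exact: UD.
- by rewrite !mulrDl ac ac' -HMl Uc.
rewrite !HDl !HDr !starD -ra -ra' [herm u' u]HC; ring.
Qed.

Let nuM u a u' a' : Dp (u) (a) -> Dp (u') (a') ->
  (nu u a * nu u' a' = nu (u + u') (a + a' + herm u u'))%g.
Proof.
move=> Du Dq; have [_ E] := nuP Du; have [_ E'] := nuP Dq; have [_ E''] := nuP (DpM Du Dq).
have /DpP[Uu _ _] := Du; have /DpP[Uu' _ _] := Dq.
by apply: GL_eqP => v; rewrite mulmxGM E E' E'' (heisM char2 qQ Ox _ _ _ hee (Ue Uu) (Ue Uu')).
Qed.

Let Dp00 : Dp (0) (0).
Proof. by case: sU => U0 _ _; apply/DpP; rewrite mul0r star0 addr0 H0l. Qed.

Let nu1 : nu 0 0 = 1%g.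
Proof.
have [_ E] := nuP Dp00; apply: GL_eqP => v.
by rewrite E mulmxG1 heis0.
Qed.

Let fE u a : Dp (u) (a) -> f *m GLval (nu u a) = f + u + act e a.
Proof.
move=> Du; have [_ ->] := nuP Du; have /DpP[Uu ac _] := Du.
by rewrite /heis hfe Uc // ac HC Uf // star0 addr0.
Qed.

Let aE u a : Dp (u) (a) -> herm (f *m GLval (nu u a)) f = a.
Proof.
move=> Du; have /DpP[Uu ac _] := Du.
by rewrite fE // !HDl HMl hff hef Uf // !add0r mulrC.
Qed.

Let nu_inj u a u' a' : Dp (u) (a) -> Dp (u') (a') -> nu u a = nu u' a' -> u = u' /\ a = a'.
Proof.
move=> Du Dq E; have Ea : a = a' by rewrite -(aE Du) -(aE Dq) E.
split=> //; have := congr1 (fun g : GL => f *m GLval g) E.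
by rewrite !fE // Ea => /addIr/addrI.
Qed.

(** One construction for four groups: [T = U] gives [N], [T = [set 0]] gives its central part [Z],
    and the two members of the flag give the abelian subgroup [A0] and its subgroup [D1]. *)
Definition heis_set (T : {set V}) := [set nu p.1 p.2 | p : V * K & Dp p.1 p.2 && (p.1 \in T)].

Lemma heis_setP (T : {set V}) g : reflect (exists u a, [/\ Dp (u) (a), u \in T & g = nu u a]) (g \in heis_set T).
Proof.
apply: (iffP imsetP) => [[[u a]]|[u [a [Du Tu ->]]]].
  by rewrite inE => /andP[Du Tu] ->; exists u, a.
by exists (u, a) => //; rewrite inE; apply/andP.
Qed.

Lemma heis_group_set T : addset T -> group_set (heis_set T).
Proof.
move=> [T0 TD]; apply/group_setP; split=> [|_ _ /heis_setP[u [a [Du Tu ->]]] /heis_setP[u' [a' [Dq Tu' ->]]]].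
  by apply/heis_setP; exists 0, 0; split=> //; rewrite nu1.
apply/heis_setP; exists (u + u'), (a + a' + herm u u').
by split; [exact: DpM | exact: TD | rewrite nuM].
Qed.

Lemma heis_card (T : {set V}) : T \subset U -> #|heis_set T| = (#|T| * #|Kp c|)%N.
Proof.
move=> sTU; have [t tc tt] := trace_one char2 odd_x pc ntc.
pose h (p : V * K) := nu p.1 (t * herm p.1 p.1 + p.2).
have hD u k : u \in U -> k \in Kp c -> Dp (u) (t * herm u u + k).
  move=> Uu /KpP[kc ks]; have uuc : herm u u * c = herm u u by rewrite -HMl Uc.
  apply/DpP; split=> //; first by rewrite mulrDl kc -mulrA uuc.
  rewrite starD starM ks (herm_self char2 qQ Ox).
  have -> : t * herm u u + k + (star t * herm u u + k) = (t + star t) * herm u u + (k + k) by ring.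
  by rewrite tt addaa addr0 mulrC.
have -> : heis_set T = h @: setX T (Kp c).
  apply/setP=> g; apply/heis_setP/imsetP=> [[u [a [Du Tu ->]]]|[[u k] /setXP[Tu kk] ->]]; last first.
    by exists u, (t * herm u u + k); split=> //; apply: hD => //; apply: (subsetP sTU).
  have /DpP[Uu ac ra] := Du.
  exists (u, a + t * herm u u); last first.
    by rewrite /h /=; congr (nu _ _); rewrite addrCA addaa addr0.
  apply/setXP; split=> //; apply/KpP; have uuc : herm u u * c = herm u u by rewrite -HMl Uc.
  split; first by rewrite mulrDl ac -mulrA uuc.
  apply/eqP; rewrite -subr_eq0 oppa // starD starM (herm_self char2 qQ Ox).
  have -> : star a + star t * herm u u + (a + t * herm u u) = (a + star a) + (t + star t) * herm u u by ring.
  by rewrite ra tt mulrC uuc addaa.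
rewrite card_in_imset ?cardsX // => [[u k] [u' k']] /setXP[/= Tu kk] /setXP[/= Tu' kk'] E.
have [Eu Ea] := nu_inj (hD _ _ (subsetP sTU _ Tu) kk) (hD _ _ (subsetP sTU _ Tu') kk') E.
by move: Ea; rewrite Eu => /addrI ->.
Qed.

Let G := (GO W :&: vstab e)%G.
Let aU : addset U. Proof. by case: sU. Qed.
Let N := Group (heis_group_set aU).
Let a0 : addset [set (0 : V)].
Proof. by split=> [|u v /set1P-> /set1P->]; rewrite ?addr0 inE. Qed.
Let Z := Group (heis_group_set a0).
Let U0 : 0 \in U. Proof. by case: sU. Qed.

Let NP g : reflect (exists u a, Dp u a /\ g = nu u a) (g \in N).
Proof.
apply: (iffP (heis_setP _ _)) => [[u [a [Du _ ->]]]|[u [a [Du ->]]]]; exists u, a => //.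
by split=> //; case/DpP: Du.
Qed.
Let ZP g : reflect (exists a, Dp 0 a /\ g = nu 0 a) (g \in Z).
Proof.
apply: (iffP (heis_setP _ _)) => [[u [a [Du /set1P u0 ->]]]|[a [Du ->]]]; first by exists a; rewrite -u0.
by exists 0, a; rewrite inE.
Qed.

Let nuG u a : Dp u a -> nu u a \in G.
Proof.
move=> Du; have [On E] := nuP Du; have /DpP[Uu ac ra] := Du.
have eu : herm e u = 0 by rewrite HC Ue // star0.
apply/setIP; split; last first.
  by apply/vstabP; rewrite E /heis hee eu mulr0 addr0 !act0r !addr0.
apply/GOP; split=> // [|v pv].
  by apply: GL_eqP => v; rewrite !mulmxGM !E -!act_gen (heisM_act char2 qQ).
rewrite E /heis (herm_orth char2 qQ Ox sW Wx We pv) (herm_orth char2 qQ Ox sW Wx (UW Uu) pv).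
by rewrite mulr0 addr0 !act0r !addr0.
Qed.

Let conjE g u a : g \in O -> commute g x -> e *m GLval g = e -> Dp u a -> u *m GLval g \in U ->
  Dp (u *m GLval g) a /\ (nu u a ^ g = nu (u *m GLval g) a)%g.
Proof.
move=> Og cg eg Du Uug; have /DpP[Uu ac ra] := Du.
have Dug : Dp (u *m GLval g) a by apply/DpP; split=> //; rewrite (herm_comm char2 qQ _ _ Og cg).
split=> //; have [_ E] := nuP Du; have [_ E'] := nuP Dug.
apply: GL_eqP => v; rewrite conjgE !mulmxGM E E' /heis !mulmxDl mulmxGKV -!(act_comm _ _ cg) eg.
have Hg z : herm (v *m GLval (g^-1)%g) z = herm v (z *m GLval g).
  by rewrite -(herm_comm char2 qQ _ _ Og cg) mulmxGKV.
by rewrite !Hg eg.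
Qed.

Let conjS s u a : s \in O -> (x ^ s = x^-1)%g -> e *m GLval s = e -> Dp u a -> u *m GLval s \in U ->
  Dp (u *m GLval s) (star a) /\ (nu u a ^ s = nu (u *m GLval s) (star a))%g.
Proof.
move=> Os xs es Du Uus; have /DpP[Uu ac ra] := Du.
have Dus : Dp (u *m GLval s) (star a).
  apply/DpP; split=> //; first by rewrite -{1}cs -starM ac.
  by rewrite (herm_inv char2 qQ _ _ Os xs) -ra starD.
split=> //; have [_ E] := nuP Du; have [_ E'] := nuP Dus.
apply: GL_eqP => v; rewrite conjgE !mulmxGM E E' /heis !mulmxDl mulmxGKV !(act_inv _ _ xs) es.
have Hs z : star (herm (v *m GLval (s^-1)%g) z) = herm v (z *m GLval s).
  by rewrite -(herm_inv char2 qQ _ _ Os xs) mulmxGKV.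
by rewrite starD starM !Hs es.
Qed.

Let EL : GO W' :=: G :&: vstab f.
Proof.
case: Mprops => sM nM Mx; apply/setP=> g; apply/idP/setIP=> [Hg|[/setIP[Gg /vstabP eg] /vstabP fg]].
  have [Gg fg] := (splitM_GO char2 qQ ndQ Ox g gW sM nM sMW Mx).1 Hg.
  by split; [apply/setIP; split=> // |]; apply/vstabP/fg.
apply/(splitM_GO char2 qQ ndQ Ox g gW sM nM sMW Mx); split=> // _ /kplaneP[a [b ->]].
by have /GOP[_ cg _] := Gg; rewrite mulmxDl -!(act_comm _ _ cg) eg fg.
Qed.

Let heis_trans f' : f' \in W -> act f' c = f' -> herm e f' = c -> herm f' f' = 0 ->
  exists u a, Dp u a /\ f *m GLval (nu u a) = f'.
Proof.
(* The parameters are read off from [f' = f + u + act e a] ([fE]), where [a] must be [herm f' f]. *)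
move=> Wf' fc' ef' ff'; pose b := herm f' f; pose u := f + f' + act e b.
have bc : b * c = b by rewrite -HMl fc'.
have f'e : herm f' e = c by rewrite HC ef' cs.
have hff' : herm f f' = star b by rewrite HC.
have Uu : u \in U.
  apply/UP; split; last by rewrite !actDl fc fc' -actM bc.
  apply/W'P; split; first by case: sW => _ WD _; rewrite !WD // act_stable.
    by rewrite !HDl HMl hee hfe f'e mul0r addr0 addaa.
  by rewrite !HDl HMl hff hef -/b add0r [c * b]mulrC bc addaa.
have Dub : Dp u b.
  apply/DpP; split=> //; rewrite /u !HDl !HDr !HMl !HMr hff ff' hee hef ef' hfe f'e hff' -/b.
  rewrite !mul0r; set X := RHS.
  have -> : X = b + star b + (c * star b + c * star b) + (c * b + c * b) by rewrite /X; ring.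
  by rewrite !addaa !addr0.
exists u, b; split=> //; rewrite fE // /u.
have -> : f + (f + f' + act e b) + act e b = (f + f) + f' + (act e b + act e b).
  by apply/rowP=> j; rewrite !mxE; ring.
by rewrite !addvv add0r addr0.
Qed.

Let Gtrans g : g \in G -> exists u a, Dp u a /\ f *m GLval (nu u a) = f *m GLval g.
Proof.
move=> /setIP[Gg /vstabP eg]; have /GOP[Og cg _] := Gg; apply: heis_trans.
- exact: (GO_stable char2 qQ ndQ nW Gg).
- by rewrite (act_comm _ _ cg) fc.
- by rewrite -{1}eg (herm_comm char2 qQ _ _ Og cg).
by rewrite (herm_comm char2 qQ _ _ Og cg).
Qed.

Let LU g : g \in GO W' -> {in U, forall u, u *m GLval g \in U}.
Proof.
move=> Lg u /UP[W'u uc]; have /GOP[Og cg _] := Lg; case: gW' => _ nW' _.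
apply/UP; split; first exact: (GO_stable char2 qQ ndQ nW' Lg).
by rewrite (act_comm _ _ cg) uc.
Qed.

Let LP g : g \in GO W' -> [/\ g \in O, commute g x, e *m GLval g = e & f *m GLval g = f].
Proof.
move=> Lg; have /GOP[Og cg _] := Lg; move: Lg; rewrite EL => /setIP[/setIP[_ /vstabP eg] /vstabP fg].
by split.
Qed.

Let sNG : N \subset G. Proof. by apply/subsetP=> _ /NP[u [a [Du ->]]]; apply: nuG. Qed.

Let nNL : GO W' \subset 'N(N)%g.
Proof.
apply/subsetP=> g Lg; have [Og cg eg _] := LP Lg; rewrite inE; apply/subsetP.
move=> _ /imsetP[_ /NP[u [a [Du ->]]] ->]; have /DpP[Uu _ _] := Du.
have [Dug ->] := conjE Og cg eg Du (LU Lg Uu); apply/NP.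
by exists (u *m GLval g), a.
Qed.

Let defG : (N ><| GO W' = G)%g.
Proof.
rewrite EL; apply: regular_sdprod => //.
- apply/subsetP=> g Gg; have [u [a [Du Eu]]] := Gtrans (groupVr Gg).
  have Nn : nu u a \in N by apply/NP; exists u, a.
  have Lg : (nu u a * g)%g \in GO W'.
    rewrite EL; apply/setIP; split; first exact: (groupM (nuG Du) Gg).
    by apply/vstabP; rewrite mulmxGM Eu mulmxGKV.
  have nNV : ((nu u a)^-1)%g \in 'N(N)%g by rewrite groupV (subsetP (normG N) _ Nn).
  by rewrite -(mulKg (nu u a) g); apply: (@groupM _ 'N(N)%G _ _ nNV (subsetP nNL _ Lg)).
- move=> g Gg; have [u [a [Du Eu]]] := Gtrans Gg.
  by exists (nu u a) => //; apply/NP; exists u, a.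
move=> _ /NP[u [a [Du ->]]]; rewrite fE // => E.
have /DpP[Uu ac _] := Du.
have E0 : u + act e a = 0 by apply: (addrI f); rewrite addr0 addrA.
have Ea : a = 0.
  have := congr1 (fun z => herm z f) E0; rewrite /= HDl HMl Uf // hef H0l add0r mulrC ac //.
by move: E0; rewrite Ea act0r addr0 => ->; rewrite nu1.
Qed.

Let sZN : Z \subset N.
Proof. by apply/subsetP=> _ /ZP[a [Du ->]]; apply/NP; exists 0, a. Qed.

Let Z_star a : Dp 0 a -> star a = a.
Proof. by move/DpP=> [_ _]; rewrite H0l => /eqP; rewrite addr_eq0 oppa // => /eqP. Qed.

Let cZG : Z \subset 'Z(G)%g.
Proof.
apply/subsetP=> _ /ZP[a [Du ->]]; apply/setIP; split; first exact: nuG.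
apply/centP=> g /setIP[/GOP[Og cg _] /vstabP eg]; apply/commgP/conjg_fixP.
have [|_ ->] := conjE Og cg eg Du; first by rewrite mul0mx.
by rewrite mul0mx.
Qed.

Let sqN : {in N, forall g, (g ^+ 2)%g \in Z}.
Proof.
move=> _ /NP[u [a [Du ->]]]; rewrite expgS expg1 nuM //; apply/ZP.
exists (a + a + herm u u); rewrite addvv; split=> //.
by have := DpM Du Du; rewrite addvv.
Qed.

Let sqZ : {in Z, forall z, (z ^+ 2)%g = 1%g}.
Proof.
move=> _ /ZP[a [Du ->]]; rewrite expgS expg1 nuM // addvv addaa H0l addr0; exact: nu1.
Qed.

Let pN : (2.-group N)%g.
Proof.
apply/pgroupP=> p pr /(Cauchy pr)[g Ng og].
have : (#[g]%g %| 4)%N by rewrite order_dvdn (expgM g 2 2) (sqZ (sqN Ng)).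
by rewrite og (Euclid_dvdX 2 2 pr) dvdn_prime2 // andbT.
Qed.

Let comm_nu u a u' a' : Dp u a -> Dp u' a' ->
  Dp 0 (herm u u' + herm u' u) /\ [~ nu u a, nu u' a']%g = nu 0 (herm u u' + herm u' u).
Proof.
move=> Du Du'; have /DpP[Uu _ _] := Du; have /DpP[Uu' _ _] := Du'.
have Dz : Dp 0 (herm u u' + herm u' u).
  apply/DpP; split=> //; first by rewrite mulrDl -!HMl !Uc.
  by rewrite H0l starD -!HC [X in _ + X]addrC addaa.
split=> //; have E : (nu u' a' * nu u a * nu 0 (herm u u' + herm u' u) = nu u a * nu u' a')%g.
  rewrite (nuM Du' Du) (nuM (DpM Du' Du) Dz) (nuM Du Du') H0r !addr0 [u' + u]addrC.
  congr (nu _ _); rewrite -addrA [a' + a]addrC; congr (_ + _).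
  by rewrite addrCA addaa addr0.
by rewrite commgEl conjgE -E !mulgA mulgKV mulVg mul1g.
Qed.

Section WithS.
Variable s : GL.
Hypotheses (sm : smaller Q x W) (ad : adm W s) (es : e *m GLval s = e) (fs : f *m GLval s = f).
Let Os : s \in O. Proof. by case: ad. Qed.
Let xs : (x ^ s = x^-1)%g. Proof. by case: ad. Qed.
Let ad' : adm W' s.
Proof.
apply: adm_split => // _ /kplaneP[a [b ->]]; apply/kplaneP; exists (star a), (star b).
by rewrite mulmxDl !(act_inv _ _ xs) es fs.
Qed.
Let Us : vstable U s.
Proof.
move=> u /UP[W'u uc]; apply/UP; split; first by case: ad' => _ _; apply.
by rewrite -{1}cs -(act_inv _ _ xs) uc.
Qed.
Let nNs : s \in 'N(N)%g.
Proof.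
rewrite inE; apply/subsetP=> _ /imsetP[_ /NP[u [a [Du ->]]] ->]; have /DpP[Uu _ _] := Du.
have [Dus ->] := conjS Os xs es Du (Us Uu); apply/NP.
by exists (u *m GLval s), (star a).
Qed.
Let nLs : s \in 'N(GO W')%g. Proof. exact: adm_norm ad'. Qed.

(** A character of [N] trivial on [Z] is [nu u a |-> psi (B u y)] for one [y] in [U], and its
    inertia group in [GO W'] is the stabilizer of [y]. For [y] zero, isotropic or anisotropic this
    is the whole group, [class3], or [class_line], all in the smaller [W']. *)
Let heis_rec (i : Iirr N) s' : Z \subset cfker 'chi_i -> s' \in (GO W' :* s)%g ->
  ('chi_i ^ s')%CF = 'chi_i -> N2prop 'I_(GO W')['chi_i]%G s'.
Proof.
move=> kZ Ls' fixi; have [psi [psi0 psiD psi2 psint]] := additive_char_exists char2.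
have [t tc tt] := trace_one char2 odd_x pc ntc.
have Dt u : u \in U -> Dp u (t * herm u u).
  move=> Uu; have uuc : herm u u * c = herm u u by rewrite -HMl Uc.
  apply/DpP; split=> //; first by rewrite -mulrA uuc.
  by rewrite starM (herm_self char2 qQ Ox) -mulrDl tt mulrC.
pose mu u := 'chi_i (nu u (t * herm u u)).
have muE u a : Dp u a -> 'chi_i (nu u a) = mu u.
  move=> Du; have /DpP[Uu ac ra] := Du; have Dtu := Dt u Uu.
  have Dz : Dp 0 (a + t * herm u u).
    have /DpP[_ tc' rt] := Dtu; apply/DpP; split=> //; first by rewrite mulrDl ac tc'.
    by rewrite H0l starD addrACA ra rt addaa.
  have E : nu u a = (nu u (t * herm u u)%R * nu 0 (a + t * herm u u)%R)%g.
    by rewrite (nuM Dtu Dz) H0r !addr0 addrCA addaa addr0.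
  by rewrite E cfkerMr // (subsetP kZ) //; apply/ZP; exists (a + t * herm u u).
have lin : 'chi_i \is a linear_char.
  rewrite lin_irr_der1 (subset_trans _ kZ) // gen_subG.
  apply/subsetP=> _ /imset2P[_ _ /NP[u [a [Du ->]]] /NP[u' [a' [Du' ->]]] ->].
  by have [Dz ->] := comm_nu Du Du'; apply/ZP; exists (herm u u' + herm u' u).
have [y Uy yE] : exists2 y, y \in U & {in U, forall u, mu u = psi (B u y)}.
  apply: (dual_char char2 qQ psi0 psiD psi2 psint sU sU).
  - by move=> u Uu pu; apply: (perp_cap char2 qQ ndQ ndU Uu); apply/perpPx.
  - by rewrite -(muE _ _ Dp00) nu1 lin_char1.
  move=> u u' Uu Uu'; rewrite -(muE _ _ (Dt u Uu)) -(muE _ _ (Dt u' Uu')).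
  rewrite -(muE _ _ (DpM (Dt u Uu) (Dt u' Uu'))) -nuM ?Dt // lin_charM //.
    by apply/NP; exists u, (t * herm u u); rewrite Dt.
  by apply/NP; exists u', (t * herm u' u'); rewrite Dt.
have key g : g \in O -> vstable U g -> g \in 'N(N)%g ->
    (forall u a, Dp u a -> exists a', Dp (u *m GLval g) a' /\ (nu u a ^ g = nu (u *m GLval g) a')%g) ->
    ('chi_i ^ g)%CF = 'chi_i <-> y *m GLval g = y.
  move=> Og Ug nNg conjg.
  have cE u : u \in U -> 'chi_i (nu u (t * herm u u)%R ^ g)%g = psi (B u (y *m GLval (g^-1)%g)).
    move=> Uu; have [a' [Da' ->]] := conjg _ _ (Dt u Uu).
    by rewrite muE // yE ?Ug // orth_polarV.
  split=> [fixg|yg].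
    have E u : u \in U -> psi (B u (y *m GLval (g^-1)%g + y)) = 1.
      move=> Uu; rewrite BDr (psiD (B u _)) -cE // -fixg cfConjgEJ // muE ?Dt // yE //.
      by rewrite -expr2 psi2.
    have UV := vstableV Ug Uy.
    have Uz : y *m GLval (g^-1)%g + y \in U by case: sU => _ UD _; apply: UD.
    have z0 : y *m GLval (g^-1)%g + y = 0.
      apply: (perp_cap char2 qQ ndQ ndU Uz); apply/perpPx=> u Uu.
      by rewrite polarC (psi_polar1 qQ psint sU E).
    move/eqP: z0; rewrite addr_eq0 oppv => /eqP E2.
    by rewrite -{1}E2 mulmxGKV.
  have ygV : y *m GLval (g^-1)%g = y by rewrite -{1}yg mulmxGK.
  apply/cfun_inP=> _ /NP[u [a [Du ->]]]; have /DpP[Uu _ _] := Du.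
  have /NP[u1 [a1 [Du1 Eu1]]] : (nu u a ^ g^-1)%g \in N.
    have nNV : (g^-1)%g \in 'N(N)%g by rewrite groupV.
    by rewrite (memJ_norm _ nNV); apply/NP; exists u, a.
  have Ec : nu u a = (nu u1 a1 ^ g)%g by rewrite -Eu1 conjgKV.
  have [a' [Da' Ec']] := conjg _ _ Du1; have /DpP[Uu1 _ _] := Du1.
  rewrite {1}Ec cfConjgEJ // [in RHS]Ec Ec' !muE // !yE ?Ug //.
  by rewrite orth_polarV // ygV.
have keyL g : g \in GO W' -> ('chi_i ^ g)%CF = 'chi_i <-> y *m GLval g = y.
  move=> Lg; have [Og cg eg _] := LP Lg.
  apply: key => //; [exact: LU | exact: (subsetP nNL) |].
  move=> u a Du; exists a; apply: conjE => //; apply: LU => //; by case/DpP: Du.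
have [y0 Ly0 Es'] := rcosetP Ls'.
have ad'' : adm W' s' by rewrite Es'; apply: adm_coset => //; case: gW'.
have ys' : y *m GLval s' = y.
  have [Oy cy ey _] := LP Ly0; have [Os' xs' _] := ad''.
  have Us' : vstable U s' by rewrite Es'; apply: vstableM => //; apply: LU.
  apply/key => //; first by rewrite Es' groupM // (subsetP nNL).
  move=> u a Du; exists (star a); apply: conjS => //; first by rewrite Es' mulmxGM ey.
  by apply: Us'; case/DpP: Du.
have EI : 'I_(GO W')['chi_i]%g = GO W' :&: vstab y.
  apply/setP=> g; apply/setIP/setIP=> [[Lg /setIdP[_ /eqP Ig]]|[Lg /vstabP yg]]; split=> //.
    by apply/vstabP/keyL.
  by rewrite inE (subsetP nNL) //=; apply/eqP/keyL.
apply: (@N2_eq _ _ (GO W' :&: vstab y)%G); first by rewrite /= EI.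
have cW' : (#|W'| < #|W|)%N by case: Mprops => sM nM Mx; apply: (splitM_card char2 qQ ndQ sMW nM Me nze).
have [kM k3] := sm gW' cW'; have [W'y yc] := UP y Uy.
have [y0'|nzy] := eqVneq y 0.
  apply: (classM1 gW' kM) => //; rewrite y0' ?/xfix ?mul0mx //; by left.
have [hy|nzh] := eqVneq (herm y y) 0; first exact: (k3 c).
apply: (class_line char2 qQ ndQ Ox gW' _ pc W'y yc nzh ad'' ys').
by move=> W2 gW2 cW2; apply: sm => //; apply: ltn_trans cW'.
Qed.

Let nGs : s \in 'N(G)%g. Proof. exact: norm_setI (adm_norm ad) (vstab_norm es). Qed.
Let sGL : s \in G -> s \in GO W'.
Proof. by move=> Gs; rewrite EL; apply/setIP; split=> //; apply/vstabP. Qed.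
Let ss_f : f *m GLval (s ^+ 2)%g = f. Proof. by rewrite expgS expg1 mulmxGM !fs. Qed.
Let cZs : {in Z, forall z, (z ^ s)%g = z}.
Proof.
move=> _ /ZP[a [Du ->]]; have [|_ ->] := conjS Os xs es Du; first by rewrite mul0mx.
by rewrite mul0mx (Z_star Du).
Qed.

(** For [u] non-zero, [trace_onto] makes every element of [Z] a commutator of [nu u a] with an
    element of [N]. *)
Let heis_nondeg (j : Iirr Z) : j != 0 -> forall g, g \in N -> g \notin Z ->
  exists2 g', g' \in N & 'chi_j [~ g, g']%g != 1.
Proof.
move=> nzj _ /NP[u [a [Du ->]]] nZ; have /DpP[Uu ac ra] := Du.
have nzu : u != 0 by apply: contraNneq nZ => u0; apply/ZP; exists a; rewrite -u0.
have [z Zz jz] : exists2 z, z \in Z & 'chi_j z != 1.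
  apply/exists_inP; apply: contraR nzj; rewrite negb_exists_in => /forall_inP h.
  apply/eqP; apply: irr_inj; rewrite irr0; apply/cfun_inP=> z Zz; rewrite cfun1E Zz.
  by apply/eqP/negPn/h.
have /ZP[b [Dz Ez]] := Zz; have /DpP[_ bc _] := Dz; have bs := Z_star Dz.
have [u1 Uu1 nzB] := nondegP char2 qQ ndQ sU ndU Uu nzu.
have nzh : herm u u1 != 0.
  apply/eqP=> /(herm_polar char2 qQ) E; by move/eqP: nzB; rewrite E eq_sym oner_eq0.
have [k Ek] := trace_onto char2 qQ Ox odd_x pc ntc (Uc Uu) nzh bs bc.
have [t tc tt] := trace_one char2 odd_x pc ntc; have Uk := Ua k Uu1.
have Dk : Dp (act u1 k) (t * herm (act u1 k) (act u1 k)).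
  apply/DpP; split=> //; first by rewrite -mulrA -HMl Uc.
  by rewrite starM (herm_self char2 qQ Ox) -mulrDl tt mulrC -HMl Uc.
exists (nu (act u1 k) (t * herm (act u1 k) (act u1 k))); last first.
  by have [_ ->] := comm_nu Du Dk; rewrite Ek -Ez.
by apply/NP; exists (act u1 k), (t * herm (act u1 k) (act u1 k)).
Qed.

(** The group [A0] over [T] is abelian; ['chi_j] extends to [D1] by ignoring [u], and any further
    extension [l1] to [A0] will do. Elements of [S0] move [t] only by [Y], which [l1] does not see,
    so [l1] extends over [S0] with value 1 there. The twist sends [nu t a], up to [Y], to
    [nu t (star a)], the inverse of [nu t a]: this is twisted reality. *)
Let heis_ext (P : {group GL}) (j : Iirr Z) : (2.-Sylow(G) P)%g -> twists s P ->
  exists (A : {group GL}) (l : 'CF(A)),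
  [/\ A \subset P, Z \subset A, twists s A, (#|P : A|%g ^ 2 * #|Z| = #|N|)%N &
    [/\ l \is a linear_char, twisted_real s l, l (s ^+ 2)%g = 1 & {in Z, l =1 'chi_j}]].
Proof.
move=> SP tw; have [sPG P2 _] := and3P SP; have /andP[nPs Ps2] := tw.
have [nNG _ _ nNL' tiNL] := sdprod_context defG.
have sNP : N \subset P := normal_sub_max_pgroup (Hall_max SP) pN nNG.
pose S0 := (GO W' :&: P)%G.
have defP : (N ><| S0 = P)%g.
  by rewrite /= (sdprod_modl defG sNP); apply/setIidPr.
have Ss2 : (s ^+ 2)%g \in S0.
  rewrite inE Ps2 andbT.
  rewrite EL; apply/setIP; split; first exact: (subsetP sPG _ Ps2).
  exact/vstabP.
have nSs : s \in 'N(S0)%g by exact: norm_setI nLs nPs.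
have twS : twists s S0 by rewrite /twists nSs.
have S0L g : g \in S0 -> g \in GO W' by case/setIP.
have [||||Y [T [[aY aT sYT sTU cT] [hTY hTT TD Ts]]]] :=
  flag_exists char2 qQ Ox odd_x pc ntc sU Ua Uc _ (pgroupS (subsetIr _ _ : S0 \subset P) P2) twS _ _ _ Os xs Us.
- by move=> u Uu pu; apply: (perp_cap char2 qQ ndQ ndU Uu); apply/perpPx=> u' Uu'; rewrite polarC pu.
- by move=> g /S0L/LP[].
- by move=> g /S0L/LP[].
- by move=> g /S0L/LU.
have TU t : t \in T -> t \in U by exact: (subsetP sTU).
have YT y : y \in Y -> y \in T by exact: (subsetP sYT).
have [T0 TA] := aT; have [Y0 YA] := aY.
pose A0 := Group (heis_group_set aT); pose D1 := Group (heis_group_set aY).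
have A0P g : reflect (exists u a, [/\ Dp u a, u \in T & g = nu u a]) (g \in A0) := heis_setP T g.
have D1P g : reflect (exists u a, [/\ Dp u a, u \in Y & g = nu u a]) (g \in D1) := heis_setP Y g.
have sAN : A0 \subset N.
  by apply/subsetP=> _ /A0P[u [a [Du _ ->]]]; apply/NP; exists u, a.
have sDA : D1 \subset A0.
  by apply/subsetP=> _ /D1P[u [a [Du Yu ->]]]; apply/A0P; exists u, a; rewrite YT.
have abA : abelian A0.
  apply/centsP=> _ /A0P[u [a [Du Tu ->]]] _ /A0P[u' [a' [Du' Tu' ->]]]; apply/commgP/eqP.
  by have [_ ->] := comm_nu Du Du'; rewrite (hTT _ _ Tu' Tu) addaa.
have lj : 'chi_j \is a linear_char.
  by apply/char_abelianP; apply: abelianS cZG (center_abelian G).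
have YZ y a : y \in Y -> Dp y a -> Dp 0 a.
  move=> Yy /DpP[_ ac]; rewrite (hTY _ _ (YT _ Yy) Yy) => ra; apply/DpP; split=> //.
  by rewrite H0l.
have memZ a : Dp 0 a -> nu 0 a \in Z by move=> Da; apply/ZP; exists a.
(* The expression [herm (f *m GLval g) f] recovers the parameter [a] of [g = nu y a] ([aE]). *)
have [||l0 ll0 l0E] := @lin_char_of_fun _ D1 (fun g => 'chi_j (nu 0 (herm (f *m GLval g) f))).
- by rewrite mulmxG1 hff nu1 lin_char1.
- move=> _ _ /D1P[y [a [Dy Yy ->]]] /D1P[y' [a' [Dy' Yy' ->]]].
  rewrite nuM // !aE //; last exact: DpM.
  rewrite (hTY _ _ (YT _ Yy) Yy') addr0.
  have Da := YZ _ _ Yy Dy; have Da' := YZ _ _ Yy' Dy'.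
  by rewrite -(lin_charM lj) ?memZ // nuM // H0l !addr0.
have [l1 ll1 l1E] := lin_char_abelian_ext sDA abA ll0.
have memA t a : Dp t a -> t \in T -> nu t a \in A0 by move=> Da Tt; apply/A0P; exists t, a.
have DY y : y \in Y -> Dp y 0.
  by move=> Yy; apply/DpP; rewrite mul0r star0 addr0 (hTY _ _ (YT _ Yy) Yy) TU // YT.
have DTY t y a : Dp t a -> t \in T -> y \in Y -> Dp (t + y) a.
  by move=> Dt Tt Yy; have := DpM Dt (DY _ Yy); rewrite (hTY _ _ Tt Yy) !addr0.
have key t y a : Dp t a -> t \in T -> y \in Y -> l1 (nu (t + y) a) = l1 (nu t a).
  move=> Dt Tt Yy; have Dy := DY _ Yy.
  have -> : nu (t + y) a = (nu t a * nu y 0%R)%g by rewrite nuM // (hTY _ _ Tt Yy) !addr0.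
  have D1y : nu y 0 \in D1 by apply/D1P; exists y, 0.
  rewrite (lin_charM ll1 (memA _ _ Dt Tt) (memA _ _ Dy (YT _ Yy))) (l1E _ D1y) (l0E _ D1y) aE // nu1 lin_char1 ?mulr1 //.
have shift t z : z + t \in Y -> exists2 y, y \in Y & z = t + y.
  by move=> Yzt; exists (z + t) => //; rewrite addrCA addvv addr0.
have conjA t a g : g \in S0 -> Dp t a -> t \in T ->
    exists y, [/\ y \in Y, Dp (t + y) a & (nu t a ^ g)%g = nu (t + y) a].
  move=> Sg Dt Tt; have [Og cg eg _] := LP (S0L _ Sg).
  have [y Yy Ey] := shift _ _ (TD _ _ Tt Sg).
  have [|D' E'] := conjE Og cg eg Dt; first by apply: LU => //; [exact: S0L | exact: TU].
  by exists y; split=> //; [exact: DTY | rewrite E' Ey].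
have nAS : S0 \subset 'N(A0)%g.
  apply/subsetP=> g Sg; rewrite inE; apply/subsetP=> _ /imsetP[_ /A0P[t [a [Dt Tt ->]]] ->].
  have [y [Yy Dy ->]] := conjA t a g Sg Dt Tt; apply: memA => //; exact: (TA _ _ Tt (YT _ Yy)).
have conjAs t a : Dp t a -> t \in T ->
    exists y, [/\ y \in Y, Dp (t + y) (star a) & (nu t a ^ s)%g = nu (t + y) (star a)].
  move=> Dt Tt; have [y Yy Ey] := shift _ _ (Ts _ Tt).
  have [|D' E'] := conjS Os xs es Dt; first by apply: Us; exact: TU.
  by exists y; rewrite -Ey.
have nAs : s \in 'N(A0)%g.
  rewrite inE; apply/subsetP=> _ /imsetP[_ /A0P[t [a [Dt Tt ->]]] ->].
  have [y [Yy Dy ->]] := conjAs t a Dt Tt; apply: memA => //; exact: (TA _ _ Tt (YT _ Yy)).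
have sSI : S0 \subset 'I[l1]%g.
  apply/subsetP=> g Sg; apply/setIdP; split; first exact: (subsetP nAS).
  apply/eqP; apply/cfunP=> h; have [Ah|nAh] := boolP (h \in A0); last first.
    by rewrite cfConjgE ?(subsetP nAS) // !cfun0 // memJ_norm ?groupV // (subsetP nAS).
  have /A0P[t [a [Dt Tt ->]]] := Ah.
  rewrite cfConjgE; last exact: (subsetP nAS _ Sg).
  have SgV : (g^-1)%g \in S0 by rewrite groupV.
  have [y [Yy _ E]] := conjA t a _ SgV Dt Tt.
  by rewrite E; apply: (key _ _ _ Dt Tt Yy).
have tiA : (A0 :&: S0 = 1)%g.
  by apply/trivgP; rewrite -tiNL setISS // subsetIl.
pose A := (A0 <*> S0)%G.
have defA : (A0 ><| S0 = A)%g by rewrite sdprodEY.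
have [l ll lE] := sdprod_lin_ext defA ll1 sSI.
have lK g : g \in A0 -> l g = l1 g by move=> Ag; rewrite -{1}[g]mulg1 lE.
exists A, l; split.
- by rewrite join_subG (subset_trans sAN) // subsetIr.
- rewrite (subset_trans _ (joing_subl _ _)) //; apply/subsetP=> _ /ZP[a [Dz ->]]; exact: memA.
- rewrite /twists (subsetP (joing_subr _ _) _ Ss2) andbT -sub1set.
  by apply: normsY; rewrite sub1set.
- have cN : #|N| = (#|U| * #|Kp c|)%N by apply: heis_card.
  have cA : #|A0| = (#|T| * #|Kp c|)%N by apply: heis_card.
  have cZ : #|Z| = #|Kp c| by rewrite (heis_card (T := [set 0])) ?cards1 ?mul1n // sub1set.
  have sAP : A \subset P by rewrite join_subG (subset_trans sAN) // subsetIr.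
  have E : (#|P : A|%g * (#|A0| * #|S0|) = #|N| * #|S0|)%N.
    by rewrite (sdprod_card defA) (sdprod_card defP) mulnC Lagrange.
  have iE : #|P : A|%g = #|T|.
    apply/eqP; have k0 : (0 < #|A0| * #|S0|)%N by rewrite muln_gt0 !cardG_gt0.
    by rewrite -(eqn_pmul2r k0) E cN cA -cT expnS expn1; apply/eqP; ring.
  by rewrite iE cZ cN cT.
split=> //.
- move=> g Ag; have /mulsgP[k h Ak Sh ->] : g \in (A0 * S0)%g by rewrite (sdprodW defA).
  have Shs : (h ^ s)%g \in S0 by rewrite memJ_norm.
  have Aks : (k ^ s)%g \in A0 by rewrite memJ_norm.
  rewrite conjMg !lE //; have /A0P[t [a [Dt Tt Ek]]] := Ak.
  have [y [Yy Dy ->]] : exists y, [/\ y \in Y, Dp (t + y) (star a) & (k ^ s)%g = nu (t + y) (star a)].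
    by rewrite Ek; apply: conjAs.
  have Dts : Dp t (star a) by have /DpP[Ut ac ra] := Dt; apply/DpP; rewrite -{1}cs -starM ac starK addrC.
  have EV : nu t (star a) = (k^-1)%g.
    have /DpP[_ _ ra] := Dt; apply/eqP; rewrite eq_sym eq_invg_mul Ek nuM // ra addvv addaa nu1 //.
  by rewrite key // EV lin_charV_conj.
- by rewrite -[(s ^+ 2)%g]mul1g lE // lin_char1.
move=> _ /ZP[a [Dz ->]]; have D1z : nu 0 a \in D1 by apply/D1P; exists 0, a.
by rewrite lK ?memA // (l1E _ D1z) (l0E _ D1z) aE.
Qed.

Lemma heis_N2_fixed : N2prop G s.
Proof.
apply: N2prop_Sylow => // P chi SP tw Zchi re; have /andP[_ Ps2] := tw.
have Ls2 : (s ^+ 2)%g \in GO W'.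
  by rewrite EL; apply/setIP; split; [apply: (subsetP (pHall_sub SP)) | apply/vstabP].
apply: (Heisenberg_RR defG pN nNs nLs Ls2 sGL sZN cZG sqN sqZ cZs Zchi SP tw re heis_rec heis_nondeg).
by move=> j _; apply: heis_ext.
Qed.

End WithS.

(** Some element of [N] carries [f] to its image under [s^-1]; multiplying the twist by it gives one
    that fixes [f]. *)
Lemma heis_N2 s : smaller Q x W -> adm W s -> e *m GLval s = e -> N2prop G s.
Proof.
move=> sm ad es; have [Os xs Ws] := ad.
have xsV : (x ^ s^-1 = x^-1)%g by rewrite -[in LHS](invgK x) -xs conjVg conjgK.
have OsV : (s^-1)%g \in O by rewrite groupV.
have esV : e *m GLval (s^-1)%g = e by rewrite -{1}es mulmxGK.
have [||||u [a [Du Eu]]] := heis_trans (f' := f *m GLval (s^-1)%g).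
- exact: vstableV.
- by rewrite -{1}cs -(act_inv _ _ xsV) fc.
- by rewrite -{1}esV (herm_inv char2 qQ _ _ OsV xsV) hef.
- by rewrite (herm_inv char2 qQ _ _ OsV xsV) hff star0.
have Nn : nu u a \in N by apply/NP; exists u, a.
have [nNG _ _ _ _] := sdprod_context defG.
have Gn := nuG Du; have /setIP[GOn /vstabP en] := Gn.
apply: (N2prop_coset nNG pN Nn (norm_setI (adm_norm ad) (vstab_norm es))).
apply: heis_N2_fixed => //; first exact: adm_coset.
  by rewrite mulmxGM en.
by rewrite mulmxGM Eu mulmxGKV.
Qed.

End Step.

Lemma class3_step W : goodW W -> smaller Q x W -> class3 Q x W.
Proof.
move=> gW sm c e s pc ntc We ec nze hee ad es.
have [f [Wf fc hef hff]] := class3_partner gW pc ntc We ec nze hee ad es.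
have [nu nuP] := heis_nu_exists W f pc ntc ec hee.
exact: (heis_N2 gW pc ntc We ec hee nze Wf fc hef hff nuP sm ad es).
Qed.

End Class3.

(** * The centralizer of an isometry of odd order *)

Section Class1.
Variables (F : finFieldType) (m : nat).
Local Notation V := 'rV[F]_m.-1.+1.
Local Notation GL := {'GL_m[F]}.
Variable Q : V -> F.
Hypotheses (char2 : 2%N \in [pchar F]) (qQ : is_quadratic_form Q) (ndQ : qnondegenerate Q).
Local Notation B := (polar Q).
Local Notation O := (qorth_group Q).
Variable x : GL.
Hypotheses (Ox : x \in O) (odd_x : odd #[x]%g).
Local Notation n := #[x]%g.
Local Notation K := (cyc_alg F n).
Local Notation xi := (cyc_gen F n).
Local Notation act := (@act F m x).
Local Notation herm := (@herm F m Q x).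
Implicit Types (u v w e f : V) (g h s : GL) (W M U : {set V}).
Let addvv := @addvv F m char2.
Let oppv := @oppv F m char2.
Let addff := @addff F char2.
Let BDl := @polarDl F m Q qQ.
Let BDr := @polarDr F m Q qQ.
Let BZr := @polarZr F m Q qQ.
Let B0l := @polar0l F m Q qQ.
Let B0r := @polar0r F m Q qQ.
Let Bvv := @polarvv F m Q char2 qQ.
Let perpPx := @perpP F m Q.
Local Notation GO := (@GO F m Q x).
Local Notation goodW := (@goodW F m Q x).
Local Notation adm := (@adm F m Q x).
Local Notation xfix := (@xfix F m x).
Implicit Types (a b k r : K).
Let addaa := @addaa F m char2 x.

Lemma N2prop_trivial (gT : finGroupType) (G : {group gT}) (s : gT) : (G \subset [1])%g -> N2prop G s.
Proof.
move=> sG1 P chi sPG _ tw Zchi _; have P1 : P :=: 1%g by apply/trivgP/(subset_trans sPG).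
have P1e (g : gT) : g \in P -> g = 1%g by rewrite P1 => /set1P.
have s2 : (s ^+ 2 = 1)%g by apply: P1e; case/andP: tw.
split; first exact: cfRes_vchar.
  move=> g Pg; have -> : g = 1%g by apply: P1e.
  rewrite conj1g cfRes1 aut_intr // Cint_vchar1 //.
move=> i E; have : fs_ind s 'chi_i = 'chi_i 1%g.
  have -> : fs_ind s 'chi_i = #|P|%:R^-1 * \sum_(g in [1 gT]%g) 'chi_i ((s * g) ^+ 2)%g.
    by rewrite /fs_ind; congr (_ * _); apply: eq_bigl => g; rewrite P1.
  have c1 : #|P| = 1%N by rewrite P1 cards1.
  by rewrite c1 invr1 mul1r big_set1 mulg1 s2.
by move=> E2; have := irr1_gt0 i; rewrite -E2 E oppr_gt0 ltr10.
Qed.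

(** A Sylow 2-subgroup and [s] fix some [v] modulo [w] among the [x]-fixed vectors orthogonal to
    [w], and fix [v] itself since [Q w] is non-zero. The singular vector of [v + F w] then places
    the 2-subgroup in a stabilizer of type [class2]. If there are only multiples of [w] to choose
    from, the stabilizer of [w] already has the shape of [class4]. *)
Lemma class1_anis W w s : goodW W -> class2 Q x W -> class4 Q x W -> w \in W -> xfix w ->
  Q w != 0 -> adm W s -> w *m GLval s = w -> N2prop (GO W :&: vstab w)%G s.
Proof.
move=> gW k2 k4 Ww fw Qw ad ws; have [[W0 WD WZ] nW Wx] := gW; have [Os xs Ws] := ad.
have [sX nX] := xfixed_props char2 qQ Ox odd_x gW; have [X0 XD XZ] := sX.
have Xw : w \in xfixed x W by apply/xfixedP.
have nzw : w != 0 by apply: contraNneq Qw => ->; rewrite q0.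
pose E := [set v in xfixed x W | B v w == 0].
have EP v : reflect (v \in xfixed x W /\ B v w = 0) (v \in E).
  by apply: (iffP setIdP) => [[Xv /eqP]|[Xv ->]].
pose A := [set a *: w | a : F].
have AP v : reflect (exists a : F, v = a *: w) (v \in A).
  by apply: (iffP imsetP) => [[a _ ->]|[a ->]]; exists a.
have Xg g : g \in GO W -> vstable (xfixed x W) g.
  move=> Gg v /xfixedP[Wv fv]; have /GOP[_ cg _] := Gg; apply/xfixedP; split.
    exact: (GO_stable char2 qQ ndQ nW Gg).
  exact: presx_comm.
have Xs : vstable (xfixed x W) s.
  by move=> v /xfixedP[Wv fv]; apply/xfixedP; split; [exact: Ws | exact: presx_inv].
have Est g : g \in O -> vstable (xfixed x W) g -> w *m GLval g = w -> vstable E g.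
  by move=> Og Xsg wg v /EP[Xv vw]; apply/EP; split; [exact: Xsg | rewrite -{1}wg orth_polar].
have Ast g : w *m GLval g = w -> vstable A g.
  by move=> wg _ /AP[a ->]; apply/AP; exists a; rewrite -scalemxAl wg.
have aA : addset A.
  split=> [|_ _ /AP[a ->] /AP[b ->]]; apply/AP; first by exists 0; rewrite scale0r.
  by exists (a + b); rewrite scalerDl.
have aE : addset E.
  split=> [|u v /EP[Xu uw] /EP[Xv vw]]; apply/EP; first by rewrite B0l.
  by rewrite XD // BDl uw vw addr0.
have fixA v g : g \in O -> B v w = 0 -> v *m GLval g + v \in A -> v *m GLval g = v.
  move=> /orthP Og vw /AP[a E0].
  have E1 : v *m GLval g = v + a *: w by rewrite -E0 addrCA addvv addr0.
  have := Og v; rewrite E1 qD BZr vw mulr0 addr0 qZ // -{2}[Q v]addr0 => /addrI/eqP.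
  by rewrite mulf_eq0 (negPf Qw) orbF expf_eq0 /= => /eqP->; rewrite scale0r addr0.
have [sEA|/subsetPn[v0 Ev0 nv0]] := boolP (E \subset A).
  have [u Xu Bwu] := nondegP char2 qQ ndQ sX nX Xw nzw; have [Wu fu] := xfixedP _ _ _ Xu.
  have ls g : g \in O -> vstable (xfixed x W) g -> w *m GLval g = w -> g \in lstab w u.
    move=> Og Xsg wg; apply/lstabP; split=> //.
    have : u *m GLval g + u \in E.
      apply/EP; split; first by apply: XD => //; apply: Xsg.
      by rewrite BDl -{1}wg orth_polar // addff.
    move/(subsetP sEA)/AP=> [a Ea]; exists a; by rewrite -Ea addrCA addvv addr0.
  apply: (@N2_eq _ _ (GO W :&: lstab w u)%G).
    apply/setP=> g; apply/setIP/setIP=> [[Gg /lstabP[wg _]]|[Gg /vstabP wg]]; split=> //.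
      exact/vstabP.
    by have /GOP[Og _ _] := Gg; apply: ls => //; apply: Xg.
  apply: k4 => //; last exact: ls.
  by rewrite polarC Bwu oner_eq0.
apply: N2prop_Sylow; first exact: norm_setI (adm_norm ad) (vstab_norm ws).
move=> P chi SP tw Zchi re; have [sPG P2 _] := and3P SP.
have PP g : g \in P -> g \in GO W /\ w *m GLval g = w.
  by move=> Pg; have /setIP[Gg /vstabP wg] := subsetP sPG _ Pg.
have PO g : g \in GO W -> g \in O by case/GOP.
have [|||v [Ev nv fv fvs]] := fix_coset_twists char2 P2 tw aA aE _ _ (Ast _ ws) (Est _ Os Xs ws).
- by move=> g /PP[_ /Ast].
- by move=> g /PP[Gg wg]; apply: Est => //; [exact: PO | exact: Xg].
- by exists v0.
have [Xv vw] := EP _ Ev; have [Wv fxv] := xfixedP _ _ _ Xv.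
have [b Eb] := sqrtF char2 (Q v / Q w); pose e := v + b *: w.
have Qe : Q e = 0 by rewrite /e qD qZ // Eb mulfVK // BZr vw mulr0 addr0 addff.
have We : e \in W by rewrite WD ?WZ.
have nze : e != 0.
  apply: contra nv; rewrite addr_eq0 oppv => /eqP->; by apply/AP; exists b.
have eg g : w *m GLval g = w -> v *m GLval g = v -> e *m GLval g = e.
  by move=> wg vg; rewrite mulmxDl vg -scalemxAl wg.
have es : e *m GLval s = e by apply: eg => //; apply: fixA.
have fe : xfix e by apply: eg.
have nHs : s \in 'N(GO W :&: vstab w :&: vstab e)%g.
  exact: norm_setI (norm_setI (adm_norm ad) (vstab_norm ws)) (vstab_norm es).
apply: (@N2prop_sub _ _ (GO W :&: vstab w :&: vstab e)%G _ _ _ _ _ P2 tw Zchi nHs re).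
- exact: subsetIl.
- apply/subsetP=> g Pg; have [Gg wg] := PP g Pg; apply/setIP; split; first exact: (subsetP sPG).
  by apply/vstabP; apply: eg => //; apply: fixA => //; [exact: PO | exact: fv].
apply: k2 => //; first by right.
by rewrite /e BDr BZr Bvv mulr0 addr0 polarC.
Qed.

(** For [w = 0], a Sylow 2-subgroup and [s] fix a non-zero [v], hence also its component
    [e = act v c], because [c] is self-adjoint. If [xi] is non-trivial on [c], then [e] is handled
    through [herm]; otherwise [e] is fixed by [x] and is handled through [Q]. *)
Lemma class1_step W : goodW W -> smaller Q x W -> class2 Q x W -> class3 Q x W -> class4 Q x W ->
  class1 Q x W.
Proof.
move=> gW sm k2 k3 k4 w s Ww fw aw ad ws; have [sW nW Wx] := gW; have [W0 WD WZ] := sW.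
case: aw => [w0|Qw]; last exact: class1_anis.
apply: (@N2_eq _ _ (GO W)); first by rewrite /= w0 vstab0 setIT.
have [Os xs Ws] := ad; have [W1|/subsetPn[v0 Wv0 nv0]] := boolP (W \subset [set 0]).
  apply: N2prop_trivial; apply/subsetP=> g /GOP[_ _ fg]; apply/set1P; apply: GL_eqP => v.
  rewrite mulmxG1 fg //; apply/perpPx=> u /(subsetP W1)/set1P->; exact: B0r.
apply: N2prop_Sylow; first exact: adm_norm.
move=> P chi SP tw Zchi re; have [sPG P2 _] := and3P SP.
have a0 : addset [set (0 : V)] by split=> [|u v /set1P-> /set1P->]; rewrite ?addr0 inE.
have st0 g : vstable [set (0 : V)] g by move=> _ /set1P->; rewrite mul0mx inE.
have aW : addset W by split.
have [|||v [Wv nv fv fvs]] := fix_coset_twists char2 P2 tw a0 aW _ _ (st0 s) Ws.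
- by move=> g _; apply: st0.
- by move=> g /(subsetP sPG)/(GO_stable char2 qQ ndQ nW).
- by exists v0.
have fixv g : v *m GLval g + v \in [set 0] -> v *m GLval g = v.
  by move/set1P/eqP; rewrite addr_eq0 oppv => /eqP.
have nzv : v != 0 by move: nv; rewrite inE.
have [c pc nze] := prim_exists char2 Ox odd_x nzv; have [cc cs _] := pc.
pose e := act v c; have We : e \in W by apply: act_stable.
have ec : act e c = e by rewrite -actM cc.
have es : e *m GLval s = e by rewrite (act_inv _ _ xs) cs fixv.
have eP g : g \in P -> e *m GLval g = e.
  move=> Pg; have /GOP[_ cg _] := subsetP sPG _ Pg.
  by rewrite -(act_comm _ _ cg) fixv // fv.
have nHs : s \in 'N(GO W :&: vstab e)%g by exact: norm_setI (adm_norm ad) (vstab_norm es).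
apply: (@N2prop_sub _ _ (GO W :&: vstab e)%G _ _ _ _ _ P2 tw Zchi nHs re).
- exact: subsetIl.
- by apply/subsetP=> g Pg; apply/setIP; split; [exact: (subsetP sPG) | apply/vstabP/eP].
have [xc|ntc] := eqVneq (xi * c) c; last first.
  have [hee|nzh] := eqVneq (herm e e) 0; first exact: (k3 c).
  exact: (class_line char2 qQ ndQ Ox gW sm pc We ec nzh ad es).
have fe : xfix e by rewrite /xfix -act_gen -actM mulrC xc.
have [Qe|nQe] := eqVneq (Q e) 0; last exact: class1_anis.
apply: (@N2_eq _ _ (GO W :&: vstab 0 :&: vstab e)%G); first by rewrite /= vstab0 setIT.
by apply: k2 => //; rewrite ?/xfix ?mul0mx ?B0l //; left.
Qed.

Lemma classes_all W : goodW W -> classM Q x W /\ class3 Q x W.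
Proof.
have [k] := ubnP #|W|; elim: k W => // k IH W cW gW.
have sm : smaller Q x W by move=> W' gW' cW'; apply: IH => //; apply: leq_trans cW' _.
have k2 := class2_step char2 qQ ndQ Ox odd_x gW sm; have k4 := class4_step char2 qQ ndQ Ox gW sm.
have k3 := class3_step char2 qQ ndQ Ox odd_x gW sm.
by split=> //; apply: classM_cases => //; apply: class1_step.
Qed.

Lemma good_setT : goodW [set: V].
Proof.
split=> [|v|v _]; last exact: in_setT; first by split=> [|u v _ _|a v _]; exact: in_setT.
by exists v; rewrite ?in_setT // addvv; apply/perpPx=> u _; apply: B0l.
Qed.

Lemma GO_setT : GO [set: V] :=: 'C_O[x]%g.
Proof.
apply/setP=> g; apply/GOP/setIP=> [[Og cg _]|[Og /cent1P cg]]; split=> //; first exact/cent1P.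
move=> v /perpPx pv; suff -> : v = 0 by rewrite mul0mx.
by apply: ndQ => u; apply: pv; rewrite inE.
Qed.

Lemma GO_N2prop W s : goodW W -> adm W s -> N2prop (GO W) s.
Proof.
move=> gW ad; have [kM _] := classes_all gW; exact: class1_GO gW (classM1 gW kM) ad.
Qed.

Lemma cent_N2prop s : s \in O -> (x ^ s = x^-1)%g -> N2prop 'C_O[x]%G s.
Proof.
move=> Os xs; apply: (@N2_eq _ _ (GO [set: V])); first exact: GO_setT.
apply: GO_N2prop; first exact: good_setT.
by split=> // v _; rewrite inE.
Qed.

End Class1.

(** * Conjugacy of an isometry and its inverse *)

Section Reality.
Variables (F : finFieldType) (m : nat).
Local Notation V := 'rV[F]_m.-1.+1.
Local Notation GL := {'GL_m[F]}.
Variable Q : V -> F.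
Hypotheses (char2 : 2%N \in [pchar F]) (qQ : is_quadratic_form Q) (ndQ : qnondegenerate Q).
Local Notation B := (polar Q).
Local Notation O := (qorth_group Q).
Local Notation perp := (@perp F m Q).
Local Notation nondeg := (@nondeg F m Q).
Implicit Types (u v w e f : V) (g h s : GL) (W M U : {set V}).
Let addvv := @addvv F m char2.
Let oppv := @oppv F m char2.
Let addff := @addff F char2.
Let BDl := @polarDl F m Q qQ.
Let BZl := @polarZl F m Q qQ.
Let perpPx := @perpP F m Q.

Lemma nondeg_cap U : subsp U -> (forall u, u \in U -> u \in perp U -> u = 0) -> nondeg U.
Proof.
move=> sU cap v; have [psi [psi0 psiD psi2 psint]] := additive_char_exists char2.
have [U0 UD UZ] := sU; have [P0 PD PZ] := subsp_perp qQ U.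
have sV : subsp [set: V] by split=> [|a b _ _|a b _]; exact: in_setT.
have cP : (#|U| * #|perp U| = #|[set: V]|)%N.
  have -> : perp U = [set u in [set: V] | [forall t in U, B u t == 0]] by apply/setP=> u; rewrite !inE.
  apply: (perp_card char2 qQ psi0 psiD psint sU sV) => t Ut h; apply: cap => //.
  by apply/perpPx=> u _; rewrite polarC h // in_setT.
pose h (p : V * V) := p.1 + p.2.
have inj : {in setX U (perp U) &, injective h}.
  move=> [a b] [a' b'] /setXP[/= Ua Pb] /setXP[/= Ua' Pb'] E.
  have E2 : a + a' = b + b'.
    by apply/eqP; rewrite -subr_eq0 oppv addrACA [a + b]E addvv.
  have z : a + a' = 0 by apply: cap; [exact: UD | rewrite E2; exact: PD].
  have -> : a = a' by apply/eqP; rewrite -subr_eq0 oppv z.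
  by have -> : b = b' by apply/eqP; rewrite -subr_eq0 oppv -E2 z.
have /imsetP[[a b] /setXP[/= Ua Pb] ->] : v \in h @: setX U (perp U).
  have /eqP-> : h @: setX U (perp U) == [set: V].
    by rewrite eqEcard subsetT /= card_in_imset // cardsX cP.
  exact: in_setT.
by exists a => //; rewrite addrAC addvv add0r.
Qed.

Lemma orth_extend U (f : V -> V) : subsp U -> nondeg U ->
    {in U &, forall u v, f (u + v) = f u + f v} ->
    (forall (a : F) v, v \in U -> f (a *: v) = a *: f v) ->
    {in U, forall v, f v \in U} -> {in U, forall v, Q (f v) = Q v} ->
  exists t : GL, [/\ t \in O, {in U, forall v, v *m GLval t = f v}
    & {in perp U, forall v, v *m GLval t = v}].
Proof.
move=> sU nU fD fZ fU fQ; have [U0 UD UZ] := sU; have [P0 PD PZ] := subsp_perp qQ U.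
have ex v : exists u, (u \in U) && (v + u \in perp U).
  by have [u Uu p] := nU v; exists u; apply/andP.
pose pr v := xchoose (ex v).
have prP v : pr v \in U /\ v + pr v \in perp U by apply/andP; exact: (xchooseP (ex v)).
have prE v u : u \in U -> v + u \in perp U -> pr v = u.
  move=> Uu pu; have [Up pp] := prP v; apply/eqP; rewrite -subr_eq0 oppv; apply/eqP.
  apply: (perp_cap char2 qQ ndQ nU); first exact: UD.
  have -> : pr v + u = (v + pr v) + (v + u) by rewrite addrACA addvv add0r.
  exact: PD.
have prU v : pr v \in U by case: (prP v).
have prp v : v + pr v \in perp U by case: (prP v).
have prD u v : pr (u + v) = pr u + pr v.
  by apply: prE; [exact: UD | rewrite addrACA; exact: PD].
have prZ a v : pr (a *: v) = a *: pr v.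
  by apply: prE; [exact: UZ | rewrite -scalerDr; exact: PZ].
move: pr prP prE prU prp prD prZ => pr prP prE prU prp prD prZ.
have [|||t Ot tE] := @orth_of_fun F m Q qQ ndQ (fun v => f (pr v) + (v + pr v)).
- by move=> u v; rewrite prD fD // [in RHS]addrACA [u + pr u + _]addrACA.
- by move=> a v; rewrite prZ fZ // !scalerDr.
- move=> v; have E z : z \in U -> B z (v + pr v) = 0.
    by move=> Uz; rewrite polarC; apply: (perpPx _ _ (prp v)).
  have Ev : v = pr v + (v + pr v) by rewrite addrCA addvv addr0.
  have EQ : Q v = Q (pr v) + Q (v + pr v) by rewrite {1}Ev qD E // addr0.
  by rewrite qD E ?fU // fQ // addr0 EQ.
have f0 : f 0 = 0 by have := fZ 0 0 U0; rewrite !scale0r.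
exists t; split=> // v; rewrite tE => Hv.
  by rewrite (prE v v) ?addvv // addr0.
by rewrite (prE v 0) ?addr0 // f0 add0r.
Qed.

(** On [W] this says that [t] conjugates [g] to its inverse. The identity on [perp W] allows the
    conjugators of orthogonal summands to be multiplied. *)
Definition reversible g W := exists t : GL, [/\ t \in O, {in perp W, forall v, v *m GLval t = v}
  & {in W, forall v, v *m GLval g *m GLval t *m GLval g = v *m GLval t}].

Lemma fix_perp_stable W t : nondeg W -> t \in O -> {in perp W, forall v, v *m GLval t = v} -> vstable W t.
Proof.
move=> nW Ot ft w Ww; apply: (perpK char2 qQ ndQ nW) => u pu.
by rewrite -{1}(ft u pu) orth_polar // polarC; apply: (perpPx _ _ pu).
Qed.

Lemma reversible_glue g W M : g \in O -> nondeg M -> subsp W -> nondeg W -> vstable W g -> vstable M g ->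
    M \subset W -> nondeg (W :&: perp M) ->
    reversible g M -> reversible g (W :&: perp M) -> reversible g W.
Proof.
move=> Og nM sW nW Wg Mg sMW nW' [t1 [Ot1 p1 r1]] [t2 [Ot2 p2 r2]].
have [W0 WD WZ] := sW.
have st1 := fix_perp_stable nM Ot1 p1; have st2 := fix_perp_stable nW' Ot2 p2.
have M2 v : v \in M -> v *m GLval t2 = v.
  move=> Mv; apply: p2; apply/perpPx=> u /setIP[_ pu]; rewrite polarC; exact: (perpPx _ _ pu).
have W'1 v : v \in W :&: perp M -> v *m GLval t1 = v by case/setIP=> _; exact: p1.
exists (t1 * t2)%g; split; first exact: groupM.
  move=> v /perpPx pv; rewrite mulmxGM p1; last first.
    by apply/perpPx=> u Mu; apply: pv; apply: (subsetP sMW).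
  by apply: p2; apply/perpPx=> u /setIP[Wu _]; apply: pv.
move=> v Wv; have [a Ma pa] := nM v.
have W'b : v + a \in W :&: perp M by apply/setIP; split=> //; apply: WD => //; apply: (subsetP sMW).
have -> : v = a + (v + a) by rewrite addrCA addvv addr0.
move: (v + a) W'b => b W'b; rewrite !mulmxDl !mulmxGM; congr (_ + _).
  by rewrite (M2 _ (st1 _ (Mg _ Ma))) (M2 _ (st1 _ Ma)) r1.
have E : b *m GLval g \in W :&: perp M.
  have /setIP[Wb pb] := W'b; apply/setIP; split; first exact: Wg.
  exact: (perp_stable Og Mg).
by rewrite (W'1 _ E) (W'1 _ W'b) r2.
Qed.

(** With trivial twist the alternative [1 \in P] always holds, so [N2prop] yields reality of all
    characters on [<[u]>] with no assumption on conjugacy. *)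
Lemma N2prop_real (gT : finGroupType) (G : {group gT}) (u : gT) : N2prop G 1%g -> u \in G ->
  (2.-elt u)%g -> exists2 t, t \in G & (u ^ t = u^-1)%g.
Proof.
move=> n2 Gu u2; suff /imsetP[t Gt ->] : (u^-1 \in u ^: G)%g by exists t.
apply/eq_irr_mem_classP=> // i; rewrite irr_inv.
have sU : <[u]>%g \subset G by rewrite cycle_subG.
have tw : twists 1%g <[u]>%G by rewrite /twists group1 expg1n group1.
have [|_ re _] := n2 <[u]>%G _ sU u2 tw (irr_vchar i); first by left; rewrite group1.
by have := re u (cycle_id u); rewrite conjg1 !cfResE ?cycle_id // => <-.
Qed.

Lemma unipotent_reversible (u : GL) X : u \in O -> (2.-elt u)%g -> subsp X -> nondeg X -> vstable X u ->
  reversible u X.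
Proof.
move=> Ou u2 sX nX Xu.
have [||||u1 [Ou1 u1X u1p]] := @orth_extend X (fun v => v *m GLval u) sX nX.
- by move=> a b _ _; apply: mulmxDl.
- by move=> a b _; rewrite scalemxAl.
- exact: Xu.
- by move=> v _; apply/orthP.
have O1 : 1%g \in O by exact: group1.
have odd1 : odd #[1%g : GL]%g by rewrite order1.
have gX : goodW Q 1%g X by split=> // v Xv; rewrite mulmxG1.
have ad : adm Q 1%g X 1%g by split=> //; rewrite ?conjg1 ?invg1 // => v Xv; rewrite mulmxG1.
have n2 := GO_N2prop char2 qQ ndQ O1 odd1 gX ad.
have powX k : {in X, forall v, v *m GLval (u1 ^+ k)%g = v *m GLval (u ^+ k)%g}.
  elim: k => [|k IH] v Xv; first by rewrite !mulmxG1.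
  by rewrite !expgS !mulmxGM u1X // IH ?Xu.
have powp k : {in perp X, forall v, v *m GLval (u1 ^+ k)%g = v}.
  by elim: k => [|k IH] v pv; rewrite ?mulmxG1 // expgS mulmxGM u1p // IH.
have u1n : (u1 ^+ #[u] = 1)%g.
  apply: GL_eqP => v; have [a Xa pa] := nX v.
  have -> : v = a + (v + a) by rewrite addrCA addvv addr0.
  move: (v + a) pa => b pb.
  by rewrite !mulmxDl powX // powp // expg_order !mulmxG1.
have u12 : (2.-elt u1)%g by apply: pnat_dvd u2; rewrite order_dvdn u1n.
have Gu1 : u1 \in GO Q 1%g X by apply/GOP; split=> //; rewrite /commute mulg1 mul1g.
have [t Gt ut] := N2prop_real n2 Gu1 u12; have /GOP[Ot _ tp] := Gt.
exists t; split=> // v Xv; have Xt := fix_perp_stable nX Ot tp.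
have E : (u1 * t * u1 = t)%g.
  by rewrite (conjgC u1 t) ut mulgKV.
have Xvu := Xt _ (Xu _ Xv).
by rewrite -(u1X _ Xvu) -(u1X _ Xv) -[t in RHS]E !mulmxGM.
Qed.

Section Cyclic.
Variables (g : GL) (v : V).
Hypothesis Og : g \in O.
Local Notation N := #[g]%g.
(** Vectors of the span are given by coefficient families, so that the reversal [L a |-> L' a] can
    be written down before it is known to depend on [L a] only. *)
Let L (a : {ffun 'I_N -> F}) := \sum_(k < N) a k *: (v *m GLval (g ^+ k)%g).
Let L' (a : {ffun 'I_N -> F}) := \sum_(k < N) a k *: (v *m GLval (g ^- k)%g).
Definition gspan := [set L a | a : {ffun 'I_N -> F}].

Let spanP w : reflect (exists a, w = L a) (w \in gspan).
Proof. by apply: (iffP imsetP) => [[a _ ->]|[a ->]]; exists a. Qed.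

Let LD a b : L (a + b) = L a + L b.
Proof. by rewrite -big_split; apply: eq_bigr => k _; rewrite ffunE scalerDl. Qed.
Let L'D a b : L' (a + b) = L' a + L' b.
Proof. by rewrite -big_split; apply: eq_bigr => k _; rewrite ffunE scalerDl. Qed.
Let LZ (c : F) (a : {ffun 'I_N -> F}) : L [ffun k => c * a k] = c *: L a.
Proof. by rewrite scaler_sumr; apply: eq_bigr => k _; rewrite ffunE scalerA. Qed.
Let L'Z (c : F) (a : {ffun 'I_N -> F}) : L' [ffun k => c * a k] = c *: L' a.
Proof. by rewrite scaler_sumr; apply: eq_bigr => k _; rewrite ffunE scalerA. Qed.
Let sum_delta (G : 'I_N -> V) k0 : \sum_(k < N) [ffun k : 'I_N => (k == k0)%:R : F] k *: G k = G k0.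
Proof.
rewrite (bigD1 k0) //= ffunE eqxx scale1r big1 ?addr0 // => k nk.
by rewrite ffunE (negPf nk) scale0r.
Qed.

Let Ld j : exists a, L a = v *m GLval (g ^+ j)%g /\ L' a = v *m GLval (g ^- j)%g.
Proof.
have lt : (j %% N < N)%N by rewrite ltn_mod order_gt0.
rewrite -(expg_mod_order g j); move: (j %% N)%N lt => r lt.
exists [ffun k => (k == Ordinal lt)%:R]; split.
  exact: (sum_delta (fun k => v *m GLval (g ^+ k)%g) (Ordinal lt)).
exact: (sum_delta (fun k => v *m GLval (g ^- k)%g) (Ordinal lt)).
Qed.

Lemma gspan_subsp : subsp gspan.
Proof.
split=> [|_ _ /spanP[a ->] /spanP[b ->]|c _ /spanP[a ->]]; apply/spanP.
- by exists [ffun=> 0]; rewrite /L big1 // => k _; rewrite ffunE scale0r.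
- by exists (a + b); rewrite LD.
by exists [ffun k => c * a k]; rewrite LZ.
Qed.

Lemma gspan_sub W : subsp W -> vstable W g -> v \in W -> gspan \subset W.
Proof.
move=> [W0 WD WZ] Wg Wv; apply/subsetP=> _ /spanP[a ->]; rewrite /L.
by elim/big_ind: _ => // k _; apply: WZ; apply: vstableX.
Qed.

Lemma gspan_pow j : v *m GLval (g ^+ j)%g \in gspan.
Proof. by have [a [<- _]] := Ld j; apply/spanP; exists a. Qed.

Lemma gspan_ind (T : V -> Prop) : T 0 -> (forall a b, T a -> T b -> T (a + b)) ->
    (forall (c : F) a, T a -> T (c *: a)) -> (forall j, T (v *m GLval (g ^+ j)%g)) ->
  {in gspan, forall w, T w}.
Proof. by move=> T0 TD TZ Tv _ /spanP[a ->]; rewrite /L; elim/big_ind: _ => // k _; apply: TZ. Qed.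

Lemma gspan_stable : vstable gspan g.
Proof.
have [S0 SD SZ] := gspan_subsp.
apply: gspan_ind; first by rewrite mul0mx.
- by move=> a b Sa Sb; rewrite mulmxDl SD.
- by move=> c a Sa; rewrite -scalemxAl SZ.
by move=> j; rewrite -mulmxGM -expgSr gspan_pow.
Qed.

(** The isometry [g^(i+j)] carries [v g^-i] and [v g^-j] to [v g^j] and [v g^i]; the polar form is
    symmetric. *)
Let BLL a b : B (L' a) (L' b) = B (L a) (L b).
Proof.
rewrite /L /L' !(polar_suml qQ); apply: eq_bigr => i _; rewrite !BZl; congr (_ * _).
rewrite polarC [RHS]polarC !(polar_suml qQ); apply: eq_bigr => j _; rewrite !BZl; congr (_ * _).
rewrite -(orth_polar _ _ (groupX (i + j) Og)) -!mulmxGM polarC.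
have c1 : (g ^- i * g ^+ (i + j) = g ^+ j)%g by rewrite expgD mulKg.
have c2 : (g ^- j * g ^+ (i + j) = g ^+ i)%g by rewrite addnC expgD mulKg.
by rewrite c1 c2.
Qed.

(* The reversal [v p(g) |-> v p(g^-1)] is an isometry of the polar form, hence
   well defined when the span is nondegenerate. *)
Lemma gspan_reversible x : nondeg gspan -> x \in <[g]>%g -> odd #[x]%g ->
  {in gspan, forall w, w *m GLval x = w -> w = 0} -> reversible g gspan.
Proof.
move=> nd /cycleP[r xE] odd_x nofix; have [S0 SD SZ] := gspan_subsp.
have L'S a : L' a \in gspan.
  rewrite /L'; elim/big_ind: _ => // k _; apply: SZ.
  rewrite -expgVn invg_expg -expgM; exact: gspan_pow.
have L'P : {in gspan, forall w, exists b, w = L' b}.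
  apply: gspan_ind => [|w w' [b ->] [b' ->]|c w [b ->]|j].
  - by exists [ffun=> 0]; rewrite /L' big1 // => k _; rewrite ffunE scale0r.
  - by exists (b + b'); rewrite L'D.
  - by exists [ffun k => c * b k]; rewrite L'Z.
  have [b [_ Eb]] := Ld (#[g]%g.-1 * j)%N; exists b; rewrite Eb.
  by rewrite expgM -invg_expg expgVn invgK.
have uniq a b : L a = L b -> L' a = L' b.
  move=> E; apply/eqP; rewrite -subr_eq0 oppv; apply/eqP.
  apply: (perp_cap char2 qQ ndQ nd); first exact: SD.
  apply/perpPx=> w Sw; have [c ->] := L'P w Sw.
  by rewrite BDl !BLL E addff.
pose f w := if [pick a | L a == w] is Some a then L' a else 0.
have fE a : f (L a) = L' a.
  by rewrite /f; case: pickP => [b /eqP/uniq//|/(_ a)]; rewrite eqxx.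
have {}fE : forall a, f (L a) = L' a by [].
move: f fE => f fE.
have fD : {in gspan &, forall w w', f (w + w') = f w + f w'}.
  by move=> _ _ /spanP[a ->] /spanP[b ->]; rewrite -LD !fE L'D.
have fZ (c : F) w : w \in gspan -> f (c *: w) = c *: f w.
  by move=> /spanP[a ->]; rewrite -LZ !fE L'Z.
have f0 : f 0 = 0 by have := fZ 0 0 S0; rewrite !scale0r.
have fS : {in gspan, forall w, f w \in gspan} by move=> _ /spanP[a ->]; rewrite fE.
have fB : {in gspan &, forall w w', B (f w) (f w') = B w w'}.
  by move=> _ _ /spanP[a ->] /spanP[b ->]; rewrite !fE BLL.
have Sg := gspan_stable.
have fg w : w \in gspan -> f (w *m GLval g) = f w *m GLval (g^-1)%g.
  move=> Sw; suff [] : w \in gspan /\ f (w *m GLval g) = f w *m GLval (g^-1)%g by [].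
  move: w Sw; apply: gspan_ind => [|a b [Sa Ea] [Sb Eb]|c a [Sa Ea]|j].
  - by split=> //; rewrite mul0mx f0 mul0mx.
  - by rewrite SD // mulmxDl !fD ?Sg // mulmxDl Ea Eb.
  - by rewrite SZ // -scalemxAl !fZ ?Sg // -scalemxAl Ea.
  split; first exact: gspan_pow; have [a [E1 E2]] := Ld j; have [b [E3 E4]] := Ld j.+1.
  by rewrite -mulmxGM -expgSr -E3 -E1 !fE E2 E4 -mulmxGM -invMg -expgS.
have Sgk k := vstableX k Sg.
have fgk k w : w \in gspan -> f (w *m GLval (g ^+ k)%g) = f w *m GLval (g ^- k)%g.
  elim: k w => [|k IH] w Sw; first by rewrite invg1 !mulmxG1.
  by rewrite expgSr mulmxGM fg ?Sgk // IH // -mulmxGM -invMg -expgS expgSr.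
have Sx : vstable gspan x by rewrite xE; exact: Sgk.
have Ox : x \in O by rewrite xE groupX.
(* As in [orth_of_fixed], the defect is additive and [x]-invariant. Here orbit sums of [x] vanish,
   since there is no fixed vector in the span, so an odd multiple of each defect is zero. *)
pose d w := Q (f w) + Q w.
have dD w w' : w \in gspan -> w' \in gspan -> d (w + w') = d w + d w'.
  move=> Sw Sw'; rewrite /d fD // !qD fB //.
  have -> : Q (f w) + Q (f w') + B w w' + (Q w + Q w' + B w w') =
    Q (f w) + Q w + (Q (f w') + Q w') + (B w w' + B w w') by ring.
  by rewrite addff addr0.
have d0 : d 0 = 0 by rewrite /d f0 q0 // addr0.
have dx w k : w \in gspan -> d (w *m GLval (x ^+ k)%g) = d w.
  move=> Sw; rewrite /d xE -expgM fgk //.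
  by rewrite (orthP _ _ (groupVr (groupX _ Og))) (orthP _ _ (groupX _ Og)).
have fQ : {in gspan, forall w, Q (f w) = Q w}.
  move=> w Sw; suff E : d w = 0 by apply/eqP; rewrite -subr_eq0 (oppf char2) -/(d w) E.
  pose t j := \sum_(k < j) w *m GLval (x ^+ k)%g.
  have tS j : t j \in gspan /\ d (t j) = j%:R * d w.
    elim: j => [|j [IH1 IH2]]; first by rewrite /t big_ord0 d0 mul0r.
    have Sj : w *m GLval (x ^+ j)%g \in gspan by apply: vstableX.
    rewrite /t big_ord_recr /= -/(t j) SD // dD // IH2 dx //; split=> //.
    by rewrite -natr1 mulrDl mul1r.
  have [St dt] := tS #[x]%g.
  have t0 : t #[x]%g = 0.
    apply: nofix => //; rewrite /t mulmx_suml.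
    apply: (addrI w); rewrite -{1}[w]mulmxG1 -(expg0 x).
    rewrite (eq_bigr (fun k : 'I__ => w *m GLval (x ^+ (lift ord0 k))%g)) => [|k _]; last first.
      by rewrite -mulmxGM -expgSr.
    rewrite -(big_ord_recl _ (fun k : 'I_(#[x]%g).+1 => w *m GLval (x ^+ k)%g)).
    by rewrite big_ord_recr /= expg_order mulmxG1 addrC.
  have n1 : #[x]%g%:R = 1 :> F.
    by rewrite -(odd_double_half #[x]%g) odd_x natrD -muln2 natrM (pcharf0 char2) mulr0 addr0.
  by move: dt; rewrite t0 d0 n1 mul1r.
have [t [Ot tS tp]] := orth_extend gspan_subsp nd fD fZ fS fQ.
exists t; split=> // w Sw; rewrite (tS _ (Sg _ Sw)) fg // mulmxGKV tS //.
Qed.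

End Cyclic.
End Reality.

(** * Nondegenerate cyclic subspaces *)

Section Existence.
Variables (F : finFieldType) (m : nat).
Local Notation V := 'rV[F]_m.-1.+1.
Local Notation GL := {'GL_m[F]}.
Variable Q : V -> F.
Hypotheses (char2 : 2%N \in [pchar F]) (qQ : is_quadratic_form Q) (ndQ : qnondegenerate Q).
Local Notation O := (qorth_group Q).
Variable x : GL.
Hypotheses (Ox : x \in O) (odd_x : odd #[x]%g).
Local Notation n := #[x]%g.
Local Notation xi := (cyc_gen F n).
Local Notation star := (@cyc_star F n).
Local Notation act := (@act F m x).
Local Notation herm := (@herm F m Q x).
Local Notation perp := (@perp F m Q).
Local Notation nondeg := (@nondeg F m Q).
Implicit Types (u v w e f : V) (g h s : GL) (W M U : {set V}).
Let addvv := @addvv F m char2.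
Let oppv := @oppv F m char2.
Let addff := @addff F char2.
Let n_gt0 : (0 < n)%N. Proof. exact: order_gt0. Qed.
Let starM := @cyc_starM F n n_gt0.
Let addaa := @addaa F m char2 x.
Let HDl := @hermDl F m Q char2 qQ x.
Let HDr := @hermDr F m Q char2 qQ x Ox.
Let HMl := @hermMl F m Q char2 qQ x.
Let HC := @hermC F m Q char2 qQ x Ox.
Let H0r := @herm0r F m Q char2 qQ x Ox.

Section Unipotent.
Variables g u : GL.
Hypotheses (Ou : u \in O) (cux : commute u x) (u2 : (2.-elt u)%g) (gE : g = (x * u)%g).
Hypotheses (xg : x \in <[g]>%g) (ug : u \in <[g]>%g).

(** This is [u - 1] in characteristic 2, nilpotent because [u] has 2-power order. *)
Let nil1 v := v *m GLval u + v.

Let nilD a b : nil1 (a + b) = nil1 a + nil1 b.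
Proof. by rewrite /nil1 mulmxDl addrACA. Qed.
Let nilkD k a b : iter k nil1 (a + b) = iter k nil1 a + iter k nil1 b.
Proof. by elim: k => //= k ->; rewrite nilD. Qed.
Let nilk_act k v r : iter k nil1 (act v r) = act (iter k nil1 v) r.
Proof. by elim: k => //= k ->; rewrite /nil1 actDl (act_comm _ _ cux). Qed.
Let nil_pow2 (e : nat) v : iter (2 ^ e)%N nil1 v = v *m GLval (u ^+ (2 ^ e)%N)%g + v.
Proof.
elim: e v => [|e IH] v; first by rewrite expn0 /= expg1.
rewrite expnS mul2n -addnn iterD !IH mulmxDl -mulmxGM -expgD.
by rewrite -addrA [v *m _ + (v *m _ + v)]addrA addvv add0r.
Qed.
Let nil_vanish : exists k, forall v, iter k nil1 v = 0.
Proof.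
have [e Ee] := p_natP u2; exists (2 ^ e)%N => v.
by rewrite nil_pow2 -Ee expg_order mulmxG1 addvv.
Qed.

Let herm_nil j v w : herm (iter j nil1 v) w = herm v (iter j nil1 w *m GLval (u ^- j)%g).
Proof.
elim: j v => [|j IH] v; first by rewrite invg1 mulmxG1.
rewrite iterSr IH {1}/nil1 HDl.
have -> z : herm (v *m GLval u) z = herm v (z *m GLval (u^-1)%g).
  by rewrite -(herm_comm char2 qQ v _ Ou cux) mulmxGKV.
rewrite -HDr iterS {4}/nil1 mulmxDl; congr (herm v _).
rewrite -!mulmxGM -invMg -expgS addrC; congr (_ *m _ + _); congr GLval.
by rewrite expgSr invMg mulKVg.
Qed.

(** Let [nil1^j] be the last power that is non-zero on the component [C] of [c]. Then
    [herm (nil1^j v) w] is a non-zero hermitian form on [C], hence non-zero at some [(v, v)]. The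
    span of such a [v] is nondegenerate: its last layer, the multiples of [nil1^j v], is detected by
    pairing with [v]. *)
Lemma nondeg_gspan_exists W : subsp W -> nondeg W -> vstable W x -> vstable W u ->
    {in W, forall v, v *m GLval x = v -> v = 0} -> (exists2 v, v \in W & v != 0) ->
  exists v, [/\ v \in W, v != 0 & nondeg (gspan g v)].
Proof.
move=> sW nW Wx Wu nofix [v0 Wv0 nz0]; have [W0 WD WZ] := sW.
have [c pc nzc] := prim_exists char2 Ox odd_x nz0; have [cc cs cinv] := pc.
have ntc : xi * c != c.
  apply: contra_neq nzc => xc; apply: nofix; first exact: act_stable.
  by rewrite -act_gen -actM mulrC xc.
pose C := [set v in W | act v c == v].
have CP v : reflect (v \in W /\ act v c = v) (v \in C).
  by apply: (iffP setIdP) => [[? /eqP]|[? ?]]; split=> //; apply/eqP.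
have Cact v r : v \in C -> act v r \in C.
  move=> /CP[Wv vc]; apply/CP; split; first exact: act_stable.
  by rewrite -actM mulrC actM vc.
have Cu : vstable C u.
  by move=> v /CP[Wv vc]; apply/CP; split; [exact: Wu | rewrite (act_comm _ _ cux) vc].
have CD : {in C &, forall v w, v + w \in C}.
  by move=> v w /CP[Wv vc] /CP[Ww wc]; apply/CP; rewrite WD // actDl vc wc.
have sC : subsp C.
  split=> [||r v /CP[Wv vc]] //; apply/CP; first by rewrite act0l.
  by rewrite WZ // actZl vc.
have CN k v : v \in C -> iter k nil1 v \in C.
  by move=> Cv; elim: k => //= k IH; apply: CD => //; apply: Cu.
have Cc v : v \in C -> act v c = v by case/CP.
have C0 : act v0 c \in C by apply/CP; rewrite -actM cc; split=> //; apply: act_stable.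
have exk : exists k, [forall v in C, iter k nil1 v == 0].
  by have [k h] := nil_vanish; exists k; apply/forall_inP=> v _; rewrite h.
case: (ex_minnP exk) => [[|j]] /forall_inP kill0 kmin.
  by have := kill0 _ C0; rewrite (negPf nzc).
have kill v : v \in C -> iter j.+1 nil1 v = 0 by move/kill0/eqP.
have [a Ca nza] : exists2 a, a \in C & iter j nil1 a != 0.
  apply/exists_inP; apply: contraT; rewrite negb_exists_in => /forall_inP h.
  suff /kmin : [forall v in C, iter j nil1 v == 0] by rewrite ltnn.
  by apply/forall_inP=> v Cv; apply/negPn/h.
have fixu z : nil1 z = 0 -> forall k, z *m GLval (u ^- k)%g = z.
  move/eqP; rewrite addr_eq0 oppv => /eqP zu k.
  have zk : z *m GLval (u ^+ k)%g = z.
    by elim: k => [|k IH]; rewrite ?mulmxG1 // expgSr mulmxGM IH.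
  by rewrite -{1}zk mulmxGK.
have hE b b' : b' \in C -> herm (iter j nil1 b) b' = herm b (iter j nil1 b').
  by move=> Cb'; rewrite herm_nil fixu //; exact: (kill b').
(* If [herm (nil1^j v) v] vanished on [C], the hermitian form [herm (nil1^j v) w]
   would take only self-adjoint values, hence be zero. *)
have [v Cv nzh] : exists2 v, v \in C & herm (iter j nil1 v) v != 0.
  apply/exists_inP; apply: contraT; rewrite negb_exists_in => /forall_inP h0.
  have h v : v \in C -> herm (iter j nil1 v) v = 0 by move=> Cv; apply/eqP/negPn/h0.
  have sym b b' : b \in C -> b' \in C ->
      star (herm (iter j nil1 b) b') = herm (iter j nil1 b) b'.
    move=> Cb Cb'; have := h (b + b') (CD _ _ Cb Cb').
    rewrite nilkD HDl !HDr !h // add0r addr0 [herm (iter j nil1 b') b]HC -hE // => /eqP.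
    by rewrite addr_eq0 oppa // => /eqP <-.
  have zero b b' : b \in C -> b' \in C -> herm (iter j nil1 b) b' = 0.
    move=> Cb Cb'; have [t tc tt] := trace_one char2 odd_x pc ntc.
    have Xc : herm (iter j nil1 b) b' * c = herm (iter j nil1 b) b' by rewrite -HMl Cc ?CN.
    have := sym (act b t) b' (Cact _ _ Cb) Cb'.
    rewrite nilk_act HMl starM sym // => E.
    by rewrite -Xc -tt mulrDr E addaa.
  have Wz : iter j nil1 a \in W by have /CP[] := CN j _ Ca.
  have [b Wb Bzb] := nondegP char2 qQ ndQ sW nW Wz nza.
  have Cb : act b c \in C by apply/CP; rewrite -actM cc; split=> //; apply: act_stable.
  have := herm_polar char2 qQ (zero a _ Ca Cb).
  rewrite -{1}cs -act_adj // Cc ?CN // Bzb => /eqP; by rewrite oner_eq0.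
pose th := herm (iter j nil1 v) v.
have ths : star th = th by rewrite /th -HC -hE.
have thc : th * c = th by rewrite -HMl Cc ?CN.
have [th' _ [_ thK]] := cinv th ths thc nzh.
have [Wv vc] := CP _ Cv.
exists v; split=> //; first by apply: contraNneq nzh => ->; rewrite H0r.
have sM := gspan_subsp g v; have [M0 MD MZ] := sM; have Mg := @gspan_stable F m g v.
have Cx : vstable C x.
  move=> w /CP[Ww wc]; apply/CP; split; first exact: Wx.
  by rewrite -act_gen -actM mulrC actM wc.
have Cg : vstable C g by rewrite gE; apply: vstableM.
have sMC : gspan g v \subset C by apply: gspan_sub.
have MC w : w \in gspan g v -> w \in C by exact: (subsetP sMC).
have Mv : v \in gspan g v by rewrite -[v in v \in _](mulmxG1 v) -(expg0 g) gspan_pow.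
have Mx : vstable (gspan g v) x by have /cycleP[r ->] := xg; apply: vstableX.
have Mu : vstable (gspan g v) u by have /cycleP[r ->] := ug; apply: vstableX.
(* The span equals [v K] plus its image under [nil1], the first step of the filtration by powers of
   [nil1]. *)
have dec : {in gspan g v, forall z, exists r z', z' \in gspan g v /\ z = act v r + nil1 z'}.
  apply: gspan_ind => [|_ _ [r [z [Mz ->]]] [r' [z' [Mz' ->]]]|k _ [r [z [Mz ->]]]|k].
  - by exists 0, 0; rewrite /nil1 act0r mul0mx !addr0.
  - by exists (r + r'), (z + z'); rewrite MD // actDr nilD addrACA.
  - exists (r * cyc_const n k), (k *: z); rewrite MZ // actM act_const /nil1.
    by rewrite !scalerDr -scalemxAl.
  elim: k => [|k [r [z [Mz E]]]]; first by exists 1, 0; rewrite /nil1 act1 mul0mx !addr0 mulmxG1.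
  set y := v *m GLval (g ^+ k)%g in E; have My : y \in gspan g v by exact: gspan_pow.
  exists (r * xi), (z *m GLval x + y *m GLval x); split; first by rewrite MD ?Mx.
  have nx w : nil1 (w *m GLval x) = nil1 w *m GLval x.
    by rewrite /nil1 mulmxDl -!mulmxGM cux.
  rewrite expgSr mulmxGM -/y {1}gE mulmxGM nilD addrA nx actM act_gen -mulmxDl -E.
  by rewrite /nil1 addrCA addvv addr0.
apply: nondeg_cap => // w Mw pw.
have [P0 PD _] := subsp_perp qQ (gspan g v).
have pN k z : z \in perp (gspan g v) -> iter k nil1 z \in perp (gspan g v).
  by move=> pz; elim: k => //= k IH; apply: PD => //; apply: perp_stable.
(* Induction on the number [d] of powers of [nil1] left. With [z = act v r + nil1 z'], orthogonality
   of [nil1^j z] to [v] gives [th * r = 0], hence [c * r = 0]. So [nil1^i z] equals [nil1^(i+1) z'],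
   and one power is gained. *)
suff main d i z : (i + d = j.+1)%N -> z \in gspan g v -> iter i nil1 z \in perp (gspan g v) ->
    iter i nil1 z = 0 by exact: (main j.+1 0%N w).
elim: d i z => [|d IH] i z; first by rewrite addn0 => -> Mz _; apply/kill/MC.
move=> Ei Mz pz; have [r [z' [Mz' Ez]]] := dec z Mz.
have Ej : j = (d + i)%N by apply/eqP; rewrite -eqSS -Ei addnS addnC.
have Ezi k : iter k nil1 z = act (iter k nil1 v) r + iter k.+1 nil1 z'.
  by rewrite Ez nilkD nilk_act -iterSr.
have rz : th * r = 0.
  have pj : iter j nil1 z \in perp (gspan g v) by rewrite Ej iterD pN.
  rewrite /th -HMl; have := herm_orth char2 qQ Ox sM Mx Mv pj.
  by rewrite Ezi (kill z') ?MC // addr0.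
have cr : c * r = 0 by rewrite -thK mulrAC rz mul0r.
have E : iter i nil1 z = iter i.+1 nil1 z'.
  by rewrite Ezi -(Cc (iter i nil1 v)) ?CN // -actM cr act0r add0r.
by rewrite E IH // ?addSnnS // -E.
Qed.

End Unipotent.
End Existence.

(** * Reality of isometries and total orthogonality *)

Section Final.
Variables (F : finFieldType) (m : nat).
Local Notation V := 'rV[F]_m.-1.+1.
Local Notation GL := {'GL_m[F]}.
Variable Q : V -> F.
Hypotheses (char2 : 2%N \in [pchar F]) (qQ : is_quadratic_form Q) (ndQ : qnondegenerate Q).
Local Notation O := (qorth_group Q).
Implicit Types (u v w e f : V) (g h s : GL) (W M U : {set V}).
Let addvv := @addvv F m char2.
Let oppv := @oppv F m char2.
Let addff := @addff F char2.

Lemma constt_cycle (gT : finGroupType) (pi : nat_pred) (g : gT) : (g.`_pi \in <[g]>)%g.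
Proof. by rewrite /constt mem_cycle. Qed.

Section Real.
Variable g : GL.
Hypothesis Og : g \in O.
Local Notation x := (g.`_2%N^')%g.
Local Notation u := (g.`_2%N)%g.

Let sgO : <[g]>%g \subset O. Proof. by rewrite cycle_subG. Qed.
Let Ox : x \in O. Proof. exact: subsetP sgO _ (constt_cycle _ _). Qed.
Let Ou : u \in O. Proof. exact: subsetP sgO _ (constt_cycle _ _). Qed.
Let odd_x : odd #[x]%g. Proof. by rewrite odd_2'nat; apply: p_elt_constt. Qed.
Let cux : commute u x.
Proof. exact: (centsP (cycle_abelian g)) (constt_cycle _ _) _ (constt_cycle _ _). Qed.
Let gE : g = (x * u)%g. Proof. by rewrite -cux consttC. Qed.

Let stable_cycle W h : vstable W g -> h \in <[g]>%g -> vstable W h.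
Proof. by move=> Wg /cycleP[r ->]; apply: vstableX. Qed.

Lemma reversible_nofix W : goodW Q g W -> {in W, forall v, v *m GLval x = v -> v = 0} ->
  reversible Q g W.
Proof.
have [k] := ubnP #|W|; elim: k W => // k IH W cW gW nofix; have [sW nW Wg] := gW.
have [W1|/subsetPn[v0 Wv0 nv0]] := boolP (W \subset [set 0]).
  exists 1%g; split=> [|v _|v /(subsetP W1)/set1P->]; rewrite ?group1 ?mulmxG1 //.
  by rewrite !mul0mx.
have [|v [Wv nzv nM]] := nondeg_gspan_exists char2 qQ ndQ Ox odd_x Ou cux (p_elt_constt 2%N g) gE
  (constt_cycle _ _) (constt_cycle _ _) sW nW (stable_cycle Wg (constt_cycle _ _))
  (stable_cycle Wg (constt_cycle _ _)) nofix.
  by exists v0 => //; move: nv0; rewrite inE.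
have sMW := gspan_sub sW Wg Wv.
have Mv : v \in gspan g v by rewrite -[v in v \in _](mulmxG1 v) -(expg0 g) gspan_pow.
have gW' := splitM_good qQ Og gW (gspan_subsp g v) nM sMW (@gspan_stable F m g v).
have [_ nW' _] := gW'.
apply: (reversible_glue char2 qQ ndQ Og nM sW nW Wg (@gspan_stable F m g v) sMW nW').
  apply: (gspan_reversible char2 qQ ndQ Og nM (constt_cycle _ _) odd_x) => w Mw.
  by apply: nofix; apply: (subsetP sMW).
apply: IH => // [|w /setIP[Ww _]]; last exact: nofix.
exact: leq_trans (splitM_card char2 qQ ndQ sMW nM Mv nzv) _.
Qed.

Lemma orth_real : exists2 t, t \in O & (g ^ t = g^-1)%g.
Proof.
have gT := good_setT char2 qQ x; have [sV nV _] := gT.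
have [sX nX] := xfixed_props char2 qQ Ox odd_x gT.
set X := xfixed x [set: V] in sX nX.
have Xg : vstable X g.
  move=> v /xfixedP[_ fv]; apply/xfixedP; split; first exact: in_setT.
  apply: presx_comm fv; exact: (centsP (cycle_abelian g)) (cycle_id _) _ (constt_cycle _ _).
have Vg : vstable [set: V] g by move=> v _; exact: in_setT.
have gV : goodW Q g [set: V] by [].
have sXV : X \subset [set: V] by exact: subsetT.
have gX' := splitM_good qQ Og gV sX nX sXV Xg; have [_ nX' _] := gX'.
have [t [Ot _ tE]] : reversible Q g [set: V].
  apply: (reversible_glue char2 qQ ndQ Og nX sV nV Vg Xg sXV nX'); last first.
    apply: reversible_nofix gX' _ => v /setIP[_ pv] fv.
    by apply: (perp_cap char2 qQ ndQ nX) pv; apply/xfixedP; split; first exact: in_setT.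
  have Xu := stable_cycle Xg (constt_cycle 2%N g).
  have [t [Ot pt tE]] := unipotent_reversible char2 qQ ndQ Ou (p_elt_constt 2%N g) sX nX Xu.
  have gu w : w \in X -> w *m GLval g = w *m GLval u.
    by move=> /xfixedP[_ fw]; rewrite [in LHS]gE mulmxGM fw.
  have Xt := fix_perp_stable char2 qQ ndQ nX Ot pt.
  exists t; split=> // v Xv; rewrite (gu v Xv) gu ?tE //.
  by apply: Xt; apply: Xu.
have E : (g * t * g = t)%g.
  by apply: GL_eqP => v; rewrite !mulmxGM tE // in_setT.
exists t => //; apply: (mulgI t); rewrite -conjgC; apply: (mulIg g).
by rewrite E mulgKV.
Qed.

End Real.

Theorem orth_totally_orthogonal : totally_orthogonal (qorth_group Q).
Proof.
move=> i; have -> : fs_indicator 'chi_i = fs_ind 1%g 'chi_i.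
  by rewrite /fs_indicator /fs_ind; congr (_ * _); apply: eq_bigr => g _; rewrite mul1g.
apply: real_local_fs_ind => [g Og|x s Ox ox Os xs]; first exact: orth_real.
by apply: cent_N2prop => //; rewrite odd_2'nat.
Qed.

End Final.

(** * The split quadratic form *)

Section SplitForm.
Variables (F : fieldType) (n k : nat).
Hypothesis nk : k.+1 = n.*2.
Local Notation Q := (@split_qform F n k).

Lemma split_qform_quadratic : is_quadratic_form Q.
Proof.
exists (\sum_(i < n) delta_mx (inord i) (inord (k - i))) => x.
rewrite mulmx_sumr mulmx_suml summxE; apply: eq_bigr => i _.
rewrite -(mul_delta_mx (0 : 'I_1)) mulmxA -mulmxA -colE -rowE mxE big_ord1 !mxE //.
Qed.

Lemma split_qform_polar x y : polar Q x y =
  \sum_(i < n) (x 0 (inord i) * y 0 (inord (k - i)) + y 0 (inord i) * x 0 (inord (k - i))).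
Proof. by rewrite /polar /split_qform -!sumrB; apply: eq_bigr => i _; rewrite !mxE; ring. Qed.

Let inord_eq a b : (a <= k)%N -> (b <= k)%N -> (inord a == inord b :> 'I_k.+1) = (a == b).
Proof. by move=> ha hb; rewrite -val_eqE /= !inordK. Qed.

Lemma split_qform_nondegenerate : qnondegenerate Q.
Proof.
move=> x xp; apply/rowP=> l; rewrite mxE.
(* Coordinate [l] is read off against the basis vector of index [k - l]. As [k] is odd, the two
   indices differ and exactly one of them is below [n], so a single term of the sum survives. *)
have := xp (delta_mx 0 (inord (k - l))); rewrite split_qform_polar.
have lk : (l <= k)%N by rewrite -ltnS.
have [ln|nl] := ltnP l n.
  rewrite (bigD1 (Ordinal ln)) //= big1 => [|i ni].
    rewrite !mxE !eqxx !inord_eq ?leq_subr //=.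
    have -> : (nat_of_ord l == k - l)%N = false by lia.
    by rewrite mulr1 mul0r !addr0 inord_val.
  have ni' : (nat_of_ord i != l) by move: ni; rewrite -val_eqE.
  have ik : (i <= k)%N by have := ltn_ord i; lia.
  have lin := ltn_ord i; rewrite !mxE !eqxx !inord_eq ?leq_subr //=.
  have -> : (k - i == k - l)%N = false by lia.
  have -> : (nat_of_ord i == k - l)%N = false by lia.
  by rewrite mulr0 mul0r addr0.
have ln : (k - l < n)%N by lia.
rewrite (bigD1 (Ordinal ln)) //= big1 => [|i ni].
  rewrite !mxE !eqxx !inord_eq ?leq_subr //=.
  have -> : (k - (k - l) == k - l)%N = false by lia.
  by rewrite mulr0 mul1r add0r addr0 subKn // inord_val.
have ni' : (nat_of_ord i != k - l)%N by move: ni; rewrite -val_eqE.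
have ik : (i <= k)%N by have := ltn_ord i; lia.
  have lin := ltn_ord i; rewrite !mxE !eqxx !inord_eq ?leq_subr //=.
have -> : (k - i == k - l)%N = false by lia.
by rewrite (negPf ni') mulr0 mul0r addr0.
Qed.

End SplitForm.

Theorem theorem8p2 (F : finFieldType) (char2 : 2%N \in [pchar F]) (n : nat) (n_gt0 : (0 < n)%N) :
  totally_orthogonal (Oplus F n) /\
  (forall Q : 'rV[F]_(n.*2).-1.+1 -> F,
     is_quadratic_form Q -> qnondegenerate Q -> qwitt_index Q n.-1 ->
     totally_orthogonal (qorth_group Q)).
Proof.
have nk : (n.*2).-1.+1 = n.*2 by rewrite prednK // double_gt0.
split=> [|Q qQ ndQ _]; last exact: orth_totally_orthogonal.
apply: orth_totally_orthogonal => //; first exact: split_qform_quadratic.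
exact: split_qform_nondegenerate.
Qed.
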